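(* Let $b:\mathbb{R}^v\to\mathbb{R}^v$ be of class $C^1$ and $\sigma:\mathbb{R}^v\to\mathbb{R}^{v\times r}$ be of class $C^2$. Suppose that: (1) there is a constant $M_c$ such that $|\nabla b(x)|\vee|\nabla\sigma_{\cdot,j}(x)|\vee|\nabla^2\sigma_{\cdot,j}(x)|\le M_c$ for all $x\in\mathbb{R}^v$ and all $j\in\{1,\dots,r\}$, where $\sigma_{\cdot,j}$ is the $j$-th column of $\sigma$; (2) the function $\Sigma:\mathbb{R}^v\to\mathbb{R}^v$ with $i$-th entry $$\Sigma_i(x):=\sum_{k,m=1}^r\sum_{l=1}^v\sigma_{l,k}(x)\,\frac{\partial}{\partial x^l}\sigma_{i,m}(x)$$ is globally Lipschitz continuous. Let $T>0$, let $B$ be an $r$-dimensional Wiener process, and let $(B^d)_{d\in\mathbb{N}}$ be the piecewise linear interpolations of $B$ along a nested sequence of partitions $(\Pi_d)_{d\in\mathbb{N}}$ of $[0,T]$ with mesh sizes $\delta_d\to0$ (as defined in the context). Let $x_0\in\mathbb{R}^v$ be fixed but arbitrary. Let $X^d$ be the unique solution on $[0,T]$ of the (random) ordinary differential equation $$dX_t^d=b(X_t^d)\,dt+\sigma(X_t^d)\,\dot B_t^d\,dt,\qquad X_0^d=x_0,$$ and let $X$ be the unique strong solution on $[0,T]$ of the Stratonovich stochastic differential equation $$dX_t=b(X_t)\,dt+\sigma(X_t)\circ dB_t,\qquad X_0=x_0.$$ Then $$\lim_{d\to\infty}\mathbb{E}\Big[\sup_{0\le t\le T}|X_t-X_t^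d|^2\Big]=0.$$
   Context: $(\Omega,\mathcal{F},\mathbb{P},\{\mathcal{F}_t\}_{t\in[0,T]})$ is a filtered probability space satisfying the usual conditions, and $B$ is an $r$-dimensional Wiener process on it. For each $d\in\mathbb{N}$, $\Pi_d$ is a partition of $[0,T]$ with points $0=t_0<t_1<\dots$ ending at $T$ and consecutive points at distance $t_{i+1}-t_i=\delta_d$ (the mesh size); the partitions are nested, i.e. $\Pi_d\subset\Pi_{d+1}$ for all $d\in\mathbb{N}$, and $\delta_d\to0$ as $d\to\infty$. The nested piecewise linear approximation of $B$ is $$B_t^d=B_{t_i}+\frac{t-t_i}{\delta_d}\,(B_{t_{i+1}}-B_{t_i}),\qquad t\in[t_i,t_{i+1}),$$ where $t_i,t_{i+1}$ are consecutive points of $\Pi_d$ (and $B^d_T=B_T$). $\dot B^d$ denotes its (almost everywhere defined) time derivative, and the ordinary differential equation driven by $\dot B^d$ is understood pathwise, for each fixed realisation of $B$. $\circ\,dB_t$ denotes Stratonovich integration. *)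

(* Defs.v *)
From HB Require Import structures.
From mathcomp Require Import all_boot all_order all_algebra.
From mathcomp Require Import all_classical all_reals all_analysis.
Set Implicit Arguments.
Unset Strict Implicit.
Unset Printing Implicit Defensive.
Import Order.TTheory GRing.Theory Num.Theory.
Import numFieldNormedType.Exports.
Local Open Scope classical_set_scope.
Local Open Scope ring_scope.

(* Processes are indexed by R, but only their values at times in [0, T] are
   ever constrained or used. *)

Section Calculus.
Context {R : realType} {v : nat}.

Definition enorm n (x : 'cV[R]_n) : R := Num.sqrt (\sum_i x i 0 ^+ 2).

Definition partial (l : 'I_v) (f : 'cV[R]_v -> R) (x : 'cV[R]_v) : R :=
  'D_(delta_mx l 0) f x.

Definition class_C1 (f : 'cV[R]_v -> R) : Prop :=
  continuous f /\
  forall l, (forall x, derivable f x (delta_mx l 0)) /\ continuous (partial l f).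

Definition class_C2 (f : 'cV[R]_v -> R) : Prop :=
  class_C1 f /\ forall l, class_C1 (partial l f).

(* Euclidean (Frobenius) norms of the arrays of first and second order partial
   derivatives of a vector field. *)
Definition gradient_norm n (f : 'cV[R]_v -> 'cV[R]_n) (x : 'cV[R]_v) : R :=
  Num.sqrt (\sum_i \sum_l partial l (fun y => f y i 0) x ^+ 2).

Definition hessian_norm n (f : 'cV[R]_v -> 'cV[R]_n) (x : 'cV[R]_v) : R :=
  Num.sqrt (\sum_i \sum_k \sum_l
    partial k (partial l (fun y => f y i 0)) x ^+ 2).

Definition Sigma r (sigma : 'cV[R]_v -> 'M[R]_(v, r)) (x : 'cV[R]_v) :
    'cV[R]_v :=
  \col_i \sum_(k < r) \sum_(m < r) \sum_(l < v)
    sigma x l k * partial l (fun y => sigma y i m) x.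

Definition globally_lipschitz (f : 'cV[R]_v -> 'cV[R]_v) : Prop :=
  exists L : R, forall x y, enorm (f x - f y) <= L * enorm (x - y).

End Calculus.

Section Interpolation.
Context {R : realType}.

(* The points of the d-th partition are t d 0, ..., t d (N d). *)
Record nested_partitions (T : R) (N : nat -> nat) (delta : nat -> R)
    (t : nat -> nat -> R) : Prop := {
  partition_start : forall d, t d 0%N = 0;
  partition_end : forall d, t d (N d) = T;
  partition_mesh_gt0 : forall d, 0 < delta d;
  partition_step : forall d i, (i < N d)%N -> t d i.+1 - t d i = delta d;
  partition_nested : forall d,
    [set t d i | i in [set i | (i <= N d)%N]] `<=`
    [set t d.+1 i | i in [set i | (i <= N d.+1)%N]];
  partition_mesh_cvg : delta @ \oo --> (0 : R) }.

(* Piecewise linear interpolation of w at the points t 0, ..., t N; the default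
   branch is reached, for times in [0, T], only at the final time t N = T. *)
Definition interpolation r (N : nat) (delta : R) (t : nat -> R)
    (w : R -> 'cV[R]_r) (s : R) : 'cV[R]_r :=
  if [pick i : 'I_N | t i <= s < t i.+1] is Some i then
    w (t i) + ((s - t i) / delta) *: (w (t i.+1) - w (t i))
  else w (t N).

(* x' = b(x) + sigma(x) w' on [0, T], x 0 = x0, in integral (Caratheodory) form.
   For piecewise linear w, the derivative w' only takes a default value at
   finitely many times. *)
Definition ode_solution v r (b : 'cV[R]_v -> 'cV[R]_v)
    (sigma : 'cV[R]_v -> 'M[R]_(v, r)) (x0 : 'cV[R]_v) (T : R)
    (w : R -> 'cV[R]_r) (x : R -> 'cV[R]_v) : Prop :=
  {within `[0, T], continuous x} /\
  forall t : R, 0 <= t <= T -> forall i,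
    x t i 0 = x0 i 0 +
      \int[lebesgue_measure]_(s in `[0, t])
        (b (x s) i 0 +
         \sum_(j < r) sigma (x s) i j * derive1 (fun u => w u j 0) s).

End Interpolation.

Section Stochastic.
Context {R : realType} {disp : measure_display} {Omega : measurableType disp}.
Variables (P : probability Omega R) (T : R) (F : R -> set (set Omega)).

Record usual_filtration : Prop := {
  filtration_sigma_algebra : forall t : R, 0 <= t <= T -> sigma_algebra setT (F t);
  filtration_measurable : forall t : R, 0 <= t <= T -> F t `<=` measurable;
  filtration_monotone : forall s t : R, 0 <= s -> s <= t -> t <= T ->
    F s `<=` F t;
  filtration_right_continuous : forall t : R, 0 <= t < T ->
    \bigcap_(s in `]t, T]) F s `<=` F t;
  filtration_complete : forall A, P.-negligible A -> F 0 A }.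

Definition adapted (X : R -> Omega -> R) : Prop :=
  forall t : R, 0 <= t <= T -> forall C : set R, measurable C -> F t (X t @^-1` C).

Definition ae_continuous (X : R -> Omega -> R) : Prop :=
  {ae P, forall w, {within `[0, T], continuous (X^~ w)}}.

Record wiener_process r (B : R -> Omega -> 'cV[R]_r) : Prop := {
  wiener_start : {ae P, forall w, B 0 w = 0};
  wiener_adapted : forall j, adapted (fun t w => B t w j 0);
  wiener_continuous : forall j, ae_continuous (fun t w => B t w j 0);
  wiener_independent : forall s t : R, 0 <= s -> s < t -> t <= T ->
    forall (A : set Omega) (C : 'I_r -> set R), F s A ->
    (forall j, measurable (C j)) ->
    let E := [set w | forall j, C j (B t w j 0 - B s w j 0)] in
    P (A `&` E) = (P A * P E)%E;
  wiener_gaussian : forall s t : R, 0 <= s -> s < t -> t <= T ->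
    forall C : 'I_r -> set R, (forall j, measurable (C j)) ->
    P [set w | forall j, C j (B t w j 0 - B s w j 0)] =
    (\prod_(j < r) normal_prob 0 (Num.sqrt (t - s)) (C j))%E }.

Definition martingale (M : R -> Omega -> R) : Prop :=
  [/\ adapted M,
      forall t : R, 0 <= t <= T -> P.-integrable setT (EFin \o M t) &
      forall s t : R, 0 <= s -> s <= t -> t <= T -> forall A, F s A ->
        (\int[P]_(w in A) (M t w)%:E = \int[P]_(w in A) (M s w)%:E)%E].

(* Stopping times are truncated at the horizon T. *)
Definition stopping_time (tau : Omega -> R) : Prop :=
  (forall w, 0 <= tau w <= T) /\
  forall t : R, 0 <= t <= T -> F t [set w | tau w <= t].

Definition continuous_local_martingale (M : R -> Omega -> R) : Prop :=
  [/\ adapted M, ae_continuous M &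
      exists tau : nat -> Omega -> R,
        [/\ forall n, stopping_time (tau n),
            {ae P, forall w, forall n, tau n w <= tau n.+1 w},
            {ae P, forall w, exists n, tau n w = T} &
            forall n, martingale
              (fun t w => M (Num.min t (tau n w)) w - M 0 w)]].

Definition continuous_semimartingale (X : R -> Omega -> R) : Prop :=
  [/\ adapted X, ae_continuous X &
      exists M A : R -> Omega -> R,
        [/\ continuous_local_martingale M,
            adapted A, ae_continuous A,
            {ae P, forall w, bounded_variation 0 T (A^~ w)} &
            forall t : R, 0 <= t <= T ->
              {ae P, forall w, X t w = X 0 w + M t w + A t w}]].

(* Along the partition 0 = p_0 < p_1 < ... < p_n of [0, p_n] given by the list
   s = [:: p_1; ...; p_n]. *)
Definition stratonovich_sum (Y W : R -> Omega -> R) (s : seq R) (w : Omega) :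
    R :=
  let p := nth 0 (0 :: s) in
  \sum_(i < size s)
    (Y (p i) w + Y (p i.+1) w) / 2 * (W (p i.+1) w - W (p i) w).

(* I is the Stratonovich integral of Y against W over [0, t]: the limit in
   probability of the symmetric Riemann sums as the mesh tends to 0. *)
Definition stratonovich_integral (Y W : R -> Omega -> R) (t : R)
    (I : Omega -> R) : Prop :=
  measurable_fun setT I /\
  forall e : R, 0 < e -> exists2 eta : R, 0 < eta &
    forall s : seq R, itv_partition 0 t s ->
      (forall i, (i < size s)%N -> nth 0 (0 :: s) i.+1 - nth 0 (0 :: s) i < eta)
      -> (P [set w | (e <= `|stratonovich_sum Y W s w - I w|)%R] < e%:E)%E.

(* dX = b(X) dt + sigma(X) o dB, X_0 = x0. *)
Definition stratonovich_sde_solution v r (b : 'cV[R]_v -> 'cV[R]_v)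
    (sigma : 'cV[R]_v -> 'M[R]_(v, r)) (x0 : 'cV[R]_v)
    (B : R -> Omega -> 'cV[R]_r) (X : R -> Omega -> 'cV[R]_v) : Prop :=
  [/\ forall i, continuous_semimartingale (fun t w => X t w i 0),
      {ae P, forall w, X 0 w = x0} &
      forall t : R, 0 <= t <= T ->
        exists I : 'I_v -> 'I_r -> Omega -> R,
          (forall i j, stratonovich_integral
             (fun s w => sigma (X s w) i j) (fun s w => B s w j 0) t (I i j)) /\
          {ae P, forall w, forall i,
             X t w i 0 = x0 i 0 +
               \int[lebesgue_measure]_(s in `[0, t]) (b (X s w) i 0) +
               \sum_(j < r) I i j w}].

End Stochastic.

(* Main.v *)
(* Both processes are compared at the points of the coarse partition, and no
   stochastic integral is constructed. On a step of length h the ODE solution Y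
   has the Milstein expansion
     b(Y) h + sigma(Y) dB + 1/2 sum_(j,l) (Dsigma_j sigma_l)(Y) dB^j dB^l,
   with remainder O(h^(3/2)), and a discrete Gronwall inequality together with a
   pathwise Doob inequality bounds its fourth moments uniformly in the mesh.
   The semimartingale property of X makes its quadratic variation along the
   partitions tight; expanding coarse increments along a finer partition then
   turns the symmetric Riemann sums defining the Stratonovich integral into Ito
   sums plus the drift 1/2 sum_j (Dsigma_j sigma_j)(X), in probability.
   Since the products dB^j dB^l minus their means are orthogonal noise, the
   difference of the two recursions, stopped when it leaves a small ball, has a
   second moment vanishing with the mesh, so the uniform distance tends to 0 in
   probability. Fatou's lemma transfers the fourth moment bound to X, and
   uniform integrability upgrades the convergence to mean square. *)
Require Import Defs.
From HB Require Import structures.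
From mathcomp Require Import all_boot all_order all_algebra.
From mathcomp Require Import all_classical all_reals all_analysis.
From mathcomp Require Import measurable_realfun ring lra.
Import Order.TTheory GRing.Theory Num.Theory.
Import numFieldNormedType.Exports.
Local Open Scope classical_set_scope.
Local Open Scope ring_scope.
Set Implicit Arguments.
Unset Strict Implicit.
Unset Printing Implicit Defensive.

(** * Moments and measurability with respect to a sub-sigma-algebra *)

(** The definition of the Stratonovich integral provides a limit in probability at each fixed time,
    with no rate and no moments, so that the solution [X] is at first controlled only in
    probability. Two devices answer this. The comparison takes place on a coarse grid [d] that is
    fixed first, while [D] tends to infinity behind it: finitely many limits in probability, one for
    each coarse point and coordinate, are then enough. And the quantity whose second moment is
    estimated is not [X - Y] but an adapted surrogate whose increments are multiplied by an
    indicator; it is close to [X - Y] with large probability and may be squared without knowing the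
    moments of [X]. On the side of [Y], the remainders of one step are bounded by a power of the
    step times [exp (lam |beta| / sqrt h)], whose mean is bounded independently of the step and of
    the past. The second order remainder grows quadratically in the state and serves on bounded
    sets; the moment bounds rest on the first order remainder, whose growth is linear. Suprema over
    uncountably many times enter through outer probabilities and measurable majorants. *)

Section GMeas.
Context {R : realType} {disp : measure_display} {Omega : measurableType disp}.
Implicit Types (G H : set (set Omega)) (f g : Omega -> R).

(** Measurability for a smaller sigma-algebra is ordinary measurability on the type
    [g_sigma_algebraType G], so that the closure properties of measurable functions apply to adapted
    quantities unchanged. *)
Definition gmeas d (U : measurableType d) G (f : Omega -> U) :=
  @measurable_fun _ _ (g_sigma_algebraType G) U setT f.

Record sub_sigma G : Prop := {
  sub_sigma_algebra : sigma_algebra setT G;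
  sub_sigma_measurable : G `<=` measurable }.

Lemma gmeasP d (U : measurableType d) G (f : Omega -> U) : sub_sigma G ->
  gmeas G f <-> (forall C, measurable C -> G (f @^-1` C)).
Proof.
move=> [sG _]; split.
- move=> mf C mC; have := mf measurableT C mC.
  by rewrite setTI /measurable/= sigma_algebra_id.
- by move=> mf _ C mC; rewrite setTI; apply: sub_gen_smallest; exact: mf.
Qed.

Lemma gmeas_sub d (U : measurableType d) G H (f : Omega -> U) :
  sub_sigma G -> sub_sigma H -> G `<=` H -> gmeas G f -> gmeas H f.
Proof.
by move=> sG sH GH /(gmeasP _ sG) mf; apply/(gmeasP _ sH) => C mC; exact/GH/mf.
Qed.

Lemma gmeas_measurable d (U : measurableType d) G (f : Omega -> U) :
  sub_sigma G -> gmeas G f -> measurable_fun setT f.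
Proof.
move=> sG /(gmeasP _ sG) mf _ C mC; rewrite setTI.
exact: (sub_sigma_measurable sG (mf _ mC)).
Qed.

Lemma sub_sigma_full : sub_sigma (@measurable _ Omega).
Proof.
split=> //; split; [exact: measurable0| |].
  by move=> A mA; apply: measurableD.
by move=> A mA; exact: bigcupT_measurable.
Qed.

Lemma gmeas_full d (U : measurableType d) (f : Omega -> U) :
  measurable_fun setT f -> gmeas measurable f.
Proof.
move=> mf; apply/(gmeasP _ sub_sigma_full) => C mC; rewrite -[X in measurable X]setTI; exact: mf.
Qed.

End GMeas.

Section Moments.
Context {R : realType} {disp : measure_display} {Omega : measurableType disp}.
Variable P : probability Omega R.
Implicit Types (G H : set (set Omega)) (f g : Omega -> R).

(** Finite absolute moments of every order. The class is an algebra, which spares the bookkeeping of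
    integrability exponents. *)
Definition LG G f := gmeas G f /\
  forall p, exists C : R, (\int[P]_w (`|f w| ^+ p)%:E <= C%:E)%E.

Definition Ex f := \int[P]_w f w.

Lemma LG_measurable G f : sub_sigma G -> LG G f -> measurable_fun setT f.
Proof. by move=> sG [mf _]; exact: gmeas_measurable mf. Qed.

Lemma LG_dom G f g : sub_sigma G -> gmeas G f -> LG G g ->
  (forall w, `|f w| <= `|g w|) -> LG G f.
Proof.
move=> sG mf [mg Mg] fg; split=> // p; have [C HC] := Mg p; exists C.
apply: le_trans HC; apply: ge0_le_integral => //.
- apply/measurable_EFinP/measurable_funX/measurableT_comp => //.
  exact: gmeas_measurable mf.
- apply/measurable_EFinP/measurable_funX/measurableT_comp => //.
  exact: gmeas_measurable mg.
- by move=> w _; rewrite lee_fin lerXn2r // nnegrE.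
Qed.

Lemma LG_cst G (c : R) : LG G (fun=> c).
Proof.
split; first exact: measurable_cst.
move=> p; exists (`|c| ^+ p); rewrite (integral_cst P measurableT).
by rewrite [X in (_ * X)%E](_ : _ = 1%E) ?mule1//; exact: probability_setT.
Qed.

Lemma LG_bdd G f (c : R) : sub_sigma G -> gmeas G f ->
  (forall w, `|f w| <= c) -> LG G f.
Proof.
move=> sG mf fc; apply: (LG_dom sG mf (LG_cst G c)) => w.
exact: le_trans (fc w) (ler_norm _).
Qed.

Lemma pow_add_le (a b : R) p : 0 <= a -> 0 <= b ->
  (a + b) ^+ p <= 2 ^+ p * (a ^+ p + b ^+ p).
Proof.
move=> a0 b0; wlog ab : a b a0 b0 / a <= b.
  by move=> H; case: (leP a b) => [/H|/ltW/H]; [exact|rewrite addrC [X in _ <= _ * X]addrC; exact].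
apply: (@le_trans _ _ ((2 * b) ^+ p)).
  by rewrite lerXn2r ?nnegrE ?addr_ge0// ?mulr_ge0//; lra.
by rewrite exprMn ler_wpM2l ?exprn_ge0// lerDr exprn_ge0.
Qed.

Lemma LGD G f g : sub_sigma G -> LG G f -> LG G g -> LG G (fun w => f w + g w).
Proof.
move=> sG [mf Mf] [mg Mg]; split; first exact: measurable_funD.
move=> p; have [C HC] := Mf p; have [D HD] := Mg p.
exists (2 ^+ p * (C + D)).
have mf' := gmeas_measurable sG mf; have mg' := gmeas_measurable sG mg.
have mF : measurable_fun setT (fun w => `|f w| ^+ p) by exact/measurable_funX/measurableT_comp.
have mG : measurable_fun setT (fun w => `|g w| ^+ p) by exact/measurable_funX/measurableT_comp.
apply: (@le_trans _ _ (\int[P]_w ((2 ^+ p)%:E * ((`|f w| ^+ p)%:E + (`|g w| ^+ p)%:E)))%E).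
  apply: ge0_le_integral => //.
  - by apply/measurable_EFinP/measurable_funX/measurableT_comp => //; exact: measurable_funD.
  - apply: emeasurable_funM => //; apply: emeasurable_funD; exact/measurable_EFinP.
  - move=> w _; rewrite -EFinD -EFinM lee_fin.
    apply: le_trans (pow_add_le _ (normr_ge0 _) (normr_ge0 _)).
    by rewrite lerXn2r ?nnegrE ?addr_ge0 // ler_normD.
rewrite ge0_integralZl//; last 2 first.
- apply: emeasurable_funD; exact/measurable_EFinP.
- by move=> w _; rewrite adde_ge0 ?lee_fin ?exprn_ge0.
rewrite ge0_integralD//; [|exact/measurable_EFinP..].
rewrite EFinM EFinD lee_pmul// ?lee_fin ?exprn_ge0//.
  by rewrite adde_ge0 ?integral_ge0// => w _; rewrite lee_fin exprn_ge0.
exact: leeD.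
Qed.

Lemma LG_norm G f : LG G f -> LG G (fun w => `|f w|).
Proof.
move=> [mf Mf]; split; first exact: measurableT_comp.
by move=> p; have [C HC] := Mf p; exists C; under eq_integral do rewrite normr_id.
Qed.

Lemma LGX_norm G f k : LG G f -> LG G (fun w => `|f w| ^+ k).
Proof.
move=> [mf Mf]; split; first exact/measurable_funX/measurableT_comp.
move=> p; have [C HC] := Mf (k * p)%N; exists C.
by under eq_integral do rewrite normrX normr_id -exprM.
Qed.

(** The elementary bound [|f g| <= |f|^2 + |g|^2] takes the place of Hölder's inequality, since
    squares stay in the class. *)
Lemma LGM G f g : sub_sigma G -> LG G f -> LG G g -> LG G (fun w => f w * g w).
Proof.
move=> sG Lf Lg; apply: (@LG_dom _ _ (fun w => `|f w| ^+ 2 + `|g w| ^+ 2)) => //.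
- by case: Lf Lg => mf _ [mg _]; exact: measurable_funM.
- by apply: LGD => //; exact: LGX_norm.
- move=> w; rewrite [leRHS]ger0_norm ?addr_ge0// normrM.
  by have := sqr_ge0 (`|f w| - `|g w|); have := normr_ge0 (f w); have := normr_ge0 (g w); nra.
Qed.

Lemma LGN G f : sub_sigma G -> LG G f -> LG G (fun w => - f w).
Proof.
move=> sG Lf; apply: (LG_dom sG _ Lf) => // [|w]; last by rewrite normrN.
by case: Lf => mf _; exact: measurableT_comp.
Qed.

Lemma LGB G f g : sub_sigma G -> LG G f -> LG G g -> LG G (fun w => f w - g w).
Proof. by move=> sG Lf Lg; apply: LGD => //; exact: LGN. Qed.

Lemma LGZ G f (c : R) : sub_sigma G -> LG G f -> LG G (fun w => c * f w).
Proof. by move=> sG Lf; apply: LGM => //; exact: LG_cst. Qed.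

Lemma LGX G f k : sub_sigma G -> LG G f -> LG G (fun w => f w ^+ k).
Proof.
move=> sG Lf; elim: k => [|k IH]; first exact: (@LG_cst G 1).
by under eq_fun do rewrite exprS; exact: LGM.
Qed.

Lemma LG_sum G I (s : seq I) (Q : pred I) (h : I -> Omega -> R) : sub_sigma G ->
  (forall i, Q i -> LG G (h i)) -> LG G (fun w => \sum_(i <- s | Q i) h i w).
Proof.
move=> sG Lh; elim: s => [|i s IH].
  by under eq_fun do rewrite big_nil; exact: LG_cst.
under eq_fun do rewrite big_cons.
by case: (boolP (Q i)) => // Qi; apply: LGD => //; exact: Lh.
Qed.

Lemma LG_max G f g : sub_sigma G -> LG G f -> LG G g -> LG G (fun w => Num.max (f w) (g w)).
Proof.
move=> sG Lf Lg; apply: (@LG_dom _ _ (fun w => `|f w| + `|g w|)) => //.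
- by case: Lf Lg => mf _ [mg _]; exact: measurable_maxr.
- by apply: LGD => //; exact: LG_norm.
- move=> w; rewrite [leRHS]ger0_norm ?addr_ge0// /Num.max.
  by case: ifP => _; rewrite ?lerDl ?lerDr.
Qed.

Lemma LG_indic G A : sub_sigma G -> G A -> LG G (\1_A : Omega -> R).
Proof.
move=> sG GA; apply: (@LG_bdd _ _ 1) => //.
  apply: measurable_indic; exact: sub_gen_smallest.
by move=> w; rewrite indicE normr_nat; case: (_ \in _).
Qed.

Lemma LG_sub G H f : sub_sigma G -> sub_sigma H -> G `<=` H -> LG G f -> LG H f.
Proof. by move=> sG sH GH [mf Mf]; split => //; exact: gmeas_sub mf. Qed.

Lemma LG_full G f : sub_sigma G -> LG G f -> LG measurable f.
Proof. by move=> sG; apply: LG_sub (sub_sigma_measurable sG) => //; exact: sub_sigma_full. Qed.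

Lemma LG_integrable G f : sub_sigma G -> LG G f -> P.-integrable setT (EFin \o f).
Proof.
move=> sG [mf Mf]; apply/integrableP; split.
  by apply/measurable_EFinP; exact: gmeas_measurable mf.
have [C HC] := Mf 1%N; apply: le_lt_trans (ltry C).
by apply: le_trans HC; under [leRHS]eq_integral do rewrite expr1.
Qed.

Lemma eq_Ex f g : f =1 g -> Ex f = Ex g.
Proof. by move=> fg; congr Ex; exact/funext. Qed.

Lemma Ex_cst (c : R) : Ex (fun=> c) = c.
Proof. by rewrite /Ex Rintegral_cst// [X in fine X](_ : _ = 1%E) ?mulr1//; exact: probability_setT. Qed.

Lemma Ex_ge0 f : (forall w, 0 <= f w) -> 0 <= Ex f.
Proof. by move=> f0; exact: Rintegral_ge0. Qed.

Section Full.
Variable G : set (set Omega).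
Hypothesis sG : sub_sigma G.

Lemma ExD f g : LG G f -> LG G g -> Ex (fun w => f w + g w) = Ex f + Ex g.
Proof. by move=> Lf Lg; rewrite /Ex RintegralD//; exact: (LG_integrable sG). Qed.

Lemma ExB f g : LG G f -> LG G g -> Ex (fun w => f w - g w) = Ex f - Ex g.
Proof. by move=> Lf Lg; rewrite /Ex RintegralB//; exact: (LG_integrable sG). Qed.

Lemma ExZ f (c : R) : LG G f -> Ex (fun w => c * f w) = c * Ex f.
Proof. by move=> Lf; rewrite /Ex RintegralZl//; exact: (LG_integrable sG). Qed.

Lemma Ex_sum I (s : seq I) (Q : pred I) (h : I -> Omega -> R) :
  (forall i, Q i -> LG G (h i)) ->
  Ex (fun w => \sum_(i <- s | Q i) h i w) = \sum_(i <- s | Q i) Ex (h i).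
Proof.
move=> Lh; elim: s => [|i s IH].
  by rewrite big_nil; under eq_Ex do rewrite big_nil; exact: Ex_cst.
rewrite big_cons; under eq_Ex do rewrite big_cons.
case: ifP => // Qi; rewrite ExD ?IH//; first exact: Lh.
exact: LG_sum.
Qed.

Lemma Ex_le f g : LG G f -> LG G g -> (forall w, f w <= g w) -> Ex f <= Ex g.
Proof. by move=> Lf Lg fg; apply: le_Rintegral => //; exact: (LG_integrable sG). Qed.

Lemma Ex_ereal f : LG G f -> (forall w, 0 <= f w) ->
  ((\int[P]_w (f w)%:E) = (Ex f)%:E)%E.
Proof.
move=> Lf f0; rewrite /Ex /Rintegral fineK//.
exact: (integrable_fin_num _ (LG_integrable sG Lf)).
Qed.

End Full.
End Moments.

(** * Integrals determined by a weighted law *)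

Section Weighted.
Context {R : realType}.

Let wint d (T : measurableType d) (mu : {measure set T -> \bar R})
  (U Y : T -> R) (phi : R -> R) := (\int[mu]_x (phi (U x) * Y x)%:E)%E.

Import HBNNSimple.
(** A simple function sees [U] only through the fibres of its values, so that the integral depends
    only on the weighted masses of these fibres. *)
Lemma weighted_nnsfun d (T : measurableType d) (mu : {measure set T -> \bar R})
    (U Y : T -> R) (h : {nnsfun R >-> R}) :
  measurable_fun setT U -> measurable_fun setT Y -> (forall x, 0 <= Y x) ->
  wint mu U Y h =
  (\sum_(y \in range h) (y%:E * \int[mu]_(x in U @^-1` (h @^-1` [set y])) (Y x)%:E))%E.
Proof.
move=> mU mY Y0.
have mp y : measurable (U @^-1` (h @^-1` [set y])).
  by rewrite -[X in measurable X]setTI; apply: mU => //; exact: measurable_sfunP.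
have mi y : measurable_fun [set: T] (fun x => (\1_(U @^-1` (h @^-1` [set y])) x * Y x)).
  by apply: measurable_funM => //; exact: measurable_indic.
transitivity (\int[mu]_x (\sum_(y \in range h)
    (y * (\1_(U @^-1` (h @^-1` [set y])) x * Y x))%:E)%R)%E.
  apply: eq_integral => x _; rewrite fimfunE.
  by rewrite !fsbig_finite//= mulr_suml -sumEFin; apply: eq_bigr => y _; rewrite mulrA.
have y0 y x : 0 <= (y * (\1_(U @^-1` (h @^-1` [set y])) x * Y x)).
  have [hx|hx] := boolP (x \in U @^-1` (h @^-1` [set y])).
    rewrite mulr_ge0// ?mulr_ge0//.
    by move: hx; rewrite inE /= => <-.
  by rewrite indicE (negbTE hx) mul0r mulr0.
rewrite ge0_integral_fsum//; last 2 first.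
- by move=> y; apply/measurable_EFinP/measurable_funM.
- by move=> y x _; rewrite lee_fin.
rewrite !fsbig_finite//=; apply: eq_bigr => y _.
have [yh|yh] := boolP (0 <= y); last first.
  have E0 : U @^-1` (h @^-1` [set y]) = set0.
    by rewrite -subset0 => x /= hx; move: yh; rewrite -hx => /negP; apply.
  rewrite E0 integral_set0 mule0; apply: integral0_eq => x _.
  by rewrite indicE in_set0 mul0r mulr0.
under eq_integral do rewrite EFinM.
rewrite ge0_integralZl//; last 2 first.
- exact/measurable_EFinP.
- by move=> x _; rewrite lee_fin mulr_ge0.
congr (_ * _)%E; rewrite [RHS]integral_mkcond; apply: eq_integral => x _.
rewrite /patch indicE; case: ifP => _; by rewrite ?mul1r ?mul0r.
Qed.

Lemma weighted_limit d (T : measurableType d) (mu : {measure set T -> \bar R})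
    (U Y : T -> R) (phi : R -> R) (h : ({nnsfun R >-> R})^nat) :
  measurable_fun setT U -> measurable_fun setT Y -> (forall x, 0 <= Y x) ->
  {homo (h : nat -> R -> R) : n m / (n <= m)%N >-> (n <= m)%O} ->
  (forall x, (fun n => (h n x)%:E) @ \oo --> (phi x)%:E) ->
  (fun n => wint mu U Y (h n)) @ \oo --> wint mu U Y phi.
Proof.
move=> mU mY Y0 nd hphi.
have -> : wint mu U Y phi = (\int[mu]_x limn (fun n => (h n (U x) * Y x)%:E))%E.
  apply: eq_integral => x _; apply/esym/cvg_lim => //.
  by under eq_fun do rewrite EFinM; rewrite EFinM; apply: cvgeZr => //; exact: hphi.
apply: cvg_monotone_convergence => //.
- move=> n; apply/measurable_EFinP/measurable_funM => //.
  exact: measurableT_comp.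
- by move=> n x _; rewrite lee_fin mulr_ge0.
- move=> x _ n m nm; rewrite lee_fin ler_wpM2r//.
  by have /lefP := nd _ _ nm; apply.
Qed.

(* A weighted law determines the weighted integrals of nonnegative functions;
   taken with constant weights, with densities or with indicators, this yields
   transfer to the law, density formulas and independence. *)
Lemma weighted_transfer d1 (T1 : measurableType d1) (mu1 : {measure set T1 -> \bar R})
    d2 (T2 : measurableType d2) (mu2 : {measure set T2 -> \bar R})
    (U1 Y1 : T1 -> R) (U2 Y2 : T2 -> R) (phi : R -> R) :
  measurable_fun setT U1 -> measurable_fun setT Y1 -> (forall x, 0 <= Y1 x) ->
  measurable_fun setT U2 -> measurable_fun setT Y2 -> (forall x, 0 <= Y2 x) ->
  (forall C, measurable C -> \int[mu1]_(x in U1 @^-1` C) (Y1 x)%:E =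
                             \int[mu2]_(x in U2 @^-1` C) (Y2 x)%:E)%E ->
  measurable_fun setT phi -> (forall x, 0 <= phi x) ->
  (\int[mu1]_x (phi (U1 x) * Y1 x)%:E = \int[mu2]_x (phi (U2 x) * Y2 x)%:E)%E.
Proof.
move=> mU1 mY1 Y10 mU2 mY2 Y20 H mphi phi0.
have mphi' : measurable_fun setT (EFin \o phi) by exact/measurable_EFinP.
pose h := nnsfun_approx measurableT mphi'.
have nd : {homo (h : nat -> R -> R) : n m / (n <= m)%N >-> (n <= m)%O}.
  exact: nd_nnsfun_approx.
have hphi x : (fun n => (h n x)%:E) @ \oo --> (phi x)%:E.
  by apply: cvg_nnsfun_approx => // y _; rewrite lee_fin.
have c1 := @weighted_limit _ _ mu1 _ _ _ _ mU1 mY1 Y10 nd hphi.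
have c2 := @weighted_limit _ _ mu2 _ _ _ _ mU2 mY2 Y20 nd hphi.
rewrite -/(wint mu1 U1 Y1 phi) -/(wint mu2 U2 Y2 phi).
suff E : (fun n => wint mu1 U1 Y1 (h n)) = (fun n => wint mu2 U2 Y2 (h n)).
  rewrite E in c1.
  by apply: (cvg_unique _ c1 c2); exact: ereal_hausdorff.
apply/funext => n; rewrite !weighted_nnsfun//.
by apply: eq_fsbigr => y _; rewrite H.
Qed.

End Weighted.

(** * Orthogonality to a sub-sigma-algebra *)

Section Orth.
Context {R : realType} {disp : measure_display} {Omega : measurableType disp}.
Variable P : probability Omega R.
Implicit Types (G H : set (set Omega)) (f g : Omega -> R).

Lemma maxr0_sub (x : R) : Num.max x 0 - Num.max (- x) 0 = x.
Proof. by have [x0|x0] := leP x 0; have [y0|y0] := leP (- x) 0; lra. Qed.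

Lemma LG_pos G f : sub_sigma G -> LG P G f -> LG P G (fun w => Num.max (f w) 0).
Proof. by move=> sG Lf; apply: LG_max => //; exact: LG_cst. Qed.

Lemma Ex_ereal_eq f g : LG P measurable f -> LG P measurable g ->
  (forall w, 0 <= f w) -> (forall w, 0 <= g w) ->
  (\int[P]_w (f w)%:E = \int[P]_w (g w)%:E)%E -> Ex P f = Ex P g.
Proof. by move=> Lf Lg f0 g0 E; rewrite /Ex /Rintegral E. Qed.

(** The positive and the negative part of [Y], taken as weights, give equal mass to the events of
    [U], because these belong to [G]. Hence [weighted_transfer] equates the two weighted integrals
    of the positive part of [U], and likewise of [-U], and the four terms cancel. This lemma plays
    the part of conditional expectation. *)
Lemma Ex_orth G (U Y : Omega -> R) : sub_sigma G -> LG P G U -> LG P measurable Y ->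
  (forall A, G A -> Ex P (fun w => Y w * \1_A w) = 0) ->
  Ex P (fun w => U w * Y w) = 0.
Proof.
move=> sG LU LY H.
have sF := @sub_sigma_full disp Omega.
have LU' : LG P measurable U by exact: LG_full LU.
pose p (f : Omega -> R) w := Num.max (f w) 0.
have Lp f : LG P measurable f -> LG P measurable (p f) by exact: LG_pos.
have LN f : LG P measurable f -> LG P measurable (fun w => - f w) by exact: LGN.
have p0 f w : 0 <= p f w by rewrite /p le_max lexx orbT.
have key (V : Omega -> R) : LG P G V ->
    Ex P (fun w => p V w * p Y w) = Ex P (fun w => p V w * p (fun w => - Y w) w).
  move=> LV; have LV' : LG P measurable V by exact: LG_full LV.
  apply: Ex_ereal_eq.
  - by apply: LGM => //; exact: Lp.
  - by apply: LGM => //; [exact: Lp|apply: Lp; exact: LN].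
  - by move=> w; rewrite mulr_ge0.
  - by move=> w; rewrite mulr_ge0.
  have mV := LG_measurable sF LV'.
  have mpos f : LG P measurable f -> measurable_fun setT (p f).
    by move=> Lf; exact: (LG_measurable sF (Lp _ Lf)).
  apply: (@weighted_transfer _ _ _ P _ _ P V (p Y) V (p (fun w => - Y w))
    (fun x => Num.max x 0)) => //.
  - exact: mpos.
  - apply: mpos; exact: LN.
  - move=> C mC; have GA : G (V @^-1` C) by have [/(gmeasP _ sG) + _] := LV; apply.
    rewrite integral_mkcond [RHS]integral_mkcond.
    have E f : (\int[P]_x ((fun x => (f x)%:E) \_ (V @^-1` C)) x =
        \int[P]_w (f w * \1_(V @^-1` C) w)%:E)%E.
      apply: eq_integral => x _; rewrite /patch indicE.
      by case: ifP => _; rewrite ?mulr1 ?mulr0.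
    rewrite !E.
    have L1 : LG P measurable (\1_(V @^-1` C) : Omega -> R).
      by apply: LG_indic => //; exact: (sub_sigma_measurable sG).
    have Lf f : LG P measurable f -> LG P measurable (fun w => p f w * \1_(V @^-1` C) w).
      by move=> Lf; apply: LGM => //; exact: Lp.
    have EE f : LG P measurable f -> (\int[P]_w (p f w * \1_(V @^-1` C) w)%:E)%E =
        (Ex P (fun w => p f w * \1_(V @^-1` C) w))%:E.
      by move=> /Lf Lf'; rewrite (Ex_ereal sF)// => w; rewrite mulr_ge0.
    rewrite !EE//; last exact: LN.
    congr EFin; apply/eqP; rewrite -subr_eq0 -(ExB sF); last 2 first.
    - exact: Lf.
    - by apply: Lf; exact: LN.
    by apply/eqP; rewrite -[RHS](H _ GA); apply: eq_Ex => w; rewrite -mulrBl maxr0_sub.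
  - by apply: measurable_maxr => //; exact: measurable_cst.
  - by move=> x; rewrite le_max lexx orbT.
have L4 f g : LG P measurable f -> LG P measurable g -> LG P measurable (fun w => p f w * p g w).
  by move=> Lf Lg; apply: LGM => //; exact: Lp.
transitivity (Ex P (fun w => (p U w * p Y w - p U w * p (fun w => - Y w) w) -
   (p (fun w => - U w) w * p Y w - p (fun w => - U w) w * p (fun w => - Y w) w))).
  by apply: eq_Ex => w; rewrite -!mulrBr -mulrBl !maxr0_sub.
have LNU := LN _ LU'; have LNY := LN _ LY.
rewrite !(ExB sF)//; try by [exact: L4 | apply: LGB => //; exact: L4].
by rewrite !key// ?subrr//; exact: LGN.
Qed.

End Orth.

(** * Gaussian increments *)

Section ExpBounds.
Context {R : realType}.
Implicit Types x y K C : R.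

Lemma mvt_bound0 (f df : R -> R) K x : (forall y, is_derive y (1:R) f (df y)) ->
  (forall y, `|y| <= `|x| -> `|df y| <= K) -> `|f x - f 0| <= K * `|x|.
Proof.
move=> fd HK.
have cf : continuous f.
  by move=> y; apply/differentiable_continuous/derivable1_diffP; case: (fd y).
have [x0|x0] := leP 0 x.
  have [|c /itvP cx ->] := @MVT_segment _ f df 0 x x0 (fun y _ => fd y).
    exact: continuous_subspaceT.
  rewrite subr0 normrM ler_wpM2r// HK// !ger0_norm// ?cx//.
have [|c /itvP cx E] := @MVT_segment _ f df x 0 (ltW x0) (fun y _ => fd y).
  exact: continuous_subspaceT.
rewrite -normrN opprB E sub0r normrM normrN ler_wpM2r// HK//.
by rewrite !ler0_norm ?lerN2 ?cx// ltW.
Qed.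

(** The three remainders of the exponential series follow from one another by the mean value
    theorem: the derivative of each is the preceding one, and that of the first is the exponential.
    The constants are not sharp. *)
Lemma norm_expR_sub1 x : `|expR x - 1| <= `|x| * expR `|x|.
Proof.
rewrite -[in X in X <= _]expR0 mulrC; apply: (@mvt_bound0 expR expR) => y yx.
by rewrite ger0_norm ?expR_ge0// ler_expR (le_trans (ler_norm _)).
Qed.

Lemma norm_expR_sub2 x : `|expR x - 1 - x| <= `|x| ^+ 2 * expR `|x|.
Proof.
pose f y := expR y - 1 - y : R.
have -> : expR x - 1 - x = f x - f 0 by rewrite /f expR0; ring.
rewrite expr2 -mulrA mulrC.
apply: (@mvt_bound0 f (fun y => expR y - 1)) => y => [|yx].
  rewrite /f; apply: is_derive_eq; rewrite /GRing.scale/=; ring.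
apply: le_trans (norm_expR_sub1 y) _; rewrite ler_pM ?expR_ge0//.
by rewrite ler_expR.
Qed.

Lemma norm_expR_sub3 x : `|expR x - 1 - x - x ^+ 2 / 2| <= `|x| ^+ 3 * expR `|x|.
Proof.
pose f y := expR y - 1 - y - y ^+ 2 / 2 : R.
have -> : expR x - 1 - x - x ^+ 2 / 2 = f x - f 0 by rewrite /f expR0; ring.
rewrite exprS -mulrA mulrC.
apply: (@mvt_bound0 f (fun y => expR y - 1 - y)) => y => [|yx].
  rewrite /f; apply: is_derive_eq; rewrite /GRing.scale/=; field=> //.
apply: le_trans (norm_expR_sub2 y) _; rewrite ler_pM ?expR_ge0//.
  by rewrite lerXn2r ?nnegrE.
by rewrite ler_expR.
Qed.

Lemma pow_le_exp x n : 0 <= x -> x ^+ n <= n`!%:R * expR x.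
Proof.
case: n => [|n] x0; first by rewrite expr0 fact0 mul1r -expR0 ler_expR.
have := expR_ge1Dxn n x0; have f0 : (0 : R) < n.+1`!%:R by rewrite ltr0n fact_gt0.
move=> H; rewrite mulrC -ler_pdivrMr//; lra.
Qed.

Lemma le0_of_small (a C : R) : (forall l, 0 < l -> l <= 1 -> a <= C * l) -> a <= 0.
Proof.
move=> H; apply/ler_addgt0Pr => e e0; rewrite add0r.
have C0 : 0 < `|C| + 1 by rewrite ltr_wpDl.
pose l := Num.min 1 (e / (`|C| + 1)).
have l0 : 0 < l by rewrite lt_min ltr01 divr_gt0.
apply: le_trans (H l l0 _) _; first by rewrite ge_min lexx.
apply: (@le_trans _ _ ((`|C| + 1) * l)).
  by rewrite ler_wpM2r ?(ltW l0)// (le_trans (ler_norm _))// lerDl.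
by rewrite mulrC -ler_pdivlMr// ge_min lexx orbT.
Qed.

End ExpBounds.

Section Increment.
Context {R : realType} {disp : measure_display} {Omega : measurableType disp}.
Variables (P : probability Omega R) (r : nat).
Implicit Types (G H : set (set Omega)) (f g : Omega -> R).

(** One Wiener increment over a step [h]. Independence from the past [G] and the law are given on
    products of coordinate events; moments and orthogonality relations are derived from these. *)
Record gauss_incr G (h : R) (W : Omega -> 'cV[R]_r) : Prop := {
  gi_gt0 : 0 < h;
  gi_meas : forall j, measurable_fun setT (fun w => W w j 0);
  gi_indep : forall (A : set Omega) (C : 'I_r -> set R), G A ->
    (forall j, measurable (C j)) ->
    let E := [set w | forall j, C j (W w j 0)] in
    P (A `&` E) = (P A * P E)%E;
  gi_law : forall C : 'I_r -> set R, (forall j, measurable (C j)) ->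
    P [set w | forall j, C j (W w j 0)] =
    (\prod_(j < r) normal_prob 0 (Num.sqrt h) (C j))%E }.

Variables (G : set (set Omega)) (h : R) (W : Omega -> 'cV[R]_r).
Hypotheses (sG : sub_sigma G) (HW : gauss_incr G h W).
Let h0 := gi_gt0 HW.
Let sF := @sub_sigma_full disp Omega.

Lemma gi_law1 j C : measurable C ->
  P [set w | C (W w j 0)] = normal_prob 0 (Num.sqrt h) C.
Proof.
move=> mC.
have := gi_law HW (C := fun i => if i == j then C else setT).
rewrite (bigD1 j)//= eqxx big1 => [|i /negbTE ->]; last exact: probability_setT.
rewrite mule1 => <-; last by move=> i; case: ifP.
congr (P _); apply/seteqP; split => w /=.
  by move=> Cw i; case: eqVneq => // ->.
by move=> /(_ j); rewrite eqxx.
Qed.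

(** Completing the square: [exp (l x)] times the centred density of variance [h] is
    [exp (l^2 h / 2)] times the density of mean [l h]. *)
Lemma gi_mgf j (l : R) :
  (\int[P]_w (expR (l * W w j 0))%:E = (expR (l ^+ 2 * h / 2))%:E)%E.
Proof.
have s0 : Num.sqrt h != 0 by rewrite gt_eqF// sqrtr_gt0.
transitivity (\int[lebesgue_measure]_x (expR (l * x) * normal_pdf 0 (Num.sqrt h) x)%:E)%E.
  transitivity (\int[P]_w (expR (l * W w j 0) * 1)%:E)%E.
    by under [in RHS]eq_integral do rewrite mulr1.
  apply: (@weighted_transfer _ _ _ P _ _ lebesgue_measure (fun w => W w j 0) (cst 1)
    id (normal_pdf 0 (Num.sqrt h)) (fun x => expR (l * x))) => //.
  - exact: gi_meas HW j.
  - exact: measurable_normal_pdf.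
  - exact: normal_pdf_ge0.
  - move=> C mC; have -> : (fun x : Omega => (cst 1 x)%:E) = cst (1%:E) :> (Omega -> \bar R) by [].
    rewrite integral_cst//=; last first.
      by rewrite -[X in measurable X]setTI; exact: (gi_meas HW j).
    by rewrite mul1e; exact: gi_law1.
  - apply: measurableT_comp; first exact: measurable_expR.
    exact: mulrl_measurable.
transitivity (\int[lebesgue_measure]_x
   ((expR (l ^+ 2 * h / 2))%:E * (normal_pdf (l * h) (Num.sqrt h) x)%:E))%E.
  apply: eq_integral => x _; rewrite -EFinM; congr EFin.
  rewrite !normal_pdfE//= /normal_fun sqr_sqrtr ?(ltW h0)//.
  rewrite mulrCA [RHS]mulrCA; congr (_ * _); rewrite -!expRD; congr expR.
  have hn : h != 0 by rewrite gt_eqF.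
  by rewrite -mulr_natr; field.
rewrite ge0_integralZl//.
- by rewrite integral_normal_pdf mule1.
- by apply/measurable_EFinP; exact: measurable_normal_pdf.
- by move=> x _; rewrite lee_fin normal_pdf_ge0.
Qed.

(** A power of such an exponential is again one, so that the moment generating function bounds all
    moments. *)
Lemma LG_expW j l : LG P measurable (fun w => expR (l * W w j 0)).
Proof.
split.
  apply: gmeas_full.
  apply: measurableT_comp; first exact: measurable_expR.
  by apply: measurable_funM => //; exact: gi_meas HW j.
move=> p; exists (expR ((p%:R * l) ^+ 2 * h / 2)).
rewrite -(gi_mgf j); under eq_integral do rewrite ger0_norm ?expR_ge0// -expRM_natl mulrA.
by [].
Qed.

Lemma expR_norm_le (x : R) : expR `|x| <= expR x + expR (- x).
Proof. have := expR_ge0 x; have := expR_ge0 (- x).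
by have [x0|x0] := leP 0 x; [rewrite (ger0_norm x0)|rewrite (ltr0_norm x0)]; lra. Qed.

Lemma LG_W j : LG P measurable (fun w => W w j 0).
Proof.
apply: (@LG_dom _ _ _ _ _ _ (fun w => expR (1 * W w j 0) + expR (- 1 * W w j 0))) => //.
- by apply: gmeas_full; exact: gi_meas HW j.
- by apply: LGD => //; exact: LG_expW.
- move=> w; rewrite [leRHS]ger0_norm ?addr_ge0 ?expR_ge0// mul1r mulN1r.
  apply: le_trans (expR_norm_le _); apply: le_trans (expR_ge1Dx _).
  by rewrite lerDr.
Qed.

Lemma Ex_expW j l : Ex P (fun w => expR (l * W w j 0)) = expR (l ^+ 2 * h / 2).
Proof. by rewrite /Ex /Rintegral gi_mgf. Qed.

(** Mean and variance are read off the moment generating function: both sides of [Ex_expW] are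
    expanded to second order in [l], and the expansions agree up to [C |l|^3]. *)
Lemma Ex_W12 j : Ex P (fun w => W w j 0) = 0 /\ Ex P (fun w => W w j 0 ^+ 2) = h.
Proof.
have LW := LG_W j.
set m := Ex P _; set q := Ex P _.
pose E1 w := expR (1 * W w j 0) + expR (- 1 * W w j 0).
have LE : LG P measurable E1 by apply: LGD => //; exact: LG_expW.
pose D w := `|W w j 0| ^+ 3 * E1 w.
have LD : LG P measurable D by apply: LGM => //; exact: LGX_norm.
have LX2 := LGX 2 sF LW.
(* For [|l| <= 1], the first summand bounds the mean remainder of [exp (l W)], the second the
   remainder of [exp (l^2 h / 2)]. *)
pose C := Ex P D + h ^+ 2 * expR h.
have key (l : R) : `|l| <= 1 -> `|l * m + l ^+ 2 / 2 * (q - h)| <= C * `|l| ^+ 3.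
  move=> l1.
  have LS : LG P measurable (fun w => expR (l * W w j 0) - 1 - l * W w j 0 - l ^+ 2 / 2 * W w j 0 ^+ 2).
    by repeat apply: LGB => //; [exact: LG_expW|exact: LG_cst|exact: LGZ|exact: LGZ].
  have E : Ex P (fun w => expR (l * W w j 0) - 1 - l * W w j 0 - l ^+ 2 / 2 * W w j 0 ^+ 2) =
     expR (l ^+ 2 * h / 2) - 1 - l * m - l ^+ 2 / 2 * q.
    have L1 := LG_expW j l; have L2 := LG_cst P measurable (1 : R).
    have L3 := LGZ l sF LW; have L4 := LGZ (l ^+ 2 / 2) sF LX2.
    rewrite (ExB sF (LGB sF (LGB sF L1 L2) L3) L4) (ExB sF (LGB sF L1 L2) L3) (ExB sF L1 L2).
    by rewrite Ex_cst Ex_expW (ExZ sF _ LW) (ExZ sF _ LX2).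
  have l01 : 0 <= `|l| by [].
  have l3 : `|l| ^+ 4 <= `|l| ^+ 3 by rewrite ler_wiXn2l.
  have B1 : `|Ex P (fun w => expR (l * W w j 0) - 1 - l * W w j 0 - l ^+ 2 / 2 * W w j 0 ^+ 2)|
      <= `|l| ^+ 3 * Ex P D.
    rewrite -(ExZ sF _ LD); apply: le_trans (le_normr_Rintegral _ _) _ => //.
      exact: LG_integrable LS.
    apply: (Ex_le sF) => //; first exact: LG_norm.
      exact: LGZ.
    move=> w; rewrite -[l ^+ 2 / 2 * _](_ : (l * W w j 0) ^+ 2 / 2 = _); last by field.
    apply: le_trans (norm_expR_sub3 _) _.
    rewrite normrM exprMn -mulrA ler_wpM2l ?exprn_ge0//.
    rewrite ler_wpM2l ?exprn_ge0//; apply: (@le_trans _ _ (expR `|W w j 0|)).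
      by rewrite ler_expR ler_piMl.
    by rewrite /E1 mul1r mulN1r expR_norm_le.
  have B2 : `|expR (l ^+ 2 * h / 2) - 1 - l ^+ 2 * h / 2| <= `|l| ^+ 3 * (h ^+ 2 * expR h).
    apply: le_trans (norm_expR_sub2 _) _.
    have l2 : l ^+ 2 <= 1 by rewrite -real_normK ?num_real// exprn_ile1.
    have h2 : 0 <= l ^+ 2 * h / 2 by rewrite divr_ge0// mulr_ge0 ?sqr_ge0// ltW.
    rewrite ger0_norm// mulrA; apply: ler_pM; rewrite ?exprn_ge0 ?expR_ge0//; last first.
      rewrite ler_expR; have := ler_wpM2r (ltW h0) l2; have := ltW h0; lra.
    rewrite -mulrA exprMn -exprM -[l ^+ _](_ : `|l| ^+ 4 = _); last first.
      by rewrite (exprM _ 2 2) -[in RHS](real_normK (num_real l)) -exprM.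
    apply: ler_pM; rewrite ?exprn_ge0//.
      by rewrite ?divr_ge0 ?(ltW h0).
    by rewrite lerXn2r ?nnegrE ?divr_ge0 ?(ltW h0)//; have := ltW h0; lra.
  have -> : l * m + l ^+ 2 / 2 * (q - h) = (expR (l ^+ 2 * h / 2) - 1 - l ^+ 2 * h / 2)
     - Ex P (fun w => expR (l * W w j 0) - 1 - l * W w j 0 - l ^+ 2 / 2 * W w j 0 ^+ 2).
    by rewrite E; field.
  apply: le_trans (ler_normB _ _) _; rewrite [C * _]mulrC /C [`|l| ^+ 3 * _]mulrDr addrC.
  by rewrite lerD.
(* From the estimate at [l] and at [-l], the difference isolates the mean and the sum isolates the
   variance. *)
have kk (l : R) : 0 < l -> l <= 1 -> l * `|m| <= C * l ^+ 3 /\ l ^+ 2 * `|q - h| <= 2 * C * l ^+ 3.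
  move=> l0 l1; have := key l; have := key (- l); rewrite normrN (gtr0_norm l0).
  move=> /(_ l1) + /(_ l1); rewrite sqrrN !ler_norml => /andP[a b] /andP[c d].
  rewrite -[l * `|m|](_ : `|l * m| = _); last by rewrite normrM (gtr0_norm l0).
  rewrite -[l ^+ 2 * `|_|](_ : `|l ^+ 2 * (q - h)| = _); last first.
    by rewrite normrM (@ger0_norm _ (l ^+ 2)) ?sqr_ge0.
  by split; rewrite ler_norml; apply/andP; split; lra.
have C0 : 0 <= C.
  apply: addr_ge0; last by rewrite mulr_ge0 ?expR_ge0 ?sqr_ge0.
  apply: Ex_ge0 => w.
  by rewrite mulr_ge0 ?exprn_ge0// addr_ge0 ?expR_ge0.
split.
  apply/eqP; rewrite -normr_eq0 eq_le normr_ge0 andbT; apply: (@le0_of_small _ _ C) => l l0 l1.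
  have [H _] := kk l l0 l1; rewrite -(ler_pM2l l0); apply: le_trans H _.
  have l3 : l ^+ 3 <= l * l.
    by rewrite exprSr expr2 ler_piMr// mulr_ge0// ltW.
  by rewrite [leRHS]mulrCA ler_wpM2l.
apply/eqP; rewrite -subr_eq0 -normr_eq0 eq_le normr_ge0 andbT.
apply: (@le0_of_small _ _ (2 * C)) => l l0 l1.
have [_ H] := kk l l0 l1; have l2 : 0 < l ^+ 2 by rewrite exprn_gt0.
by rewrite -(ler_pM2l l2); apply: le_trans H _; rewrite [leRHS]mulrCA -exprSr.
Qed.

Definition coord_sigma j : set (set Omega) :=
  preimage_set_system setT (fun w => W w j 0) measurable.

Lemma coord_sub_sigma j : sub_sigma (coord_sigma j).
Proof.
split; last first.
  by move=> _ [C mC <-]; apply: (gi_meas HW j) => //.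
exact: sigma_algebra_preimage (sigma_algebra_measurable _).
Qed.

Lemma gmeas_coord j : gmeas (coord_sigma j) (fun w => W w j 0).
Proof.
apply/(gmeasP _ (coord_sub_sigma j)) => C mC; exists C => //.
by rewrite setTI.
Qed.

Lemma Ex_indic A : measurable A -> Ex P (\1_A : Omega -> R) = fine (P A).
Proof.
by move=> mA; rewrite /Ex /Rintegral integral_indic// setIT.
Qed.

(** [Ex_orth] is used twice. The centred indicator of an event of [G] is orthogonal to functions of
    the coordinate, by independence on product events; therefore the centred [phi (W_j)] is
    orthogonal to [Z]. *)
Lemma Ex_indep Z phi j : LG P G Z -> measurable_fun setT phi ->
  LG P measurable (fun w => phi (W w j 0)) ->
  Ex P (fun w => Z w * phi (W w j 0)) = Ex P Z * Ex P (fun w => phi (W w j 0)).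
Proof.
move=> LZ mphi Lphi; set c := Ex P (fun w => phi _).
have LZ' := LG_full sG LZ; have Lc := LG_cst P measurable c.
have : Ex P (fun w => Z w * (phi (W w j 0) - c)) = 0.
  apply: (Ex_orth sG LZ); first exact: LGB.
  move=> A GA; have mA := sub_sigma_measurable sG GA.
  have LA : LG P measurable (\1_A : Omega -> R) by exact: LG_indic.
  have LPA := LG_cst P measurable (fine (P A)).
  have E : Ex P (fun w => phi (W w j 0) * (\1_A w - fine (P A))) = 0.
    apply: (@Ex_orth _ _ _ _ (coord_sigma j)); first exact: coord_sub_sigma.
    - split; first by apply: measurableT_comp => //; exact: gmeas_coord.
      by have [_] := Lphi.
    - exact: LGB.
    - move=> _ [C mC <-]; rewrite setTI.
      pose D := (fun w => W w j 0) @^-1` C; rewrite -/D.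
      have mD : measurable D by rewrite -[D]setTI; exact: (gi_meas HW j).
      have LD : LG P measurable (\1_D : Omega -> R) by exact: LG_indic.
      transitivity (Ex P (fun w => \1_(A `&` D) w - fine (P A) * \1_D w)).
        by apply: eq_Ex => w; rewrite indicI mulrBl.
      rewrite (ExB sF) ?(ExZ sF _ LD)//; last 2 first.
      - by apply: LG_indic => //; exact: measurableI.
      - exact: LGZ.
      rewrite !Ex_indic//; last exact: measurableI.
      have := gi_indep HW (C := fun i => if i == j then C else setT) GA.
      have -> : [set w | forall i, (if i == j then C else setT) (W w i 0)] = D.
        apply/seteqP; split => w /=; first by move=> /(_ j); rewrite eqxx.
        by move=> Cw i; case: eqVneq => // ->.
      move=> ->; last by move=> i; case: ifP.
      by rewrite fineM ?subrr//; exact: fin_num_measure.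
  transitivity (Ex P (fun w => phi (W w j 0) * (\1_A w - fine (P A)) +
     (fine (P A) * phi (W w j 0) - c * \1_A w))).
    by apply: eq_Ex => w; ring.
  have L1 := LGZ (fine (P A)) sF Lphi; have L2 := LGZ c sF LA.
  rewrite (ExD sF) ?E//; last 2 first.
  - by apply: LGM => //; exact: LGB.
  - exact: LGB.
  by rewrite (ExB sF L1 L2) (ExZ sF _ Lphi) (ExZ sF _ LA) Ex_indic// -/c add0r mulrC subrr.
have L1 : LG P measurable (fun w => Z w * phi (W w j 0)) by exact: LGM.
have L2 := LGZ c sF LZ'.
move=> H; apply/eqP; rewrite -subr_eq0 mulrC -(ExZ sF _ LZ') -(ExB sF L1 L2) -H.
by apply/eqP; apply: eq_Ex => w; ring.
Qed.

Lemma Ex_mulW Z j : LG P G Z -> Ex P (fun w => Z w * W w j 0) = 0.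
Proof.
move=> LZ; rewrite (Ex_indep (phi := id)) ?(Ex_W12 j).1 ?mulr0//; exact: LG_W.
Qed.

(** Off the diagonal [Ex_orth] removes [Z], then coordinate [m], then coordinate [j], until only
    indicators remain; on product events, independence from [G] and the product form of the law
    factorise the probability. *)
Lemma Ex_mulWW Z j m : LG P G Z ->
  Ex P (fun w => Z w * (W w j 0 * W w m 0)) = (j == m)%:R * h * Ex P Z.
Proof.
move=> LZ; have [<-|jm] := eqVneq j m.
  rewrite mul1r mulrC -(Ex_W12 j).2.
  under eq_Ex do rewrite -expr2.
  rewrite (Ex_indep (phi := fun x => x ^+ 2))//.
  by apply: LGX => //; exact: LG_W.
rewrite !mul0r; have Lj := LG_W j; have Lm := LG_W m.
apply: (Ex_orth sG LZ) => [|A GA]; first exact: LGM.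
have mA := sub_sigma_measurable sG GA.
have LA : LG P measurable (\1_A : Omega -> R) by exact: LG_indic.
transitivity (Ex P (fun w => W w m 0 * (W w j 0 * \1_A w))).
  by apply: eq_Ex => w; ring.
have Wcoord i : LG P (coord_sigma i) (fun w => W w i 0).
  by split; [exact: gmeas_coord|have [_] := LG_W i].
apply: (Ex_orth (coord_sub_sigma m)); [exact: Wcoord|exact: LGM|].
move=> _ [C mC <-]; rewrite setTI; pose B := (fun w => W w m 0) @^-1` C; rewrite -/B.
have mB : measurable B by rewrite -[B]setTI; exact: (gi_meas HW m).
have LB : LG P measurable (\1_B : Omega -> R) by exact: LG_indic.
(* Since [W_j] is centred, subtracting the constant [c] changes nothing; it makes the product of
   indicators orthogonal to the events of coordinate [j]. *)
pose c := fine (P A) * fine (P B).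
have LAB : LG P measurable (fun w => \1_A w * \1_B w : R) by exact: LGM.
have Lc := LG_cst P measurable c.
have : Ex P (fun w => W w j 0 * (\1_A w * \1_B w - c)) = 0.
  apply: (Ex_orth (coord_sub_sigma j)); [exact: Wcoord|exact: LGB|].
  move=> _ [D mD <-]; rewrite setTI; pose E := (fun w => W w j 0) @^-1` D; rewrite -/E.
  have mE : measurable E by rewrite -[E]setTI; exact: (gi_meas HW j).
  have LE : LG P measurable (\1_E : Omega -> R) by exact: LG_indic.
  transitivity (Ex P (fun w => \1_(A `&` (B `&` E)) w - c * \1_E w)).
    by apply: eq_Ex => w; rewrite !indicI mulrBl/= mulrA.
  rewrite (ExB sF) ?(ExZ sF _ LE)//; last 2 first.
  - by apply: LG_indic => //; apply: measurableI => //; exact: measurableI.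
  - exact: LGZ.
  rewrite !Ex_indic//; last by apply: measurableI => //; exact: measurableI.
  pose K i := if i == j then D else if i == m then C else setT.
  have mK i : measurable (K i) by rewrite /K; case: ifP => // _; case: ifP.
  have KE : [set w | forall i, K i (W w i 0)] = B `&` E.
    apply/seteqP; split => w /=.
      move=> H; split; have := H j; have := H m; rewrite /K !eqxx//.
      by rewrite eq_sym (negbTE jm).
    by move=> [Bw Ew] i; rewrite /K; case: eqVneq => [->//|_]; case: eqVneq => [->|].
  have := gi_indep HW GA mK => /=; rewrite KE => ->.
  have PBE : P (B `&` E) = (P B * P E)%E.
    rewrite -KE (gi_law HW mK) (bigD1 m)//= (bigD1 j)//= big1 ?mule1; last first.
      by move=> i /andP[im ij]; rewrite /K (negbTE im) (negbTE ij); exact: probability_setT.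
    by rewrite /K !eqxx eq_sym (negbTE jm) -(gi_law1 m mC) -(gi_law1 j mD).
  rewrite PBE !fineM ?fin_numM ?fin_num_measure// /c; ring.
have L1 : LG P measurable (fun w => W w j 0 * (\1_A w * \1_B w)) by exact: LGM.
have L2 := LGZ c sF Lj.
move=> H.
transitivity (Ex P (fun w => W w j 0 * (\1_A w * \1_B w - c) + c * W w j 0)).
  by apply: eq_Ex => w; ring.
rewrite (ExD sF) ?H ?(ExZ sF _ Lj) ?(Ex_W12 j).1 ?mulr0 ?addr0//.
by apply: LGM => //; exact: LGB.
Qed.

(** A majorant of [exp (l |W| / sqrt h)] made of exponentials of single coordinates, whose means are
    explicit. The scaling makes its mean [gconst l] free of [h]. *)
Definition gexp l w := 1 + \sum_(j < r)
  (expR (l / Num.sqrt h * W w j 0) + expR (- (l / Num.sqrt h) * W w j 0)).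

Lemma LG_gexp l : LG P measurable (gexp l).
Proof.
apply: LGD => //; first exact: LG_cst.
by apply: LG_sum => // j _; apply: LGD => //; exact: LG_expW.
Qed.

Definition gconst (l : R) := 1 + (r%:R * (expR (l ^+ 2 / 2) *+ 2)).

Lemma gconst_ge1 l : 1 <= gconst l.
Proof. by rewrite lerDl mulr_ge0// mulrn_wge0// expR_ge0. Qed.

Lemma Ex_gexp Z l : LG P G Z -> Ex P (fun w => Z w * gexp l w) = gconst l * Ex P Z.
Proof.
move=> LZ; have LZ' := LG_full sG LZ.
have L0 j (a : R) : LG P measurable (fun w => Z w * expR (a * W w j 0)).
  by apply: LGM => //; exact: LG_expW.
transitivity (Ex P (fun w => Z w + \sum_(j < r)
   (Z w * expR (l / Num.sqrt h * W w j 0) + Z w * expR (- (l / Num.sqrt h) * W w j 0)))).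
  by apply: eq_Ex => w; rewrite /gexp mulrDr mulr1 mulr_sumr; under eq_bigr do rewrite mulrDr.
rewrite (ExD sF)//; last by apply: LG_sum => // j _; exact: LGD.
rewrite (Ex_sum sF)//; last by move=> j _; exact: LGD.
under eq_bigr => j _.
  rewrite (ExD sF)//.
  have E (a : R) : a ^+ 2 = l ^+ 2 / h -> Ex P (fun w => Z w * expR (a * W w j 0)) =
      Ex P Z * expR (l ^+ 2 / 2).
    move=> aE; rewrite (Ex_indep (phi := fun x => expR (a * x)))//.
    - by rewrite Ex_expW aE divfK// gt_eqF.
    - apply: measurableT_comp; first exact: measurable_expR.
      exact: mulrl_measurable.
    - exact: LG_expW.
  rewrite !E ?sqrrN; last 2 first.
  - by rewrite expr_div_n sqr_sqrtr// ltW.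
  - by rewrite expr_div_n sqr_sqrtr// ltW.
  over.
rewrite sumr_const card_ord /gconst -mulr_natl -mulr2n.
by ring.
Qed.

End Increment.

(** * Coefficients and one step of the differential equation *)

Section ColNorm.
Context {R : realType} {n : nat}.
Implicit Types x y : 'cV[R]_n.

(** The norm of a column is the maximum of its coordinates; [enorm_sqr_le] bounds by it the
    Euclidean norm in which the result is stated. *)
Lemma colnorm_ge x i : `|x i 0| <= `|x|.
Proof.
rewrite [leRHS]mx_normrE; exact: (@le_bigmax _ _ _ 0 (fun ij : 'I_n * 'I_1 => `|x ij.1 ij.2|) (i, 0)).
Qed.

Lemma colnorm_le x K : 0 <= K -> (forall i, `|x i 0| <= K) -> `|x| <= K.
Proof.
move=> K0 H; rewrite [leLHS]mx_normrE; apply/bigmax_leP; split=> // -[i j] _ /=.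
by rewrite ord1.
Qed.

Lemma enorm_sqr x : enorm x ^+ 2 = \sum_i x i 0 ^+ 2.
Proof. by rewrite /enorm sqr_sqrtr// sumr_ge0// => i _; rewrite sqr_ge0. Qed.

Lemma enorm_sqr_le x : enorm x ^+ 2 <= n%:R * `|x| ^+ 2.
Proof.
rewrite enorm_sqr -[n in n%:R]card_ord -sumr_const mulr_suml ler_sum// => i _.
by rewrite mul1r -real_normK ?num_real// lerXn2r ?nnegrE ?colnorm_ge.
Qed.

End ColNorm.

Section Calculus.
Context {R : realType} {v : nat}.
Implicit Types (f : 'cV[R]_v -> R) (x y : 'cV[R]_v).

Lemma is_derive_line f x (l : 'I_v) (t : R) :
  derivable f (x + t *: delta_mx l 0) (delta_mx l 0) ->
  is_derive t (1 : R) (fun t => f (x + t *: delta_mx l 0))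
    (partial l f (x + t *: delta_mx l 0)).
Proof.
set e := delta_mx l 0 => /derivableP[df Df].
have E : (fun h : R => h^-1 *: (((fun t => f (x + t *: e)) \o shift t) (h *: (1 : R)) - f (x + t *: e)))
  = (fun h : R => h^-1 *: ((f \o shift (x + t *: e)) (h *: e) - f (x + t *: e))).
  apply/funext => h /=; congr (_ *: (f _ - _)).
  by rewrite [h%:A]mulr1 scalerDl addrCA.
split; first by rewrite /derivable E.
by rewrite /derive E.
Qed.

(** The segment from [x] to [y] is replaced by a path that changes one coordinate at a time. On each
    leg the one-dimensional mean value theorem asks only for a partial derivative, and the legs stay
    within [|y - x|] of [x] because the norm is the maximum norm. *)
Lemma mvt_coord f x y : (forall l z, derivable f z (delta_mx l 0)) ->
  exists xi : 'I_v -> 'cV[R]_v, (forall l, `|xi l - x| <= `|y - x|) /\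
    f y - f x = \sum_l partial l f (xi l) * (y l 0 - x l 0).
Proof.
move=> df.
pose z k : 'cV[R]_v := \col_i if (i < k)%N then y i 0 else x i 0.
have zS (l : 'I_v) : z l.+1 = z l + (y l 0 - x l 0) *: delta_mx l 0.
  apply/matrixP => i j; rewrite ord1 !mxE ltnS leq_eqVlt andbT.
  case: (ltngtP i l) => il /=.
  - by rewrite -val_eqE/= (ltn_eqF il) mulr0 addr0.
  - by rewrite -val_eqE/= (gtn_eqF il) mulr0 addr0.
  - by rewrite (val_inj il : i = l) eqxx mulr1 addrC subrK.
have step (l : 'I_v) : exists xi, `|xi - x| <= `|y - x| /\
    f (z l.+1) - f (z l) = partial l f xi * (y l 0 - x l 0).
  pose phi t := f (z l + t *: delta_mx l 0).
  have dphi t : is_derive t (1 : R) phi (partial l f (z l + t *: delta_mx l 0)).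
    exact: is_derive_line.
  have cphi : continuous phi.
    by move=> t; apply/differentiable_continuous/derivable1_diffP; case: (dphi t).
  have [c [cb E]] : exists c, `|c| <= `|y l 0 - x l 0| /\
      phi (y l 0 - x l 0) - phi 0 = partial l f (z l + c *: delta_mx l 0) * (y l 0 - x l 0).
    have [a0|a0] := leP 0 (y l 0 - x l 0).
      have [|c /itvP cx ->] := @MVT_segment _ phi _ 0 _ a0 (fun t _ => dphi t).
        exact: continuous_subspaceT.
      by exists c; rewrite subr0 !ger0_norm ?cx.
    have [|c /itvP cx E] := @MVT_segment _ phi _ _ 0 (ltW a0) (fun t _ => dphi t).
      exact: continuous_subspaceT.
    exists c; rewrite !ler0_norm ?cx ?(ltW a0)// lerN2 cx; split=> //.
    by rewrite -opprB E sub0r mulrN opprK.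
  exists (z l + c *: delta_mx l 0); split; last first.
    by rewrite -E /phi scale0r addr0 zS.
  apply: colnorm_le => // i; rewrite !mxE andbT.
  have := colnorm_ge (y - x) i; rewrite !mxE => Hi.
  have [<-|il] := eqVneq i l.
    rewrite ltnn mulr1 addrAC subrr add0r; apply: le_trans cb _.
    by have := colnorm_ge (y - x) l; rewrite !mxE.
  by rewrite mulr0 addr0; case: ifP => // _; rewrite subrr normr0.
have [xi Hxi] := choice step; exists xi; split; first by move=> l; case: (Hxi l).
under eq_bigr => l _ do rewrite -(Hxi l).2.
have -> : y = z v by apply/matrixP => i j; rewrite ord1 mxE ltn_ord.
have -> : x = z 0%N by apply/matrixP => i j; rewrite ord1 mxE.
by rewrite -(big_mkord xpredT (fun l => f (z l.+1) - f (z l))) telescope_sumr.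
Qed.

Lemma lipschitz_of_partial f K x y : (forall l z, derivable f z (delta_mx l 0)) ->
  (forall l z, `|partial l f z| <= K) -> `|f y - f x| <= v%:R * K * `|y - x|.
Proof.
move=> df HK; have [xi [_ ->]] := mvt_coord x y df.
apply: le_trans (ler_norm_sum _ _ _) _.
rewrite -[v in v%:R]card_ord -sumr_const -mulrA mulr_suml ler_sum// => l _.
rewrite mul1r normrM ler_pM//.
by have := colnorm_ge (y - x) l; rewrite !mxE.
Qed.

Lemma taylor_of_partial f L x y : (forall l z, derivable f z (delta_mx l 0)) -> 0 <= L ->
  (forall l z z', `|partial l f z - partial l f z'| <= L * `|z - z'|) ->
  `|f y - f x - \sum_l partial l f x * (y l 0 - x l 0)| <= v%:R * L * `|y - x| ^+ 2.
Proof.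
move=> df L0 HL; have [xi [xib ->]] := mvt_coord x y df.
rewrite -sumrB; apply: le_trans (ler_norm_sum _ _ _) _.
rewrite -[v in v%:R]card_ord -sumr_const -mulrA mulr_suml ler_sum// => l _.
rewrite mul1r -mulrBl normrM expr2 mulrA ler_pM//.
  by apply: le_trans (HL _ _ _) _; rewrite ler_wpM2l.
by have := colnorm_ge (y - x) l; rewrite !mxE.
Qed.

End Calculus.

Section Coefficients.
Context {R : realType} {v r : nat}.
Variables (b : 'cV[R]_v -> 'cV[R]_v) (sigma : 'cV[R]_v -> 'M[R]_(v, r)).

Definition dsigma i j l x := partial l (fun y => sigma y i j) x.

(** A single constant serves all estimates of the coefficients, in the maximum norm; [1 <= K] allows
    powers of [K] to be compared. *)
Record coefficient_bounds (K : R) : Prop := {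
  cb_ge1 : 1 <= K;
  cb_b_lip : forall i x y, `|b x i 0 - b y i 0| <= K * `|x - y|;
  cb_s_lip : forall i j x y, `|sigma x i j - sigma y i j| <= K * `|x - y|;
  cb_ds_lip : forall i j l x y, `|dsigma i j l x - dsigma i j l y| <= K * `|x - y|;
  cb_ds_bound : forall i j l x, `|dsigma i j l x| <= K;
  cb_taylor : forall i j x y,
    `|sigma y i j - sigma x i j - \sum_l dsigma i j l x * (y l 0 - x l 0)|
      <= K * `|y - x| ^+ 2;
  cb_b_growth : forall i x, `|b x i 0| <= K * (1 + `|x|);
  cb_s_growth : forall i j x, `|sigma x i j| <= K * (1 + `|x|) }.

Lemma coefficient_boundsP (Mc : R) :
  (forall i, class_C1 (fun x => b x i 0)) ->
  (forall i j, class_C2 (fun x => sigma x i j)) ->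
  (forall x, gradient_norm b x <= Mc) ->
  (forall j x, gradient_norm (fun y => col j (sigma y)) x <= Mc) ->
  (forall j x, hessian_norm (fun y => col j (sigma y)) x <= Mc) ->
  exists K, coefficient_bounds K.
Proof.
move=> bC1 sC2 bM sM1 sM2.
have sq (I : finType) (F : I -> R) (i : I) : (forall i, 0 <= F i) -> F i <= \sum_i F i.
  by move=> F0; rewrite (bigD1 i)//= lerDl sumr_ge0.
have db i l x : `|partial l (fun y => b y i 0) x| <= Mc.
  apply: le_trans (bM x); rewrite -sqrtr_sqr ler_wsqrtr//.
  apply: le_trans (sq _ (fun i => \sum_l _) i _) => [|k]; last first.
    by rewrite sumr_ge0// => ? _; rewrite sqr_ge0.
  by apply: (sq _ (fun l => partial l (fun y => b y i 0) x ^+ 2) l) => k; rewrite sqr_ge0.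
have cE i j : (fun y => col j (sigma y) i 0) = (fun y => sigma y i j).
  by apply/funext => y; rewrite mxE.
have ds i j l x : `|dsigma i j l x| <= Mc.
  apply: le_trans (sM1 j x); rewrite -sqrtr_sqr ler_wsqrtr//.
  apply: le_trans (sq _ (fun i => \sum_l _) i _) => [|k]; last first.
    by rewrite sumr_ge0// => ? _; rewrite sqr_ge0.
  rewrite cE; by apply: (sq _ (fun l => partial l (fun y => sigma y i j) x ^+ 2) l) => k; rewrite sqr_ge0.
have dds i j k l x : `|partial k (dsigma i j l) x| <= Mc.
  apply: le_trans (sM2 j x); rewrite -sqrtr_sqr ler_wsqrtr//.
  apply: le_trans (sq _ (fun i => \sum_k \sum_l _) i _) => [|?]; last first.
    by rewrite sumr_ge0// => ? _; rewrite sumr_ge0// => ? _; rewrite sqr_ge0.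
  apply: le_trans (sq _ (fun k => \sum_l _) k _) => [|?]; last first.
    by rewrite sumr_ge0// => ? _; rewrite sqr_ge0.
  rewrite cE; apply: (sq _ (fun l => partial k (partial l (fun y => sigma y i j)) x ^+ 2) l).
  by move=> ?; rewrite sqr_ge0.
pose M : R := `|Mc|; have MM (a : R) : a <= Mc -> a <= M by move=> /le_trans; apply; exact: ler_norm.
have M0 : 0 <= M by exact: normr_ge0.
have v0 : 0 <= v%:R :> R by [].
(* The values at the origin; together with the Lipschitz bounds they give linear growth. *)
pose B := \sum_i `|b 0 i 0| + \sum_i \sum_j `|sigma 0 i j|.
have B0 : 0 <= B by rewrite addr_ge0 ?sumr_ge0// => i _; rewrite sumr_ge0.
have vM0 : 0 <= v%:R * M by rewrite mulr_ge0.
have vvM0 : 0 <= v%:R * (v%:R * M) by rewrite mulr_ge0.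
pose K := 1 + M + v%:R * M + v%:R * (v%:R * M) + B.
have le1 (x a : R) : 0 <= x -> a <= v%:R * M * x -> a <= K * x.
  by move=> x0 /le_trans; apply; rewrite ler_wpM2r// /K; lra.
have bl i x y : `|b x i 0 - b y i 0| <= v%:R * M * `|x - y|.
  apply: (@lipschitz_of_partial _ _ (fun x => b x i 0)) => [l z|l z].
    by have [_ /(_ l)[+ _]] := bC1 i; apply.
  exact/MM/db.
have sl i j x y : `|sigma x i j - sigma y i j| <= v%:R * M * `|x - y|.
  apply: (@lipschitz_of_partial _ _ (fun x => sigma x i j)) => [l z|l z].
    by have [[_ /(_ l)[+ _]] _] := sC2 i j; apply.
  exact/MM/ds.
have dsl i j l x y : `|dsigma i j l x - dsigma i j l y| <= v%:R * M * `|x - y|.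
  apply: (@lipschitz_of_partial _ _ (dsigma i j l)) => [k z|k z].
    by have [_ /(_ l)[_ /(_ k)[+ _]]] := sC2 i j; apply.
  exact/MM/dds.
have growth (F : 'cV[R]_v -> R) x : (forall x y, `|F x - F y| <= v%:R * M * `|x - y|) ->
    `|F 0| <= B -> `|F x| <= K * (1 + `|x|).
  move=> FL F0; rewrite -[F x](subrK (F 0)); apply: le_trans (ler_normD _ _) _.
  have := FL x 0; rewrite subr0 => H; have nx := normr_ge0 x.
  rewrite /K; nra.
exists K; split.
- rewrite /K; lra.
- by move=> i x y; exact: le1.
- by move=> i j x y; exact: le1.
- by move=> i j l x y; exact: le1.
- by move=> i j l x; apply: le_trans (MM _ (ds i j l x)) _; rewrite /K; lra.
- move=> i j x y.
  apply: (@le_trans _ _ (v%:R * (v%:R * M) * `|y - x| ^+ 2)).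
    apply: (@taylor_of_partial _ _ (fun x => sigma x i j)) => // l z.
      by have [[_ /(_ l)[+ _]] _] := sC2 i j; apply.
    by move=> z'; exact: dsl.
  by rewrite ler_wpM2r ?exprn_ge0// /K; lra.
- move=> i x; apply: (growth (fun x => b x i 0)) => // .
  by rewrite /B ler_wpDr ?(sq _ (fun i => `|b 0 i 0|))// sumr_ge0// => k _; rewrite sumr_ge0.
- move=> i j x; apply: (growth (fun x => sigma x i j)) => //.
  rewrite /B ler_wpDl ?sumr_ge0//.
  apply: le_trans (sq _ (fun i => \sum_j `|sigma 0 i j|) i _) => [|k]; last by rewrite sumr_ge0.
  exact: (sq _ (fun j => `|sigma 0 i j|)).
Qed.

End Coefficients.

Section MeasurableComp.
Context {R : realType} {v : nat} {d : measure_display} {T : measurableType d}.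

(** The coordinates are rounded down to multiples of [1 / (m + 1)]. The rounded column takes
    countably many values, each on a measurable set, so that every function of it is measurable;
    continuity of [f] gives the limit. No sigma-algebra on columns is involved. *)
Lemma measurable_comp_col (X : T -> 'cV[R]_v) (f : 'cV[R]_v -> R) :
  (forall i, measurable_fun setT (fun w => X w i 0)) -> continuous f ->
  measurable_fun setT (fun w => f (X w)).
Proof.
move=> mX cf.
pose z m w : 'cV[int]_v := \col_i Num.floor (m.+1%:R * X w i 0).
pose g m (u : 'cV[int]_v) : 'cV[R]_v := \col_i ((u i 0)%:~R / m.+1%:R).
have mz m u : measurable [set w | z m w = u].
  have -> : [set w | z m w = u] = \bigcap_(i in [set: 'I_v])
      ((fun w => X w i 0) @^-1` `[(u i 0)%:~R / m.+1%:R, (u i 0 + 1)%:~R / m.+1%:R[).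
    have E i w : (X w i 0 \in `[(u i 0)%:~R / m.+1%:R, (u i 0 + 1)%:~R / m.+1%:R[) =
       (Num.floor (m.+1%:R * X w i 0) == u i 0).
      by rewrite in_itv/= ler_pdivrMr// ltr_pdivlMr// floor_eq mulrC.
    apply/seteqP; split => w /=.
      by move=> zu i _ /=; rewrite E -zu mxE.
    move=> H; apply/matrixP => i j; rewrite ord1 mxE.
    by apply/eqP; rewrite -E; exact: H.
  apply: fin_bigcap_measurable => [|i _]; first exact: finite_finset.
  by rewrite -[X in measurable X]setTI; apply: mX => //; exact: measurable_itv.
apply: (@measurable_fun_cvg _ _ _ _ (fun m w => f (g m (z m w)))).
  move=> m _ C mC; rewrite setTI.
  have -> : (fun w => f (g m (z m w))) @^-1` C =
     \bigcup_(u : 'cV[int]_v) (if f (g m u) \in C then [set w | z m w = u] else set0).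
    apply/seteqP; split => w /=.
      by move=> Cw; exists (z m w) => //; rewrite mem_set.
    by move=> [u _]; case: ifPn => // /set_mem Cu /= ->.
  by apply: countable_bigcupT_measurable => // u; case: ifP.
move=> w _; apply: (@cvg_comp _ _ _ (fun m => g m (z m w)) f _ (nbhs (X w))); last exact: cf.
apply/cvgrPdist_le => e e0; near=> m.
apply: colnorm_le; first exact: ltW.
move=> i; rewrite !mxE.
have m0 : 0 < m.+1%:R :> R by [].
have /andP[a1 a2] := floor_itv (m.+1%:R * X w i 0).
have -> : X w i 0 - (Num.floor (m.+1%:R * X w i 0))%:~R / m.+1%:R =
  (m.+1%:R * X w i 0 - (Num.floor (m.+1%:R * X w i 0))%:~R) / m.+1%:R by field.
rewrite ger0_norm; last by rewrite divr_ge0// subr_ge0.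
rewrite ler_pdivrMr//; apply: (@le_trans _ _ 1).
  by move: a2; rewrite intrD => a2; lra.
rewrite -ler_pdivrMl//; rewrite mulr1.
apply: (@le_trans _ _ m%:R); last by rewrite ler_nat.
near: m; exact: nbhs_infty_ger.
Unshelve. all: by end_near. Qed.

Lemma measurable_colnorm (X : T -> 'cV[R]_v) :
  (forall i, measurable_fun setT (fun w => X w i 0)) -> measurable_fun setT (fun w => `|X w|).
Proof. by move=> mX; apply: measurable_comp_col => // x; exact: norm_continuous. Qed.

End MeasurableComp.

Definition cont_on {R : realType} (a c : R) (f : R -> R) := {within `[a, c], continuous f}.

Lemma cont_on_sub {R : realType} (f : R -> R) (a c a' c' : R) : a <= a' -> c' <= c ->
  cont_on a c f -> cont_on a' c' f.
Proof.
move=> aa cc; apply: continuous_subspaceW => s /=; rewrite !in_itv/= => /andP[? ?].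
by apply/andP; split; lra.
Qed.

Section Grid.
Context {R : realType}.

Lemma integrable_disjU d (T : measurableType d) (mu : {measure set T -> \bar R}) A B (f : T -> \bar R) :
  measurable A -> measurable B -> [disjoint A & B] ->
  mu.-integrable A f -> mu.-integrable B f -> mu.-integrable (A `|` B) f.
Proof.
move=> mA mB AB /integrableP[mfA iA] /integrableP[mfB iB].
have mU : measurable_fun (A `|` B) f by apply/measurable_funU.
apply/integrableP; split=> //.
rewrite ge0_integral_setU//; last exact: measurableT_comp.
by rewrite lte_add_pinfty.
Qed.

Lemma uniform_grid (N : nat) (delta : R) (t : nat -> R) : t 0%N = 0 ->
  (forall i, (i < N)%N -> t i.+1 - t i = delta) ->
  forall i, (i <= N)%N -> t i = i%:R * delta.
Proof.
move=> t0 st; elim=> [_|i IH iN]; first by rewrite t0 mul0r.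
by rewrite -[t i.+1](subrK (t i)) st// IH ?(ltnW iN)// -natr1; ring.
Qed.

Lemma interpolation_in r (N : nat) (delta : R) (t : nat -> R) (w : R -> 'cV[R]_r) k u :
  0 < delta -> (forall i, (i <= N)%N -> t i = i%:R * delta) -> (k < N)%N ->
  t k <= u < t k.+1 ->
  interpolation N delta t w u = w (t k) + ((u - t k) / delta) *: (w (t k.+1) - w (t k)).
Proof.
move=> d0 tE kN /andP[ku uk]; rewrite /interpolation; case: pickP => [i /andP[iu ui]|].
  suff -> : i = k :> nat by [].
  have iN := ltn_ord i; have kN' := ltnW kN; have iN' := ltnW iN.
  rewrite (tE _ kN') in ku; rewrite (tE _ kN) in uk.
  rewrite (tE _ iN') in iu; rewrite (tE _ iN) in ui.
  apply/eqP; rewrite eqn_leq -(ltnS i) -(ltnS k).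
  have := le_lt_trans iu uk; have := le_lt_trans ku ui.
  by rewrite !ltr_pM2r// !ltr_nat => -> ->.
by move=> /(_ (Ordinal kN)) /=; rewrite ku uk.
Qed.

End Grid.

(** * The differential equation on one cell of the partition *)

Section OdePiece.
Context {R : realType} {v r : nat}.
Variables (b : 'cV[R]_v -> 'cV[R]_v) (sigma : 'cV[R]_v -> 'M[R]_(v, r)).

Definition field (delta : R) (beta : 'cV[R]_r) (x : 'cV[R]_v) : 'cV[R]_v :=
  \col_i (b x i 0 + \sum_(j < r) sigma x i j * (beta j 0 / delta)).

(** A classical solution on a cell where the driver has constant slope [beta / delta]. The
    derivative is asked on the open interval, since the driver may have kinks at the grid points. *)
Record ode_piece (a delta : R) (beta : 'cV[R]_r) (x : R -> 'cV[R]_v) : Prop := {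
  op_cont : forall i, cont_on a (a + delta) (fun t => x t i 0);
  op_deriv : forall i t, t \in `]a, a + delta[ ->
    is_derive t (1 : R) (fun t => x t i 0) (field delta beta (x t) i 0) }.

Lemma lipschitz_continuous (f : 'cV[R]_v -> R) (K : R) :
  (forall x y, `|f x - f y| <= K * `|x - y|) -> continuous f.
Proof.
move=> fl x; apply/(@cvgrPdist_le _ _ _ (nbhs x) (nbhs_filter x)) => e e0.
have K1 : 0 < `|K| + 1 by rewrite ltr_wpDl.
have := @cvgrPdist_le _ _ _ (nbhs x) (nbhs_filter x) id x.
  move=> [/(_ cvg_id)/(_ (e / (`|K| + 1)) (divr_gt0 e0 K1)) + _].
apply: filterS => y xy; apply: le_trans (fl _ _) _.
apply: (@le_trans _ _ ((`|K| + 1) * `|x - y|)).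
  by rewrite ler_wpM2r// (le_trans (ler_norm _))// lerDl.
by rewrite mulrC -ler_pdivlMr.
Qed.

Lemma field_lipschitz K delta beta i x y : coefficient_bounds b sigma K -> 0 < delta ->
  `|field delta beta x i 0 - field delta beta y i 0| <=
  K * ((delta + r%:R * `|beta|) / delta) * `|x - y|.
Proof.
move=> cb d0; rewrite !mxE opprD addrACA -sumrB.
apply: le_trans (ler_normD _ _) _.
have K0 : 0 <= K by have := cb_ge1 cb; lra.
have -> : K * ((delta + r%:R * `|beta|) / delta) * `|x - y| =
  K * `|x - y| + \sum_(j < r) K * `|x - y| * (`|beta| / delta).
  by rewrite sumr_const card_ord -mulr_natl; field; rewrite gt_eqF.
apply: lerD; first exact: (cb_b_lip cb).
apply: le_trans (ler_norm_sum _ _ _) _; apply: ler_sum => j _.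
rewrite -mulrBl normrM normrM normfV (gtr0_norm d0) ler_pM//; rewrite ?divr_ge0 ?(ltW d0)//; first exact: (cb_s_lip cb).
by rewrite ler_wpM2r ?invr_ge0 ?(ltW d0)// colnorm_ge.
Qed.

Lemma field_continuous K delta beta i : coefficient_bounds b sigma K -> 0 < delta ->
  continuous (fun x => field delta beta x i 0).
Proof. by move=> cb d0; apply: lipschitz_continuous => x y; exact: (field_lipschitz _ _ _ _ cb). Qed.

(** On an open cell the integrand coincides with the continuous function [field] along the path, so
    that the integral equation can be differentiated by the fundamental theorem of calculus. *)
Lemma ode_solution_pieces K (N : nat) (delta T : R) (t : nat -> R) (w : R -> 'cV[R]_r) x0 x :
  coefficient_bounds b sigma K -> 0 < delta -> t 0%N = 0 -> t N = T ->
  (forall i, (i < N)%N -> t i.+1 - t i = delta) ->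
  ode_solution b sigma x0 T (interpolation N delta t w) x ->
  x 0 = x0 /\ forall k, (k < N)%N ->
    ode_piece (t k) delta (w (t k.+1) - w (t k)) x.
Proof.
move=> cb d0 t0 tN tS [cx Ix].
have tE := uniform_grid t0 tS.
have T0 : 0 <= T by rewrite -tN tE// mulr_ge0// ltW.
have tT k : (k <= N)%N -> 0 <= t k <= T.
  by move=> kN; rewrite -tN !tE// mulr_ge0 ?(ltW d0)//= ler_wpM2r ?(ltW d0)// ler_nat.
have tlt k : (k < N)%N -> t k < t k.+1 by move=> kN; rewrite -subr_gt0 tS.
pose g (i : 'I_v) (s : R) : R := b (x s) i 0 +
   \sum_(j < r) sigma (x s) i j * derive1 (fun u => interpolation N delta t w u j 0) s.
pose be k := w (t k.+1) - w (t k).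
pose h (k : nat) (i : 'I_v) (s : R) : R := field delta (be k) (x s) i 0.
have cxi i : cont_on 0 T (fun s => x s i 0).
  apply: (@within_continuous_comp _ _ R _ x (fun y : 'cV[R]_v => y i 0 : R)) => // y _.
  exact: coord_continuous.
have ch k i : {within `[0, T], continuous (h k i)}.
  apply: (@within_continuous_comp _ _ R _ x (fun y => field delta (be k) y i 0 : R)) => // y _.
  have H := @field_continuous K delta (be k) i cb d0 y.
  exact: H.
have gh k i s : (k < N)%N -> s \in `]t k, t k.+1[ -> g i s = h k i s.
  move=> kN sk; rewrite /g /h mxE; congr (_ + _); apply: eq_bigr => j _; congr (_ * _).
  rewrite derive1E.
  rewrite (@near_eq_derive _ _ _ _ (fun u => w (t k) j 0 + (u - t k) * (be k j 0 / delta))).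
    have -> : (fun u => w (t k) j 0 + (u - t k) * (be k j 0 / delta)) =
      (fun u => (be k j 0 / delta) * u + (w (t k) j 0 - t k * (be k j 0 / delta))).
      by apply/funext => u; ring.
    have D : is_derive s (1 : R) (fun u : R => (be k j 0 / delta) * u +
       (w (t k) j 0 - t k * (be k j 0 / delta))) (be k j 0 / delta).
      by apply: is_derive_eq; rewrite /GRing.scale/=; ring.
    by rewrite derive_val.
  have /= := near_in_itvoo sk; apply: filterS => u; rewrite in_itv/= => /andP[ku uk].
  rewrite (@interpolation_in _ _ _ _ _ _ k)// ?(ltW ku)//.
  by rewrite !mxE; ring.
(* The integral equation does not state integrability. It is gained cell by cell; the grid points,
   where the derivative of the driver may be a default value, are split off as singletons. *)
have ig k i : (k <= N)%N -> lebesgue_measure.-integrable `[0, t k] (EFin \o g i).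
  elim: k => [_|k IH kN].
    rewrite t0 set_itv1; apply/integrableP; split; first exact: measurable_fun_set1.
    by rewrite integral_set1 ltry.
  have /andP[k0 kT] := tT _ (ltnW kN); have /andP[k10 k1T] := tT _ kN.
  have -> : `[0, t k.+1]%classic = (`[0, t k] `|` `]t k, t k.+1[) `|` `[t k.+1, t k.+1] :> set R.
    apply/seteqP; split => s /=; rewrite !in_itv/=; have := tlt _ kN => H.
      move=> /andP[s0 sk1]; case: (leP s (t k)) => sk; first by left; left; rewrite s0.
      by case: (ltP s (t k.+1)) => sk2; [left; right|right; rewrite sk1].
    move=> [[/andP[s0 sk]|/andP[s0 sk]]|/andP[s0 sk]]; apply/andP; split => //; lra.
  apply: integrable_disjU => //; last 2 first.
  - apply: integrable_disjU => //; last 2 first.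
    + exact: IH (ltnW kN).
    + have ic : lebesgue_measure.-integrable `[t k, t k.+1] (EFin \o h k i).
        apply: continuous_compact_integrable; first exact: segment_compact.
        apply: continuous_subspaceW (ch k i) => s /=; rewrite !in_itv/= => /andP[? ?].
        apply/andP; split; lra.
      have : lebesgue_measure.-integrable `]t k, t k.+1[ (EFin \o h k i).
        by apply: integrableS ic => //; exact: subset_itv_oo_cc.
      by apply: eq_integrable => // s; rewrite inE => /= sk; rewrite (gh k i s kN).
    + by apply/disj_setPS => s /= [] /[!in_itv]/= /andP[_ a] /andP[c _]; move: (le_lt_trans a c); rewrite ltxx.
  - rewrite set_itv1; apply/integrableP; split; first exact: measurable_fun_set1.
    by rewrite integral_set1 ltry.
  - exact: measurableU.
  - apply/disj_setPS => s /= [[|]] /[!in_itv]/= /andP[_ a] /andP[c _]; have := tlt _ kN; lra.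
split.
  apply/matrixP => i j; rewrite ord1 (Ix 0 _ i) ?lexx//.
  by rewrite set_itv1 Rintegral_set1 addr0.
move=> k kN.
have tk1 : t k + delta = t k.+1 by rewrite -(tS k kN) addrC subrK.
have /andP[k0 kT] := tT _ (ltnW kN); have /andP[k10 k1T] := tT _ kN.
split=> [i|i s]; rewrite tk1.
  exact: cont_on_sub (cxi i).
move=> sk; move: (sk); rewrite in_itv/= => /andP[ks sk1].
have s0 : 0 < s by lra.
have sT : s \in `]0, T[ by rewrite in_itv/= s0/=; lra.
have cg : {for s, continuous (g i)}.
  have chs : {for s, continuous (h k i)} := within_continuous_continuous (lt_trans s0 (lt_le_trans sk1 k1T)) (ch k i) sT.
  rewrite /prop_for /continuous_at (gh k i s kN sk); apply: cvg_trans chs.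
  apply: near_eq_cvg.
  by have := near_in_itvoo sk; apply: filterS => u uk; rewrite (gh k i u kN).
have [dF F's] := @continuous_FTC1_closed R (g i) 0 s (t k.+1) sk1 (ig k.+1 i kN) s0 cg.
rewrite -/(h k i s) -(gh k i s kN sk) -F's.
pose F y := x0 i 0 + \int[lebesgue_measure]_(u in `[0, y]) g i u.
apply: (@near_eq_is_derive _ _ _ F).
  have := near_in_itvoo sT; apply: filterS => u; rewrite in_itv/= => /andP[u0 uT].
  by rewrite /F (Ix u _ i)// (ltW u0) (ltW uT).
rewrite derive1E; apply: is_derive_eq.
  by apply: is_deriveD; exact: derivableP.
by rewrite add0r.
Qed.

End OdePiece.
Arguments op_cont {R v r b sigma a delta beta x} _ i.

(** * Expansion of the solution over one cell *)

Section StepBounds.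
Context {R : realType} {v r : nat}.
Variables (b : 'cV[R]_v -> 'cV[R]_v) (sigma : 'cV[R]_v -> 'M[R]_(v, r)).

Lemma mvt_le (f df : R -> R) (a c B : R) : a <= c ->
  (forall s, s \in `]a, c[ -> is_derive s (1 : R) f (df s)) ->
  cont_on a c f ->
  (forall s, s \in `]a, c[ -> `|df s| <= B) -> `|f c - f a| <= B * (c - a).
Proof.
rewrite le_eqVlt => /predU1P[->|ac] fd cf HB; first by rewrite !subrr normr0 mulr0.
have [s sac ->] := MVT ac fd cf.
by rewrite normrM (@ger0_norm _ (c - a)) ?ler_wpM2r ?HB ?subr_ge0 ?(ltW ac).
Qed.

(** Component [i] of the derivative of column [j] of [sigma] along column [m]. The diagonal [j = m]
    yields the Ito correction; the other terms meet products of distinct increments, which are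
    centred. *)
Definition drift_rate i j m x := \sum_(l < v) dsigma sigma i j l x * sigma x l m.

Section Fixed.
Variables (K a delta : R) (beta : 'cV[R]_r) (x : R -> 'cV[R]_v).
Hypotheses (cb : coefficient_bounds b sigma K) (d0 : 0 < delta)
  (op : ode_piece b sigma a delta beta x).
(** The amount of time and of driving signal spent on the cell; [K * (rho / delta)] bounds both the
    growth and the Lipschitz constant of the field. *)
Let rho := delta + r%:R * `|beta|.
Let K1 := cb_ge1 cb.
Let K0 : 0 <= K. Proof. by have := K1; lra. Qed.
Let rho0 : 0 < rho. Proof. by rewrite ltr_pwDl// mulr_ge0. Qed.
Let rb : r%:R * `|beta| <= rho. Proof. by rewrite lerDr ltW. Qed.

Let rd0 : 0 <= rho / delta. Proof. by rewrite divr_ge0 ?ltW. Qed.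

Lemma weighted_sum_le (c : 'I_r -> R) B : (forall j, `|c j| <= B) ->
  `|\sum_(j < r) c j * (beta j 0 / delta)| <= B * (r%:R * `|beta| / delta).
Proof.
move=> cB; apply: le_trans (ler_norm_sum _ _ _) _.
rewrite -[r in r%:R]card_ord -sumr_const mulr_suml mulr_suml mulr_sumr ler_sum// => j _.
rewrite mul1r normrM ler_pM// normrM normfV (gtr0_norm d0).
by rewrite ler_wpM2r ?invr_ge0 ?(ltW d0)// colnorm_ge.
Qed.

Lemma field_growth i y : `|field b sigma delta beta y i 0| <= K * (rho / delta) * (1 + `|y|).
Proof.
rewrite mxE; apply: le_trans (ler_normD _ _) _.
have -> : K * (rho / delta) * (1 + `|y|) = K * (1 + `|y|) +
   K * (1 + `|y|) * (r%:R * `|beta| / delta) by rewrite /rho; field; rewrite gt_eqF.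
apply: lerD; first exact: (cb_b_growth cb).
by apply: weighted_sum_le => j; exact: (cb_s_growth cb).
Qed.

Let sqs t := 1 + \sum_i x t i 0 ^+ 2.

Lemma colnorm_sqr_le (y : 'cV[R]_v) : `|y| ^+ 2 <= \sum_i y i 0 ^+ 2.
Proof.
have [->|] := eqVneq `|y| 0; first by rewrite expr0n sumr_ge0// => i _; rewrite sqr_ge0.
move=> /mx_norm_neq0[[i j]] /=; rewrite ord1 => E; rewrite [`|y|]E.
by rewrite (bigD1 i)//= real_normK ?num_real// lerDl sumr_ge0// => ? _; rewrite sqr_ge0.
Qed.

(** Gronwall's inequality in differential form. The sum of squares is smooth, unlike the norm, and
    multiplied by [exp (- c (t - a))] it has a nonpositive derivative. *)
Lemma sqs_growth t : a <= t <= a + delta ->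
  sqs t <= sqs a * expR (4 * v%:R * K * rho).
Proof.
move=> /andP[at_ ta].
pose c := 4 * v%:R * K * (rho / delta).
pose sqs' t := \sum_i (2 * x t i 0 * field b sigma delta beta (x t) i 0).
have c0 : 0 <= c by do 2 rewrite mulr_ge0//.
have sqs0 s : 1 + `|x s| ^+ 2 <= sqs s by rewrite lerD2l colnorm_sqr_le.
have sqs'c s : sqs' s <= c * sqs s.
  apply: (@le_trans _ _ (\sum_(i < v) 4 * K * (rho / delta) * sqs s)); last first.
    by rewrite sumr_const card_ord -mulr_natl /c le_eqVlt; apply/orP; left; apply/eqP; ring.
  apply: ler_sum => i _; have xi := colnorm_ge (x s) i; have fi := field_growth i (x s).
  apply: (@le_trans _ _ (2 * `|x s| * (K * (rho / delta) * (1 + `|x s|)))).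
    apply: le_trans (ler_norm _) _; rewrite !normrM ger0_norm//.
    by rewrite -[X in X <= _]mulrA -[X in _ <= X]mulrA ler_wpM2l// ler_pM.
  have -> : 2 * `|x s| * (K * (rho / delta) * (1 + `|x s|)) =
    (K * (rho / delta)) * (2 * (`|x s| + `|x s| ^+ 2)) by ring.
  have -> : 4 * K * (rho / delta) * sqs s = (K * (rho / delta)) * (4 * sqs s) by ring.
  rewrite ler_wpM2l//; first exact: mulr_ge0.
  have := sqs0 s; have := normr_ge0 (x s); have := sqr_ge0 (`|x s| - 1); lra.
pose g s := expR (- c * (s - a)) * sqs s.
have ga : g a = sqs a by rewrite /g subrr mulr0 expR0 mul1r.
have dsqs s : s \in `]a, a + delta[ -> is_derive s (1 : R) sqs (sqs' s).
  move=> sa; have D i := op_deriv op i sa.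
  have -> : sqs = cst 1 + \sum_(i < v) (fun t => x t i 0 ^+ 2).
    by apply/funext => u; rewrite /sqs fctE fct_sumE.
  apply: is_derive_eq.
  by rewrite add0r; apply: eq_bigr => i _; rewrite /GRing.scale/=; ring.
have dg s : s \in `]a, a + delta[ -> is_derive s (1 : R) g
    (expR (- c * (s - a)) * (sqs' s - c * sqs s)).
  move=> sa; have D := dsqs s sa.
  have De : is_derive s (1 : R) (fun s => expR (- c * (s - a))) (expR (- c * (s - a)) * - c).
    apply: (@is_derive1_comp _ expR (fun s => - c * (s - a))).
    by apply: is_derive_eq; rewrite /GRing.scale/=; ring.
  by rewrite /g; apply: is_derive_eq; rewrite /GRing.scale/=; ring.
have csqs : cont_on a (a + delta) sqs.
  have cs l : cont_on a (a + delta) (fun s => \sum_(i <- l) x s i 0 ^+ 2).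
    elim: l => [|i l IH].
      by under eq_fun do rewrite big_nil; apply: continuous_subspaceT => z; exact: cvg_cst.
    under eq_fun do rewrite big_cons expr2.
    by move=> y; apply: cvgD; [apply: cvgM; exact: (op_cont op i)|exact: IH].
  by move=> y; apply: cvgD; [exact: cvg_cst|exact: cs].
have cg : cont_on a (a + delta) g.
  move=> y; apply: cvgM; last exact: csqs.
  have ce : cont_on a (a + delta) (fun s => expR (- c * (s - a))).
    apply: continuous_subspaceT => z.
    apply: continuous_comp; last exact: continuous_expR.
    apply: cvgM; first exact: cvg_cst.
    by apply: cvgB; [exact: cvg_id|exact: cvg_cst].
  exact: ce.
have : g t <= g a.
  have dg' s : s \in `]a, t[ -> is_derive s (1 : R) g
      (expR (- c * (s - a)) * (sqs' s - c * sqs s)).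
    by rewrite in_itv/= => /andP[? ?]; apply: dg; rewrite in_itv/=; apply/andP; split; lra.
  have [s sat E] := MVT_segment at_ dg' (cont_on_sub (lexx a) ta cg).
  rewrite -subr_ge0 -opprB oppr_ge0 E.
  rewrite mulr_le0_ge0// ?subr_ge0// mulr_ge0_le0 ?expR_ge0// subr_le0.
  exact: sqs'c.
rewrite ga /g mulNr expRN -ler_pdivlMl ?invr_gt0 ?expR_gt0// invrK => H.
apply: le_trans H _; rewrite mulrC ler_wpM2l//.
  by apply: le_trans (sqs0 a); rewrite addr_ge0 ?exprn_ge0.
rewrite ler_expR /c -!mulrA !ler_wpM2l//.
rewrite -[leRHS]mulr1 ler_wpM2l ?(ltW rho0)// mulrC ler_pdivrMr//; lra.
Qed.

(** A bound of [1 + |x|] on the whole cell; [2 + 2 v] pays for the passage between sums of squares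
    and the maximum norm. *)
Let M := (2 + 2 * v%:R) * expR (2 * v%:R * K * rho) * (1 + `|x a|).

Lemma piece_growth t : a <= t <= a + delta -> 1 + `|x t| <= M.
Proof.
move=> ta; have H := sqs_growth ta.
have M0 : 0 <= M by rewrite !mulr_ge0 ?expR_ge0 ?addr_ge0// mulr_ge0.
rewrite -(ler_pXn2r (n := 2)) ?nnegrE ?addr_ge0//.
apply: (@le_trans _ _ (2 * sqs t)).
  have := colnorm_sqr_le (x t); have := sqr_ge0 (`|x t| - 1); rewrite /sqs; lra.
apply: (@le_trans _ _ (2 * ((1 + v%:R) * (1 + `|x a|) ^+ 2 * expR (4 * v%:R * K * rho)))).
  rewrite ler_wpM2l//; apply: le_trans H _; rewrite ler_wpM2r ?expR_ge0//.
  rewrite /sqs; have := enorm_sqr_le (x a); rewrite enorm_sqr => H.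
  have := normr_ge0 (x a); have : 0 <= v%:R :> R by []; have := sqr_ge0 `|x a|; nra.
rewrite /M !exprMn -expRM_natl.
have -> : 2%:R * (2 * v%:R * K * rho) = 4 * v%:R * K * rho by ring.
have v0 : 0 <= v%:R :> R by [].
have -> : 2 * ((1 + v%:R) * (1 + `|x a|) ^+ 2 * expR (4 * v%:R * K * rho)) =
  (2 * (1 + v%:R)) * (expR (4 * v%:R * K * rho) * (1 + `|x a|) ^+ 2) by ring.
rewrite -[leRHS]mulrA ler_wpM2r ?mulr_ge0 ?expR_ge0 ?sqr_ge0//; nra.
Qed.

Lemma piece_M1 : 1 <= M.
Proof.
have /piece_growth : a <= a <= a + delta by rewrite lexx/= lerDl ltW.
by apply: le_trans; rewrite lerDl.
Qed.

Lemma piece_move t : a <= t <= a + delta -> `|x t - x a| <= K * rho * M.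
Proof.
move=> /andP[at_ ta]; have M1 := piece_M1.
have B0 : 0 <= K * (rho / delta) * M.
  by rewrite mulr_ge0//; [exact: mulr_ge0|lra].
apply: colnorm_le => [|i]; first by rewrite !mulr_ge0 ?(ltW rho0)//; lra.
rewrite !mxE; apply: (@le_trans _ _ (K * (rho / delta) * M * (t - a))).
  apply: (@mvt_le (fun s => x s i 0 : R) (fun s => field b sigma delta beta (x s) i 0)) => //.
  - by move=> s; rewrite in_itv/= => /andP[? ?]; apply: (op_deriv op); rewrite in_itv/=; lra.
  - exact: (cont_on_sub (lexx a) ta (op_cont op i)).
  - move=> s; rewrite in_itv/= => /andP[? ?]; apply: le_trans (field_growth _ _) _.
    rewrite ler_wpM2l//; first exact: mulr_ge0.
    by apply: piece_growth; apply/andP; split; lra.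
apply: (@le_trans _ _ (K * (rho / delta) * M * delta)); first by rewrite ler_wpM2l//; lra.
by rewrite le_eqVlt; apply/orP; left; apply/eqP; field; rewrite gt_eqF.
Qed.

Lemma piece_first_order t i : a <= t <= a + delta ->
  `|x t i 0 - x a i 0 - (t - a) / delta * \sum_(j < r) sigma (x a) i j * beta j 0|
   <= K ^+ 2 * M * (delta + rho ^+ 2).
Proof.
move=> /andP[at_ ta]; have M1 := piece_M1; have r0 := ltW rho0.
pose S := \sum_(j < r) sigma (x a) i j * (beta j 0 / delta).
pose h s := x s i 0 - (s - a) * S.
have -> : x t i 0 - x a i 0 - (t - a) / delta * \sum_(j < r) sigma (x a) i j * beta j 0 =
  h t - h a.
  rewrite /h /S subrr mul0r subr0 mulr_sumr mulr_sumr addrAC; congr (_ - _ - _).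
  by apply: eq_bigr => j _; field; rewrite gt_eqF.
pose B := K * M + K * (K * rho * M) * (r%:R * `|beta| / delta).
have B0 : 0 <= B by rewrite addr_ge0 ?mulr_ge0 ?invr_ge0 ?(ltW d0)//; lra.
apply: (@le_trans _ _ (B * (t - a))).
  apply: (@mvt_le h (fun s => field b sigma delta beta (x s) i 0 - S)) => //.
  - move=> s; rewrite in_itv/= => /andP[? ?].
    have sa : s \in `]a, a + delta[ by rewrite in_itv/=; apply/andP; split; lra.
    have D := op_deriv op i sa; rewrite /h.
    by apply: is_derive_eq; rewrite /GRing.scale/=; ring.
  - have ci : cont_on a t (fun s => x s i 0).
      exact: (cont_on_sub (lexx a) ta (op_cont op i)).
    move=> y; apply: cvgB; first exact: ci.
    have cl : cont_on a t (fun s => (s - a) * S).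
      apply: continuous_subspaceT => z; apply: cvgM; last exact: cvg_cst.
      by apply: cvgB; [exact: cvg_id|exact: cvg_cst].
    exact: cl.
  - move=> s; rewrite in_itv/= => /andP[? ?].
    have sa : a <= s <= a + delta by apply/andP; split; lra.
    rewrite /S mxE -addrA -sumrB; apply: le_trans (ler_normD _ _) _; apply: lerD.
      apply: le_trans (cb_b_growth cb _ _) _; rewrite ler_wpM2l//; exact: piece_growth.
    under eq_bigr do rewrite -mulrBl.
    apply: weighted_sum_le => j; apply: le_trans (cb_s_lip cb _ _ _ _) _.
    by rewrite ler_wpM2l//; exact: piece_move.
apply: (@le_trans _ _ (B * delta)); first by rewrite ler_wpM2l//; lra.
have -> : B * delta = K * M * delta + K * (K * rho * M) * (r%:R * `|beta|).
  by rewrite /B; field; rewrite gt_eqF.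
rewrite [leRHS]mulrDr; apply: lerD.
  rewrite ler_wpM2r ?(ltW d0)// ler_wpM2r//; last by rewrite expr2 ler_peMl.
  lra.
have -> : K ^+ 2 * M * rho ^+ 2 = K * (K * rho * M) * rho by ring.
by rewrite ler_wpM2l// !mulr_ge0//; lra.
Qed.

(** The first order expansion, inserted in [sigma (x s)], produces a term linear in [s - a]. Its
    primitive [(s - a)^2 / (2 delta)] accounts for the factor 1/2, and the derivative of [h]
    contains only remainders. The Taylor remainder of [sigma] is quadratic in the displacement,
    whence [M ^+ 2]. *)
Lemma piece_second_order i :
  `|x (a + delta) i 0 - x a i 0 - b (x a) i 0 * delta
    - \sum_(j < r) sigma (x a) i j * beta j 0
    - 2^-1 * \sum_(j < r) \sum_(m < r) drift_rate i j m (x a) * (beta j 0 * beta m 0)|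
   <= (1 + v%:R) * K ^+ 3 * M ^+ 2 * (delta * rho + rho ^+ 3).
Proof.
have M1 := piece_M1; have r0 := ltW rho0; have dn : delta != 0 by rewrite gt_eqF.
have at_ : a <= a + delta by rewrite lerDl ltW.
pose S := \sum_(j < r) sigma (x a) i j * (beta j 0 / delta).
pose Q j := \sum_(m < r) drift_rate i j m (x a) * beta m 0.
pose QQ := \sum_(j < r) Q j * (beta j 0 / delta).
pose h s := x s i 0 - (s - a) * (b (x a) i 0 + S) - (s - a) ^+ 2 / (2 * delta) * QQ.
have -> : x (a + delta) i 0 - x a i 0 - b (x a) i 0 * delta
    - \sum_(j < r) sigma (x a) i j * beta j 0
    - 2^-1 * \sum_(j < r) \sum_(m < r) drift_rate i j m (x a) * (beta j 0 * beta m 0)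
   = h (a + delta) - h a.
  have ES : \sum_(j < r) sigma (x a) i j * beta j 0 = delta * S.
    by rewrite /S mulr_sumr; apply: eq_bigr => j _; field.
  have EQ : \sum_(j < r) \sum_(m < r) drift_rate i j m (x a) * (beta j 0 * beta m 0) = delta * QQ.
    rewrite /QQ mulr_sumr; apply: eq_bigr => j _; rewrite /Q mulr_suml mulr_sumr.
    by apply: eq_bigr => m _; field.
  by rewrite ES EQ /h; field.
pose B := K * (K * rho * M) +
  (K * (K * rho * M) ^+ 2 + v%:R * (K * (K ^+ 2 * M * (delta + rho ^+ 2)))) * (r%:R * `|beta| / delta).
have M0 : 0 <= M by lra.
have B20 : 0 <= K * (K * rho * M) ^+ 2 + v%:R * (K * (K ^+ 2 * M * (delta + rho ^+ 2))).
  by rewrite addr_ge0 ?mulr_ge0 ?sqr_ge0// addr_ge0 ?sqr_ge0 ?(ltW d0).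
apply: (@le_trans _ _ (B * delta)).
  have -> : B * delta = B * (a + delta - a) by congr (_ * _); ring.
  apply: (@mvt_le h (fun s => field b sigma delta beta (x s) i 0 - (b (x a) i 0 + S)
     - (s - a) / delta * QQ)) => //.
  - move=> s sa; have D := op_deriv op i sa; rewrite /h.
    apply: is_derive_eq; rewrite /GRing.scale/=; field; exact: dn.
  - have cl : cont_on a (a + delta) (fun s => (s - a) * (b (x a) i 0 + S) +
        (s - a) ^+ 2 / (2 * delta) * QQ).
      apply: continuous_subspaceT => z.
      have c1 : (fun s => s - a) @ z --> z - a by apply: cvgB; [exact: cvg_id|exact: cvg_cst].
      apply: cvgD; first by apply: cvgM => //; exact: cvg_cst.
      apply: cvgM; last exact: cvg_cst.
      apply: cvgM; last exact: cvg_cst.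
      by rewrite expr2; under eq_fun do rewrite expr2; exact: cvgM.
    have -> : h = fun s => x s i 0 - ((s - a) * (b (x a) i 0 + S) + (s - a) ^+ 2 / (2 * delta) * QQ).
      by apply/funext => s; rewrite /h opprD addrA.
    by move=> y; apply: cvgB; [exact: (op_cont op i)|exact: cl].
  - move=> s; rewrite in_itv/= => /andP[as_ sd].
    have sa : a <= s <= a + delta by apply/andP; split; lra.
    have -> : field b sigma delta beta (x s) i 0 - (b (x a) i 0 + S) - (s - a) / delta * QQ =
      (b (x s) i 0 - b (x a) i 0) + \sum_(j < r)
         (sigma (x s) i j - sigma (x a) i j - (s - a) / delta * Q j) * (beta j 0 / delta).
      rewrite mxE /S /QQ mulr_sumr.
      under [in RHS]eq_bigr do rewrite mulrBl mulrBl.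
      rewrite !sumrB.
      set S1 := \sum_i0 (s - a) / delta * _; set S2 := \sum_i0 (s - a) / delta * _ * _.
      have -> : S1 = S2 by apply: eq_bigr => ? _; rewrite mulrA.
      ring.
    apply: le_trans (ler_normD _ _) _; apply: lerD.
      by apply: le_trans (cb_b_lip cb _ _ _) _; rewrite ler_wpM2l//; exact: piece_move.
    apply: weighted_sum_le => j.
    have -> : sigma (x s) i j - sigma (x a) i j - (s - a) / delta * Q j =
      (sigma (x s) i j - sigma (x a) i j - \sum_l dsigma sigma i j l (x a) * (x s l 0 - x a l 0)) +
      \sum_l dsigma sigma i j l (x a) * (x s l 0 - x a l 0 -
          (s - a) / delta * \sum_(m < r) sigma (x a) l m * beta m 0).
      have -> : \sum_l dsigma sigma i j l (x a) * (x s l 0 - x a l 0 -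
          (s - a) / delta * \sum_(m < r) sigma (x a) l m * beta m 0) =
        \sum_l dsigma sigma i j l (x a) * (x s l 0 - x a l 0) - (s - a) / delta * Q j.
        under eq_bigr do rewrite mulrBr.
        rewrite sumrB; congr (_ - _).
        rewrite /Q /drift_rate mulr_sumr.
        under [RHS]eq_bigr do rewrite mulr_suml mulr_sumr.
        rewrite exchange_big /=; apply: eq_bigr => l _; rewrite !mulr_sumr.
        by apply: eq_bigr => m _; ring.
      ring.
    apply: le_trans (ler_normD _ _) _; apply: lerD.
      apply: le_trans (cb_taylor cb _ _ _ _) _; rewrite ler_wpM2l//.
      by rewrite lerXn2r ?nnegrE ?mulr_ge0//; exact: piece_move.
    apply: le_trans (ler_norm_sum _ _ _) _.
    rewrite -[v in v%:R]card_ord -sumr_const mulr_suml ler_sum// => l _.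
    rewrite mul1r normrM ler_pM//; first exact: (cb_ds_bound cb).
    exact: piece_first_order.
have -> : B * delta = K * (K * rho * M) * delta +
  (K * (K * rho * M) ^+ 2 + v%:R * (K * (K ^+ 2 * M * (delta + rho ^+ 2)))) * (r%:R * `|beta|).
  by rewrite /B; field.
have v0 : 0 <= v%:R :> R by [].
have MM : M <= M ^+ 2 by rewrite expr2 ler_peMl.
have KK : K ^+ 2 <= K ^+ 3 by rewrite [leRHS]exprSr ler_peMr ?sqr_ge0.
have dr0 : 0 <= delta * rho by rewrite mulr_ge0// ltW.
apply: (@le_trans _ _ (K ^+ 2 * M * (delta * rho) +
   (K * (K * rho * M) ^+ 2 + v%:R * (K * (K ^+ 2 * M * (delta + rho ^+ 2)))) * rho)).
  apply: lerD; last by rewrite ler_wpM2l.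
  by rewrite le_eqVlt; apply/orP; left; apply/eqP; ring.
have -> : (1 + v%:R) * K ^+ 3 * M ^+ 2 * (delta * rho + rho ^+ 3) =
  K ^+ 3 * M ^+ 2 * (delta * rho) + K ^+ 3 * M ^+ 2 * rho ^+ 3 +
  v%:R * K ^+ 3 * (delta * rho + rho ^+ 3) * M ^+ 2 by ring.
have -> : K ^+ 2 * M * (delta * rho) +
   (K * (K * rho * M) ^+ 2 + v%:R * (K * (K ^+ 2 * M * (delta + rho ^+ 2)))) * rho =
  K ^+ 2 * M * (delta * rho) + K ^+ 3 * M ^+ 2 * rho ^+ 3 +
  v%:R * K ^+ 3 * (delta * rho + rho ^+ 3) * M by ring.
apply: lerD; [apply: lerD => //|].
  by rewrite ler_wpM2r// ler_pM ?exprn_ge0.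
by rewrite ler_wpM2l// !mulr_ge0 ?exprn_ge0// addr_ge0// exprn_ge0.
Qed.

End Fixed.

(** With [q = sqrt T + r |beta| / sqrt delta] one has [rho <= sqrt delta * q]. Each bound becomes a
    power of [sqrt delta] times a power of [q] times a growth factor [exp (kap q)]; the last two are
    absorbed in one exponential. *)
Lemma ode_step (K T : R) : coefficient_bounds b sigma K -> 0 <= T ->
  exists C lam, [/\ 1 <= C, 0 <= lam & forall a delta beta x, 0 < delta -> delta <= T ->
    ode_piece b sigma a delta beta x ->
    let E := expR (lam * (`|beta| / Num.sqrt delta)) in let X := 1 + `|x a| in
    [/\ forall t, a <= t <= a + delta ->
          1 + `|x t| <= C * E * X /\ `|x t - x a| <= C * Num.sqrt delta * E * X,
        forall i, `|x (a + delta) i 0 - x a i 0 - \sum_(j < r) sigma (x a) i j * beta j 0|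
          <= C * delta * E * X &
        forall i, `|x (a + delta) i 0 - x a i 0 - b (x a) i 0 * delta
          - \sum_(j < r) sigma (x a) i j * beta j 0
          - 2^-1 * \sum_(j < r) \sum_(m < r) drift_rate i j m (x a) * (beta j 0 * beta m 0)|
          <= C * (delta * Num.sqrt delta) * E * X ^+ 2]].
Proof.
move=> cb T0; have K1 := cb_ge1 cb.
pose kap := 2 * v%:R * K * Num.sqrt T.
pose c0 : R := 2 + 2 * v%:R.
(* [2 * kap] is for the square of the growth factor, 1 for the powers of [q]. In [C], the factor 7
   comes from [q + q^3 <= 7 exp q], and the exponential collects the part [sqrt T] of [q]. *)
pose lam := (2 * kap + 1) * r%:R.
pose C := 7 * (1 + v%:R) * K ^+ 3 * c0 ^+ 2 * expR ((2 * kap + 1) * Num.sqrt T).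
have v0 : 0 <= v%:R :> R by [].
have sT0 : 0 <= Num.sqrt T by exact: sqrtr_ge0.
have kap0 : 0 <= kap by rewrite !mulr_ge0//; lra.
have c01 : 2 <= c0 by rewrite /c0; lra.
have eT1 : 1 <= expR ((2 * kap + 1) * Num.sqrt T).
  by rewrite -[leLHS]expR0 ler_expR mulr_ge0//; lra.
have K21 : 1 <= K ^+ 2 by rewrite exprn_ege1.
have K32 : K ^+ 2 <= K ^+ 3 by rewrite [leRHS]exprSr ler_peMr ?sqr_ge0.
have KK2 : K <= K ^+ 2 by rewrite expr2 ler_peMl//; lra.
have c02 : 2 * c0 <= c0 ^+ 2 by rewrite expr2 ler_wpM2r//; lra.
have coef : 3 * K ^+ 2 * c0 <= 7 * (1 + v%:R) * K ^+ 3 * c0 ^+ 2.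
  apply: (@le_trans _ _ (3 * K ^+ 3 * c0 ^+ 2)).
    by apply: ler_pM; [rewrite mulr_ge0 ?sqr_ge0|lra|rewrite ler_wpM2l|lra].
  by rewrite !ler_wpM2r ?sqr_ge0 ?exprn_ge0//; lra.
have C1 : 1 <= C.
  rewrite /C; apply: mulr_ege1 => //; apply: le_trans coef.
  by rewrite -mulrA mulr_ege1// ?mulr_ege1//; lra.
exists C, lam; split=> //; first by rewrite mulr_ge0//; lra.
move=> a delta beta x d0 dT op E X.
pose s := Num.sqrt delta; pose n := `|beta| / s; pose q := Num.sqrt T + r%:R * n.
have s0 : 0 < s by rewrite sqrtr_gt0.
have ss : s ^+ 2 = delta by rewrite sqr_sqrtr// ltW.
have sT : s <= Num.sqrt T by rewrite ler_wsqrtr.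
have n0 : 0 <= n by rewrite divr_ge0// ltW.
have q0 : 0 <= q by rewrite addr_ge0// mulr_ge0.
pose rho := delta + r%:R * `|beta|.
have rho0 : 0 <= rho by rewrite addr_ge0 ?mulr_ge0// ltW.
have sq0 : 0 <= s * q by rewrite mulr_ge0// ltW.
have rq : rho <= s * q.
  rewrite /rho /q mulrDr -ss expr2; apply: lerD; first by rewrite ler_wpM2l// ltW.
  by rewrite /n mulrCA [s * _]mulrC divfK// gt_eqF.
have X1 : 1 <= X by rewrite /X lerDl.
pose e := expR (kap * q).
have Mle : (2 + 2 * v%:R) * expR (2 * v%:R * K * rho) * (1 + `|x a|) <= c0 * e * X.
  rewrite ler_wpM2r ?addr_ge0// -/c0; apply: ler_wpM2l; first lra.
  rewrite ler_expR /kap -[X in _ <= X]mulrA; apply: ler_wpM2l; first by rewrite !mulr_ge0//; lra.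
  by apply: le_trans rq _; rewrite ler_wpM2r.
have M0 : 0 <= (2 + 2 * v%:R) * expR (2 * v%:R * K * rho) * (1 + `|x a|).
  apply: mulr_ge0; last by rewrite addr_ge0.
  by apply: mulr_ge0; [lra|exact: expR_ge0].
have e1 : 1 <= e by rewrite -[leLHS]expR0 ler_expR mulr_ge0.
have q1e : q <= expR q by apply: le_trans (expR_ge1Dx q); lra.
have q2e : q ^+ 2 <= 2 * expR q by exact: pow_le_exp.
have q3e : q ^+ 3 <= 6 * expR q by exact: pow_le_exp.
have eq1 : 1 <= expR q by rewrite -[leLHS]expR0 ler_expR.
have EE : e ^+ 2 * expR q = expR ((2 * kap + 1) * Num.sqrt T) * E.
  by rewrite /e -expRM_natl -!expRD /E /lam -/s -/n /q; congr expR; ring.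
have Ele : e * expR q <= expR ((2 * kap + 1) * Num.sqrt T) * E.
  by rewrite -EE ler_wpM2r ?expR_ge0// expr2 ler_peMl// expR_ge0.
have Eb : e <= expR ((2 * kap + 1) * Num.sqrt T) * E.
  by apply: le_trans Ele; rewrite ler_peMr ?expR_ge0.
have X0 : 0 <= X by lra.
have e0 : 0 <= e by lra.
have fin A Y B : 0 <= Y -> A <= 3 * K ^+ 2 * c0 -> 0 <= A -> 0 <= B ->
   B <= expR ((2 * kap + 1) * Num.sqrt T) * E -> A * B * Y <= C * E * Y.
  move=> Y0 AC A0 B0 BE; rewrite ler_wpM2r// /C -[leRHS]mulrA ler_pM//.
  exact: le_trans coef.
have K0 : 0 <= K by lra.
split.
- move=> t ta; split.
    apply: le_trans (piece_growth cb d0 op ta) _; apply: le_trans Mle _.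
    by apply: fin => //; nra.
  apply: le_trans (piece_move cb d0 op ta) _.
  apply: (@le_trans _ _ (K * (s * q) * (c0 * e * X))).
    by apply: ler_pM; [exact: mulr_ge0|exact: M0|rewrite ler_wpM2l|exact: Mle].
  have -> : K * (s * q) * (c0 * e * X) = (K * c0) * (e * q) * (s * X) by ring.
  have -> : C * Num.sqrt delta * E * X = C * E * (s * X) by rewrite -/s; ring.
  apply: fin => //.
  - by rewrite mulr_ge0// ltW.
  - by nra.
  - by rewrite mulr_ge0//; lra.
  - exact: mulr_ge0.
  - by apply: le_trans Ele; rewrite ler_wpM2l.
- move=> i; have adl : a <= a + delta <= a + delta by rewrite lexx lerDl ltW.
  have := piece_first_order cb d0 op i adl.
  rewrite [a + delta - a](_ : _ = delta); last by ring.
  rewrite divff ?gt_eqF// mul1r => /le_trans; apply.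
  apply: (@le_trans _ _ (K ^+ 2 * (c0 * e * X) * (s ^+ 2 + (s * q) ^+ 2))).
    apply: ler_pM.
    - by apply: mulr_ge0; [exact: sqr_ge0|exact: M0].
    - by rewrite addr_ge0 ?sqr_ge0// ltW.
    - by apply: ler_wpM2l; [exact: sqr_ge0|exact: Mle].
    - by rewrite ss lerD2l; apply: lerXn2r; [exact: rho0|exact: sq0|exact: rq].
  have -> : K ^+ 2 * (c0 * e * X) * (s ^+ 2 + (s * q) ^+ 2) =
    (K ^+ 2 * c0) * (e * (1 + q ^+ 2)) * (s ^+ 2 * X) by ring.
  have -> : C * delta * E * X = C * E * (s ^+ 2 * X) by rewrite ss; ring.
  apply: (@le_trans _ _ ((3 * K ^+ 2 * c0) * (e * expR q) * (s ^+ 2 * X))).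
    apply: ler_wpM2r; first by apply: mulr_ge0; [exact: sqr_ge0|].
    have -> : 3 * K ^+ 2 * c0 * (e * expR q) = K ^+ 2 * c0 * (e * (3 * expR q)) by ring.
    apply: ler_wpM2l; first by apply: mulr_ge0; [exact: sqr_ge0|lra].
    by apply: ler_wpM2l => //; lra.
  apply: fin => //.
  - by apply: mulr_ge0; [exact: sqr_ge0|].
  - by apply: mulr_ge0; [apply: mulr_ge0; [|exact: sqr_ge0]|lra].
  - by apply: mulr_ge0; [|exact: expR_ge0].
- move=> i; apply: le_trans (piece_second_order cb d0 op i) _.
  apply: (@le_trans _ _ ((1 + v%:R) * K ^+ 3 * (c0 * e * X) ^+ 2 *
      (s ^+ 2 * (s * q) + (s * q) ^+ 3))).
    have v10 : 0 <= 1 + v%:R :> R by lra.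
    apply: ler_pM.
    - by apply: mulr_ge0; [rewrite mulr_ge0 ?exprn_ge0|exact: sqr_ge0].
    - by rewrite addr_ge0 ?mulr_ge0 ?exprn_ge0// ltW.
    - apply: ler_wpM2l; first by rewrite mulr_ge0 ?exprn_ge0.
      apply: lerXn2r; [exact: M0| |exact: Mle].
      by rewrite nnegrE mulr_ge0// mulr_ge0//; lra.
    - rewrite ss; apply: lerD; first by apply: ler_wpM2l; [exact: ltW|exact: rq].
      by apply: lerXn2r; [exact: rho0|exact: sq0|exact: rq].
  have -> : (1 + v%:R) * K ^+ 3 * (c0 * e * X) ^+ 2 * (s ^+ 2 * (s * q) + (s * q) ^+ 3) =
    (1 + v%:R) * K ^+ 3 * c0 ^+ 2 * (e ^+ 2 * (q + q ^+ 3)) * (s ^+ 3 * X ^+ 2) by ring.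
  have -> : C * (delta * Num.sqrt delta) * E * X ^+ 2 =
    7 * (1 + v%:R) * K ^+ 3 * c0 ^+ 2 * (expR ((2 * kap + 1) * Num.sqrt T) * E) * (s ^+ 3 * X ^+ 2).
    by rewrite /C -/s -{1}ss; ring.
  apply: ler_wpM2r; first by apply: mulr_ge0; apply: exprn_ge0 => //; exact: ltW.
  rewrite -EE.
  have -> : 7 * (1 + v%:R) * K ^+ 3 * c0 ^+ 2 * (e ^+ 2 * expR q) =
    (1 + v%:R) * K ^+ 3 * c0 ^+ 2 * (e ^+ 2 * (7 * expR q)) by ring.
  apply: ler_wpM2l.
    apply: mulr_ge0; last exact: sqr_ge0.
    by apply: mulr_ge0; [lra|exact: exprn_ge0].
  by apply: ler_wpM2l; [exact: sqr_ge0|lra].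
Qed.
End StepBounds.

Lemma gronwall_le {R : realType} (u : nat -> R) (A D : R) n : 0 <= A -> 0 <= D -> 0 <= u 0%N ->
  (forall i, (i < n)%N -> u i.+1 <= (1 + A) * u i + D) ->
  forall i, (i <= n)%N -> u i <= (u 0%N + i%:R * D) * expR (i%:R * A).
Proof.
move=> A0 D0 u0 H; elim=> [_|i IH iN]; first by rewrite !mul0r addr0 expR0 mulr1.
have E1 : 1 <= expR (i.+1%:R * A) by rewrite -[leLHS]expR0 ler_expR mulr_ge0.
have v0 : 0 <= u 0%N + i%:R * D by rewrite addr_ge0// mulr_ge0.
apply: le_trans (H i iN) _.
apply: (@le_trans _ _ (expR A * ((u 0%N + i%:R * D) * expR (i%:R * A)) + D * expR (i.+1%:R * A))).
  apply: lerD; last by rewrite ler_peMr.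
  apply: (@le_trans _ _ ((1 + A) * ((u 0%N + i%:R * D) * expR (i%:R * A)))).
    by apply: ler_wpM2l (IH (ltnW iN)); rewrite addr_ge0.
  by apply: ler_wpM2r (expR_ge1Dx A); rewrite mulr_ge0// expR_ge0.
have -> : expR A * ((u 0%N + i%:R * D) * expR (i%:R * A)) =
    (u 0%N + i%:R * D) * expR (i.+1%:R * A).
  by rewrite mulrCA -expRD; congr (_ * expR _); rewrite -natr1; ring.
rewrite -mulrDl [X in X * _ <= _](_ : _ = u 0%N + i.+1%:R * D)//.
by rewrite -natr1; ring.
Qed.

(** * Euler scheme and measurability of the endpoint of a cell *)

Section Euler.
Context {R : realType} {v r : nat}.
Variables (b : 'cV[R]_v -> 'cV[R]_v) (sigma : 'cV[R]_v -> 'M[R]_(v, r)).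

Definition euler (h delta : R) beta (y : 'cV[R]_v) := y + h *: field b sigma delta beta y.

Lemma colnorm_field_lipschitz K delta beta x y : coefficient_bounds b sigma K -> 0 < delta ->
  `|field b sigma delta beta x - field b sigma delta beta y| <=
  K * ((delta + r%:R * `|beta|) / delta) * `|x - y|.
Proof.
move=> cb d0; have K1 := cb_ge1 cb; apply: colnorm_le => [|i].
  rewrite mulr_ge0//; apply: mulr_ge0; first lra.
  by rewrite divr_ge0 ?(ltW d0)// addr_ge0 ?(ltW d0)// mulr_ge0.
by have := field_lipschitz beta i x y cb d0; rewrite !mxE.
Qed.

Section Fixed.
Variables (K a delta : R) (beta : 'cV[R]_r) (x : R -> 'cV[R]_v).
Hypotheses (cb : coefficient_bounds b sigma K) (d0 : 0 < delta)
  (op : ode_piece b sigma a delta beta x).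

Lemma piece_lipschitz : exists2 W, 0 <= W & forall s t, a <= s -> s <= t -> t <= a + delta ->
  `|x t - x s| <= W * (t - s).
Proof.
set rd := (delta + r%:R * `|beta|) / delta.
have rd0 : 0 <= rd by rewrite divr_ge0 ?(ltW d0)// addr_ge0 ?(ltW d0)// mulr_ge0.
have K0 : 0 <= K by have := cb_ge1 cb; lra.
have [M MB] : exists M, forall t, a <= t <= a + delta -> 1 + `|x t| <= M.
  by eexists; exact: (piece_growth cb d0 op).
have M0 : 0 <= M.
  apply: le_trans (MB a _); first by rewrite addr_ge0.
  by rewrite lexx lerDl ltW.
have KM0 : 0 <= K * rd * M by rewrite mulr_ge0//; exact: mulr_ge0.
exists (K * rd * M) => //.
move=> s t as_ st td; apply: colnorm_le => [|i].
  by rewrite mulr_ge0// subr_ge0.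
rewrite !mxE.
apply: (@mvt_le _ (fun s => x s i 0) (fun s => field b sigma delta beta (x s) i 0)) => //.
- by move=> u; rewrite in_itv/= => /andP[su ut]; apply: (op_deriv op); rewrite in_itv/= (le_lt_trans as_ su) (lt_le_trans ut td).
- exact: cont_on_sub (op_cont op i).
- move=> u; rewrite in_itv/= => /andP[su ut]; have H := field_growth beta cb d0 i (x u); apply: (le_trans H).
  apply: ler_wpM2l; first exact: mulr_ge0.
  by apply: MB; rewrite (le_trans as_ (ltW su)) (le_trans (ltW ut) td).
Qed.

Lemma euler_local : exists2 C, 0 <= C & forall t h, a <= t -> 0 <= h -> t + h <= a + delta ->
  `|x (t + h) - euler h delta beta (x t)| <= C * h ^+ 2.
Proof.
have [W W0 HW] := piece_lipschitz.
set L := K * ((delta + r%:R * `|beta|) / delta).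
have L0 : 0 <= L.
  apply: mulr_ge0; first by have := cb_ge1 cb; lra.
  by rewrite divr_ge0 ?(ltW d0)// addr_ge0 ?(ltW d0)// mulr_ge0.
exists (L * W); first exact: mulr_ge0.
move=> t h at_ h0 th; apply: colnorm_le => [|i]; first by apply: mulr_ge0; [exact: mulr_ge0|exact: sqr_ge0].
pose f s := x s i 0 - (s - t) * field b sigma delta beta (x t) i 0.
have -> : (x (t + h) - euler h delta beta (x t)) i 0 = f (t + h) - f t.
  by rewrite /f /euler !mxE; ring.
have -> : L * W * h ^+ 2 = L * W * h * (t + h - t) by ring.
apply: (@mvt_le _ f (fun s => field b sigma delta beta (x s) i 0 - field b sigma delta beta (x t) i 0)).
- by rewrite lerDl.
- move=> s; rewrite in_itv/= => /andP[ts sh].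
  have sa : s \in `]a, a + delta[ by rewrite in_itv/= (le_lt_trans at_ ts) (lt_le_trans sh th).
  have D := op_deriv op i sa; rewrite /f.
  by apply: is_derive_eq; rewrite /GRing.scale/=; ring.
- have cl : cont_on t (t + h) (fun s => (s - t) * field b sigma delta beta (x t) i 0).
    apply: continuous_subspaceT => z; apply: cvgM; last exact: cvg_cst.
    by apply: cvgB; [exact: cvg_id|exact: cvg_cst].
  have ci : cont_on t (t + h) (fun s => x s i 0) by exact: cont_on_sub (op_cont op i).
  by move=> y; apply: cvgB; [exact: ci|exact: cl].
- move=> s; rewrite in_itv/= => /andP[ts sh].
  apply: le_trans (field_lipschitz _ _ _ _ cb d0) _; rewrite -/L.
  have -> : L * W * h = L * (W * h) by rewrite mulrA.
  apply: ler_wpM2l => //.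
  apply: le_trans (HW _ _ at_ (ltW ts) (le_trans (ltW sh) th)) _.
  by rewrite ler_wpM2l// lerBlDl ltW.
Qed.

(** The local error is of order [h^2] and the Euler map is stable with factor [1 + h L]; the
    discrete Gronwall inequality gives a global error of order [1 / (m + 1)]. *)
Lemma euler_cvg :
  (fun m => iter m.+1 (euler (delta / m.+1%:R) delta beta) (x a)) @ \oo --> x (a + delta).
Proof.
have [C C0 HC] := euler_local.
set L := K * ((delta + r%:R * `|beta|) / delta).
have L0 : 0 <= L.
  apply: mulr_ge0; first by have := cb_ge1 cb; lra.
  by rewrite divr_ge0 ?(ltW d0)// addr_ge0 ?(ltW d0)// mulr_ge0.
have key m : `|x (a + delta) - iter m.+1 (euler (delta / m.+1%:R) delta beta) (x a)| <=
   C * delta ^+ 2 * expR (delta * L) / m.+1%:R.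
  pose h := delta / m.+1%:R.
  have h0 : 0 <= h by rewrite divr_ge0// ltW.
  have mh : m.+1%:R * h = delta by rewrite /h; field.
  pose u i := `|x (a + i%:R * h) - iter i (euler h delta beta) (x a)|.
  have step i : (i < m.+1)%N -> u i.+1 <= (1 + h * L) * u i + C * h ^+ 2.
    move=> im; rewrite /u -natr1 mulrDl mul1r addrA iterS.
    set t := a + i%:R * h; set y := iter i _ _.
    have at_ : a <= t by rewrite lerDl mulr_ge0.
    have th : t + h <= a + delta.
      have -> : t + h = a + i.+1%:R * h by rewrite /t -natr1; ring.
      by rewrite lerD2l -mh ler_wpM2r// ler_nat.
    have := HC t h at_ h0 th => Hl.
    have -> : x (t + h) - euler h delta beta y =
      (x t - y + h *: (field b sigma delta beta (x t) - field b sigma delta beta y)) +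
      (x (t + h) - euler h delta beta (x t)).
      by rewrite /euler scalerBr; apply/matrixP => k l; rewrite !mxE; ring.
    apply: le_trans (ler_normD _ _) _; apply: lerD => //.
    apply: le_trans (ler_normD _ _) _; rewrite mulrDl mul1r lerD2l normrZ (ger0_norm h0).
    by rewrite -mulrA ler_wpM2l//; exact: colnorm_field_lipschitz.
  have u00 : u 0%N = 0 by rewrite /u mul0r addr0 subrr normr0.
  have := @gronwall_le R u (h * L) (C * h ^+ 2) m.+1 _ _ _ step m.+1 (leqnn _).
  rewrite u00 add0r {1}/u mh => H; apply: le_trans (H _ _ _) _ => //.
  - exact: mulr_ge0.
  - by rewrite mulr_ge0 ?sqr_ge0.
  - rewrite le_eqVlt; apply/orP; left; apply/eqP.
    have -> : m.+1%:R * (h * L) = delta * L by rewrite mulrA mh.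
    have -> : m.+1%:R * (C * h ^+ 2) = C * delta ^+ 2 / m.+1%:R by rewrite /h; field.
    by rewrite mulrAC.
apply/cvgrPdist_le => e e0; near=> m.
apply: le_trans (key m) _; rewrite ler_pdivrMr//.
rewrite -ler_pdivrMl//.
apply: (@le_trans _ _ m%:R); last by rewrite ler_nat.
near: m; exact: nbhs_infty_ger.
Unshelve. all: by end_near. Qed.

End Fixed.

(** The solutions are given path by path, without measurability in [w]. The endpoint is the limit of
    Euler iterates, which are explicit functions of the measurable data. *)
Lemma measurable_ode_step d (S : measurableType d) K (a delta : R)
    (X : S -> 'cV[R]_v) (beta : S -> 'cV[R]_r) (x : S -> R -> 'cV[R]_v) :
  coefficient_bounds b sigma K -> 0 < delta ->
  (forall i, measurable_fun setT (fun w => X w i 0)) ->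
  (forall j, measurable_fun setT (fun w => beta w j 0)) ->
  (forall w, ode_piece b sigma a delta (beta w) (x w)) -> (forall w, x w a = X w) ->
  forall i, measurable_fun setT (fun w => x w (a + delta) i 0).
Proof.
move=> cb d0 mX mb op xa i.
pose y m k w := iter k (euler (delta / m.+1%:R) delta (beta w)) (X w).
have my m k j : measurable_fun setT (fun w => y m k w j 0).
  elim: k j => [|k IH] j; first exact: mX.
  have -> : (fun w => y m k.+1 w j 0) = (fun w => y m k w j 0 + delta / m.+1%:R *
     (b (y m k w) j 0 + \sum_(l < r) sigma (y m k w) j l * (beta w l 0 / delta))).
    by apply/funext => w; rewrite /y iterS /euler !mxE.
  apply: measurable_funD => //; apply: measurable_funM => //; apply: measurable_funD.
    apply: (measurable_comp_col (f := fun z => b z j 0)) => //.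
    exact: lipschitz_continuous (cb_b_lip cb j).
  apply: measurable_sum => l; apply: measurable_funM; last exact: measurable_funM.
  apply: (measurable_comp_col (f := fun z => sigma z j l)) => //.
  exact: lipschitz_continuous (cb_s_lip cb j l).
apply: (measurable_fun_cvg (h := fun m w => y m m.+1 w i 0)).
  by move=> m; exact: my.
move=> w _; rewrite /y; have := euler_cvg cb d0 (op w); rewrite xa => H.
apply: (@cvg_comp _ _ _ _ (fun z : 'cV[R]_v => z i 0) _ _ _ H).
exact: coord_continuous.
Qed.

End Euler.

(** * Adapted recursions and moments of the polygonal solutions *)

Ltac lgt := lazymatch goal with
  | H : LG ?P ?G ?f |- LG ?P ?G ?f => exact: H
  | |- LG ?P ?G (fun w => ?f w) => change (LG P G f); lgt
  | |- LG _ _ (fun _ => ?c) => exact: LG_cst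
  | |- LG _ _ (fun w => @?f w + @?g w) => apply: (@LGD _ _ _ _ _ f g); lgt
  | |- LG _ _ (fun w => - @?f w) => apply: (@LGN _ _ _ _ _ f); lgt
  | |- LG _ _ (fun w => @?f w * @?g w) => apply: (@LGM _ _ _ _ _ f g); lgt
  | |- LG _ _ (fun w => @?f w ^+ _) => apply: (@LGX _ _ _ _ _ f); lgt
  | |- LG _ _ (fun w => `|@?f w|) => apply: (@LG_norm _ _ _ _ _ f); lgt
  | |- LG _ _ (fun w => Num.max (@?f w) (@?g w)) => apply: (@LG_max _ _ _ _ _ f g); lgt
  | |- LG _ _ (fun w => \sum_(_ <- _ | _) _) => apply: LG_sum => [|? _]; lgt
  | |- _ => eassumption end.

Section Noise.
Context {R : realType} {disp : measure_display} {Omega : measurableType disp}.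
Variables (P : probability Omega R) (r : nat).
Implicit Types (G : nat -> set (set Omega)) (h : R) (beta : nat -> Omega -> 'cV[R]_r).

(** A Wiener process seen along a uniform grid: [G k] is the information available before step [k],
    and [beta k] becomes known at [k.+1]. Coarse and fine grids are both instances. *)
Record noise (N : nat) h G beta : Prop := {
  noise_sub : forall k, (k <= N)%N -> sub_sigma (G k);
  noise_mono : forall k, (k < N)%N -> G k `<=` G k.+1;
  noise_incr : forall k, (k < N)%N -> gauss_incr P (G k) h (beta k);
  noise_meas : forall k j, (k < N)%N -> gmeas (G k.+1) (fun w => beta k w j 0) }.

(* Dividing by [sqrt h] makes its mean independent of the step. *)
Definition nexp (h lam : R) (W : Omega -> 'cV[R]_r) w := expR (lam * (`|W w| / Num.sqrt h)).

Variables (N : nat) (h : R) (G : nat -> set (set Omega)) (beta : nat -> Omega -> 'cV[R]_r).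
Hypothesis HN : noise N h G beta.
Let sF := @sub_sigma_full disp Omega.

Lemma noise_mono_le k l : (k <= l)%N -> (l <= N)%N -> G k `<=` G l.
Proof.
elim: l => [|l IH]; first by rewrite leqn0 => /eqP -> _; exact: subset_refl.
rewrite leq_eqVlt => /predU1P[-> _|kl lN]; first exact: subset_refl.
exact: (subset_trans (IH kl (ltnW lN)) (noise_mono HN lN)).
Qed.

Lemma LG_lift k l f : (k <= l)%N -> (l <= N)%N -> LG P (G k) f -> LG P (G l) f.
Proof.
move=> kl lN; apply: LG_sub; [exact: (noise_sub HN) (leq_trans kl lN)|exact: (noise_sub HN)|].
exact: noise_mono_le.
Qed.

Lemma LG_of k f : (k <= N)%N -> LG P (G k) f -> LG P measurable f.
Proof. by move=> kN; apply: LG_full; exact: (noise_sub HN). Qed.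

Lemma LG_beta k j : (k < N)%N -> LG P (G k.+1) (fun w => beta k w j 0).
Proof.
move=> kN; split; first exact: (noise_meas HN).
by have [_] := LG_W (noise_incr HN kN) j.
Qed.

Lemma gmeas_nexp k lam : (k < N)%N -> gmeas (G k.+1) (nexp h lam (beta k)).
Proof.
move=> kN; apply: measurableT_comp; first exact: measurable_expR.
apply: measurable_funM => //; apply: measurable_funM => //.
by apply: measurable_colnorm => j; exact: (noise_meas HN).
Qed.

(** The maximum norm is attained at one coordinate, and the two exponentials of this coordinate in
    [gexp] suffice. *)
Lemma nexp_le k lam w : 0 <= lam -> nexp h lam (beta k) w <= gexp h (beta k) lam w.
Proof.
move=> l0; rewrite /nexp /gexp.
have E0 (a : R) : 0 <= expR a by exact: expR_ge0.
have [->|] := eqVneq `|beta k w| 0.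
  by rewrite mul0r mulr0 expR0 lerDl sumr_ge0// => j _; rewrite addr_ge0.
move=> /mx_norm_neq0[[j z]] /=; rewrite ord1 => E; rewrite [`|_|]E.
rewrite (bigD1 j)//=.
have -> : lam * (`|beta k w j 0| / Num.sqrt h) = `|lam / Num.sqrt h * beta k w j 0|.
  by rewrite normrM normrM (ger0_norm l0) normfV (ger0_norm (sqrtr_ge0 h)); ring.
apply: le_trans (expR_norm_le _) _; rewrite mulNr addrCA lerDl addr_ge0//.
by apply: sumr_ge0 => i _; rewrite addr_ge0.
Qed.

Lemma nexp_ge0 k lam w : 0 <= nexp h lam (beta k) w.
Proof. exact: expR_ge0. Qed.

Lemma LG_nexp k lam : (k < N)%N -> 0 <= lam -> LG P (G k.+1) (nexp h lam (beta k)).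
Proof.
move=> kN l0; split; first exact: gmeas_nexp.
have Lg := LG_gexp (noise_incr HN kN) lam.
have mm : gmeas measurable (nexp h lam (beta k)).
  by apply: gmeas_full; apply: gmeas_measurable (gmeas_nexp lam kN); exact: (noise_sub HN).
have [] // := LG_dom sF mm Lg _ => w.
rewrite (ger0_norm (nexp_ge0 _ _ _)); apply: le_trans (ler_norm _); exact: nexp_le.
Qed.

Lemma Ex_nexp k lam Z : (k < N)%N -> 0 <= lam -> LG P (G k) Z -> (forall w, 0 <= Z w) ->
  Ex P (fun w => Z w * nexp h lam (beta k) w) <= gconst r lam * Ex P Z.
Proof.
move=> kN l0 LZ Z0; have sk := noise_sub HN (ltnW kN).
rewrite -(Ex_gexp sk (noise_incr HN kN) lam LZ).
have LZ' := LG_full sk LZ; have L1 := LG_of kN (LG_nexp kN l0).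
have L2 := LG_gexp (noise_incr HN kN) lam.
apply: (Ex_le sF); [by lgt|by lgt|move=> w].
by rewrite ler_wpM2l//; exact: nexp_le.
Qed.

Lemma nexpX k lam n w : nexp h lam (beta k) w ^+ n = nexp h (n%:R * lam) (beta k) w.
Proof. by rewrite /nexp -expRM_natl mulrA. Qed.

Lemma norm_beta_le k w : (k < N)%N -> `|beta k w| <= Num.sqrt h * nexp h 1 (beta k) w.
Proof.
move=> kN; have h0 := gi_gt0 (noise_incr HN kN); have s0 : 0 < Num.sqrt h by rewrite sqrtr_gt0.
rewrite mulrC -ler_pdivrMr// /nexp mul1r; apply: le_trans (expR_ge1Dx _).
by rewrite lerDr.
Qed.

Definition gsum (l : 'I_r -> Omega -> R) k w := \sum_(j < r) l j w * beta k w j 0.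

Lemma LG_gsum l k : (k < N)%N -> (forall j, LG P (G k) (l j)) -> LG P (G k.+1) (gsum l k).
Proof.
move=> kN Ll; have sk := noise_sub HN kN.
apply: LG_sum => // j _; apply: LGM => //; last exact: LG_beta.
exact: LG_lift (Ll j).
Qed.

Lemma Ex_gsum Z l k : (k < N)%N -> LG P (G k) Z -> (forall j, LG P (G k) (l j)) ->
  Ex P (fun w => Z w * gsum l k w) = 0.
Proof.
move=> kN LZ Ll; have sk := noise_sub HN (ltnW kN); have sk1 := noise_sub HN kN.
transitivity (Ex P (fun w => \sum_(j < r) (Z w * l j w) * beta k w j 0)).
  by apply: eq_Ex => w; rewrite mulr_sumr; apply: eq_bigr => j _; rewrite mulrA.
have LZl j : LG P (G k) (fun w => Z w * l j w) by exact: LGM.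
rewrite (Ex_sum sk1); last first.
  by move=> j _; apply: LGM => //; [exact: LG_lift (LZl j)|exact: LG_beta].
by rewrite big1// => j _; exact: (Ex_mulW sk (noise_incr HN kN) j (LZl j)).
Qed.

End Noise.

(** * Moments of a nonnegative scalar recursion *)

Section ScalarRecursion.
Context {R : realType} {disp : measure_display} {Omega : measurableType disp}.
Variables (P : probability Omega R) (r : nat).
Variables (N : nat) (h T : R) (G : nat -> set (set Omega)) (beta : nat -> Omega -> 'cV[R]_r).
Hypotheses (HN : noise P N h G beta) (h0 : 0 < h) (hT : N%:R * h <= T) (hT1 : h <= T).
Variables (V : nat -> Omega -> R) (l : nat -> 'I_r -> Omega -> R) (rem : nat -> Omega -> R)
  (c mu v0 : R).
Hypotheses (c0 : 0 <= c) (mu0 : 0 <= mu) (v00 : 0 <= v0)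
  (V0 : forall w, V 0%N w = v0) (Vge0 : forall k w, 0 <= V k w)
  (LV : forall k, (k <= N)%N -> LG P (G k) (V k))
  (Ll : forall k j, (k < N)%N -> LG P (G k) (l k j))
  (Lrem : forall k, (k < N)%N -> LG P (G k.+1) (rem k))
  (VS : forall k w, (k < N)%N -> V k.+1 w = V k w + gsum beta (l k) k w + rem k w)
  (lB : forall k w, (k < N)%N -> `|gsum beta (l k) k w| <= c * Num.sqrt h * nexp h mu (beta k) w * V k w)
  (rB : forall k w, (k < N)%N -> `|rem k w| <= c * h * nexp h mu (beta k) w * V k w).

Let sF := @sub_sigma_full disp Omega.

(** The first summand comes from [2 V rem], the second from [(gsum + rem)^2], where [h^2 <= T h]. *)
Definition rec_rate := 2 * c * gconst r mu + 2 * c ^+ 2 * (1 + T) * gconst r (2 * mu).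

Lemma T_ge0 : 0 <= T. Proof. exact: le_trans (ltW h0) hT1. Qed.

Lemma rec_rate_ge0 : 0 <= rec_rate.
Proof.
have := T_ge0; have := gconst_ge1 r mu; have := gconst_ge1 r (2 * mu) => *.
by rewrite addr_ge0 ?mulr_ge0 ?sqr_ge0//; lra.
Qed.

(** In the square of the recursion the cross term with [gsum] has mean zero. The rest is of order
    [h] relative to [V^2], since [V] belongs to the past and the mean of [nexp] has a bound free of
    [h]. *)
Lemma second_moment k : (k <= N)%N -> Ex P (fun w => V k w ^+ 2) <= v0 ^+ 2 * expR (T * rec_rate).
Proof.
move=> kN; pose u k := Ex P (fun w => V k w ^+ 2).
have u0 : u 0%N = v0 ^+ 2 by rewrite /u; under eq_Ex do rewrite V0; exact: Ex_cst.
have step i : (i < N)%N -> u i.+1 <= (1 + h * rec_rate) * u i + 0.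
  move=> iN; rewrite addr0.
  have L0 := LV (ltnW iN); have LVi := LG_of HN (ltnW iN) L0.
  have Lg := LG_of HN iN (LG_gsum HN iN (fun j => Ll j iN)).
  have Lr := LG_of HN iN (Lrem iN).
  have Le := LG_of HN iN (LG_nexp HN iN mu0).
  have LV2 : LG P (G i) (fun w => V i w ^+ 2) by apply: LGX => //; exact: (noise_sub HN (ltnW iN)).
  have mu20 : 0 <= 2 * mu by rewrite mulr_ge0.
  have Le2 := LG_of HN iN (LG_nexp HN iN mu20).
  have H1 := Ex_nexp HN iN mu0 LV2 (fun w => sqr_ge0 _).
  have H2 := Ex_nexp HN iN mu20 LV2 (fun w => sqr_ge0 _).
  have LV2' := LG_of HN (ltnW iN) LV2.
  pose M w := V i w ^+ 2 + 2 * (V i w * gsum beta (l i) i w) +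
     (2 * c * h * (V i w ^+ 2 * nexp h mu (beta i) w) +
      2 * c ^+ 2 * (1 + T) * h * (V i w ^+ 2 * nexp h (2 * mu) (beta i) w)).
  apply: (@le_trans _ _ (Ex P M)).
    apply: (Ex_le sF); [|by rewrite /M; lgt|].
      by apply: LGX => //; exact: (LG_of HN iN (LV iN)).
    move=> w; rewrite VS// /M.
    set g := gsum _ _ _ _; set e := nexp h mu _ _; set q := rem i w; set x := V i w.
    have gb : `|g| <= c * Num.sqrt h * e * x by exact: lB.
    have qb : `|q| <= c * h * e * x by exact: rB.
    have x0 : 0 <= x by exact: Vge0.
    have e0 : 0 <= e by exact: nexp_ge0.
    have -> : nexp h (2 * mu) (beta i) w = e ^+ 2 by rewrite /e nexpX.
    have sh : Num.sqrt h ^+ 2 = h by rewrite sqr_sqrtr// ltW.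
    have A1 : x * q <= c * h * (x ^+ 2 * e).
      apply: (@le_trans _ _ (x * (c * h * e * x))); last by rewrite le_eqVlt; apply/orP; left; apply/eqP; ring.
      by rewrite ler_wpM2l// (le_trans (ler_norm _)).
    have A2 : g ^+ 2 <= c ^+ 2 * h * (x ^+ 2 * e ^+ 2).
      apply: (@le_trans _ _ ((c * Num.sqrt h * e * x) ^+ 2)).
        by rewrite -[leLHS]real_normK ?num_real// lerXn2r ?nnegrE// (le_trans _ gb).
      by rewrite !exprMn sh le_eqVlt; apply/orP; left; apply/eqP; ring.
    have A3 : q ^+ 2 <= c ^+ 2 * T * h * (x ^+ 2 * e ^+ 2).
      apply: (@le_trans _ _ ((c * h * e * x) ^+ 2)).
        by rewrite -[leLHS]real_normK ?num_real// lerXn2r ?nnegrE// (le_trans _ qb).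
      have -> : (c * h * e * x) ^+ 2 = (c ^+ 2 * h * (x ^+ 2 * e ^+ 2)) * h by ring.
      have -> : c ^+ 2 * T * h * (x ^+ 2 * e ^+ 2) = (c ^+ 2 * h * (x ^+ 2 * e ^+ 2)) * T by ring.
      apply: ler_wpM2l => //; apply: mulr_ge0; last by rewrite mulr_ge0 ?sqr_ge0.
      by rewrite mulr_ge0 ?sqr_ge0// ltW.
    have A4 : (g + q) ^+ 2 <= 2 * g ^+ 2 + 2 * q ^+ 2 by have := sqr_ge0 (g - q); lra.
    have -> : (x + g + q) ^+ 2 = x ^+ 2 + 2 * (x * g) + (2 * (x * q) + (g + q) ^+ 2) by ring.
    rewrite lerD2l; apply: lerD; first by rewrite -2!mulrA ler_pM2l// mulrA.
    apply: (le_trans A4); rewrite [leRHS](_ : _ = 2 * (c ^+ 2 * h * (x ^+ 2 * e ^+ 2)) +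
      2 * (c ^+ 2 * T * h * (x ^+ 2 * e ^+ 2))); last by ring.
    by apply: lerD; rewrite ler_pM2l.
  have Lr2 : LG P measurable (fun w => V i w * gsum beta (l i) i w) by lgt.
  have La : LG P measurable (fun w => V i w ^+ 2 * nexp h mu (beta i) w) by lgt.
  have Lb : LG P measurable (fun w => V i w ^+ 2 * nexp h (2 * mu) (beta i) w) by lgt.
  rewrite /M (ExD sF); [|by lgt|by lgt].
  rewrite (ExD sF); [|by lgt|by lgt].
  rewrite (ExD sF (f := fun w => 2 * c * h * _)); [|by lgt|by lgt].
  rewrite (ExZ sF _ Lr2) (ExZ sF _ La) (ExZ sF _ Lb).
  rewrite (Ex_gsum HN iN L0 (fun j => Ll j iN)) mulr0 addr0 -/(u i).
  apply: (@le_trans _ _ (u i + (2 * c * h * (gconst r mu * u i) +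
    2 * c ^+ 2 * (1 + T) * h * (gconst r (2 * mu) * u i)))).
    have T0 := T_ge0.
    rewrite lerD2l; apply: lerD; apply: ler_wpM2l => //.
      by rewrite !mulr_ge0// ltW.
    by rewrite !mulr_ge0 ?sqr_ge0 ?addr_ge0// ltW.
  by rewrite /rec_rate le_eqVlt; apply/orP; left; apply/eqP; ring.
have hr0 : 0 <= h * rec_rate by rewrite mulr_ge0 ?rec_rate_ge0// ltW.
have uu0 : 0 <= u 0%N by rewrite u0 sqr_ge0.
have := gronwall_le hr0 (lexx 0) uu0 step kN.
rewrite u0 mulr0 addr0 => /le_trans; apply; rewrite ler_wpM2l ?sqr_ge0// ler_expR mulrA.
rewrite ler_wpM2r ?rec_rate_ge0//; apply: le_trans hT.
by rewrite ler_wpM2r ?(ltW h0)// ler_nat.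
Qed.

Fixpoint runmax k w := if k is k'.+1 then Num.max (runmax k' w) (V k w) else V 0%N w.

Lemma runmax_ge k w i : (i <= k)%N -> V i w <= runmax k w.
Proof.
elim: k => [|k IH]; first by rewrite leqn0 => /eqP ->.
rewrite leq_eqVlt => /predU1P[->|ik] /=; first by rewrite le_max lexx orbT.
by rewrite le_max IH.
Qed.

Lemma LG_runmax k : (k <= N)%N -> LG P (G k) (runmax k).
Proof.
elim: k => [|k IH] kN; first exact: LV.
have sk := noise_sub HN kN.
apply: LG_max => //; last exact: LV.
by apply: (LG_lift HN _ _ (IH (ltnW kN))).
Qed.

(* Pathwise form of Doob's maximal inequality: [S^2 - 2 S V] decreases by at
   least [2 S dV] at each step, where [S] is the running maximum of [V]. *)
Lemma maximal_second_moment :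
  Ex P (fun w => runmax N w ^+ 2) <= 4 * (v0 ^+ 2 * expR (T * rec_rate)) * expR (T * (4 * c * gconst r mu)).
Proof.
set M := v0 ^+ 2 * expR (T * rec_rate).
have M0 : 0 <= M by rewrite mulr_ge0 ?sqr_ge0 ?expR_ge0.
pose phi k := Ex P (fun w => runmax k w ^+ 2 - 2 * (runmax k w * V k w)).
pose s k := Ex P (fun w => runmax k w ^+ 2).
(* From [(S - 2 V)^2 >= 0]: the second moment of the maximum is controlled by [phi] and by the
   moment of [V] already bounded. *)
have sphi k : (k <= N)%N -> s k <= 2 * (phi k + 2 * M).
  move=> kN; have L1 := LG_of HN kN (LG_runmax kN); have L2 := LG_of HN kN (LV kN).
  have H := second_moment kN.
  have Lp : LG P measurable (fun w => runmax k w ^+ 2 - 2 * (runmax k w * V k w)) by lgt.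
  have LV2 : LG P measurable (fun w => V k w ^+ 2) by lgt.
  apply: (@le_trans _ _ (Ex P (fun w => 2 * (runmax k w ^+ 2 - 2 * (runmax k w * V k w)) + 4 * V k w ^+ 2))).
    apply: (Ex_le sF); [by lgt|by lgt|move=> w].
    by have := sqr_ge0 (runmax k w - 2 * V k w); lra.
  rewrite (ExD sF); [|by lgt|by lgt].
  rewrite (ExZ sF _ Lp) (ExZ sF _ LV2) -[Ex P (fun w => runmax k w ^+ 2 - _)]/(phi k).
  by rewrite mulrDr mulrA lerD2l (_ : 2 * 2 = 4 :> R) ?ler_wpM2l//; lra.
pose g := gconst r mu.
have g1 : 1 <= g := gconst_ge1 r mu.
have step k : (k < N)%N -> phi k.+1 + 2 * M <= (1 + h * (4 * c * g)) * (phi k + 2 * M) + 0.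
  move=> kN; have L0 := LG_runmax (ltnW kN).
  have L1 := LG_of HN (ltnW kN) L0; have L2 := LG_of HN (ltnW kN) (LV (ltnW kN)).
  have L1' := LG_of HN kN (LG_runmax kN); have L2' := LG_of HN kN (LV kN).
  have Lg := LG_of HN kN (LG_gsum HN kN (fun j => Ll j kN)).
  have Le := LG_of HN kN (LG_nexp HN kN mu0).
  have Lrg : LG P measurable (fun w => runmax k w * gsum beta (l k) k w) by lgt.
  have LR2 : LG P (G k) (fun w => runmax k w ^+ 2) by apply: LGX => //; exact: (noise_sub HN (ltnW kN)).
  have LR2' := LG_of HN (ltnW kN) LR2.
  have LRe : LG P measurable (fun w => runmax k w ^+ 2 * nexp h mu (beta k) w) by lgt.
  have H : phi k.+1 <= phi k + 2 * c * h * (g * s k).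
    apply: (@le_trans _ _ (Ex P (fun w => (runmax k w ^+ 2 - 2 * (runmax k w * V k w)) +
       (-2 * (runmax k w * gsum beta (l k) k w) + 2 * c * h * (runmax k w ^+ 2 * nexp h mu (beta k) w))))).
      apply: (Ex_le sF); [by lgt|by lgt|move=> w].
      have rV : V k w <= runmax k w by exact: runmax_ge.
      have V0' := Vge0 k w; have qb := rB w kN; have vs := VS w kN.
      rewrite /=; set S := runmax k w; set x := V k w in rV V0' qb vs *.
      set gg := gsum _ _ _ _ in vs *; set e := nexp _ _ _ _ in qb *; set q := rem k w in qb vs.
      set y := V k.+1 w in vs *.
      have e0 : 0 <= e by exact: nexp_ge0.
      have S0 : 0 <= S by exact: le_trans V0' rV.
      have B : - (S * q) <= c * h * (S ^+ 2 * e).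
        apply: (@le_trans _ _ (S * (c * h * e * S))); last by rewrite le_eqVlt; apply/orP; left; apply/eqP; ring.
        rewrite -mulrN ler_wpM2l//; apply: (@le_trans _ _ `|q|).
          by rewrite -normrN ler_norm.
        apply: le_trans qb _; rewrite ler_wpM2l// !mulr_ge0// ltW//.
      (* When the maximum is renewed this is [(S - y)^2 >= 0]; otherwise it is an equality. *)
      have A : Num.max S y ^+ 2 - 2 * (Num.max S y * y) <= S ^+ 2 - 2 * (S * x) - 2 * (S * (y - x)).
        by case: (leP S y) => _; [have := sqr_ge0 (S - y); lra|lra].
      apply: (le_trans A); rewrite vs (_ : x + gg + q - x = gg + q); last by ring.
      rewrite -subr_ge0.
      by rewrite (_ : _ - _ = 2 * (c * h * (S ^+ 2 * e) - - (S * q))) ?mulr_ge0 ?subr_ge0//; ring.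
    have Lp : LG P measurable (fun w => runmax k w ^+ 2 - 2 * (runmax k w * V k w)) by lgt.
    rewrite (ExD sF Lp); last by lgt.
    rewrite lerD2l (ExD sF); [|by lgt|by lgt].
    rewrite (ExZ sF _ Lrg) (ExZ sF _ LRe) (Ex_gsum HN kN L0 (fun j => Ll j kN)) mulr0 add0r.
    apply: ler_wpM2l; first by rewrite !mulr_ge0// ltW.
    exact: (Ex_nexp HN kN mu0 LR2 (fun w => sqr_ge0 _)).
  rewrite addr0; have hs := sphi k (ltnW kN).
  have : 2 * c * h * (g * s k) <= 2 * c * h * (g * (2 * (phi k + 2 * M))).
    apply: ler_wpM2l; first by rewrite !mulr_ge0// ltW.
    by apply: ler_wpM2l => //; lra.
  move: H; set A := 2 * c * h * (g * s k) => H1 H2.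
  have -> : (1 + h * (4 * c * g)) * (phi k + 2 * M) = phi k + 2 * M + 2 * c * h * (g * (2 * (phi k + 2 * M))) by ring.
  lra.
have phi0 : phi 0%N = - v0 ^+ 2.
  rewrite /phi (_ : (fun w => _) = fun=> - v0 ^+ 2) ?Ex_cst//.
  by apply/funext => w /=; rewrite V0; ring.
have s00 : 0 <= s 0%N by apply: Ex_ge0 => w; exact: sqr_ge0.
have p0 : 0 <= phi 0%N + 2 * M by have := sphi 0%N (leq0n _); lra.
have hc0 : 0 <= h * (4 * c * g) by rewrite !mulr_ge0//; [exact: ltW|lra].
have := @gronwall_le R (fun k => phi k + 2 * M) _ _ N hc0 (lexx 0) p0 step N (leqnn _).
rewrite mulr0 addr0 => H; apply: le_trans (sphi _ (leqnn _)) _.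
have pM : phi 0%N + 2 * M <= 2 * M by rewrite phi0; have := sqr_ge0 v0; lra.
have -> : 4 * M * expR (T * (4 * c * gconst r mu)) = 2 * (2 * M * expR (T * (4 * c * g))) by rewrite -/g; ring.
apply: ler_wpM2l => //; apply: le_trans H _; apply: (ler_pM p0 (expR_ge0 _) pM).
rewrite ler_expR mulrA ler_wpM2r// !mulr_ge0//; lra.
Qed.

End ScalarRecursion.

Lemma pow4_add_le {R : realType} (a d : R) : (a + d) ^+ 4 <= 8 * a ^+ 4 + 8 * d ^+ 4.
Proof.
have A : (a + d) ^+ 2 <= 2 * (a ^+ 2 + d ^+ 2) by have := sqr_ge0 (a - d); lra.
have B : ((a + d) ^+ 2) ^+ 2 <= (2 * (a ^+ 2 + d ^+ 2)) ^+ 2.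
  by apply: lerXn2r; rewrite ?nnegrE ?sqr_ge0// mulr_ge0// addr_ge0 ?sqr_ge0.
have := sqr_ge0 (a ^+ 2 - d ^+ 2); lra.
Qed.

(** * Fourth moments of the polygonal solutions *)

Section OdeMoments.
Context {R : realType} {disp : measure_display} {Omega : measurableType disp} {v r : nat}.
Variables (b : 'cV[R]_v -> 'cV[R]_v) (sigma : 'cV[R]_v -> 'M[R]_(v, r)).

Definition step_bounds (T C lam : R) := forall a delta beta x, 0 < delta -> delta <= T ->
  ode_piece b sigma a delta beta x ->
  let E := expR (lam * (`|beta| / Num.sqrt delta)) in let X := 1 + `|x a| in
  [/\ forall t, a <= t <= a + delta ->
        1 + `|x t| <= C * E * X /\ `|x t - x a| <= C * Num.sqrt delta * E * X,
      forall i, `|x (a + delta) i 0 - x a i 0 - \sum_(j < r) sigma (x a) i j * beta j 0|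
        <= C * delta * E * X &
      forall i, `|x (a + delta) i 0 - x a i 0 - b (x a) i 0 * delta
        - \sum_(j < r) sigma (x a) i j * beta j 0
        - 2^-1 * \sum_(j < r) \sum_(m < r) drift_rate sigma i j m (x a) * (beta j 0 * beta m 0)|
        <= C * (delta * Num.sqrt delta) * E * X ^+ 2].

Variables (P : probability Omega R) (K T C lam : R) (x0 : 'cV[R]_v).
Hypotheses (cb : coefficient_bounds b sigma K) (C1 : 1 <= C) (lam0 : 0 <= lam)
  (HC : step_bounds T C lam).
Variables (N : nat) (h : R) (G : nat -> set (set Omega)) (beta : nat -> Omega -> 'cV[R]_r)
  (x : Omega -> R -> 'cV[R]_v).
Hypotheses (HN : noise P N h G beta) (h0 : 0 < h) (hT : N%:R * h = T) (hT1 : h <= T)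
  (xstart : forall w, x w 0 = x0)
  (xpiece : forall k w, (k < N)%N -> ode_piece b sigma (k%:R * h) h (beta k w) (x w)).

Let sF := @sub_sigma_full disp Omega.

Definition gval k w := x w (k%:R * h).

Lemma gridS k : k.+1%:R * h = k%:R * h + h :> R.
Proof. by rewrite -natr1 mulrDl mul1r. Qed.

Lemma gmeas_gval k i : (k <= N)%N -> gmeas (G k) (fun w => gval k w i 0).
Proof.
elim: k i => [|k IH] i kN.
  rewrite /gval (_ : (fun w => _) = fun=> x0 i 0); first exact: measurable_cst.
  by apply/funext => w; rewrite mul0r xstart.
rewrite /gval gridS; apply: (@measurable_ode_step R v r b sigma _ (g_sigma_algebraType (G k.+1)) K _ _
  (gval k) (beta k) x cb h0) => //.
- move=> l; apply: (gmeas_sub (noise_sub HN (ltnW kN)) (noise_sub HN kN) (noise_mono HN kN)).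
  exact: IH (ltnW kN).
- by move=> j; exact: (noise_meas HN).
- by move=> w; exact: xpiece.
Qed.

Lemma piece_bounds k w : (k < N)%N ->
  let E := nexp h lam (beta k) w in let X := 1 + `|gval k w| in
  [/\ forall t, k%:R * h <= t <= k.+1%:R * h ->
        1 + `|x w t| <= C * E * X /\ `|x w t - gval k w| <= C * Num.sqrt h * E * X,
      forall i, `|gval k.+1 w i 0 - gval k w i 0 - \sum_(j < r) sigma (gval k w) i j * beta k w j 0|
        <= C * h * E * X &
      forall i, `|gval k.+1 w i 0 - gval k w i 0 - b (gval k w) i 0 * h
        - \sum_(j < r) sigma (gval k w) i j * beta k w j 0
        - 2^-1 * \sum_(j < r) \sum_(m < r) drift_rate sigma i j m (gval k w) * (beta k w j 0 * beta k w m 0)|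
        <= C * (h * Num.sqrt h) * E * X ^+ 2].
Proof. by move=> kN; rewrite /gval gridS; exact: (HC h0 hT1 (xpiece w kN)). Qed.

(** Only finiteness of the moments is obtained here, with constants that deteriorate from step to
    step; it licenses the algebra of expectations from which the uniform bounds follow. *)
Lemma LG_gnorm k : (k <= N)%N -> LG P (G k) (fun w => 1 + `|gval k w|).
Proof.
elim: k => [|k IH] kN.
  rewrite /gval (_ : (fun w => _) = fun=> 1 + `|x0|); first exact: LG_cst.
  by apply/funext => w; rewrite mul0r xstart.
have sk := noise_sub HN kN; have L0 := LG_lift HN (leqnSn k) kN (IH (ltnW kN)).
have Le := LG_nexp HN kN lam0.
apply: (LG_dom sk (g := fun w => C * nexp h lam (beta k) w * (1 + `|gval k w|))); last 2 first.
- by lgt.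
- move=> w; have [/(_ (k.+1%:R * h)) + _ _] := piece_bounds w kN.
  rewrite lexx gridS lerDl (ltW h0) => /(_ isT)[H _].
  rewrite ger0_norm ?addr_ge0// /gval gridS; exact: le_trans H (ler_norm _).
apply: measurable_funD => //; apply: measurable_colnorm => i; exact: gmeas_gval.
Qed.

Lemma LG_gval k i : (k <= N)%N -> LG P (G k) (fun w => gval k w i 0).
Proof.
move=> kN; apply: (LG_dom (noise_sub HN kN) (gmeas_gval i kN) (LG_gnorm kN)) => w.
rewrite [leRHS]ger0_norm ?addr_ge0//; apply: le_trans (colnorm_ge _ _) _.
by rewrite lerDr.
Qed.

Lemma LG_coef (f : 'cV[R]_v -> R) c k : continuous f -> (forall y, `|f y| <= c * (1 + `|y|)) ->
  (k <= N)%N -> LG P (G k) (fun w => f (gval k w)).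
Proof.
move=> cf fc kN; have sk := noise_sub HN kN; have L0 := LG_gnorm kN.
apply: (LG_dom sk (g := fun w => c * (1 + `|gval k w|))); last 2 first.
- by lgt.
- by move=> w; apply: le_trans (fc _) (ler_norm _).
by apply: measurable_comp_col => // i; exact: gmeas_gval.
Qed.

Lemma LG_sigma k i j : (k <= N)%N -> LG P (G k) (fun w => sigma (gval k w) i j).
Proof.
apply: (LG_coef (f := fun y => sigma y i j) (c := K)).
  exact: lipschitz_continuous (cb_s_lip cb i j).
by move=> y; exact: (cb_s_growth cb).
Qed.

(** A polynomial substitute for the squared norm, to which the scalar recursion applies. Its second
    moment controls the fourth moment of the solution. *)
Definition energy k w : R := 1 + \sum_i gval k w i 0 ^+ 2.

Definition energy_grad k (j : 'I_r) w : R := \sum_i 2 * gval k w i 0 * sigma (gval k w) i j.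

Lemma energy_ge1 k w : 1 <= energy k w.
Proof. by rewrite lerDl sumr_ge0// => i _; rewrite sqr_ge0. Qed.

Lemma gnorm_energy k w : (1 + `|gval k w|) ^+ 2 <= 2 * energy k w.
Proof. by have := colnorm_sqr_le (gval k w); have := sqr_ge0 (1 - `|gval k w|); rewrite /energy; lra. Qed.

Lemma LG_energy k : (k <= N)%N -> LG P (G k) (energy k).
Proof.
move=> kN; have sk := noise_sub HN kN; apply: LGD => //; first exact: LG_cst.
by apply: LG_sum => // i _; apply: LGX => //; exact: LG_gval.
Qed.

Lemma LG_energy_grad k j : (k <= N)%N -> LG P (G k) (energy_grad k j).
Proof.
move=> kN; have sk := noise_sub HN kN; apply: LG_sum => // i _.
have L1 := LG_gval i kN; have L2 := LG_sigma i j kN; lgt.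
Qed.

Definition energy_rate : R := 2 * v%:R * (2 * C + C ^+ 2) + 4 * v%:R * C * (1 + Num.sqrt T).

Let c := energy_rate.

Lemma energy_rate_ge0 : 0 <= c.
Proof.
have C0 : 0 <= C := le_trans ler01 C1.
apply: addr_ge0; apply: mulr_ge0 => //.
- by rewrite addr_ge0 ?mulr_ge0// sqr_ge0.
- by rewrite !mulr_ge0.
Qed.

Definition energy_rem k w : R := energy k.+1 w - energy k w - gsum beta (energy_grad k) k w.

Lemma gsum_energy_grad k w : gsum beta (energy_grad k) k w =
  \sum_i 2 * gval k w i 0 * \sum_(j < r) sigma (gval k w) i j * beta k w j 0.
Proof.
rewrite /gsum /energy_grad; under eq_bigr do rewrite mulr_suml.
rewrite exchange_big /=; apply: eq_bigr => i _; rewrite mulr_sumr.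
by apply: eq_bigr => j _; rewrite mulrA.
Qed.

Lemma sum_const_le (a : 'I_v -> R) q : (forall i, `|a i| <= q) -> `|\sum_i a i| <= v%:R * q.
Proof.
move=> aq; apply: le_trans (ler_norm_sum _ _ _) _.
by rewrite -[v in v%:R]card_ord -sumr_const mulr_suml ler_sum// => i _; rewrite mul1r.
Qed.

(** Once [gsum] is removed, the increment of the squares is a sum of terms [2 Y (D - S) + D^2], with
    [D] the increment of the solution and [S] its noise part. Both are of order [h] with growth
    quadratic in the state, hence proportional to the energy. *)
Lemma energy_step_bounds k w : (k < N)%N ->
  `|gsum beta (energy_grad k) k w| <= c * Num.sqrt h * nexp h (2 * lam) (beta k) w * energy k w /\
  `|energy_rem k w| <= c * h * nexp h (2 * lam) (beta k) w * energy k w.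
Proof.
move=> kN; have [/(_ (k.+1%:R * h)) + H2 _] := piece_bounds w kN.
rewrite lexx gridS lerDl (ltW h0) => /(_ isT)[_ H1]; move: H1 H2.
have -> : nexp h (2 * lam) (beta k) w = nexp h lam (beta k) w ^+ 2 by rewrite nexpX.
have E1 : 1 <= nexp h lam (beta k) w.
  by rewrite /nexp -[leLHS]expR0 ler_expR mulr_ge0// divr_ge0.
set E := nexp _ _ _ _ in E1 *.
have -> : x w (k%:R * h + h) = gval k.+1 w by rewrite /gval gridS.
have XV := gnorm_energy k w; set V := energy k w in XV *.
set X := 1 + `|gval k w| in XV *; set s := Num.sqrt h => H1 H2.
have s0 : 0 <= s by exact: sqrtr_ge0.
have sh : s ^+ 2 = h by rewrite sqr_sqrtr// ltW.
have sT : s <= Num.sqrt T by rewrite ler_sqrt// (le_trans (ltW h0)).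
have C0 : 0 <= C := le_trans ler01 C1.
have X1 : 1 <= X by rewrite lerDl.
pose S i := \sum_(j < r) sigma (gval k w) i j * beta k w j 0.
pose D i := gval k.+1 w i 0 - gval k w i 0.
have Yb i : `|gval k w i 0| <= X by apply: le_trans (colnorm_ge _ _) _; rewrite lerDr.
have Db i : `|D i| <= C * s * E * X.
  by apply: le_trans H1; have := colnorm_ge (gval k.+1 w - gval k w) i; rewrite !mxE.
have Rb i : `|D i - S i| <= C * h * E * X by exact: H2.
have E0 : 0 <= E by lra.
have EE : E <= E ^+ 2 by rewrite expr2 ler_peMr.
have X0 : 0 <= X by lra.
have T1 : 0 <= E ^+ 2 * X ^+ 2 by rewrite mulr_ge0 ?sqr_ge0.
have Sb i : `|S i| <= C * (1 + Num.sqrt T) * s * E * X.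
  have -> : S i = D i - (D i - S i) by ring.
  apply: le_trans (ler_normB _ _) _.
  rewrite (_ : _ * X = C * s * E * X + C * (s * Num.sqrt T) * E * X); last by ring.
  apply: lerD => //; apply: le_trans (Rb i) _.
  do 2! (apply: ler_wpM2r => //); apply: ler_wpM2l => //.
  by rewrite -sh expr2 ler_wpM2l.
have XVE a : 0 <= a -> a * E ^+ 2 * X ^+ 2 <= 2 * a * E ^+ 2 * V.
  move=> a0; rewrite (_ : 2 * a * _ * _ = a * E ^+ 2 * (2 * V)); last by ring.
  by rewrite ler_wpM2l// mulr_ge0 ?sqr_ge0.
have EX a : 0 <= a -> a * E * X ^+ 2 <= a * E ^+ 2 * X ^+ 2.
  by move=> a0; apply: ler_wpM2r; [exact: sqr_ge0|exact: ler_wpM2l].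
have sT1 : 0 <= 1 + Num.sqrt T by rewrite addr_ge0 ?sqrtr_ge0.
split.
  rewrite gsum_energy_grad; apply: (@le_trans _ _ (v%:R * (2 * X * (C * (1 + Num.sqrt T) * s * E * X)))).
    apply: sum_const_le => i; rewrite normrM normrM (@ger0_norm _ 2)//.
    apply: ler_pM; [|exact: normr_ge0| |exact: Sb].
      exact: mulr_ge0.
    by rewrite ler_pM2l.
  pose a : R := 2 * v%:R * C * (1 + Num.sqrt T) * s.
  have a0 : 0 <= a by rewrite /a; do 4! (apply: mulr_ge0 => //).
  rewrite [leLHS](_ : _ = a * E * X ^+ 2); last by rewrite /a; ring.
  apply: (le_trans (EX _ a0)); apply: (le_trans (XVE _ a0)).
  apply: ler_wpM2r; first by have := energy_ge1 k w; rewrite -/V; lra.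
  apply: ler_wpM2r; first exact: sqr_ge0.
  rewrite /c /energy_rate [leRHS]mulrDl (_ : 2 * a = 4 * v%:R * C * (1 + Num.sqrt T) * s); last by rewrite /a; ring.
  rewrite lerDr; apply: mulr_ge0 => //; apply: mulr_ge0; first exact: mulr_ge0.
  by rewrite addr_ge0 ?mulr_ge0// sqr_ge0.
have -> : energy_rem k w = \sum_i (2 * gval k w i 0 * (D i - S i) + D i ^+ 2).
  rewrite /energy_rem gsum_energy_grad /energy opprD addrACA subrr add0r -!sumrB.
  by apply: eq_bigr => i _; rewrite -/(S i) /D; ring.
apply: (@le_trans _ _ (v%:R * (2 * X * (C * h * E * X) + (C * s * E * X) ^+ 2))).
  apply: sum_const_le => i; apply: le_trans (ler_normD _ _) _; apply: lerD.
    rewrite normrM normrM (@ger0_norm _ 2)//; apply: ler_pM; [|exact: normr_ge0| |exact: Rb].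
      exact: mulr_ge0.
    by rewrite ler_pM2l.
  by rewrite normrX; apply: lerXn2r; rewrite ?nnegrE ?(le_trans _ (Db i)).
pose a : R := v%:R * (2 * C + C ^+ 2) * h.
have a0 : 0 <= a.
  by rewrite /a; apply: mulr_ge0; [apply: mulr_ge0 => //; rewrite addr_ge0 ?mulr_ge0 ?sqr_ge0|exact: ltW].
have a10 : 0 <= v%:R * (2 * C) * h by apply: mulr_ge0; [rewrite !mulr_ge0|exact: ltW].
apply: (@le_trans _ _ (a * E ^+ 2 * X ^+ 2)).
  have := EX _ a10; rewrite /a -sh => H; rewrite -subr_ge0 in H; rewrite -subr_ge0.
  by apply: le_trans H _; rewrite le_eqVlt; apply/orP; left; apply/eqP; ring.
apply: (le_trans (XVE _ a0)).
apply: ler_wpM2r; first by have := energy_ge1 k w; rewrite -/V; lra.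
apply: ler_wpM2r; first exact: sqr_ge0.
rewrite /c /energy_rate [leRHS]mulrDl (_ : 2 * a = 2 * v%:R * (2 * C + C ^+ 2) * h); last by rewrite /a; ring.
rewrite lerDl; apply: mulr_ge0; last exact: ltW.
by apply: mulr_ge0 => //; rewrite !mulr_ge0.
Qed.

Let v00 : R := 1 + \sum_i x0 i 0 ^+ 2.
Let M2 := v00 ^+ 2 * expR (T * rec_rate r T c (2 * lam)).

(** The first term covers the grid points, the second the displacements inside cells, through
    [(a + d)^4 <= 8 a^4 + 8 d^4]; the factor 32 is this 8 times 4, from
    [(1 + |Y|)^2 <= 2 energy]. *)
Definition ode_dominator w : R := 32 * runmax energy N w ^+ 2 +
  8 * \sum_(k < N) 4 * C ^+ 4 * h ^+ 2 * (energy k w ^+ 2 * nexp h (4 * lam) (beta k) w).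
(** A sum over cells stands in for a maximum. The loss of a factor [N] is affordable at the fourth
    power: [N] terms of order [h^2] have a mean of order [h]. *)
Definition ode_modulus w : R :=
  \sum_(k < N) 4 * C ^+ 4 * h ^+ 2 * (energy k w ^+ 2 * nexp h (4 * lam) (beta k) w).

Definition modulus_rate := 4 * C ^+ 4 * T * (gconst r (4 * lam) * M2).
Definition dominator_bound :=
  32 * (4 * M2 * expR (T * (4 * c * gconst r (2 * lam)))) + 8 * modulus_rate * T.

Lemma T_gt0' : 0 < T. Proof. exact: lt_le_trans h0 hT1. Qed.

Lemma energy0 w : energy 0 w = v00.
Proof. by rewrite /energy /gval mul0r xstart. Qed.

Lemma energyS k w : energy k.+1 w = energy k w + gsum beta (energy_grad k) k w + energy_rem k w.
Proof. by rewrite /energy_rem; ring. Qed.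

Lemma LG_energy_rem k : (k < N)%N -> LG P (G k.+1) (energy_rem k).
Proof.
move=> kN; have sk := noise_sub HN kN; have L1 := LG_energy kN.
have L2 := LG_lift HN (leqnSn k) kN (LG_energy (ltnW kN)).
have L3 := LG_gsum HN kN (fun j => LG_energy_grad j (ltnW kN)).
by rewrite /energy_rem; lgt.
Qed.

Let lam20 : 0 <= 2 * lam. Proof. exact: mulr_ge0. Qed.
Let lam40 : 0 <= 4 * lam. Proof. exact: mulr_ge0. Qed.
Let energy_ge0 k w : 0 <= energy k w := le_trans ler01 (energy_ge1 k w).

Lemma ode_second_moment k : (k <= N)%N -> Ex P (fun w => energy k w ^+ 2) <= M2.
Proof.
move=> kN; apply: (second_moment HN h0 _ hT1 energy_rate_ge0 lam20 energy0
  energy_ge0 LG_energy (fun k j kN => LG_energy_grad j (ltnW kN)) LG_energy_rem _ _ _ kN) => //.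
- by rewrite hT.
- by move=> ? ? _; exact: energyS.
- by move=> ? ? ?; exact: (energy_step_bounds _ _).1.
- by move=> ? ? ?; exact: (energy_step_bounds _ _).2.
Qed.

Lemma ode_maximal : Ex P (fun w => runmax energy N w ^+ 2) <=
  4 * M2 * expR (T * (4 * c * gconst r (2 * lam))).
Proof.
apply: (maximal_second_moment HN h0 _ hT1 energy_rate_ge0 lam20 energy0
  energy_ge0 LG_energy (fun k j kN => LG_energy_grad j (ltnW kN)) LG_energy_rem) => //.
- by rewrite hT.
- by move=> ? ? _; exact: energyS.
- by move=> ? ? ?; exact: (energy_step_bounds _ _).1.
- by move=> ? ? ?; exact: (energy_step_bounds _ _).2.
Qed.

Let C0 : 0 <= C := le_trans ler01 C1.

Lemma modulus_coef_ge0 : 0 <= 4 * C ^+ 4 * h ^+ 2.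
Proof. by apply: mulr_ge0; [apply: mulr_ge0 => //; exact: exprn_ge0|exact: sqr_ge0]. Qed.

Lemma LG_modulus_term k : (k < N)%N ->
  LG P measurable (fun w => energy k w ^+ 2 * nexp h (4 * lam) (beta k) w).
Proof.
move=> kN; have L1 := LG_of HN (ltnW kN) (LG_energy (ltnW kN)).
have L2 := LG_of HN kN (LG_nexp HN kN lam40); lgt.
Qed.

Lemma LG_modulus : LG P measurable ode_modulus.
Proof.
apply: LG_sum => // k _; have L1 := LG_modulus_term (ltn_ord k).
exact: LGZ L1.
Qed.

Lemma LG_dominator : LG P measurable ode_dominator.
Proof.
have L1 := LG_modulus; have L2 := LG_of HN (leqnn _) (LG_runmax HN LG_energy (leqnn N)).
change (LG P measurable (fun w => 32 * runmax energy N w ^+ 2 + 8 * ode_modulus w)); lgt.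
Qed.

Lemma M2_ge0 : 0 <= M2.
Proof. by rewrite mulr_ge0 ?sqr_ge0 ?expR_ge0. Qed.

Lemma Ex_modulus : Ex P ode_modulus <= modulus_rate * h.
Proof.
rewrite (Ex_sum sF); last by move=> k _; apply: (LGZ _ sF); exact: LG_modulus_term.
have A0 := modulus_coef_ge0.
apply: (@le_trans _ _ (\sum_(k < N) 4 * C ^+ 4 * h ^+ 2 * (gconst r (4 * lam) * M2))).
  apply: ler_sum => k _; rewrite (ExZ sF _ (LG_modulus_term (ltn_ord k))) ler_wpM2l//.
  have kN := ltn_ord k; have sk := noise_sub HN (ltnW kN).
  have L1 := LG_energy (ltnW kN).
  have L2 : LG P (G k) (fun w => energy k w ^+ 2) by lgt.
  apply: le_trans (Ex_nexp HN kN lam40 L2 (fun w => sqr_ge0 _)) _.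
  apply: ler_wpM2l; first by have := gconst_ge1 r (4 * lam); lra.
  exact: ode_second_moment (ltnW kN).
rewrite sumr_const card_ord -[leLHS]mulr_natl /modulus_rate -hT le_eqVlt; apply/orP; left; apply/eqP; ring.
Qed.

Lemma modulus_rate_ge0 : 0 <= modulus_rate.
Proof.
have := T_gt0'; have := M2_ge0; have := gconst_ge1 r (4 * lam) => *.
rewrite /modulus_rate; apply: mulr_ge0; first by rewrite !mulr_ge0 ?exprn_ge0// ltW.
by apply: mulr_ge0 => //; lra.
Qed.

Lemma Ex_dominator : Ex P ode_dominator <= dominator_bound.
Proof.
have L1 := LG_modulus; have L2 := LG_of HN (leqnn _) (LG_runmax HN LG_energy (leqnn N)).
rewrite [leLHS](_ : _ = Ex P (fun w => 32 * runmax energy N w ^+ 2 + 8 * ode_modulus w))//.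
have L3 : LG P measurable (fun w => runmax energy N w ^+ 2) by lgt.
rewrite (ExD sF); [|by lgt|by lgt].
rewrite (ExZ sF _ L3) (ExZ sF _ L1); apply: lerD.
  by rewrite ler_pM2l//; exact: ode_maximal.
rewrite -mulrA ler_pM2l//; apply: le_trans Ex_modulus _.
by apply: ler_wpM2l => //; exact: modulus_rate_ge0.
Qed.

Lemma modulus_ge0 w k : 0 <= 4 * C ^+ 4 * h ^+ 2 * (energy k w ^+ 2 * nexp h (4 * lam) (beta k) w).
Proof.
apply: mulr_ge0; first exact: modulus_coef_ge0.
by rewrite mulr_ge0 ?sqr_ge0// nexp_ge0.
Qed.

Lemma ode_modulus_le k t w : (k < N)%N -> k%:R * h <= t <= k.+1%:R * h ->
  `|x w t - gval k w| ^+ 4 <= ode_modulus w.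
Proof.
move=> kN kt; have [/(_ t kt)[_ H] _ _] := piece_bounds w kN.
rewrite /ode_modulus (bigD1 (Ordinal kN))//=.
apply: le_trans (_ : _ <= 4 * C ^+ 4 * h ^+ 2 * (energy k w ^+ 2 * nexp h (4 * lam) (beta k) w)) _; last first.
  by rewrite lerDl sumr_ge0// => i _; exact: modulus_ge0.
have -> : nexp h (4 * lam) (beta k) w = nexp h lam (beta k) w ^+ 4 by rewrite nexpX.
have E0 := nexp_ge0 h beta k lam w; set E := nexp _ _ _ _ in H E0 *.
have s0 := sqrtr_ge0 h; set s := Num.sqrt h in H s0.
have X0 : 0 <= 1 + `|gval k w| by exact: addr_ge0.
have XV := gnorm_energy k w; set X := 1 + `|gval k w| in H X0 XV.
apply: (@le_trans _ _ ((C * s * E * X) ^+ 4)).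
  by apply: lerXn2r => //; rewrite nnegrE ?(le_trans _ H).
have -> : (C * s * E * X) ^+ 4 = C ^+ 4 * (s ^+ 2) ^+ 2 * E ^+ 4 * (X ^+ 2) ^+ 2 by ring.
rewrite sqr_sqrtr ?(ltW h0)//.
have -> : 4 * C ^+ 4 * h ^+ 2 * (energy k w ^+ 2 * E ^+ 4) = C ^+ 4 * h ^+ 2 * E ^+ 4 * (2 * energy k w) ^+ 2 by ring.
apply: ler_wpM2l; first by do 2! (apply: mulr_ge0; last exact: exprn_ge0 || exact: sqr_ge0); exact: exprn_ge0.
by apply: lerXn2r => //; rewrite nnegrE ?sqr_ge0// mulr_ge0.
Qed.

Lemma grid_cell t : 0 <= t <= T -> exists2 k, (k < N)%N & k%:R * h <= t <= k.+1%:R * h.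
Proof.
have N0 : (0 < N)%N by rewrite lt0n; apply/eqP => N0; have := T_gt0'; rewrite -hT N0 mul0r ltxx.
rewrite -hT => /andP[t0]; elim: (N) N0 => [//|n IH _] tn.
have [nt|nt] := ltP (n%:R * h) t; first by exists n => //; rewrite (ltW nt).
case: n IH tn nt => [|n] IH tn nt; first by exists 0%N => //; rewrite mul0r t0.
by have [k kn kt] := IH isT nt; exists k => //; exact: ltnW.
Qed.

Lemma ode_dominator_le t w : 0 <= t <= T -> (1 + `|x w t|) ^+ 4 <= ode_dominator w.
Proof.
move=> /grid_cell[k kN kt]; have H := ode_modulus_le w kN kt.
have XV := gnorm_energy k w.
have VS := runmax_ge energy w (ltnW kN); have V0 := energy_ge0 k w.
have a0 : 0 <= 1 + `|gval k w| by rewrite addr_ge0.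
have d0 := normr_ge0 (x w t - gval k w).
apply: (@le_trans _ _ ((1 + `|gval k w| + `|x w t - gval k w|) ^+ 4)).
  apply: lerXn2r; rewrite ?nnegrE ?addr_ge0//.
  by rewrite -addrA lerD2l -[in leLHS](subrK (gval k w) (x w t)) addrC ler_normD.
apply: le_trans (pow4_add_le _ _) _; rewrite /ode_dominator -/(ode_modulus w); apply: lerD; last by rewrite ler_pM2l.
have -> : 32 * runmax energy N w ^+ 2 = 8 * (2 * runmax energy N w) ^+ 2 by ring.
rewrite ler_pM2l// (_ : _ ^+ 4 = ((1 + `|gval k w|) ^+ 2) ^+ 2); last by ring.
apply: lerXn2r; rewrite ?nnegrE ?sqr_ge0//.
  by rewrite mulr_ge0// (le_trans V0).
by apply: le_trans XV _; rewrite ler_pM2l.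
Qed.

End OdeMoments.

(** * Outer probability and convergence in probability *)

Section OuterProbability.
Context {R : realType} {disp : measure_display} {Omega : measurableType disp}.
Variable P : probability Omega R.
Implicit Types (Q : set Omega) (e a : R).

(* Upper bound on the outer probability: the events below need not be measurable. *)
Definition pr_le Q e := exists E, [/\ measurable E, Q `<=` E & (P E <= e%:E)%E].

Lemma pr_le_sub Q Q' e e' : Q `<=` Q' -> e' <= e -> pr_le Q' e' -> pr_le Q e.
Proof.
move=> QQ ee [E [mE QE PE]]; exists E; split => //; first exact: subset_trans QE.
by apply: le_trans PE _; rewrite lee_fin.
Qed.

Lemma pr_leU Q Q' e e' : pr_le Q e -> pr_le Q' e' -> pr_le (Q `|` Q') (e + e').
Proof.
move=> [E [mE QE PE]] [E' [mE' QE' PE']]; exists (E `|` E'); split.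
- exact: measurableU.
- by move=> w [/QE|/QE']; [left|right].
- by apply: le_trans (measureU2 _ _ _) _ => //; rewrite EFinD leeD.
Qed.

Lemma pr_le_cover Q Q1 Q2 e : Q `<=` Q1 `|` Q2 -> pr_le Q1 (e / 2) -> pr_le Q2 (e / 2) -> pr_le Q e.
Proof.
move=> QQ H1 H2; apply: pr_le_sub QQ _ (pr_leU H1 H2).
by rewrite -splitr.
Qed.

Lemma pr_le_ae Q e : 0 <= e -> {ae P, forall w, ~ Q w} -> pr_le Q e.
Proof.
move=> e0 [E [mE PE QE]]; exists E; split => //; last by rewrite PE lee_fin.
by move=> w Qw; apply: QE => /= H; exact: H Qw.
Qed.

Lemma pr_le_sub_ae Q Q' e : {ae P, forall w, Q w -> Q' w} -> pr_le Q' e -> pr_le Q e.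
Proof.
move=> QQ' H; have N0 : {ae P, forall w, ~ (Q w /\ ~ Q' w)}.
  by apply: filterS QQ' => w QQ' [] /QQ'.
have := pr_leU H (pr_le_ae (lexx 0) N0); rewrite addr0; apply: pr_le_sub => // w Qw.
by have [Q'w|] := pselect (Q' w); [left|right].
Qed.

Lemma pr_le_measurable Q e : measurable Q -> (P Q <= e%:E)%E -> pr_le Q e.
Proof. by move=> mQ PQ; exists Q; split. Qed.

Lemma pr_le_bigcup n (Q : nat -> set Omega) e : (forall k, (k < n)%N -> pr_le (Q k) e) ->
  pr_le [set w | exists2 k, (k < n)%N & Q k w] (n%:R * e).
Proof.
elim: n => [|n IH] H.
  exists set0; split => //; first by move=> w [].
  by rewrite measure0 lee_fin mul0r.
rewrite -natr1 mulrDl mul1r.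
apply: (pr_le_sub _ (lexx _) (pr_leU (IH (fun k kn => H k (ltnW kn))) (H n (ltnSn n)))).
move=> w [k kn Qk]; move: kn; rewrite ltnS leq_eqVlt => /predU1P[kn|kn]; last by left; exists k.
by right; rewrite -kn.
Qed.

Lemma pr_le_markov_integral (f : Omega -> R) c a : measurable_fun setT f -> (forall w, 0 <= f w) ->
  (\int[P]_w (f w)%:E <= c%:E)%E -> 0 < a -> pr_le [set w | a <= f w] (c / a).
Proof.
move=> mf f0 fc a0.
have mfE : measurable_fun setT (EFin \o f) by exact/measurable_EFinP.
have mQ : measurable [set w | a <= f w].
  rewrite (_ : [set w | _] = f @^-1` `[a, +oo[); last first.
    by apply/seteqP; split => w /=; rewrite in_itv/= andbT.
  by rewrite -[X in measurable X]setTI; exact: mf.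
apply: pr_le_measurable => //; rewrite -(@lee_pmul2l _ a%:E)// ?lte_fin// -EFinM mulrCA divff ?gt_eqF// mulr1.
apply: le_trans fc; rewrite -integral_cst//; set Q := [set w | a <= f w] in mQ *.
apply: (@le_trans _ _ (\int[P]_(w in Q) (f w)%:E)%E).
  apply: ge0_le_integral => //.
  - by move=> ? _; rewrite lee_fin ltW.
  - exact: measurable_funTS.
apply: ge0_subset_integral => //.
by move=> ? _; rewrite lee_fin.
Qed.

Lemma pr_le_markov (f : Omega -> R) a : LG P measurable f -> (forall w, 0 <= f w) ->
  0 < a -> pr_le [set w | a <= f w] (Ex P f / a).
Proof.
move=> Lf f0 a0; have sF := @sub_sigma_full disp Omega.
by apply: pr_le_markov_integral => //; [exact: LG_measurable Lf|rewrite (Ex_ereal sF)].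
Qed.

(* Continuity from above, as "almost surely eventually false" implies "false with
   high probability". *)
Lemma pr_le_decreasing (A : nat -> set Omega) e : (forall n, measurable (A n)) ->
  (forall n, A n.+1 `<=` A n) -> {ae P, forall w, exists n, ~ A n w} -> 0 < e ->
  exists n, forall m, (n <= m)%N -> pr_le (A m) e.
Proof.
move=> mA AS Ae e0.
have hA : {homo A : n m / (n <= m)%N >-> (m <= n)%O}.
  move=> n m; rewrite subsetEset; elim: m => [|m IH]; first by rewrite leqn0 => /eqP ->.
  rewrite leq_eqVlt => /predU1P[->//|nm].
  exact: subset_trans (AS m) (IH nm).
have mI : measurable (\bigcap_n A n) by exact: bigcapT_measurable.
have PI : P (\bigcap_n A n) = 0%E.
  apply: (measure_negligible mI); apply: negligibleS Ae => w Aw /= [n]; apply.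
  exact: Aw.
have P0 : (P (A 0%N) < +oo)%E by apply: le_lt_trans (probability_le1 _ (mA _)) (ltry _).
have : (P \o A) @ \oo --> 0%E by rewrite -PI; exact: nonincreasing_cvg_mu.
move=> /fine_cvgP[fA] /cvgrPdist_le /(_ e e0)[n _ Hn]; exists n => m nm.
apply: pr_le_measurable => //; have := Hn m nm; rewrite /= sub0r normrN => H.
rewrite -(fineK (fin_num_measure P _ (mA m))) lee_fin; exact: le_trans (ler_norm _) H.
Qed.

(** The events that some member exceeds [m + 1] decrease with [m], and almost surely one of them
    fails. *)
Lemma pr_le_bounded_family (f : nat -> Omega -> R) e : (forall n, measurable_fun setT (f n)) ->
  {ae P, forall w, exists c, forall n, f n w <= c} -> 0 < e ->
  exists c, 0 < c /\ pr_le [set w | exists n, c < f n w] e.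
Proof.
move=> mf fb e0; pose A m := [set w | exists n, m.+1%:R < f n w].
have [|n w [k nk]||n Hn] := @pr_le_decreasing A e _ _ _ e0.
- move=> m; rewrite (_ : A m = \bigcup_k (f k) @^-1` `]m.+1%:R, +oo[); last first.
    by apply/seteqP; split => w [k]; [exists k => //=; rewrite in_itv/= andbT|
       move=> _ /=; rewrite in_itv/= andbT; exists k].
  by apply: bigcupT_measurable => k; rewrite -[X in measurable X]setTI; exact: mf.
- by exists k; apply: lt_trans nk; rewrite ltr_nat.
- apply: filterS fb => w [c fc]; exists (Num.truncn `|c|) => -[k].
  apply/negP; rewrite -leNgt; apply: le_trans (fc k) _.
  by apply: le_trans (ler_norm c) _; rewrite ltW// truncnS_gt.
- by exists n.+1%:R; split => //; apply: Hn.
Qed.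

End OuterProbability.

(** * Rare events, convergence and tightness in probability *)

Section ProbabilityCalculus.
Context {R : realType} {disp : measure_display} {Omega : measurableType disp}.
Variable P : probability Omega R.
Context {I : Type} (Fl : set_system I) {FF : Filter Fl}.
Implicit Types (f g : I -> Omega -> R) (Q : I -> set Omega) (e K : R).

(** [Fl] is an arbitrary filter, so that the same calculus serves limits over one partition index
    and iterated limits over a coarse and a fine one. *)
Definition prare Q := forall e, 0 < e -> Fl [set i | pr_le P (Q i) e].
Definition ptends f := forall e, 0 < e -> prare (fun i => [set w | e < `|f i w|]).
Definition ptight f := forall e, 0 < e ->
  exists2 K, 0 < K & Fl [set i | pr_le P [set w | K < `|f i w|] e].

Lemma prare_sub Q Q' : (Fl [set i | Q i `<=` Q' i]) -> prare Q' -> prare Q.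
Proof.
move=> QQ H e e0; apply: filterS2 QQ (H e e0) => i QQi; exact: pr_le_sub.
Qed.

Lemma prareU Q Q' : prare Q -> prare Q' -> prare (fun i => Q i `|` Q' i).
Proof.
move=> H H' e e0; have e20 : 0 < e / 2 by rewrite divr_gt0.
by apply: filterS2 (H _ e20) (H' _ e20) => i; exact: pr_le_cover.
Qed.

Lemma ptendsP f : (forall e, 0 < e -> Fl [set i | pr_le P [set w | e < `|f i w|] e]) -> ptends f.
Proof.
move=> H e e0 e' e'0; have m0 : 0 < Num.min e e' by rewrite lt_min e0.
apply: filterS (H _ m0) => i; apply: pr_le_sub; last by rewrite ge_min lexx orbT.
by move=> w /=; apply: le_lt_trans; rewrite ge_min lexx.
Qed.

(** Localisation: off a set of arbitrarily small probability, [f] may be dominated by a family [g]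
    that depends on the tolerance. Truncated quantities, which have moments, enter in this way. *)
Lemma ptends_on f : (forall e, 0 < e -> exists g Q, [/\ ptends g, Fl [set i | pr_le P (Q i) e] &
  Fl [set i | forall w, ~ Q i w -> `|f i w| <= `|g i w|]]) -> ptends f.
Proof.
move=> H e e0 e' e'0; have e20 : 0 < e' / 2 by rewrite divr_gt0.
have [g [Q [tg HQ HL]]] := H _ e20.
apply: filterS3 (tg e e0 _ e20) HQ HL => i Hg Hq fg; apply: pr_le_cover Hg Hq => w /= fw.
by case: (pselect (Q i w)) => [|/fg fgw]; [right|left; exact: lt_le_trans fw fgw].
Qed.

Lemma ptends_le f g : Fl [set i | forall w, `|f i w| <= `|g i w|] -> ptends g -> ptends f.
Proof.
move=> fg tg e e0; apply: prare_sub (tg e e0); apply: filterS fg => i fg w /= H.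
exact: lt_le_trans H (fg w).
Qed.

Lemma ptendsD f g : ptends f -> ptends g -> ptends (fun i w => f i w + g i w).
Proof.
move=> tf tg e e0; have e20 : 0 < e / 2 by rewrite divr_gt0.
apply: prare_sub (prareU (tf _ e20) (tg _ e20)); apply: filterE => i w /= H.
have := ler_normD (f i w) (g i w).
have [fl|] := leP `|f i w| (e / 2); last by left.
have [gl|] := leP `|g i w| (e / 2); last by right.
lra.
Qed.

Lemma ptendsN f : ptends f -> ptends (fun i w => - f i w).
Proof. by apply: ptends_le; apply: filterE => i w; rewrite normrN. Qed.

Lemma ptendsB f g : ptends f -> ptends g -> ptends (fun i w => f i w - g i w).
Proof. by move=> tf tg; apply: ptendsD => //; exact: ptendsN. Qed.

Lemma ptends0 : ptends (fun _ _ => 0).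
Proof.
move=> e e0 e' e'0; apply: filterE => i; apply: pr_le_ae; first exact: ltW.
by apply: filterE => w /=; rewrite normr0 => /lt_geF; rewrite (ltW e0).
Qed.

Lemma ptends_sum (J : Type) (s : seq J) (h : J -> I -> Omega -> R) : (forall j, ptends (h j)) ->
  ptends (fun i w => \sum_(j <- s) h j i w).
Proof.
move=> th; elim: s => [|j s IH].
  by apply: ptends_le ptends0; apply: filterE => i w; rewrite big_nil.
by apply: ptends_le (ptendsD (th j) IH); apply: filterE => i w; rewrite big_cons.
Qed.

Lemma ptendsM f g : ptends f -> ptight g -> ptends (fun i w => f i w * g i w).
Proof.
move=> tf tg e e0 e' e'0; have e20 : 0 < e' / 2 by rewrite divr_gt0.
have [K K0 HK] := tg _ e20; have eK : 0 < e / K by rewrite divr_gt0.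
apply: filterS2 (tf _ eK _ e20) HK => i H1 H2; apply: pr_le_cover H1 H2 => w /= H.
have [gK|] := leP `|g i w| K; last by right.
left => /=; rewrite ltr_pdivrMr//; apply: lt_le_trans H _; rewrite normrM ler_wpM2l//.
Qed.

Lemma ptight_le f g : Fl [set i | forall w, `|f i w| <= `|g i w|] -> ptight g -> ptight f.
Proof.
move=> fg tg e e0; have [K K0 HK] := tg _ e0; exists K => //.
apply: filterS2 fg HK => i fgi; apply: pr_le_sub => // w /= H; exact: lt_le_trans H (fgi w).
Qed.

Lemma ptightD f g : ptight f -> ptight g -> ptight (fun i w => f i w + g i w).
Proof.
move=> tf tg e e0; have e20 : 0 < e / 2 by rewrite divr_gt0.
have [K K0 HK] := tf _ e20; have [L L0 HL] := tg _ e20; exists (K + L); first exact: addr_gt0.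
apply: filterS2 HK HL => i H1 H2; apply: pr_le_cover H1 H2 => w /= H.
have := ler_normD (f i w) (g i w).
have [fl|] := leP `|f i w| K; last by left.
have [gl|] := leP `|g i w| L; last by right.
lra.
Qed.

Lemma ptight_cst (c : R) : ptight (fun _ _ => c).
Proof.
move=> e e0; exists (`|c| + 1); first by rewrite ltr_wpDl.
apply: filterE => i; apply: pr_le_ae; first exact: ltW.
by apply: filterE => w /= H; have := lerDl `|c| 1; rewrite ler01 => /le_gtF; rewrite H.
Qed.

Lemma ptightM f g : ptight f -> ptight g -> ptight (fun i w => f i w * g i w).
Proof.
move=> tf tg e e0; have e20 : 0 < e / 2 by rewrite divr_gt0.
have [K K0 HK] := tf _ e20; have [L L0 HL] := tg _ e20; exists (K * L); first exact: mulr_gt0.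
apply: filterS2 HK HL => i H1 H2; apply: pr_le_cover H1 H2 => w /= H.
have [fl|] := leP `|f i w| K; last by left.
have [gl|] := leP `|g i w| L; last by right.
by move: H; rewrite normrM ltNge ler_pM.
Qed.

Lemma ptight_sum (J : Type) (s : seq J) (h : J -> I -> Omega -> R) : (forall j, ptight (h j)) ->
  ptight (fun i w => \sum_(j <- s) h j i w).
Proof.
move=> th; elim: s => [|j s IH].
  by apply: ptight_le (ptight_cst 0); apply: filterE => i w; rewrite big_nil.
by apply: ptight_le (ptightD (th j) IH); apply: filterE => i w; rewrite big_cons.
Qed.

Lemma ptight_Ex f (c : R) : Fl [set i | LG P measurable (f i)] ->
  Fl [set i | Ex P (fun w => `|f i w|) <= c] -> ptight f.
Proof.
move=> Lf Ef e e0; pose K := (`|c| + 1) / e.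
have K0 : 0 < K by rewrite divr_gt0// ltr_wpDl.
exists K => //; apply: filterS2 Lf Ef => i Li Ei.
apply: pr_le_sub (pr_le_markov (f := fun w => `|f i w|) (LG_norm Li) (fun w => normr_ge0 _) K0).
  by move=> w /= /ltW.
rewrite ler_pdivrMr// (le_trans Ei)// /K mulrC divfK ?gt_eqF//.
by rewrite (le_trans (ler_norm c))// lerDl.
Qed.

End ProbabilityCalculus.

(* Coarse index d, fine index D: the inner limit over D is taken first. *)
Definition iter_near : set_system (nat * nat) :=
  [set A | \forall d \near \oo, \forall D \near \oo, A (d, D)].

Global Instance iter_near_filter : Filter iter_near.
Proof.
split=> [|A B nA nB|A B AB nA].
- by apply: nearW => d; exact: nearW.
- apply: (@filterS2 _ \oo _ _ _ _ _ nA nB) => d; exact: (@filterS2 _ \oo).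
- by apply: (@filterS _ \oo _ _ _ _ nA) => d; apply: (@filterS _ \oo) => D; exact: AB.
Qed.

Section Iterated.
Context {R : realType} {disp : measure_display} {Omega : measurableType disp}.
Variable P : probability Omega R.

Lemma ptends_iter (f : nat * nat -> Omega -> R) :
  (forall d, ptends P \oo (fun D => f (d, D))) -> ptends P iter_near f.
Proof. by move=> H e e0 e' e'0; apply: nearW => d; exact: H. Qed.

Lemma iter_near_outer (A : set nat) : (\forall d \near \oo, A d) -> iter_near [set x | A x.1].
Proof. by apply: filterS => d Ad; exact: nearW. Qed.

(** A family that ignores the fine index needs only one admissible [D]; here the auxiliary fine
    partition disappears again. *)
Lemma prare_outer (Q : nat -> set Omega) : prare P iter_near (fun x => Q x.1) -> prare P \oo Q.
Proof.
move=> H e e0; apply: (@filterS _ \oo _ _ _ _ (H e e0)) => d Hd.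
by have [D] := filter_ex Hd.
Qed.

Lemma prare_to_outer (Q : nat -> set Omega) : prare P \oo Q -> prare P iter_near (fun x => Q x.1).
Proof. by move=> H e e0; exact: iter_near_outer (H e e0). Qed.

Lemma ptends_outer (f : nat -> Omega -> R) : ptends P iter_near (fun x => f x.1) -> ptends P \oo f.
Proof. by move=> H e e0; apply: prare_outer; exact: H. Qed.

Lemma ptends_to_outer (f : nat -> Omega -> R) : ptends P \oo f -> ptends P iter_near (fun x => f x.1).
Proof. by move=> H e e0; exact: (@prare_to_outer (fun d => [set w | e < `|f d w|]) (H e e0)). Qed.

Lemma ptight_to_inner (f : nat -> Omega -> R) : ptight P \oo f -> ptight P iter_near (fun x => f x.2).
Proof. by move=> H e e0; have [K K0 HK] := H e e0; exists K => //; exact: nearW. Qed.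

End Iterated.

(** * Nested partitions and path regularity *)

(** Heine's theorem: near each point half of its radius of continuity serves, and the near-covering
    form of compactness makes the choice uniform. *)
Lemma cont_on_unif {R : realType} (a c : R) (f : R -> R) : cont_on a c f ->
  forall e, 0 < e -> exists2 q, 0 < q & forall u s, a <= u <= c -> a <= s <= c ->
    `|u - s| < q -> `|f u - f s| < e.
Proof.
move=> /subspace_continuousP cf e e0.
pose Q (q x : R) := forall u, a <= u <= c -> a <= x <= c -> `|u - x| < q -> `|f u - f x| < e.
have e20 : 0 < e / 2 by rewrite divr_gt0.
have : \forall q \near (0 : R)^'+, `[a, c] `<=` Q q.
  apply: (proj1 (compact_near_coveringP `[a, c]) (@segment_compact _ a c)) => x /= xac.
  have /cvgrPdist_lt /(_ _ e20) /= := cf x xac.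
  rewrite /within/= => -[q0 q00 H].
  have q20 : 0 < q0 / 2 by rewrite divr_gt0.
  have H' z : a <= z <= c -> `|x - z| < q0 -> `|f x - f z| < e / 2.
    by move=> zac xz; apply: H => //=; rewrite in_itv/=.
  exists (ball x (q0 / 2), [set q | q < q0 / 2]) => /=; first split.
  - exact: nbhsx_ballx.
  - exact: nbhs_right_lt.
  move=> [y q] [/= xy qq] u uac yac uy.
  rewrite /ball/= in xy.
  have A1 : `|f x - f y| < e / 2 by apply: H' => //; apply: lt_trans xy _; lra.
  have A2 : `|f x - f u| < e / 2.
    apply: H' => //; have := ler_distD y x u; rewrite (distrC y u); move: xy uy qq; lra.
  by have := ler_distD (f x) (f u) (f y); rewrite (distrC (f u) (f x)); lra.
move=> H; have [q [q0 Hq]] : exists q, 0 < q /\ `[a, c] `<=` Q q.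
  by have [q [Hq q0]] := @filter_ex _ _ (at_right_proper_filter (0 : R)) _ (filterI H (nbhs_right_gt (0 : R))); exists q.
exists q => // u s uac sac; exact: Hq.
Qed.

Section Grids.
Context {R : realType}.
Variables (T : R) (N : nat -> nat) (delta : nat -> R) (t_ : nat -> nat -> R).
Hypotheses (T0 : 0 < T) (HG : nested_partitions T N delta t_).

Definition pt d k : R := k%:R * delta d.

Lemma gridE d k : (k <= N d)%N -> t_ d k = pt d k.
Proof.
move=> kN; apply: uniform_grid kN => [|i]; first exact: (partition_start HG).
exact: (partition_step HG).
Qed.

Lemma mesh_gt0 d : 0 < delta d. Proof. exact: (partition_mesh_gt0 HG). Qed.

Lemma grid_end d : pt d (N d) = T.
Proof. by rewrite -gridE// (partition_end HG). Qed.

Lemma grid_size_gt0 d : (0 < N d)%N.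
Proof.
rewrite lt0n; apply/eqP => N0; have := grid_end d.
by rewrite /pt N0 mul0r => T00; move: T0; rewrite -T00 ltxx.
Qed.

Lemma mesh_le d : delta d <= T.
Proof.
rewrite -(grid_end d) /pt ler_peMl ?(ltW (mesh_gt0 d))//.
by rewrite ler1n grid_size_gt0.
Qed.

Lemma ptS d k : pt d k.+1 = pt d k + delta d.
Proof. by rewrite /pt -natr1 mulrDl mul1r. Qed.

Lemma pt0 d : pt d 0 = 0. Proof. by rewrite /pt mul0r. Qed.

Lemma pt_ge0 d k : 0 <= pt d k.
Proof. by rewrite mulr_ge0// ltW// mesh_gt0. Qed.

Lemma pt_le d k l : (k <= l)%N -> pt d k <= pt d l.
Proof. by move=> kl; rewrite ler_wpM2r ?ler_nat// ltW// mesh_gt0. Qed.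

Lemma pt_lt d k l : (k < l)%N -> pt d k < pt d l.
Proof. by move=> kl; rewrite ltr_pM2r ?ltr_nat// mesh_gt0. Qed.

Lemma pt_leT d k : (k <= N d)%N -> pt d k <= T.
Proof. by move=> kN; rewrite -(grid_end d) pt_le. Qed.

Lemma pt_in d k : (k <= N d)%N -> 0 <= pt d k <= T.
Proof. by move=> kN; rewrite pt_ge0 pt_leT. Qed.

(** The first positive point of a grid is a point of the next one, so that the ratio of successive
    meshes is an integer. The common endpoint [T] then fixes the number of cells. *)
Lemma refine d D : (d <= D)%N -> exists m, [/\ (0 < m)%N, delta d = m%:R * delta D & (N D = N d * m)%N].
Proof.
elim: D => [|D IH]; first by rewrite leqn0 => /eqP ->; exists 1%N; rewrite mul1r muln1.
rewrite leq_eqVlt => /predU1P[->|]; first by exists 1%N; rewrite mul1r muln1.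
move=> /IH[m [m0 dE NE]].
have /(partition_nested HG) [i /= iN] : [set t_ D i | i in [set i | (i <= N D)%N]] (pt D 1).
  by exists 1%N => /=; rewrite ?gridE// grid_size_gt0.
rewrite gridE// /pt mul1r => iE.
have i0 : (0 < i)%N.
  by rewrite lt0n; apply/eqP => i0; have := mesh_gt0 D; rewrite -iE i0 mul0r ltxx.
exists (m * i)%N; split; first by rewrite muln_gt0 m0.
  by rewrite dE -iE natrM mulrA.
have := grid_end D; rewrite -(grid_end D.+1) /pt -iE mulrA -natrM.
move=> /(mulIf (lt0r_neq0 (mesh_gt0 D.+1))) /eqP; rewrite eqr_nat => /eqP <-.
by rewrite NE mulnA.
Qed.

Lemma mesh_mono d D : (d <= D)%N -> delta D <= delta d.
Proof.
move=> /refine[m [m0 -> _]]; rewrite ler_peMl ?(ltW (mesh_gt0 D))//.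
by rewrite ler1n.
Qed.

Lemma mesh_small e : 0 < e -> exists d, forall D, (d <= D)%N -> delta D < e.
Proof.
move=> e0; have /cvgrPdist_lt /(_ e e0)[d _ Hd] := partition_mesh_cvg HG.
by exists d => D /Hd /=; rewrite sub0r normrN gtr0_norm// mesh_gt0.
Qed.

Lemma mesh_small_near e : 0 < e -> \forall D \near \oo, delta D < e.
Proof. by move=> /mesh_small[d Hd]; exists d. Qed.

Lemma grid_floor d s : 0 <= s <= T -> exists2 k, (k < N d)%N & pt d k <= s <= pt d k.+1.
Proof. exact: (grid_cell (mesh_gt0 d) (grid_end d) (mesh_le d)). Qed.

End Grids.

Section PathRegularity.
Context {R : realType} {disp : measure_display} {Omega : measurableType disp}.
Variables (P : probability Omega R).
Variables (T : R) (N : nat -> nat) (delta : nat -> R) (t_ : nat -> nat -> R).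
Hypotheses (T0 : 0 < T) (HG : nested_partitions T N delta t_).
Variable (Y : R -> Omega -> R).
Hypotheses (mY : forall t, 0 <= t <= T -> measurable_fun setT (Y t)) (cY : ae_continuous P T Y).

Definition osc D e w := exists s t,
  [/\ 0 <= s <= T, 0 <= t <= T, `|s - t| <= delta D & e < `|Y s w - Y t w|].

(** The event [osc] involves uncountably many times and may fail to be measurable. Up to a null set
    it is enclosed in a countable union [A] over the points of all finer grids, and for almost every
    path [A] fails once [D] is large, by uniform continuity. *)
Lemma prare_osc e : 0 < e -> prare P \oo (fun D => osc D e).
Proof.
move=> e0; have e20 : 0 < e / 2 by rewrite divr_gt0.
have e40 : 0 < e / 4 by rewrite divr_gt0.
pose B D D' q q' := [set w | [/\ (D <= D')%N, (q <= N D')%N, (q' <= N D')%N,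
  `|pt delta D' q - pt delta D' q'| <= 2 * delta D &
  e / 2 < `|Y (pt delta D' q) w - Y (pt delta D' q') w|]].
have mB D D' q q' : measurable (B D D' q q').
  have [DD|DD] := boolP (D <= D')%N; last first.
    by rewrite (_ : B _ _ _ _ = set0)//; apply/seteqP; split => w // [] H; rewrite H in DD.
  have [qN|qN] := boolP (q <= N D')%N; last first.
    by rewrite (_ : B _ _ _ _ = set0)//; apply/seteqP; split => w // [] _ H; rewrite H in qN.
  have [qN'|qN'] := boolP (q' <= N D')%N; last first.
    by rewrite (_ : B _ _ _ _ = set0)//; apply/seteqP; split => w // [] _ _ H; rewrite H in qN'.
  have [qq|qq] := boolP (`|pt delta D' q - pt delta D' q'| <= 2 * delta D); last first.
    by rewrite (_ : B _ _ _ _ = set0)//; apply/seteqP; split => w // [] _ _ _ H; rewrite H in qq.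
  pose g w := `|Y (pt delta D' q) w - Y (pt delta D' q') w|.
  have mg : measurable_fun setT g.
    by apply: measurableT_comp => //; apply: measurable_funB; apply: mY; exact: (pt_in HG).
  rewrite (_ : B _ _ _ _ = g @^-1` `]e / 2, +oo[); first by rewrite -[X in measurable X]setTI; exact: mg.
  by apply/seteqP; split => w /=; rewrite in_itv/= andbT; [case|].
pose A D := \bigcup_D' \bigcup_q \bigcup_q' B D D' q q'.
have cw : {ae P, forall w, forall e, 0 < e -> exists2 q, 0 < q & forall u s,
    0 <= u <= T -> 0 <= s <= T -> `|u - s| < q -> `|Y u w - Y s w| < e}.
  by apply: filterS cY => w /cont_on_unif.
move=> e' e'0; have [|n||n Hn] := @pr_le_decreasing _ _ _ P A e' _ _ _ e'0.
- by move=> n; do 3! apply: bigcupT_measurable => ?.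
- move=> w [D' _ [q _ [q' _ [nD H1 H2 H3 H4]]]]; exists D' => //; exists q => //; exists q' => //.
  split => //; first exact: ltnW.
  by apply: le_trans H3 _; rewrite ler_pM2l// (mesh_mono T0 HG).
- apply: filterS cw => w /(_ _ e20)[q q0 Hq].
  have q20 : 0 < q / 2 by rewrite divr_gt0.
  have [D HD] := mesh_small HG q20; exists D => -[D' _ [i _ [j _ [_ iN jN ij]]]].
  apply/negP; rewrite -leNgt ltW//; apply: Hq; [exact: (pt_in HG)|exact: (pt_in HG)|].
  apply: le_lt_trans ij _; have := HD D (leqnn _); lra.
exists n => // m nm; apply: pr_le_sub_ae (Hn m nm).
apply: filterS cw => w /(_ _ e40)[q q0 Hq] [s [t [sT tT st est]]].
(* The finer mesh is at most half of [delta m], so that replacing two times by grid points increases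
   their distance to at most [2 * delta m], while each value moves by less than [e / 4]. *)
have r0 : 0 < Num.min q (delta m / 2) by rewrite lt_min q0 divr_gt0// (mesh_gt0 HG).
have [D0 HD0] := mesh_small HG r0; pose D := maxn D0 m.
have := HD0 D (leq_maxl _ _); rewrite lt_min => /andP[dq dm].
have [i iN /andP[i1 i2]] := grid_floor T0 HG D sT.
have [j jN /andP[j1 j2]] := grid_floor T0 HG D tT.
rewrite ptS in i2; rewrite ptS in j2.
have D0' := mesh_gt0 HG D.
have si : `|s - pt delta D i| <= delta D by rewrite ger0_norm; lra.
have tj : `|t - pt delta D j| <= delta D by rewrite ger0_norm; lra.
exists D => //; exists i => //; exists j => //; split; [exact: leq_maxr|exact: ltnW|exact: ltnW| |].
  have := ler_distD s (pt delta D i) (pt delta D j); have := ler_distD t s (pt delta D j).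
  rewrite (distrC _ s); lra.
have A1 := Hq s (pt delta D i) sT (pt_in HG (ltnW iN)) (le_lt_trans si dq).
have A2 := Hq t (pt delta D j) tT (pt_in HG (ltnW jN)) (le_lt_trans tj dq).
have := ler_distD (Y (pt delta D i) w) (Y s w) (Y t w).
have := ler_distD (Y (pt delta D j) w) (Y (pt delta D i) w) (Y t w).
rewrite (distrC (Y (pt delta D j) w) (Y t w)); lra.
Qed.

Lemma osc_bound D e w t : ~ osc D e w -> 0 <= t <= T -> `|Y t w| <= `|Y 0 w| + (N D)%:R * e.
Proof.
move=> no tT.
have cell s u : 0 <= s <= T -> 0 <= u <= T -> `|s - u| <= delta D -> `|Y s w - Y u w| <= e.
  by move=> sT uT su; rewrite leNgt; apply/negP => H; apply: no; exists s, u.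
have step k : (k <= N D)%N -> `|Y (pt delta D k) w| <= `|Y 0 w| + k%:R * e.
  elim: k => [|k IH] kN; first by rewrite pt0 mul0r addr0.
  have H : `|Y (pt delta D k.+1) w - Y (pt delta D k) w| <= e.
    apply: cell; [exact: (pt_in HG)|exact: (pt_in HG (ltnW kN))|].
    by rewrite ptS addrAC subrr add0r gtr0_norm// (mesh_gt0 HG).
  have := IH (ltnW kN); have := ler_normB (Y (pt delta D k) w) (Y (pt delta D k) w - Y (pt delta D k.+1) w).
  rewrite opprB addrCA subrr addr0 (distrC (Y (pt delta D k) w)) -natr1; lra.
have [k kN /andP[k1 k2]] := grid_floor T0 HG D tT.
rewrite ptS in k2.
have H : `|Y t w - Y (pt delta D k) w| <= e.
  by apply: cell => //; [exact: (pt_in HG (ltnW kN))|rewrite ger0_norm; lra].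
have e0 : 0 <= e by exact: le_trans (normr_ge0 _) H.
have := step k (ltnW kN).
have := ler_normB (Y (pt delta D k) w) (Y (pt delta D k) w - Y t w).
rewrite opprB addrCA subrr addr0 (distrC (Y (pt delta D k) w)) => A1 A2.
have : k.+1%:R * e <= (N D)%:R * e by rewrite ler_wpM2r// ler_nat.
by rewrite -natr1; lra.
Qed.

(** On one fixed grid the path oscillates by at most 1 in each cell outside a rare event, hence it
    stays within [N D] of the size of its initial value. *)
Lemma path_bounded e : 0 < e -> exists2 K, 0 < K &
  pr_le P [set w | exists2 t, 0 <= t <= T & K < `|Y t w|] e.
Proof.
move=> e0; have e20 : 0 < e / 2 by rewrite divr_gt0.
have [D HD] := filter_ex (prare_osc ltr01 e20).
have T00 : 0 <= (0 : R) <= T by rewrite lexx ltW.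
have m0 : forall n : nat, measurable_fun setT (fun w => `|Y 0 w|).
  by move=> _; apply: measurableT_comp => //; exact: mY.
have [|c [c0 Hc]] := @pr_le_bounded_family _ _ _ P (fun _ w => `|Y 0 w|) _ m0 _ e20.
  by apply: filterE => w; exists `|Y 0 w|.
exists (c + (N D)%:R * 1); first by rewrite ltr_wpDr// mulr_ge0.
apply: pr_le_cover Hc HD => w [t tT Kt].
have [|no] := pselect (osc D 1 w); first by right.
left; exists 0%N; have := osc_bound no tT; lra.
Qed.

End PathRegularity.

(** * Quadratic variation of semimartingales *)

Section Integrable.
Context {R : realType} {disp : measure_display} {Omega : measurableType disp}.
Variable P : probability Omega R.
Implicit Types (G : set (set Omega)) (f g U : Omega -> R).

(** Martingales come with a first moment only; they need a calculus of expectations parallel to that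
    of [LG]. *)
Definition INT f := P.-integrable setT (EFin \o f).

Lemma INT_measurable f : INT f -> measurable_fun setT f.
Proof. by move=> /integrableP[/measurable_EFinP]. Qed.

Lemma INTD f g : INT f -> INT g -> INT (fun w => f w + g w).
Proof. by move=> If Ig; exact: (integrableD measurableT If Ig). Qed.

Lemma INTZ c f : INT f -> INT (fun w => c * f w).
Proof. by move=> If; exact: (integrableZl measurableT c If). Qed.

Lemma INTN f : INT f -> INT (fun w => - f w).
Proof. by move=> If; under eq_fun do rewrite -mulN1r; exact: INTZ. Qed.

Lemma INTB f g : INT f -> INT g -> INT (fun w => f w - g w).
Proof. by move=> If Ig; apply: INTD => //; exact: INTN. Qed.

Lemma INT_dom f g : measurable_fun setT f -> INT g -> (forall w, `|f w| <= `|g w|) -> INT f.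
Proof.
move=> mf Ig fg; apply: (le_integrable measurableT _ _ Ig); first exact/measurable_EFinP.
by move=> w _; rewrite lee_fin.
Qed.

Lemma INT_bdd U f c : measurable_fun setT U -> (forall w, `|U w| <= c) -> INT f ->
  INT (fun w => U w * f w).
Proof.
move=> mU Uc If; apply: (INT_dom (g := fun w => c * f w)); last 2 first.
- exact: INTZ.
- move=> w; rewrite !normrM ler_wpM2r//; exact: le_trans (Uc w) (ler_norm c).
by apply: measurable_funM => //; exact: INT_measurable.
Qed.

Lemma INT_cst (c : R) : INT (fun=> c).
Proof. exact: (LG_integrable (@sub_sigma_full disp Omega) (LG_cst P _ c)). Qed.

Lemma IxD f g : INT f -> INT g -> Ex P (fun w => f w + g w) = Ex P f + Ex P g.
Proof. by move=> If Ig; exact: RintegralD. Qed.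

Lemma IxZ c f : INT f -> Ex P (fun w => c * f w) = c * Ex P f.
Proof. by move=> If; exact: RintegralZl. Qed.

Lemma IxB f g : INT f -> INT g -> Ex P (fun w => f w - g w) = Ex P f - Ex P g.
Proof. by move=> If Ig; exact: RintegralB. Qed.

Lemma Ix_le f g : INT f -> INT g -> (forall w, f w <= g w) -> Ex P f <= Ex P g.
Proof. by move=> If Ig fg; apply: le_Rintegral. Qed.

Lemma Ix_ereal f : INT f -> (forall w, 0 <= f w) -> (\int[P]_w (f w)%:E = (Ex P f)%:E)%E.
Proof. by move=> If f0; rewrite /Ex /Rintegral fineK//; exact: integrable_fin_num. Qed.

Lemma INT_max0 f : INT f -> INT (fun w => Num.max (f w) 0).
Proof.
move=> If; have mf := INT_measurable If; apply: (INT_dom _ If) => [|w].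
  exact: measurable_maxr.
by case: (leP (f w) 0) => fw; [rewrite normr0|].
Qed.

(** The counterpart of [Ex_orth] for bounded [U] and integrable [f], [g]. The nonnegative functions
    [Y1] and [Y2] have difference [f - g] and equal masses on [G]; shifting [U] by its bound [c]
    makes the integrand nonnegative, as [weighted_transfer] requires. *)
Lemma bounded_orth G U f g c : sub_sigma G -> gmeas G U -> (forall w, `|U w| <= c) ->
  INT f -> INT g ->
  (forall A, G A -> (\int[P]_(w in A) (f w)%:E = \int[P]_(w in A) (g w)%:E)%E) ->
  Ex P (fun w => U w * f w) = Ex P (fun w => U w * g w).
Proof.
move=> sG mU Uc If Ig H.
pose p (f : Omega -> R) w := Num.max (f w) 0.
have mU' := gmeas_measurable sG mU.
have Ip f' : INT f' -> INT (p f') by exact: INT_max0.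
have p0 f' w : 0 <= p f' w by rewrite /p le_max lexx orbT.
have INf := INTN If; have INg := INTN Ig.
pose Y1 w := p f w + p (fun w => - g w) w.
pose Y2 w := p g w + p (fun w => - f w) w.
have I1 : INT Y1 by apply: INTD; exact: Ip.
have I2 : INT Y2 by apply: INTD; exact: Ip.
have Y10 w : 0 <= Y1 w by rewrite addr_ge0.
have Y20 w : 0 <= Y2 w by rewrite addr_ge0.
have YY w : Y1 w - Y2 w = f w - g w.
  by rewrite /Y1 /Y2 opprD addrACA -[in RHS](maxr0_sub (f w)) -[in RHS](maxr0_sub (g w)) /p; ring.
have key (phi : R -> R) : measurable_fun setT phi -> (forall x, 0 <= phi x) ->
    (\int[P]_w (phi (U w) * Y1 w)%:E = \int[P]_w (phi (U w) * Y2 w)%:E)%E.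
  move=> mphi phi0; apply: (@weighted_transfer _ _ _ P _ _ P U Y1 U Y2) => //.
  - exact: INT_measurable.
  - exact: INT_measurable.
  move=> C mC; have GA : G (U @^-1` C) by apply: (proj1 (gmeasP _ sG)).
  set A := U @^-1` C in GA *; have mA : measurable A := sub_sigma_measurable sG GA.
  have IA h : INT h -> P.-integrable A (EFin \o h).
    by move=> Ih; apply: integrableS Ih.
  have R1 : \int[P]_(w in A) f w = \int[P]_(w in A) g w.
    by rewrite /Rintegral; congr fine; exact: H.
  have R2 : \int[P]_(w in A) Y1 w = \int[P]_(w in A) Y2 w.
    apply/eqP; rewrite -subr_eq0 -RintegralB//; [|exact: IA|exact: IA].
    under eq_Rintegral do rewrite YY.
    by rewrite RintegralB ?R1 ?subrr//; exact: IA.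
  have E h : INT h -> (forall w, 0 <= h w) -> (\int[P]_(w in A) (h w)%:E = (\int[P]_(w in A) h w)%:E)%E.
    by move=> Ih h0; rewrite /Rintegral fineK//; apply: integrable_fin_num => //; exact: IA.
  by rewrite !E// R2.
pose phi (x : R) := Num.max (x + c) 0.
have phiU w : phi (U w) = U w + c.
  rewrite /phi; apply/max_idPl; have := Uc w; rewrite ler_norml => /andP[]; lra.
have IU h : INT h -> INT (fun w => U w * h w) by exact: INT_bdd.
have E1 := key phi; have {}E1 : (\int[P]_w ((U w + c) * Y1 w)%:E = \int[P]_w ((U w + c) * Y2 w)%:E)%E.
  under eq_integral do rewrite -phiU.
  rewrite E1.
  - by apply: eq_integral => w _; rewrite phiU.
  - by apply: measurable_maxr => //; apply: measurable_funD.
  - by move=> x; rewrite le_max lexx orbT.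
have E2 : Ex P Y1 = Ex P Y2.
  have := key (fun=> 1) (@measurable_cst _ _ _ _ _ _) (fun _ => ler01).
  move=> E; rewrite /Ex /Rintegral; congr fine; transitivity (\int[P]_w (1 * Y1 w)%:E)%E.
    by apply: eq_integral => w _; rewrite mul1r.
  by rewrite E; apply: eq_integral => w _; rewrite mul1r.
have E3 : Ex P (fun w => U w * Y1 w) = Ex P (fun w => U w * Y2 w).
  have : Ex P (fun w => (U w + c) * Y1 w) = Ex P (fun w => (U w + c) * Y2 w).
    by rewrite /Ex /Rintegral E1.
  have Ux h : INT h -> Ex P (fun w => (U w + c) * h w) = Ex P (fun w => U w * h w) + c * Ex P h.
    move=> Ih; rewrite -IxZ// -IxD//; [|exact: IU|exact: INTZ].
    by apply: eq_Ex => w; rewrite mulrDl.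
  by rewrite !Ux// E2 => /addIr.
apply/eqP; rewrite -subr_eq0 -IxB//; [|exact: IU|exact: IU].
have -> : Ex P (fun w => U w * f w - U w * g w) = Ex P (fun w => U w * Y1 w - U w * Y2 w).
  by apply: eq_Ex => w; rewrite -!mulrBr YY.
by rewrite IxB ?E3 ?subrr//; exact: IU.
Qed.

End Integrable.

Section Martingale.
Context {R : realType} {disp : measure_display} {Omega : measurableType disp}.
Variables (P : probability Omega R) (T : R) (F : R -> set (set Omega)).
Hypothesis FU : usual_filtration P T F.
Implicit Types (M : R -> Omega -> R) (n : R).

Lemma filtration_sub_sigma t : 0 <= t <= T -> sub_sigma (F t).
Proof.
by move=> tT; split; [exact: (filtration_sigma_algebra FU)|exact: (filtration_measurable FU)].
Qed.

Lemma adapted_gmeas M t : adapted T F M -> 0 <= t <= T -> gmeas (F t) (M t).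
Proof. by move=> aM tT; apply/(gmeasP _ (filtration_sub_sigma tT)) => C mC; exact: aM. Qed.

Lemma adapted_measurable M t : adapted T F M -> 0 <= t <= T -> measurable_fun setT (M t).
Proof. by move=> aM tT; apply: gmeas_measurable (adapted_gmeas aM tT); exact: filtration_sub_sigma. Qed.

Definition clip n (x : R) := Num.max (- n) (Num.min n x).

Lemma clip_bound n x : 0 <= n -> `|clip n x| <= n.
Proof.
move=> n0; rewrite ler_norml /clip le_max lexx/= ge_max ge_min lexx andbT; lra.
Qed.

Lemma clip_id n x : `|x| <= n -> clip n x = x.
Proof. by rewrite ler_norml /clip => /andP[x1 x2]; rewrite (min_idPr x2) (max_idPr x1). Qed.

(* [huber n] equals the square on [-n, n] and is continued linearly; its
   derivative is [2 * clip n]. *)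
Definition huber n (x : R) := 2 * clip n x * x - clip n x ^+ 2.

(** The excess of the convex function [huber n] over its tangent at [x]. For [0 <= n] it is
    nonnegative, and it equals the squared increment inside [[-n, n]]. *)
Definition huber_gap n (x y : R) := huber n y - huber n x - 2 * (clip n x * (y - x)).

Lemma huber_gapE n x y : huber_gap n x y = (y - clip n x) ^+ 2 - (y - clip n y) ^+ 2.
Proof. by rewrite /huber_gap /huber; ring. Qed.

(** [clip n y] is the point of [[-n, n]] nearest to [y]. *)
Lemma huber_gap_ge0 n x y : 0 <= n -> 0 <= huber_gap n x y.
Proof.
move=> n0; rewrite huber_gapE subr_ge0; have := clip_bound x n0; rewrite ler_norml => /andP[].
move: (clip n x) => c c1 c2; rewrite /clip -subr_ge0; have [yn|yn] := leP n y.
  rewrite max_r; last lra.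
  by rewrite (_ : _ - _ = (n - c) * (2 * y - c - n)); [rewrite mulr_ge0//; lra|ring].
have [h|h] := leP (- n) y; first by rewrite subrr expr0n subr0 sqr_ge0.
by rewrite (_ : _ - _ = (c + n) * (c - n - 2 * y)); [rewrite mulr_ge0//; lra|ring].
Qed.

Lemma huber_gap_small n x y : `|x| <= n -> `|y| <= n -> huber_gap n x y = (y - x) ^+ 2.
Proof. by move=> xn yn; rewrite huber_gapE !clip_id// subrr expr0n subr0. Qed.

Lemma huber_ge0 n x : 0 <= n -> 0 <= huber n x.
Proof.
move=> n0; rewrite /huber /clip; have [yn|yn] := leP n x; have [h|h] := leP (- n) _; nra.
Qed.

Lemma huber_le n x : 0 <= n -> huber n x <= 2 * n * `|x|.
Proof.
move=> n0; rewrite /huber; have := clip_bound x n0 => c.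
have : 2 * clip n x * x <= 2 * n * `|x|.
  apply: le_trans (ler_norm _) _; rewrite normrM ler_wpM2r// normrM ger0_norm// ler_pM2l//.
have := sqr_ge0 (clip n x); lra.
Qed.

Lemma measurable_clip n : measurable_fun setT (clip n).
Proof. by apply: measurable_maxr => //; exact: measurable_minr. Qed.

Lemma INT_huber n f : 0 <= n -> INT P f -> INT P (fun w => huber n (f w)).
Proof.
move=> n0 If; have mf := INT_measurable If.
have mc : measurable_fun setT (fun w => clip n (f w)).
  by apply: measurableT_comp => //; exact: measurable_clip.
apply: (INT_dom (g := fun w => 2 * n * f w)); last 2 first.
- exact: INTZ.
- move=> w; rewrite ger0_norm ?huber_ge0// normrM ger0_norm ?mulr_ge0//; exact: huber_le.
apply: measurable_funB; last exact: measurable_funX.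
by apply: measurable_funM => //; apply: measurable_funM.
Qed.

(** The gaps telescope up to terms [clip n (M_k) (M_(k+1) - M_k)], whose mean vanishes because the
    factor is bounded and known at time [k]. Since [huber n] grows linearly, a first moment suffices
    to control quadratic sums, even for a martingale that is not square integrable. *)
Lemma martingale_gaps M n (p : nat -> R) m : martingale P T F M -> 0 <= n ->
  (forall k, (k <= m)%N -> 0 <= p k <= T) -> (forall k, (k < m)%N -> p k <= p k.+1) ->
  INT P (fun w => \sum_(k < m) huber_gap n (M (p k) w) (M (p k.+1) w)) /\
  Ex P (fun w => \sum_(k < m) huber_gap n (M (p k) w) (M (p k.+1) w)) <= 2 * n * Ex P (fun w => `|M (p m) w|).
Proof.
move=> [aM iM eM] n0 pT pS.
have I k : (k <= m)%N -> INT P (M (p k)) by move=> km; exact/iM/pT.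
suff H j : (j <= m)%N -> INT P (fun w => \sum_(k < j) huber_gap n (M (p k) w) (M (p k.+1) w)) /\
    Ex P (fun w => \sum_(k < j) huber_gap n (M (p k) w) (M (p k.+1) w)) =
    Ex P (fun w => huber n (M (p j) w)) - Ex P (fun w => huber n (M (p 0%N) w)).
  have [H1 H2] := H m (leqnn m); split => //; rewrite H2.
  apply: (@le_trans _ _ (Ex P (fun w => huber n (M (p m) w)))).
    by rewrite gerBl Ex_ge0// => w; exact: huber_ge0.
  have In : INT P (fun w => `|M (p m) w|).
    apply: (INT_dom _ (I m (leqnn m))) => [|w]; last by rewrite normr_id.
    by apply: measurableT_comp => //; exact: (INT_measurable (I m (leqnn m))).
  rewrite -IxZ//; apply: Ix_le; [exact: INT_huber (I _ _)|exact: INTZ|].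
  by move=> w; exact: huber_le.
elim: j => [|j IH] jm.
  split; first by under eq_fun do rewrite big_ord0; exact: INT_cst.
  by rewrite subrr; under eq_Ex do rewrite big_ord0; exact: Ex_cst.
have [I0 E0] := IH (ltnW jm).
have Ij := I j (ltnW jm); have Ij1 := I j.+1 jm.
have mc : measurable_fun setT (fun w => clip n (M (p j) w)).
  apply: measurableT_comp; first exact: measurable_clip.
  exact: (INT_measurable Ij).
have cb w : `|clip n (M (p j) w)| <= n by exact: clip_bound.
have Ic1 := INT_bdd mc cb Ij; have Ic2 := INT_bdd mc cb Ij1.
have Ih := INT_huber n0 Ij; have Ih1 := INT_huber n0 Ij1.
have sj := filtration_sub_sigma (pT j (ltnW jm)).
have orth : Ex P (fun w => clip n (M (p j) w) * M (p j.+1) w) = Ex P (fun w => clip n (M (p j) w) * M (p j) w).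
  apply: (bounded_orth sj _ cb Ij1 Ij).
    apply: measurableT_comp; first exact: measurable_clip.
    by apply: adapted_gmeas => //; exact: pT (ltnW jm).
  move=> A FA; have /andP[p0 _] := pT j (ltnW jm); have /andP[_ p1] := pT j.+1 jm.
  by apply: eM => //; exact: pS.
pose g w := (huber n (M (p j.+1) w) - huber n (M (p j) w)) -
   2 * (clip n (M (p j) w) * M (p j.+1) w - clip n (M (p j) w) * M (p j) w).
have gE w : huber_gap n (M (p j) w) (M (p j.+1) w) = g w by rewrite /huber_gap /g mulrBr.
have Id := INTB Ih1 Ih; have Ie := INTB Ic2 Ic1.
have Ig : INT P g by apply: INTB => //; exact: INTZ.
have SE w : \sum_(k < j.+1) huber_gap n (M (p k) w) (M (p k.+1) w) =
    \sum_(k < j) huber_gap n (M (p k) w) (M (p k.+1) w) + g w.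
  by rewrite big_ord_recr /= gE.
split; first by under eq_fun do rewrite SE; exact: INTD.
rewrite (eq_Ex _ SE) (IxD I0 Ig) E0 /g (IxB Id (INTZ 2 Ie)).
by rewrite (IxZ 2 Ie) (IxB Ic2 Ic1) (IxB Ih1 Ih) orth subrr mulr0 subr0; ring.
Qed.

Variables (N : nat -> nat) (delta : nat -> R) (t_ : nat -> nat -> R).
Hypotheses (T0 : 0 < T) (HG : nested_partitions T N delta t_).

Definition qv (Y : R -> Omega -> R) D w :=
  \sum_(k < N D) (Y (pt delta D k.+1) w - Y (pt delta D k) w) ^+ 2.

Definition grid D k := [seq pt delta D i.+1 | i <- iota 0 k].

Lemma grid_nth D k i x0 : (i <= k)%N -> nth x0 (0 :: grid D k) i = pt delta D i.
Proof.
case: i => [|i] ik /=; first by rewrite pt0.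
by rewrite (nth_map 0%N) ?size_iota// nth_iota.
Qed.

Lemma size_grid D k : size (grid D k) = k. Proof. by rewrite size_map size_iota. Qed.

Lemma grid_partition D k : itv_partition 0 (pt delta D k) (grid D k).
Proof.
have L j : last 0 (grid D j) = pt delta D j.
  by rewrite (last_nth 0) size_grid grid_nth.
split; last by rewrite L.
elim: k => [//|k IH].
have -> : grid D k.+1 = rcons (grid D k) (pt delta D k.+1).
  by rewrite /grid -addn1 iotaD map_cat/= cats1 add0n addn1.
by rewrite rcons_path IH L (pt_lt HG).
Qed.

Lemma stopping_time_lt_measurable (tau : Omega -> R) : stopping_time T F tau ->
  measurable [set w | tau w < T].
Proof.
move=> [tauT Ft].
have -> : [set w | tau w < T] = \bigcup_k [set w | tau w <= T - T / k.+1%:R].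
  apply/seteqP; split => w /=; last first.
    by move=> [k _ /= H]; apply: le_lt_trans H _; rewrite gtrBl divr_gt0.
  move=> tT; have d0 : 0 < T - tau w by rewrite subr_gt0.
  exists (Num.truncn (T / (T - tau w))) => //=.
  rewrite lerBrDr -lerBrDl ler_pdivrMr// mulrC -ler_pdivrMr// ltW// truncnS_gt//.
apply: bigcupT_measurable => k; have kT : 0 <= T - T / k.+1%:R <= T.
  apply/andP; split; last by rewrite lerBlDr lerDl divr_ge0// ltW.
  by rewrite subr_ge0 ler_pdivrMr// ler_peMr ?(ltW T0)// ler1n.
exact: (sub_sigma_measurable (filtration_sub_sigma kT) (Ft _ kT)).
Qed.

(** The event that none of the first [m + 1] stopping times has reached [T] decreases with [m] on
    every path, whereas [tau] is monotone only almost surely. *)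
Lemma localized_often (tau : nat -> Omega -> R) e : (forall n : nat, stopping_time T F (tau n)) ->
  {ae P, forall w, forall n : nat, tau n w <= tau n.+1 w} ->
  {ae P, forall w, exists n : nat, tau n w = T} -> 0 < e ->
  exists n : nat, pr_le P [set w | tau n w <> T] e.
Proof.
move=> st mono ex e0.
pose A m := \bigcap_(n in [set n | (n <= m)%N]) [set w | tau n w < T].
have mA m : measurable (A m).
  by apply: bigcap_measurable => [|k _]; [exists 0%N|exact: stopping_time_lt_measurable].
have [m w Aw k /= km||n Hn] := @pr_le_decreasing _ _ _ P A e mA _ _ e0.
- by apply: Aw => /=; exact: leqW.
- apply: filterS ex => w [n tn]; exists n => /(_ n (leqnn _)) /=.
  by rewrite tn ltxx.
exists n; apply: pr_le_sub_ae (Hn n (leqnn n)).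
apply: filterS mono => w mono tn k /= kn.
rewrite lt_neqAle; have /andP[_ ->] := (st k).1 w; rewrite andbT; apply/eqP => tk.
apply: tn; apply/eqP; rewrite eq_le; have /andP[_ ->] := (st n).1 w; rewrite /= -tk.
elim: n kn {Hn} => [|n IH]; first by rewrite leqn0 => /eqP ->.
rewrite leq_eqVlt => /predU1P[->//|kn]; exact: le_trans (IH kn) (mono n).
Qed.

(** Outside a rare event the localising time has reached [T] and the path is bounded by [K]; after
    subtraction of [M 0] it is bounded by [2 * K], and the gaps at this level are the squared
    increments of [M]. The bound on their mean involves only the final time, so that it is uniform
    in [D]. *)
Lemma local_martingale_qv M : continuous_local_martingale P T F M ->
  forall e, 0 < e -> exists2 K, 0 < K & forall D, pr_le P [set w | K < qv M D w] e.
Proof.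
move=> [aM cM [tau [st mono ex mart]]] e e0.
have e20 : 0 < e / 2 by rewrite divr_gt0.
have e40 : 0 < e / 2 / 2 by rewrite divr_gt0.
have [n Hn] := localized_often st mono ex e20.
have [K K0 HK] := path_bounded T0 HG (fun t tT => adapted_measurable aM tT) cM e40.
pose L t w := M (Num.min t (tau n w)) w - M 0 w.
pose c := 2 * (2 * K) * Ex P (fun w => `|L T w|).
have c0 : 0 <= c by rewrite !mulr_ge0 ?(ltW K0)//; apply: Ex_ge0.
pose K' := (c + 1) / (e / 2 / 2).
have K'0 : 0 < K' by rewrite divr_gt0// ltr_wpDl.
exists K' => // D.
have K20 : 0 <= 2 * K by rewrite mulr_ge0// ltW.
have pS k : (k < N D)%N -> pt delta D k <= pt delta D k.+1 by move=> _; exact: (pt_le HG).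
pose S w := \sum_(k < N D) huber_gap (2 * K) (L (pt delta D k) w) (L (pt delta D k.+1) w).
have [I E] : INT P S /\ Ex P S <= c.
  by have := martingale_gaps (mart n) K20 (fun k => pt_in HG (d := D) (k := k)) pS; rewrite (grid_end HG).
have S0 w : 0 <= S w by apply: sumr_ge0 => k _; exact: huber_gap_ge0.
have IS : (\int[P]_w (S w)%:E <= (Ex P S)%:E)%E by rewrite (Ix_ereal I S0).
have H3 : pr_le P [set w | K' <= S w] (e / 2 / 2).
  apply: pr_le_sub (pr_le_markov_integral (INT_measurable I) S0 IS K'0) => //.
  rewrite ler_pdivrMr// /K' mulrC divfK ?gt_eqF//; apply: le_trans E _.
  by rewrite lerDl.
apply: pr_le_cover Hn (pr_le_cover (@subset_refl _ _) HK H3) => w /= Kq.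
have [tT|] := pselect (tau n w = T); last by left.
right; have [|nb] := pselect (exists2 t, 0 <= t <= T & K < `|M t w|); first by left.
right => /=; apply: ltW; apply: lt_le_trans Kq _; apply: ler_sum => k _.
have Mb t : 0 <= t <= T -> `|M t w| <= K.
  by move=> tT'; rewrite leNgt; apply/negP => H; apply: nb; exists t.
have T00 : 0 <= (0 : R) <= T by rewrite lexx ltW.
have LE t : 0 <= t <= T -> L t w = M t w - M 0 w.
  by move=> /andP[_ tT']; rewrite /L tT min_l.
have Lb t : 0 <= t <= T -> `|L t w| <= 2 * K.
  move=> tT'; rewrite LE//; apply: le_trans (ler_normB _ _) _.
  by have := Mb t tT'; have := Mb 0 T00; lra.
have k1 := pt_in HG (ltnW (ltn_ord k)); have k2 := pt_in HG (ltn_ord k).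
rewrite huber_gap_small; [|exact: Lb|exact: Lb].
by rewrite !LE// opprB addrA subrK.
Qed.

(** A sum of squares of nonnegative terms is at most the square of their sum, here of the variation
    along the grid. *)
Lemma bounded_variation_qv A : adapted T F A ->
  {ae P, forall w, bounded_variation 0 T (A^~ w)} ->
  forall e, 0 < e -> exists2 K, 0 < K & forall D, pr_le P [set w | K < qv A D w] e.
Proof.
move=> aA bv e e0.
have mA D : measurable_fun setT (qv A D).
  apply: measurable_sum => k; apply: measurable_funX; apply: measurable_funB.
    by apply: adapted_measurable => //; exact: (pt_in HG).
  by apply: adapted_measurable => //; exact: (pt_in HG (ltnW _)).
have [|K [K0 HK]] := @pr_le_bounded_family _ _ _ P _ _ mA _ e0; last first.
  exists K => // D; apply: pr_le_sub HK => // w /= H; by exists D.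
apply: filterS bv => w [B HB]; exists (B ^+ 2) => D.
pose d k := `|A (pt delta D k.+1) w - A (pt delta D k) w|.
have BV : \sum_(k < N D) d k <= B.
  apply: HB; exists [seq pt delta D k.+1 | k <- iota 0 (N D)].
    by rewrite -(grid_end HG D); exact: grid_partition.
  rewrite /variation size_grid big_mkord; apply: eq_bigr => k _.
  have kN := ltn_ord k.
  change (`|A (nth T (0 :: grid D (N D)) k.+1) w - A (nth T (0 :: grid D (N D)) k) w| = d k).
  by rewrite (grid_nth D T kN) (grid_nth D T (ltnW kN)).
apply: (@le_trans _ _ ((\sum_(k < N D) d k) ^+ 2)); last first.
  have S0 : 0 <= \sum_(k < N D) d k by apply: sumr_ge0 => k _; exact: normr_ge0.
  by apply: lerXn2r => //; rewrite nnegrE (le_trans S0).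
have -> : qv A D w = \sum_(k < N D) d k ^+ 2.
  by apply: eq_bigr => k _; rewrite /d real_normK ?num_real.
elim: (N D) => [|m IH]; first by rewrite !big_ord0 expr0n.
rewrite !big_ord_recr /= sqrrD lerD2r; apply: le_trans IH _.
by rewrite lerDl mulrn_wge0// mulr_ge0 ?sumr_ge0// => *; exact: normr_ge0.
Qed.

Lemma semimartingale_qv Y : continuous_semimartingale P T F Y ->
  forall e, 0 < e -> exists2 K, 0 < K & forall D, pr_le P [set w | K < qv Y D w] e.
Proof.
move=> [_ _ [M [A [lM aA _ bA YE]]]] e e0.
have e20 : 0 < e / 2 by rewrite divr_gt0.
have [K K0 HK] := local_martingale_qv lM e20.
have [L L0 HL] := bounded_variation_qv aA bA e20.
exists (2 * (K + L)) => [|D]; first by rewrite mulr_gt0// addr_gt0.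
have YE' : {ae P, forall w, forall k, (k <= N D)%N ->
    Y (pt delta D k) w = Y 0 w + M (pt delta D k) w + A (pt delta D k) w}.
  apply: ae_foralln => k; have [kN|kN] := boolP (k <= N D)%N; last by apply: filterE.
  by apply: filterS (YE _ (pt_in HG kN)) => w ->.
have := pr_le_cover (@subset_refl _ _) (HK D) (HL D).
apply: pr_le_sub_ae; apply: filterS YE' => w E /= H.
have [H1|] := leP (qv M D w) K; last by left.
have [H2|] := leP (qv A D w) L; last by right.
move: H; rewrite ltNge => /negP; case.
apply: (@le_trans _ _ (2 * (qv M D w + qv A D w))); last by rewrite ler_pM2l// lerD.
rewrite -big_split/= mulr_sumr; apply: ler_sum => k _.
rewrite !E//; last exact: ltnW.
set a := M _ w; set b := M _ w; set c := A _ w; set d := A _ w.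
have := sqr_ge0 ((a - b) - (c - d)); lra.
Qed.

End Martingale.

(** * Orthogonal noise sums *)

Lemma weighted_am_gm {R : realType} (c x y : R) : 0 < c ->
  `|x * y| <= 2^-1 * (c * x ^+ 2 + c^-1 * y ^+ 2).
Proof.
move=> c0; rewrite normrM -[x ^+ 2]real_normK ?num_real// -[y ^+ 2]real_normK ?num_real//.
have E : c^-1 * (c * `|x| - `|y|) ^+ 2 = c * `|x| ^+ 2 + c^-1 * `|y| ^+ 2 - 2 * (`|x| * `|y|).
  by field; rewrite gt_eqF.
have : 0 <= c^-1 * (c * `|x| - `|y|) ^+ 2 by rewrite mulr_ge0 ?sqr_ge0// invr_ge0 ltW.
by rewrite E; move: (c * _) (c^-1 * _) (`|x| * _) => p q z; lra.
Qed.

Section OrthogonalSums.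
Context {R : realType} {disp : measure_display} {Omega : measurableType disp}.
Variables (P : probability Omega R) (r : nat).
Variables (N : nat) (h : R) (G : nat -> set (set Omega)) (beta : nat -> Omega -> 'cV[R]_r).
Hypothesis HN : noise P N h G beta.
Let sF := @sub_sigma_full disp Omega.

(** Pythagoras: each [Z k] is orthogonal to whatever is known before step [k], in particular to the
    partial sum. *)
Lemma orthogonal_sum (Z : nat -> Omega -> R) a n : (a + n <= N)%N ->
  (forall k, (a <= k)%N -> (k < a + n)%N -> LG P (G k.+1) (Z k)) ->
  (forall k Y, (a <= k)%N -> (k < a + n)%N -> LG P (G k) Y -> Ex P (fun w => Y w * Z k w) = 0) ->
  Ex P (fun w => (\sum_(i < n) Z (a + i)%N w) ^+ 2) = \sum_(i < n) Ex P (fun w => Z (a + i)%N w ^+ 2).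
Proof.
move=> aN LZ H.
suff [] : LG P (G (a + n)%N) (fun w => \sum_(i < n) Z (a + i)%N w) /\
  Ex P (fun w => (\sum_(i < n) Z (a + i)%N w) ^+ 2) = \sum_(i < n) Ex P (fun w => Z (a + i)%N w ^+ 2) by [].
elim: n aN LZ H => [|n IH] aN LZ H.
  split; first by under eq_fun do rewrite big_ord0; exact: LG_cst.
  by under eq_Ex do rewrite big_ord0 expr0n; rewrite big_ord0 Ex_cst.
have aN' : (a + n < N)%N by move: aN; rewrite addnS.
have [] := IH (ltnW aN').
- by move=> k ak kn; apply: LZ => //; rewrite addnS ltnW.
- by move=> k Y ak kn; apply: H => //; rewrite addnS ltnW.
set S := fun w => \sum_(i < n) _ => LS ES.
have LS1 := LG_lift HN (leqnSn _) aN' LS.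
have LZn : LG P (G (a + n).+1) (Z (a + n)%N) by apply: LZ; rewrite ?leq_addr// addnS.
have sn := noise_sub HN aN'.
have SE w : \sum_(i < n.+1) Z (a + i)%N w = S w + Z (a + n)%N w by rewrite big_ord_recr.
split; first by under eq_fun do rewrite SE; rewrite addnS; exact: LGD.
have L1 : LG P measurable S by exact: (LG_of HN aN' LS1).
have L2 : LG P measurable (Z (a + n)%N) by exact: (LG_of HN aN' LZn).
have E0 : Ex P (fun w => S w * Z (a + n)%N w) = 0.
  by apply: H => //; rewrite ?leq_addr// addnS.
rewrite big_ord_recr /= -ES.
have L3 : LG P measurable (fun w => S w ^+ 2) by lgt.
have L4 : LG P measurable (fun w => Z (a + n)%N w ^+ 2) by lgt.
have L5 : LG P measurable (fun w => S w * Z (a + n)%N w) by lgt.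
rewrite (_ : Ex P _ = Ex P (fun w => S w ^+ 2 + Z (a + n)%N w ^+ 2 + 2 * (S w * Z (a + n)%N w))); last first.
  by apply: eq_Ex => w; rewrite SE; ring.
rewrite (ExD sF); [|by lgt|by lgt].
by rewrite (ExD sF L3 L4) (ExZ sF _ L5) E0 mulr0 addr0.
Qed.

(** The product of two increments minus its mean. With bounded adapted coefficients, a sum of [n] of
    these has a variance of order [n h^2], which vanishes with the mesh. *)
Definition wick (j m : 'I_r) k w := beta k w j 0 * beta k w m 0 - (j == m)%:R * h.

Lemma LG_wick j m k : (k < N)%N -> LG P (G k.+1) (wick j m k).
Proof.
move=> kN; have sk := noise_sub HN kN.
have L1 := LG_beta HN j kN; have L2 := LG_beta HN m kN; rewrite /wick; lgt.
Qed.

Lemma Ex_wick j m k Y : (k < N)%N -> LG P (G k) Y -> Ex P (fun w => Y w * wick j m k w) = 0.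
Proof.
move=> kN LY; have sk := noise_sub HN (ltnW kN).
have L1 := LG_of HN kN (LG_beta HN j kN); have L2 := LG_of HN kN (LG_beta HN m kN).
have LY' := LG_of HN (ltnW kN) LY.
rewrite (_ : Ex P _ = Ex P (fun w => Y w * (beta k w j 0 * beta k w m 0) - ((j == m)%:R * h) * Y w)); last first.
  by apply: eq_Ex => w; rewrite /wick; ring.
rewrite (ExB sF); [|by lgt|by lgt].
by rewrite (Ex_mulWW sk (noise_incr HN kN) j m LY) (ExZ sF _ LY') subrr.
Qed.

Lemma wick_le j m k w : (k < N)%N -> wick j m k w ^+ 2 <= 4 * h ^+ 2 * nexp h 4 (beta k) w.
Proof.
move=> kN; have h0 := gi_gt0 (noise_incr HN kN).
have bj := le_trans (colnorm_ge _ j) (norm_beta_le HN w kN).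
have bm := le_trans (colnorm_ge _ m) (norm_beta_le HN w kN).
have -> : nexp h 4 (beta k) w = nexp h 1 (beta k) w ^+ 4 by rewrite nexpX mulr1.
have e1 : 1 <= nexp h 1 (beta k) w.
  by rewrite /nexp -[leLHS]expR0 ler_expR mul1r divr_ge0.
move: e1 bj bm; set e := nexp _ _ _ _; set s := Num.sqrt h => e1 bj bm.
have sh : s ^+ 2 = h by rewrite sqr_sqrtr// ltW.
have bb : `|beta k w j 0 * beta k w m 0| <= h * e ^+ 2.
  by rewrite normrM -sh (_ : _ * e ^+ 2 = (s * e) * (s * e)); [exact: ler_pM|ring].
have wb : `|wick j m k w| <= 2 * h * e ^+ 2.
  apply: le_trans (ler_normB _ _) _; rewrite (_ : 2 * h * e ^+ 2 = h * e ^+ 2 + h * e ^+ 2); last by ring.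
  apply: lerD => //; rewrite normrM (gtr0_norm h0) mulrC ler_pM2l//.
  apply: (@le_trans _ _ 1); first by case: (j == m); rewrite /= ?normr1 ?normr0.
  exact: exprn_ege1.
rewrite -[leLHS]real_normK ?num_real//.
have -> : 4 * h ^+ 2 * e ^+ 4 = (2 * h * e ^+ 2) ^+ 2 by ring.
by apply: lerXn2r => //; rewrite nnegrE (le_trans _ wb).
Qed.

Lemma wick_sum (U : nat -> Omega -> R) K j m n : (n <= N)%N -> 0 <= K ->
  (forall k, (k < n)%N -> gmeas (G k) (U k)) -> (forall k w, `|U k w| <= K) ->
  LG P measurable (fun w => \sum_(k < n) U k w * wick j m k w) /\
  Ex P (fun w => (\sum_(k < n) U k w * wick j m k w) ^+ 2) <=
    n%:R * (4 * h ^+ 2 * K ^+ 2 * gconst r 4).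
Proof.
move=> nN K0 mU UK.
have LU k : (k < n)%N -> LG P (G k) (U k).
  by move=> kn; apply: (LG_bdd P (noise_sub HN (ltnW (leq_trans kn nN))) (mU k kn) (UK k)).
have LUw k : (k < n)%N -> LG P (G k.+1) (fun w => U k w * wick j m k w).
  move=> kn; have kN := leq_trans kn nN; have L1 := LG_lift HN (leqnSn _) kN (LU k kn).
  have L2 := LG_wick j m kN; have sk := noise_sub HN kN; lgt.
split.
  apply: LG_sum => // k _; apply: (LG_of HN) (LUw k _) => //; exact: leq_trans (ltn_ord k) nN.
have := @orthogonal_sum (fun k w => U k w * wick j m k w) 0 n nN; rewrite !add0n => ->; last 2 first.
- by move=> k _; exact: LUw.
- move=> k Y _ kn LY; have kN := leq_trans kn nN; have LUk := LU k kn.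
  have sk := noise_sub HN (ltnW kN).
  have LYU : LG P (G k) (fun w => Y w * U k w) by lgt.
  by rewrite -[RHS](Ex_wick j m kN LYU); apply: eq_Ex => w; rewrite mulrA.
rewrite -[n in n%:R]card_ord -sumr_const mulr_suml; apply: ler_sum => k _.
have kN := leq_trans (ltn_ord k) nN; rewrite mul1r.
have Le := LG_of HN kN (LG_nexp HN kN (ler0n _ 4)).
have L1 := LG_of HN kN (LUw k (ltn_ord k)).
apply: (@le_trans _ _ (Ex P (fun w => (4 * h ^+ 2 * K ^+ 2) * nexp h 4 (beta k) w))).
  apply: (Ex_le sF); [by lgt|by lgt|move=> w].
  rewrite exprMn mulrC (_ : _ * nexp _ _ _ _ = (4 * h ^+ 2 * nexp h 4 (beta k) w) * K ^+ 2); last by ring.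
  apply: ler_pM; rewrite ?sqr_ge0//; first exact: wick_le.
  by rewrite -[leLHS]real_normK ?num_real//; apply: lerXn2r.
have L1c := LG_cst P (G k) (1 : R).
have := Ex_nexp HN kN (ler0n _ 4) L1c (fun _ => ler01).
rewrite Ex_cst mulr1 (eq_Ex _ (fun w => mul1r _)) => H.
rewrite (ExZ sF _ Le); apply: ler_wpM2l => //.
by rewrite mulr_ge0 ?sqr_ge0// mulr_ge0 ?sqr_ge0.
Qed.

(** The discrete Ito isometry, over a block of steps that may start at any index [a], so as to fit
    inside a coarse cell. *)
Lemma ito_block (V : nat -> Omega -> R) K l a n : (a + n <= N)%N -> 0 <= K ->
  (forall k, (a <= k)%N -> (k < a + n)%N -> gmeas (G k) (V k)) -> (forall k w, `|V k w| <= K) ->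
  LG P measurable (fun w => \sum_(i < n) V (a + i)%N w * beta (a + i)%N w l 0) /\
  Ex P (fun w => (\sum_(i < n) V (a + i)%N w * beta (a + i)%N w l 0) ^+ 2) <= K ^+ 2 * (n%:R * h).
Proof.
move=> aN K0 mV VK.
have kN k : (k < a + n)%N -> (k < N)%N by move=> /leq_trans; exact.
have LV k : (a <= k)%N -> (k < a + n)%N -> LG P (G k) (V k).
  by move=> ak kn; apply: (LG_bdd P (noise_sub HN (ltnW (kN k kn))) (mV k ak kn) (VK k)).
have LVb k : (a <= k)%N -> (k < a + n)%N -> LG P (G k.+1) (fun w => V k w * beta k w l 0).
  move=> ak kn; have L1 := LG_lift HN (leqnSn _) (kN k kn) (LV k ak kn).
  have L2 := LG_beta HN l (kN k kn); have sk := noise_sub HN (kN k kn); lgt.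
have ain (i : 'I_n) : (a + i < a + n)%N by rewrite ltn_add2l.
split.
  apply: LG_sum => // i _; apply: (LG_of HN (kN _ (ain i))); apply: LVb => //; exact: leq_addr.
rewrite (orthogonal_sum aN LVb); last first.
  move=> k Y ak kn LY; have LVk := LV k ak kn; have sk := noise_sub HN (ltnW (kN k kn)).
  have LYV : LG P (G k) (fun w => Y w * V k w) by lgt.
  by rewrite -[RHS](Ex_mulW sk (noise_incr HN (kN k kn)) l LYV); apply: eq_Ex => w; rewrite mulrA.
rewrite mulrCA -[n in n%:R]card_ord -sumr_const mulr_suml; apply: ler_sum => i _.
have kk := kN _ (ain i); set k := (a + i)%N in kk *.
have Lb := LG_of HN kk (LG_beta HN l kk); have Lbb : LG P measurable (fun w => beta k w l 0 ^+ 2) by lgt.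
have L1 := LG_of HN kk (LVb k (leq_addr _ _) (ain i)).
rewrite mul1r -[in leRHS](Ex_W12 (noise_incr HN kk) l).2 -(ExZ sF _ Lbb).
apply: (Ex_le sF); [by lgt|by lgt|move=> w].
rewrite exprMn ler_wpM2r ?sqr_ge0//.
by rewrite -[leLHS]real_normK ?num_real//; apply: lerXn2r.
Qed.

End OrthogonalSums.

Section Truncation.
Context {R : realType} {disp : measure_display} {Omega : measurableType disp}.

(** Values outside [[-K, K]] are sent to 0: adaptedness is kept, a deterministic bound is gained,
    and nothing changes on the event where the bound already holds. *)
Definition trunc (K x : R) := x * \1_(`[- K, K]) x.

Lemma trunc_id K x : `|x| <= K -> trunc K x = x.
Proof. by move=> xK; rewrite /trunc indicE mem_set ?mulr1//= in_itv/= -ler_norml. Qed.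

Lemma trunc_bound K x : 0 <= K -> `|trunc K x| <= K.
Proof.
move=> K0; rewrite /trunc indicE; have [|] := boolP (x \in _); last by rewrite mulr0 normr0.
by rewrite mulr1 inE/= in_itv/= -ler_norml.
Qed.

Lemma gmeas_trunc (G : set (set Omega)) K f : gmeas G f -> gmeas G (fun w => trunc K (f w)).
Proof.
move=> mf; apply: (measurableT_comp (f := trunc K)) => //.
by apply: measurable_funM => //; exact: measurable_indic.
Qed.

End Truncation.

(** * Wiener increments along the partitions *)

Section WienerNoise.
Context {R : realType} {disp : measure_display} {Omega : measurableType disp} {r : nat}.
Variables (P : probability Omega R) (T : R) (F : R -> set (set Omega)).
Hypothesis FU : usual_filtration P T F.
Variables (B : R -> Omega -> 'cV[R]_r).
Hypothesis BW : wiener_process P T F B.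
Variables (N : nat -> nat) (delta : nat -> R) (t_ : nat -> nat -> R).
Hypotheses (T0 : 0 < T) (HG : nested_partitions T N delta t_).
Let sF := @sub_sigma_full disp Omega.

Definition dB D k w := B (pt delta D k.+1) w - B (pt delta D k) w.

Lemma wiener_measurable j t : 0 <= t <= T -> measurable_fun setT (fun w => B t w j 0).
Proof. move=> tT; exact: (adapted_measurable FU (wiener_adapted BW j) tT). Qed.

Lemma filtration_grid D k : (k <= N D)%N -> sub_sigma (F (pt delta D k)).
Proof. by move=> kN; exact: (filtration_sub_sigma FU (pt_in HG kN)). Qed.

Lemma wiener_noise D : noise P (N D) (delta D) (fun k => F (pt delta D k)) (dB D).
Proof.
have lt k : pt delta D k < pt delta D k.+1 by exact: (pt_lt HG).
have dE k : pt delta D k.+1 - pt delta D k = delta D by rewrite ptS addrAC subrr add0r.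
split=> [k kN|k kN|k kN|k j kN].
- exact: filtration_grid.
- by apply: (filtration_monotone FU); [exact: (pt_ge0 HG)|exact: ltW|exact: (pt_leT HG)].
- have p0 := pt_ge0 HG D k; have p1 := pt_leT HG kN; split.
  + exact: (mesh_gt0 HG).
  + move=> j; rewrite /dB; under eq_fun do rewrite !mxE.
    by apply: measurable_funB; apply: wiener_measurable; exact: (pt_in HG) || exact: (pt_in HG (ltnW kN)).
  + move=> A C FA mC /=; have := wiener_independent BW p0 (lt k) p1 FA mC => /=.
    rewrite /dB; set E1 := [set w | _]; set E2 := [set w | _].
    suff -> : E1 = E2 by [].
    by apply/seteqP; split => w H j; have := H j; rewrite !mxE.
  + move=> C mC; rewrite -(dE k) -(wiener_gaussian BW p0 (lt k) p1 mC); congr (P _).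
    by apply/seteqP; split => w H j; have := H j; rewrite /dB !mxE.
- have k1 := pt_in HG kN; have k0 := pt_in HG (ltnW kN).
  rewrite /dB; under eq_fun do rewrite !mxE; apply: measurable_funB.
    exact: (adapted_gmeas FU (wiener_adapted BW j) k1).
  apply: (gmeas_sub (filtration_grid (ltnW kN)) (filtration_grid kN)).
    by apply: (filtration_monotone FU); [exact: (pt_ge0 HG)|exact: ltW|exact: (pt_leT HG)].
  exact: (adapted_gmeas FU (wiener_adapted BW j) k0).
Qed.

Lemma dB_qv_tight : ptight P \oo (fun D w => \sum_(k < N D) `|dB D k w| ^+ 2).
Proof.
have L D (k : 'I_(N D)) : LG P measurable (fun w => `|dB D k w| ^+ 2).
  apply: LGX => //; have HN := wiener_noise D.
  have L1 := LG_of HN (ltn_ord k) (LG_nexp HN (ltn_ord k) (ler0n _ 1)).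
  apply: (LG_dom sF (g := fun w => Num.sqrt (delta D) * nexp (delta D) 1 (dB D k) w)).
  - apply: gmeas_full; apply: measurable_colnorm => j; exact: (gi_meas (noise_incr HN (ltn_ord k))).
  - exact: LGZ.
  - move=> w; rewrite normr_id [leRHS]ger0_norm; first exact: (norm_beta_le HN w (ltn_ord k)).
    by rewrite mulr_ge0 ?sqrtr_ge0 ?nexp_ge0.
apply: (@ptight_Ex _ _ _ _ _ _ _ _ (r%:R * T)).
  by exists 0%N => // D _; apply: LG_sum => // k _; exact: L.
exists 0%N => // D _ /=; have HN := wiener_noise D.
rewrite (_ : Ex P _ = Ex P (fun w => \sum_(k < N D) `|dB D k w| ^+ 2)); last first.
  by apply: eq_Ex => w; rewrite ger0_norm// sumr_ge0// => k _; rewrite exprn_ge0.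
rewrite (Ex_sum sF); last by move=> k _; exact: L.
rewrite -(grid_end HG D) /pt mulrCA -[N D in leRHS]card_ord -sumr_const mulr_suml.
apply: ler_sum => k _; rewrite mul1r; have HW := noise_incr HN (ltn_ord k).
have Lc j : LG P measurable (fun w => dB D k w j 0 ^+ 2) by apply: LGX => //; exact: (LG_W HW).
apply: (@le_trans _ _ (Ex P (fun w => \sum_(j < r) dB D k w j 0 ^+ 2))).
  apply: (Ex_le sF); [exact: L|by apply: LG_sum => // j _; exact: Lc|].
  by move=> w; exact: colnorm_sqr_le.
rewrite (Ex_sum sF); last by move=> j _; exact: Lc.
rewrite (eq_bigr (fun=> delta D)) => [|j _]; last by rewrite (Ex_W12 HW j).2.
by rewrite sumr_const card_ord mulr_natl.
Qed.

Definition sup_tight (n : nat -> nat) (U : nat -> nat -> Omega -> R) :=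
  forall e, 0 < e -> exists2 K, 0 < K & \forall D \near \oo,
    pr_le P [set w | exists2 k, (k < n D)%N & K < `|U D k w|] e.

(** A weak law of large numbers. Truncation changes the coefficients only on a rare event, and the
    second moment of the truncated sum is at most a constant times the mesh. *)
Lemma bracket_law (U : nat -> nat -> Omega -> R) (n : nat -> nat) j m :
  (forall D, (n D <= N D)%N) ->
  (forall D k, (k < n D)%N -> gmeas (F (pt delta D k)) (U D k)) -> sup_tight n U ->
  ptends P \oo (fun D w => \sum_(k < n D) U D k w * wick (delta D) (dB D) j m k w).
Proof.
move=> nN mU tU; apply: ptends_on => e e0; have [K K0 HK] := tU e e0.
exists (fun D w => \sum_(k < n D) trunc K (U D k w) * wick (delta D) (dB D) j m k w).
exists (fun D => [set w | exists2 k, (k < n D)%N & K < `|U D k w|]); split => //; last first.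
  exists 0%N => // D _ w nQ; rewrite le_eqVlt; apply/orP; left; apply/eqP; congr `|_|.
  apply: eq_bigr => k _; rewrite trunc_id// leNgt; apply/negP => H.
  by apply: nQ; exists k.
have H D := @wick_sum _ _ _ P r _ _ _ _ (wiener_noise D) (fun k w => trunc K (U D k w)) K j m (n D)
   (nN D) (ltW K0) (fun k kn => gmeas_trunc _ (mU D k kn)) (fun k w => trunc_bound _ (ltW K0)).
pose c := T * (4 * K ^+ 2 * gconst r 4).
have c0 : 0 <= c.
  have G1 := gconst_ge1 r (4 : R); apply: mulr_ge0; first exact: ltW.
  by apply: mulr_ge0; [rewrite mulr_ge0 ?sqr_ge0|lra].
have H2 D : Ex P (fun w => (\sum_(k < n D) trunc K (U D k w) * wick (delta D) (dB D) j m k w) ^+ 2) <= c * delta D.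
  apply: le_trans (H D).2 _; have d0 := mesh_gt0 HG D.
  apply: (@le_trans _ _ ((N D)%:R * (4 * delta D ^+ 2 * K ^+ 2 * gconst r 4))).
    rewrite ler_wpM2r ?ler_nat//; have := gconst_ge1 r (4 : R) => *.
    by rewrite !mulr_ge0 ?sqr_ge0//; lra.
  rewrite /c -(grid_end HG D) /pt le_eqVlt; apply/orP; left; apply/eqP; ring.
move=> a a0 b b0.
have ab0 : 0 < a ^+ 2 * b / (c + 1) by rewrite divr_gt0 ?mulr_gt0 ?exprn_gt0// ltr_wpDl.
apply: filterS (mesh_small_near HG ab0) => D dD.
have LH := (H D).1; have a20 : 0 < a ^+ 2 by rewrite exprn_gt0.
have LH2 : LG P measurable (fun w => (\sum_(k < n D) trunc K (U D k w) * wick (delta D) (dB D) j m k w) ^+ 2).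
  by apply: LGX.
apply: pr_le_sub (pr_le_markov LH2 (fun w => sqr_ge0 _) a20).
  by move=> w /= /ltW H'; rewrite -[leRHS]real_normK ?num_real//; apply: lerXn2r; rewrite ?nnegrE ?(ltW a0).
rewrite ler_pdivrMr//; apply: le_trans (H2 D) _; rewrite [b * _]mulrC.
have c10 : 0 < c + 1 by rewrite ltr_wpDl.
rewrite -(@ler_pM2r _ (c + 1)^-1) ?invr_gt0//; apply: le_trans (ltW dD).
rewrite mulrAC ler_piMl ?(ltW (mesh_gt0 HG D))// ler_pdivrMr// mul1r lerDl//.
Qed.

Definition ratio D D' := (N D' %/ N D)%N.

Lemma ratioP D D' : (D <= D')%N ->
  [/\ (0 < ratio D D')%N, delta D = (ratio D D')%:R * delta D' & (N D' = N D * ratio D D')%N].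
Proof.
move=> /(refine T0 HG)[m [m0 dE NE]].
by rewrite /ratio NE mulKn ?(grid_size_gt0 T0 HG).
Qed.

Lemma pt_ratio D D' p : (D <= D')%N -> pt delta D p = pt delta D' (p * ratio D D').
Proof. by move=> /ratioP[_ dE _]; rewrite /pt {1}dE natrM mulrA. Qed.

Lemma block_lt D D' p n i : (D <= D')%N -> (p < n)%N -> (n <= N D)%N -> (i < ratio D D')%N ->
  (p * ratio D D' + i < N D')%N.
Proof.
move=> DD pn nN iR; have [_ _ ->] := ratioP DD.
apply: leq_trans (_ : (p.+1 * ratio D D' <= _)%N); first by rewrite mulSn addnC ltn_add2r.
by rewrite leq_mul2r (leq_trans pn nN) orbT.
Qed.

Lemma block_sum (f : nat -> R) n m : \sum_(p < n) \sum_(i < m) f (p * m + i)%N = \sum_(q < n * m) f q.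
Proof.
elim: n => [|n IH]; first by rewrite mul0n !big_ord0.
rewrite big_ord_recr /= IH -!(big_mkord xpredT f) mulSn addnC (big_cat_nat _ (leq_addr m (n * m)))//=.
congr (_ + _); rewrite -(big_mkord xpredT (fun i => f (n * m + i)%N)).
rewrite -{2}[(n * m)%N]add0n big_addn [(n * m + m)%N]addnC addnK.
by apply: eq_big_nat => i _; rewrite addnC.
Qed.

Lemma fine_block_law (Z : nat -> nat -> Omega -> R) (V : nat * nat -> nat -> Omega -> R)
    (n : nat -> nat) j l :
  (forall D, (n D <= N D)%N) ->
  (forall x k, (x.1 <= x.2)%N -> (k < n x.1 * ratio x.1 x.2)%N -> gmeas (F (pt delta x.2 k)) (V x k)) ->
  sup_tight n Z ->
  (forall e, 0 < e -> prare P iter_near (fun x =>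
    [set w | exists2 q, (q < n x.1 * ratio x.1 x.2)%N & e < `|V x q w|])) ->
  ptends P iter_near (fun x w => \sum_(p < n x.1) Z x.1 p w * dB x.1 p w j 0 *
    \sum_(i < ratio x.1 x.2) V x (p * ratio x.1 x.2 + i)%N w * dB x.2 (p * ratio x.1 x.2 + i)%N w l 0).
Proof.
move=> nN mV tZ rV a a0 e e0.
have e20 : 0 < e / 2 by rewrite divr_gt0.
have e40 : 0 < e / 2 / 2 by rewrite divr_gt0.
have [K K0 HK] := tZ _ e20.
(* With this value Markov's inequality at the level [2 * a / K], applied to a mean of at most
   [2 * eta * T], yields exactly [e / 2 / 2]. *)
pose eta := a * (e / 2 / 2) / (K * T).
have KT0 : 0 < K * T by rewrite mulr_gt0.
have eta0 : 0 < eta by rewrite divr_gt0// mulr_gt0.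
have HK' := iter_near_outer HK.
have near_le : iter_near [set x | (x.1 <= x.2)%N].
  by apply: nearW => D; exists D.
apply: filterS3 near_le HK' (rV eta eta0 _ e40) => -[D D'] /= DD HZ HV.
pose Vt q w := trunc eta (V (D, D') q w).
pose m := ratio D D'.
pose S p w := \sum_(i < m) Vt (p * m + i)%N w * dB D' (p * m + i)%N w l 0.
have [m0 dE NE] := ratioP DD; rewrite -/m in m0 dE NE.
have HN' := wiener_noise D'; have HN := wiener_noise D.
have bl p (pn : (p < n D)%N) : (p * m + m <= n D * m)%N by rewrite addnC -mulSn leq_mul2r pn orbT.
have blN p (pn : (p < n D)%N) : (p * m + m <= N D')%N.
  by apply: leq_trans (bl p pn) _; rewrite NE leq_mul2r nN orbT.
have HS p (pn : (p < n D)%N) := @ito_block _ _ _ P r _ _ _ _ HN' Vt eta l (p * m) m (blN p pn) (ltW eta0)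
  (fun k _ kn => gmeas_trunc eta (mV (D, D') k DD (leq_trans kn (bl p pn))))
  (fun k w => trunc_bound _ (ltW eta0)).
pose H w := \sum_(p < n D) (eta * dB D p w j 0 ^+ 2 + eta^-1 * S p w ^+ 2).
have pN p : (p < n D)%N -> (p < N D)%N by move=> /leq_trans; apply.
have Lb p : (p < n D)%N -> LG P measurable (fun w => dB D p w j 0 ^+ 2).
  by move=> pn; apply: LGX => //; exact: (LG_W (noise_incr HN (pN _ pn))).
have LS p : (p < n D)%N -> LG P measurable (fun w => S p w ^+ 2).
  by move=> pn; apply: LGX => //; exact: (HS p pn).1.
have Lt p : (p < n D)%N -> LG P measurable (fun w => eta * dB D p w j 0 ^+ 2 + eta^-1 * S p w ^+ 2).
  by move=> pn; have L1 := Lb p pn; have L2 := LS p pn; lgt.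
have LH : LG P measurable H by apply: LG_sum => // p _; exact: Lt.
have H0 w : 0 <= H w.
  by apply: sumr_ge0 => p _; rewrite addr_ge0// mulr_ge0 ?sqr_ge0// ?invr_ge0 ltW.
have EH : Ex P H <= 2 * eta * T.
  rewrite (Ex_sum sF); last by move=> p _; exact: Lt.
  apply: (@le_trans _ _ (\sum_(p < n D) 2 * eta * delta D)).
    apply: ler_sum => p _; have L1 := Lb p (ltn_ord p); have L2 := LS p (ltn_ord p).
    rewrite (ExD sF); [|by lgt|by lgt]; rewrite (ExZ sF _ L1) (ExZ sF _ L2).
    rewrite (Ex_W12 (noise_incr HN (pN _ (ltn_ord p))) j).2 -mulrA mulr_natl mulr2n lerD2l.
    rewrite -(@ler_pM2l _ eta)// mulrA divff ?gt_eqF// mul1r.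
    have := (HS p (ltn_ord p)).2; rewrite -dE expr2 -mulrA; apply.
  rewrite sumr_const card_ord -[leLHS]mulr_natl -(grid_end HG D) /pt mulrCA.
  apply: ler_wpM2l; first by rewrite mulr_ge0// ltW.
  by rewrite ler_wpM2r ?ler_nat// ltW// (mesh_gt0 HG).
have aK0 : 0 < 2 * a / K by rewrite divr_gt0 ?mulr_gt0.
have H3 : pr_le P [set w | 2 * a / K <= H w] (e / 2 / 2).
  apply: pr_le_sub (pr_le_markov LH H0 aK0) => //.
  rewrite ler_pdivrMr//; apply: le_trans EH _; rewrite le_eqVlt; apply/orP; left; apply/eqP.
  by rewrite /eta; field; rewrite !gt_eqF.
apply: pr_le_cover HZ (pr_le_cover (@subset_refl _ _) HV H3) => w /= Hw.
have [|nZ] := pselect (exists2 k, (k < n D)%N & K < `|Z D k w|); first by left.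
right; have [|nV] := pselect (exists2 q, (q < n D * m)%N & eta < `|V (D, D') q w|); first by left.
right => /=; apply: ltW.
have Sw p : (p < n D)%N -> \sum_(i < m) V (D, D') (p * m + i)%N w * dB D' (p * m + i)%N w l 0 = S p w.
  move=> pn; apply: eq_bigr => i _; rewrite /Vt trunc_id// leNgt; apply/negP => HV'; apply: nV.
  exists (p * m + i)%N => //; apply: leq_trans (bl p pn); by rewrite ltn_add2l.
rewrite mulrC -ltr_pdivlMl ?invr_gt0// invrK.
rewrite -(@ltr_pM2l _ 2^-1)// mulrA mulVf// mul1r; apply: lt_le_trans Hw _.
apply: le_trans (ler_norm_sum _ _ _) _; rewrite mulr_sumr mulr_sumr; apply: ler_sum => p _.
rewrite Sw// -mulrA normrM.
have ZK : `|Z D p w| <= K by rewrite leNgt; apply/negP => HZ'; apply: nZ; exists p.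
apply: (@le_trans _ _ (K * `|dB D p w j 0 * S p w|)); first by rewrite ler_wpM2r.
rewrite mulrCA ler_pM2l// normrM.
set x := dB D p w j 0; set y := S p w.
by rewrite -normrM; exact: weighted_am_gm.
Qed.

End WienerNoise.

(** * From Stratonovich sums to Ito sums *)

Lemma primitive_increment {R : realType} (F f : R -> R) (a c e T : R) :
  (forall s, s \in `]0, T[ -> is_derive s (1 : R) F (f s)) -> cont_on 0 T F ->
  0 <= a -> a <= c -> c <= T -> (forall s, a <= s -> s <= c -> `|f s - f a| <= e) ->
  `|F c - F a - f a * (c - a)| <= e * (c - a).
Proof.
move=> dF cF a0 ac cT H; pose g (s : R) : R := F s - f a * s; pose dg (s : R) : R := f s - f a.
have -> : F c - F a - f a * (c - a) = g c - g a by rewrite /g; ring.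
have D s : s \in `]a, c[ -> is_derive s (1 : R) g (dg s).
  rewrite in_itv/= => /andP[as_ sc].
  have Ds : is_derive s (1 : R) F (f s) by apply: dF; rewrite in_itv/=; apply/andP; split; lra.
  by apply: is_derive_eq; rewrite /dg /GRing.scale/=; ring.
have C : cont_on a c g.
  have cF' : cont_on a c F := cont_on_sub a0 cT cF.
  have cI : cont_on a c (fun s => f a * s).
    by apply: continuous_subspaceT => s; apply: cvgM; [exact: cvg_cst|exact: cvg_id].
  by move=> s; apply: cvgB; [exact: cF'|exact: cI].
have {}H s : s \in `]a, c[ -> `|dg s| <= e.
  by rewrite in_itv/= => /andP[/ltW as_ /ltW sc]; exact: H.
by move: D C H; generalize g dg => g' dg' D C H; exact: (mvt_le ac D C H).
Qed.

Lemma riemann_sum_le {R : realType} (f : R -> R) (h e T : R) n : 0 < h -> 0 < T -> n%:R * h <= T ->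
  cont_on 0 T f ->
  (forall q s, (q < n)%N -> q%:R * h <= s <= q.+1%:R * h -> `|f s - f (q%:R * h)| <= e) ->
  `|\int[lebesgue_measure]_(s in `[0, n%:R * h]) f s - \sum_(q < n) f (q%:R * h) * h| <= e * (n%:R * h).
Proof.
move=> h0 T0 nT cf H.
have fi : lebesgue_measure.-integrable `[0, T] (EFin \o f).
  by apply: continuous_compact_integrable => //; exact: segment_compact.
pose F (y : R) : R := \int[lebesgue_measure]_(s in `[0, y]) f s.
have cF : cont_on 0 T F by exact: (parameterized_integral_continuous (ltW T0) fi).
have dF s : s \in `]0, T[ -> is_derive s (1 : R) F (f s).
  rewrite in_itv/= => /andP[s0 sT].
  have sT' : s \in `]0, T[ by rewrite in_itv/= s0.
  have cs : {for s, continuous f} := within_continuous_continuous T0 cf sT'.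
  have [D F's] := @continuous_FTC1_closed R f 0 s T sT fi s0 cs.
  by rewrite -F's derive1E; exact: derivableP.
rewrite -/(F _); elim: n nT H => [|n IH] nT H.
  by rewrite big_ord0 mul0r mulr0 subr0 /F set_itv1 Rintegral_set1 normr0.
have nS : n.+1%:R * h = n%:R * h + h by rewrite -natr1 mulrDl mul1r.
have nT' : n%:R * h <= T by rewrite nS in nT; lra.
have n0 : 0 <= n%:R * h by rewrite mulr_ge0// ltW.
have {}IH := IH nT' (fun q s qn => H q s (ltnW qn)).
rewrite big_ord_recr /=; set a := n%:R * h in nS nT' n0 IH *; set c := n.+1%:R * h in nS nT *.
have ac : a <= c by rewrite nS lerDl ltW.
have := primitive_increment dF cF n0 ac nT (e := e) _.
rewrite (_ : c - a = h); last by rewrite nS addrAC subrr add0r.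
move: IH; set S := \sum_(q < n) _; move=> A1 A2.
have {}A2 := A2 (fun s as_ sc => H n s (ltnSn n) (introT andP (conj as_ sc))).
have -> : F c - (S + f a * h) = (F a - S) + (F c - F a - f a * h) by ring.
apply: le_trans (ler_normD _ _) _.
by rewrite (_ : e * c = e * a + e * h); [exact: lerD|rewrite nS mulrDr].
Qed.

Lemma cont_on_lipschitz {R : realType} {v : nat} (f : 'cV[R]_v -> R) (L a c : R) (x : R -> 'cV[R]_v) :
  (forall y z, `|f y - f z| <= L * `|y - z|) -> (forall i, cont_on a c (fun s => x s i 0)) ->
  cont_on a c (fun s => f (x s)).
Proof.
move=> fL cx; apply/subspace_continuousP => t tac; apply/cvgrPdist_le => e e0.
have L1 : 0 < `|L| + 1 by rewrite ltr_wpDl.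
have e1 : 0 < e / (`|L| + 1) by rewrite divr_gt0.
have A : \forall s \near within `[a, c] (nbhs t), forall i, `|x t i 0 - x s i 0| <= e / (`|L| + 1).
  by apply: filter_forall => i; have /subspace_continuousP /(_ t tac) /cvgrPdist_le := cx i; apply.
apply: filterS A => s H; apply: le_trans (fL _ _) _.
have xs : `|x t - x s| <= e / (`|L| + 1).
  by apply: colnorm_le => [|i]; [exact: ltW|have := H i; rewrite !mxE].
apply: (@le_trans _ _ ((`|L| + 1) * (e / (`|L| + 1)))); last by rewrite mulrC divfK// gt_eqF.
apply: (@le_trans _ _ ((`|L| + 1) * `|x t - x s|)); last by rewrite ler_pM2l.
by rewrite ler_wpM2r//; apply: le_trans (ler_norm L) _; rewrite lerDl.
Qed.

Section VectorPath.
Context {R : realType} {disp : measure_display} {Omega : measurableType disp}.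
Variables (P : probability Omega R).

Lemma pr_le_exists v (Q : 'I_v -> set Omega) e : (forall i, pr_le P (Q i) e) ->
  pr_le P [set w | exists i, Q i w] (v%:R * e).
Proof.
move=> H; case: v Q H => [|v] Q H.
  by apply: pr_le_ae; [rewrite mul0r|apply: filterE => w [[]]].
apply: pr_le_sub (pr_le_bigcup (n := v.+1) (Q := fun k => Q (inord k)) (e := e) (fun k _ => H (inord k))) => //.
by move=> w [i Qi]; exists i; rewrite ?inord_val.
Qed.

Lemma prare_exists {I : Type} (Fl : set_system I) {FF : Filter Fl} v (Q : 'I_v -> I -> set Omega) :
  (forall i, prare P Fl (Q i)) -> prare P Fl (fun x => [set w | exists i, Q i x w]).
Proof.
move=> H e e0; have e1 : 0 < e / v.+1%:R by rewrite divr_gt0.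
have A : Fl [set x | forall i, pr_le P (Q i x) (e / v.+1%:R)].
  by apply: filter_forall => i; exact: H.
apply: filterS A => x Hx.
apply: pr_le_sub (pr_le_exists Hx) => //.
by rewrite mulrCA ger_pMr// ler_pdivrMr// mul1r ler_nat.
Qed.

Lemma ptight_rv {I : Type} (Fl : set_system I) {FF : Filter Fl} (f : Omega -> R) :
  measurable_fun setT f -> ptight P Fl (fun _ => f).
Proof.
move=> mf e e0; have m' : forall n : nat, measurable_fun setT (fun w => `|f w|).
  by move=> _; exact: measurableT_comp.
have [|c [c0 Hc]] := @pr_le_bounded_family _ _ _ P _ _ m' _ e0.
  by apply: filterE => w; exists `|f w|.
by exists c => //; apply: filterE => i; apply: pr_le_sub Hc => // w /= H; exists 0%N.
Qed.

Lemma ptends_le_ae {I : Type} (Fl : set_system I) {FF : Filter Fl} (f g : I -> Omega -> R) :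
  Fl [set i | {ae P, forall w, `|f i w| <= `|g i w|}] -> ptends P Fl g -> ptends P Fl f.
Proof.
move=> fg tg e e0 e' e'0; apply: filterS2 fg (tg e e0 e' e'0) => i fgi.
by apply: pr_le_sub_ae; apply: filterS fgi => w H /= H'; exact: lt_le_trans H' H.
Qed.

Variables (T : R) (N : nat -> nat) (delta : nat -> R) (t_ : nat -> nat -> R).
Hypotheses (T0 : 0 < T) (HG : nested_partitions T N delta t_).
Variables (v : nat) (X : R -> Omega -> 'cV[R]_v).
Hypotheses (mX : forall i t, 0 <= t <= T -> measurable_fun setT (fun w => X t w i 0))
  (cX : forall i, ae_continuous P T (fun t w => X t w i 0)).

Definition vosc D e w := exists s t,
  [/\ 0 <= s <= T, 0 <= t <= T, `|s - t| <= delta D & e < `|X s w - X t w|].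

Lemma prare_vosc e : 0 < e -> prare P \oo (fun D => vosc D e).
Proof.
move=> e0; have A := prare_exists (Fl := \oo) (fun i => prare_osc T0 HG (@mX i) (cX i) e0).
refine (prare_sub (Fl := \oo) _ (A _)); exists 0%N => // D _ w [s [t [sT tT st]]].
apply: contraPP => H; apply/negP; rewrite -leNgt; apply: colnorm_le => [|i]; first exact: ltW.
rewrite leNgt; apply/negP => H'; apply: H; exists i, s, t; split => //.
by move: H'; rewrite !mxE.
Qed.

Lemma vpath_bounded e : 0 < e -> exists2 K, 0 < K &
  pr_le P [set w | exists2 t, 0 <= t <= T & K < `|X t w|] e.
Proof.
move=> e0; have e1 : 0 < e / v.+1%:R by rewrite divr_gt0.
have H i := path_bounded T0 HG (@mX i) (cX i) e1.
pose K i := s2val (cid2 (H i)).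
have K0 i : 0 < K i := s2valP (cid2 (H i)).
have S0 : 0 <= \sum_i K i by apply: sumr_ge0 => i _; exact: ltW.
exists (1 + \sum_i K i); first by rewrite ltr_pwDl.
apply: pr_le_sub (pr_le_exists (fun i => s2valP' (cid2 (H i)))); last first.
  by rewrite mulrCA ger_pMr// ler_pdivrMr// mul1r ler_nat.
move=> w [t tT]; apply: contraPP => nH; apply/negP; rewrite -leNgt.
apply: colnorm_le => [|i]; first by rewrite addr_ge0.
rewrite leNgt; apply/negP => H'; apply: nH; exists i => /=; exists t => //.
apply: le_lt_trans H'; rewrite -/(K i) (bigD1 i)//= addrCA lerDl addr_ge0//.
by apply: sumr_ge0 => k _; exact: ltW.
Qed.

Lemma vosc_cell D e w k s : ~ vosc D e w -> (k < N D)%N -> pt delta D k <= s <= pt delta D k.+1 ->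
  `|X s w - X (pt delta D k) w| <= e.
Proof.
move=> no kN /andP[s1 s2]; rewrite leNgt; apply/negP => H; apply: no.
exists s, (pt delta D k); split => //; last first.
- by move: s2; rewrite ptS ger0_norm ?subr_ge0//; lra.
- exact: (pt_in HG (ltnW kN)).
- have := pt_in HG (ltnW kN); have := pt_in HG kN => /andP[_ A] /andP[A' _].
  by apply/andP; split; lra.
Qed.

End VectorPath.

(** * Expansion of the solution along a finer partition *)

Section Expansion.
Context {R : realType} {disp : measure_display} {Omega : measurableType disp} {v r : nat}.
Variables (b : 'cV[R]_v -> 'cV[R]_v) (sigma : 'cV[R]_v -> 'M[R]_(v, r)) (K : R).
Hypothesis cb : coefficient_bounds b sigma K.
Variables (P : probability Omega R) (T : R) (F : R -> set (set Omega)).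
Hypothesis FU : usual_filtration P T F.
Variables (B : R -> Omega -> 'cV[R]_r).
Hypothesis BW : wiener_process P T F B.
Variables (N : nat -> nat) (delta : nat -> R) (t_ : nat -> nat -> R).
Hypotheses (T0 : 0 < T) (HG : nested_partitions T N delta t_).
Variables (x0 : 'cV[R]_v) (X : R -> Omega -> 'cV[R]_v).
Hypothesis HX : stratonovich_sde_solution P T F b sigma x0 B X.

Definition XD D k w := X (pt delta D k) w.

Let dBw := dB B delta.

Lemma sol_semimartingale i : continuous_semimartingale P T F (fun t w => X t w i 0).
Proof. by case: HX. Qed.

Lemma sol_gmeas i t : 0 <= t <= T -> gmeas (F t) (fun w => X t w i 0).
Proof. by move=> tT; have [aX _ _] := sol_semimartingale i; exact: (adapted_gmeas FU aX tT). Qed.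

Lemma sol_measurable i t : 0 <= t <= T -> measurable_fun setT (fun w => X t w i 0).
Proof. by move=> tT; have [aX _ _] := sol_semimartingale i; exact: (adapted_measurable FU aX tT). Qed.

Lemma sol_continuous i : ae_continuous P T (fun t w => X t w i 0).
Proof. by have [] := sol_semimartingale i. Qed.

Lemma sol_comp_gmeas (f : 'cV[R]_v -> R) t : continuous f -> 0 <= t <= T -> gmeas (F t) (fun w => f (X t w)).
Proof.
by move=> cf tT; apply: (measurable_comp_col (T := g_sigma_algebraType (F t))) => // i; exact: sol_gmeas.
Qed.

Lemma sol_comp_measurable (f : 'cV[R]_v -> R) t : continuous f -> 0 <= t <= T ->
  measurable_fun setT (fun w => f (X t w)).
Proof. by move=> cf tT; apply: measurable_comp_col => // i; exact: sol_measurable. Qed.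

Lemma b_continuous i : continuous (fun x => b x i 0).
Proof. exact: lipschitz_continuous (cb_b_lip cb i). Qed.

Lemma sigma_continuous i j : continuous (fun x => sigma x i j).
Proof. exact: lipschitz_continuous (cb_s_lip cb i j). Qed.

Lemma dsigma_continuous i j l : continuous (dsigma sigma i j l).
Proof. exact: lipschitz_continuous (cb_ds_lip cb i j l). Qed.

Lemma prare_sol_osc e : 0 < e -> prare P \oo (fun D => vosc T delta X D e).
Proof.
apply: (prare_vosc T0 HG); [exact: sol_measurable|exact: sol_continuous].
Qed.

Lemma sol_bounded e : 0 < e -> exists2 n, 0 < n &
  pr_le P [set w | exists2 t, 0 <= t <= T & n < `|X t w|] e.
Proof. by apply: (vpath_bounded T0 HG); [exact: sol_measurable|exact: sol_continuous]. Qed.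

Definition strat_step D q w i := b (XD D q w) i 0 * delta D +
  \sum_(j < r) (sigma (XD D q w) i j + sigma (XD D q.+1 w) i j) / 2 * dBw D q w j 0.

(** The coarse point [k] of the grid [d] stays fixed while [D] grows; for [d <= D],
    [k * ratio N d D] is the index of the same time on the fine grid. *)
Definition expansion_error d D k w i := X (pt delta d k) w i 0 - x0 i 0 -
  \sum_(q < k * ratio N d D) strat_step D q w i.

Lemma expansion_cvg d k i : (k <= N d)%N -> ptends P \oo (fun D w => expansion_error d D k w i).
Proof.
move=> kN; have [_ _ HI] := HX.
have tT := pt_in HG kN; have [I [SI XE]] := HI _ tT.
pose bint w := \int[lebesgue_measure]_(s in `[0, pt delta d k]) b (X s w) i 0.
pose bsum D w := \sum_(q < k * ratio N d D) b (XD D q w) i 0 * delta D.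
pose S j D w := stratonovich_sum (fun s w => sigma (X s w) i j) (fun s w => B s w j 0)
  (grid delta D (k * ratio N d D)) w.
have kR D : (d <= D)%N -> (k * ratio N d D <= N D)%N.
  by move=> dD; have [_ _ ->] := ratioP T0 HG dD; rewrite leq_mul2r kN orbT.
have ptR D : (d <= D)%N -> pt delta d k = pt delta D (k * ratio N d D).
  by move=> dD; exact: (pt_ratio T0 HG).
have tb : ptends P \oo (fun D w => bint w - bsum D w).
  have cx : {ae P, forall w, forall i, cont_on 0 T (fun s => X s w i 0)}.
    by apply: filter_forall => l; exact: sol_continuous.
  apply: ptendsP => e e0.
  have c0 : 0 < K * T + 1 by rewrite ltr_wpDl// mulr_ge0 ?(ltW T0)//; have := cb_ge1 cb; lra.
  have e1 : 0 < e / (K * T + 1) by rewrite divr_gt0.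
  apply: filterS2 (prare_sol_osc e1 e0) (_ : \forall D \near \oo, (d <= D)%N); last by exists d.
  move=> D + dD; apply: pr_le_sub_ae; apply: filterS cx => w cx /=; apply: contraPP => no.
  apply/negP; rewrite -leNgt /bint /bsum (ptR _ dD).
  have cf : cont_on 0 T (fun s => b (X s w) i 0).
    exact: (cont_on_lipschitz (cb_b_lip cb i) cx).
  have nT : (k * ratio N d D)%:R * delta D <= T by exact: (pt_leT HG (kR _ dD)).
  apply: le_trans (riemann_sum_le (e := K * (e / (K * T + 1))) (mesh_gt0 HG D) T0 nT cf _) _.
    move=> q s qn sq; apply: le_trans (cb_b_lip cb _ _ _) _.
    rewrite ler_pM2l; last by have := cb_ge1 cb; lra.
    by apply: (vosc_cell HG no) => //; exact: leq_trans qn (kR _ dD).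
  apply: (@le_trans _ _ (K * (e / (K * T + 1)) * T)).
    by apply: ler_wpM2l => //; rewrite mulr_ge0 ?(ltW e1)//; have := cb_ge1 cb; lra.
  rewrite (_ : _ * T = (K * T) * e / (K * T + 1)); last by ring.
  by rewrite ler_pdivrMr// mulrC ler_pM2l// lerDl.
have ts j : ptends P \oo (fun D w => I i j w - S j D w).
  have [mI HS] := SI i j; apply: ptendsP => e e0; have [eta eta0 He] := HS e e0.
  apply: filterS2 (mesh_small_near HG eta0) (_ : \forall D \near \oo, (d <= D)%N); last by exists d.
  move=> D Deta dD; have := He (grid delta D (k * ratio N d D)).
  rewrite (ptR _ dD) => /(_ (grid_partition HG _ _)) H.
  have {}H : (P [set w | (e <= `|S j D w - I i j w|)%R] < e%:E)%E.
    apply: H => q; rewrite size_grid => qn.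
    by rewrite !grid_nth ?ptS// ?(ltnW qn)// addrAC subrr add0r.
  apply: pr_le_sub (pr_le_measurable _ (ltW H)) => //.
    by move=> w /= /ltW; rewrite distrC.
  rewrite (_ : [set w | _] = (fun w => `|S j D w - I i j w|) @^-1` `[e, +oo[); last first.
    by apply/seteqP; split => w /=; rewrite in_itv/= andbT.
  rewrite -[X in measurable X]setTI; apply: measurableT_comp => //; apply: measurable_funB => //.
  rewrite /S /stratonovich_sum size_grid; apply: measurable_sum => q.
  have q1 : 0 <= pt delta D q.+1 <= T by apply: (pt_in HG); exact: leq_trans (ltn_ord q) (kR _ dD).
  have q0 : 0 <= pt delta D q <= T by apply: (pt_in HG); exact: ltnW (leq_trans (ltn_ord q) (kR _ dD)).
  rewrite (grid_nth _ _ _ (ltn_ord q)) (grid_nth _ _ _ (ltnW (ltn_ord q))).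
  apply: measurable_funM; last by apply: measurable_funB; exact: (wiener_measurable FU BW).
  apply: measurable_funM => //; apply: measurable_funD.
    refine (sol_comp_measurable (@sigma_continuous i j) q0).
  refine (sol_comp_measurable (@sigma_continuous i j) q1).
apply: (ptends_le_ae (Fl := \oo) (g := fun D w => (bint w - bsum D w) + \sum_(j < r) (I i j w - S j D w))).
  exists d => // D dD /=; apply: filterS XE => w XE.
  rewrite le_eqVlt; apply/orP; left; apply/eqP; congr `|_|.
  rewrite /expansion_error XE -/(bint w) sumrB /strat_step big_split/= -/(bsum D w).
  have -> : \sum_(q < k * ratio N d D) \sum_(j < r) (sigma (XD D q w) i j + sigma (XD D q.+1 w) i j) / 2 * dBw D q w j 0
     = \sum_(j < r) S j D w.
    rewrite exchange_big /=; apply: eq_bigr => j _; rewrite /S /stratonovich_sum size_grid.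
    apply: eq_bigr => q _; rewrite (grid_nth _ _ _ (ltn_ord q)) (grid_nth _ _ _ (ltnW (ltn_ord q))).
    by rewrite /dBw /dB !mxE.
  by ring.
by apply: ptendsD => //; apply: ptends_sum.
Qed.

Lemma ptends_small_sum {I : Type} (Fl : set_system I) {FF : Filter Fl} (a c : I -> nat -> Omega -> R) (n : I -> nat) :
  (forall e, 0 < e -> prare P Fl (fun x => [set w | exists2 k, (k < n x)%N & e < `|a x k w|])) ->
  ptight P Fl (fun x w => \sum_(k < n x) `|c x k w|) ->
  ptends P Fl (fun x w => \sum_(k < n x) a x k w * c x k w).
Proof.
move=> Ha Hc; apply: ptendsP => e e0; have e20 : 0 < e / 2 by rewrite divr_gt0.
have [L L0 HL] := Hc _ e20; have eL : 0 < e / L by rewrite divr_gt0.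
apply: filterS2 (Ha _ eL _ e20) HL => x H1 H2; apply: pr_le_cover H1 H2 => w /= H.
have [|nE] := pselect (exists2 k, (k < n x)%N & e / L < `|a x k w|); first by left.
right; rewrite /= ger0_norm; last exact: sumr_ge0.
rewrite -(@ltr_pM2l _ (e / L))// divfK ?gt_eqF//; apply: lt_le_trans H _.
apply: le_trans (ler_norm_sum _ _ _) _; rewrite mulr_sumr; apply: ler_sum => k _.
rewrite normrM ler_wpM2r// leNgt; apply/negP => Hk; apply: nE; by exists k.
Qed.

Lemma sum_nat_le (f : nat -> R) p q : (p <= q)%N -> (forall k, 0 <= f k) ->
  \sum_(k < p) f k <= \sum_(k < q) f k.
Proof.
by move=> pq f0; rewrite -(subnKC pq) big_split_ord /= lerDl; apply: sumr_ge0 => k _.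
Qed.

Definition QX D w := \sum_(l < v) qv N delta (fun t w => X t w l 0) D w.

Lemma QX_ge0 D w : 0 <= QX D w.
Proof. by apply: sumr_ge0 => l _; apply: sumr_ge0 => k _; rewrite sqr_ge0. Qed.

Lemma QX_tight : ptight P \oo QX.
Proof.
apply: ptight_sum => l e e0.
have [L L0 HL] := semimartingale_qv FU T0 HG (sol_semimartingale l) e0.
exists L => //; exists 0%N => // D _; apply: pr_le_sub (HL D) => // w /=.
by rewrite ger0_norm//; apply: sumr_ge0 => k _; rewrite sqr_ge0.
Qed.

Lemma sum_dX_le n D w : (n <= N D)%N -> \sum_(q < n) `|XD D q.+1 w - XD D q w| ^+ 2 <= QX D w.
Proof.
move=> nN; rewrite /QX /qv exchange_big /=.
apply: (@le_trans _ _ (\sum_(q < N D) `|XD D q.+1 w - XD D q w| ^+ 2)).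
  rewrite -(subnKC nN) big_split_ord /= lerDl; apply: sumr_ge0 => k _; exact: sqr_ge0.
apply: ler_sum => q _; apply: le_trans (colnorm_sqr_le _) _.
by rewrite le_eqVlt; apply/orP; left; apply/eqP; apply: eq_bigr => l _; rewrite !mxE.
Qed.

Lemma XD_bound n D k w : (forall t, 0 <= t <= T -> `|X t w| <= n) -> (k <= N D)%N -> `|XD D k w| <= n.
Proof. by move=> H kN; apply: H; exact: (pt_in HG). Qed.

Lemma prare_dB j e : 0 < e ->
  prare P \oo (fun D => [set w | exists2 k, (k < N D)%N & e < `|dBw D k w j 0|]).
Proof.
move=> e0; have A : prare P \oo (fun D => vosc T delta B D e).
  by apply: (prare_vosc T0 HG) => //; [move=> i t; exact: (wiener_measurable FU BW)|exact: (wiener_continuous BW)].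
refine (prare_sub (Fl := \oo) _ A); exists 0%N => // D _ w [k kN H].
exists (pt delta D k.+1), (pt delta D k); split.
- exact: (pt_in HG).
- exact: (pt_in HG (ltnW kN)).
- by rewrite ptS addrAC subrr add0r ger0_norm// ltW// (mesh_gt0 HG).
- by apply: lt_le_trans H _; exact: colnorm_ge.
Qed.

Section Bracket.
Variables (n : nat -> nat) (i : 'I_v) (j : 'I_r).
Hypothesis nN : forall D, (n D <= N D)%N.

Let Z l D p w := dsigma sigma i j l (XD D p w).
Let tau D p w := sigma (XD D p.+1 w) i j - sigma (XD D p w) i j -
  \sum_l Z l D p w * (XD D p.+1 w l 0 - XD D p w l 0).

(* Discrete covariation of [sigma(X)] and [B] minus its limit; [bracket_split]
   below expands it along a finer partition [D'] into the terms [tau], [t2], ..., [t6]. *)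
Definition bracket_error D w := \sum_(p < n D)
  ((sigma (XD D p.+1 w) i j - sigma (XD D p w) i j) * dBw D p w j 0 -
   drift_rate sigma i j j (XD D p w) * delta D).

Let m D D' := ratio N D D'.
(** In order: the error of the fine expansion, its drift, the half increments of the symmetric sums,
    the variation of [sigma] inside a coarse cell, and the centred products of coarse increments. *)
Let t2 l D D' p w := dBw D p w j 0 * (Z l D p w *
  (expansion_error D D' p.+1 w l - expansion_error D D' p w l)).
Let t3 l D D' p w := dBw D p w j 0 * (Z l D p w *
  \sum_(q < m D D') b (XD D' (p * m D D' + q) w) l 0 * delta D').
Let t4 l c D D' p w := dBw D p w j 0 * (Z l D p w *
  \sum_(q < m D D') (sigma (XD D' (p * m D D' + q).+1 w) l c - sigma (XD D' (p * m D D' + q) w) l c) / 2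
     * dBw D' (p * m D D' + q)%N w c 0).
Let t5 l c D D' p w := Z l D p w * dBw D p w j 0 *
  \sum_(q < m D D') (sigma (XD D' (p * m D D' + q) w) l c - sigma (XD D p w) l c)
     * dBw D' (p * m D D' + q)%N w c 0.
Let t6 l c D p w := Z l D p w * sigma (XD D p w) l c * wick (delta D) (dBw D) j c p w.

Lemma dB_block D D' p c w : (D <= D')%N ->
  \sum_(q < m D D') dBw D' (p * m D D' + q)%N w c 0 = dBw D p w c 0.
Proof.
move=> DD; rewrite /dBw /dB !mxE !(pt_ratio T0 HG _ DD) -/(m D D').
pose f q := B (pt delta D' (p * m D D' + q)) w c 0.
rewrite (eq_bigr (fun q : 'I__ => f q.+1 - f q)); last by move=> q _; rewrite /f addnS !mxE.
rewrite -(big_mkord xpredT (fun q => f q.+1 - f q)) telescope_sumr// /f addn0.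
by rewrite mulSn addnC.
Qed.

Lemma increment_expansion D D' p l w : (D <= D')%N ->
  XD D p.+1 w l 0 - XD D p w l 0 = (expansion_error D D' p.+1 w l - expansion_error D D' p w l) +
    \sum_(q < m D D') strat_step D' (p * m D D' + q) w l.
Proof.
move=> DD; rewrite /expansion_error -!(block_sum (fun q => strat_step D' q w l)) big_ord_recr /=.
by rewrite /XD -/(m D D'); ring.
Qed.

(** [sigma] is expanded at the left end of the coarse cell, and the coarse increment of [X] is
    replaced by its fine expansion. The leading part then consists of products of coarse Wiener
    increments, and subtracting [drift_rate * delta] centres them. *)
Lemma bracket_term D D' p w : (D <= D')%N ->
  (sigma (XD D p.+1 w) i j - sigma (XD D p w) i j) * dBw D p w j 0 -
   drift_rate sigma i j j (XD D p w) * delta D =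
  dBw D p w j 0 * tau D p w + \sum_l (t2 l D D' p w + t3 l D D' p w +
    \sum_(c < r) (t4 l c D D' p w + t5 l c D D' p w + t6 l c D p w)).
Proof.
move=> DD; rewrite /tau mulrBr [dBw _ _ _ _ _ * (_ - _)]mulrC -[RHS]addrA; congr (_ + _).
rewrite mulr_sumr /drift_rate mulr_suml -!sumrN -big_split /=.
transitivity (\sum_l (- (dBw D p w j 0 * (Z l D p w * (XD D p.+1 w l 0 - XD D p w l 0))) +
  (dBw D p w j 0 * (Z l D p w * (XD D p.+1 w l 0 - XD D p w l 0)) -
   dsigma sigma i j l (XD D p w) * sigma (XD D p w) l j * delta D))).
  by apply: eq_bigr => l _; ring.
apply: eq_bigr => l _; congr (_ + _).
rewrite (increment_expansion _ _ _ DD) /strat_step big_split /= exchange_big /=.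
have dist (a z x y1 y2 q : R) : a * (z * (x + (y1 + y2))) - q = a * (z * x) + (a * (z * y1) + (a * (z * y2) - q)).
  by ring.
rewrite dist -[RHS]addrA; congr (_ + (_ + _)).
(* The symmetric mean is the left value plus half an increment, and the left value is the value at
   the coarse point plus a variation inside the cell; the part with constant coefficient sums to the
   coarse increment of [B]. *)
have C c : \sum_(q < m D D') (sigma (XD D' (p * m D D' + q) w) l c + sigma (XD D' (p * m D D' + q).+1 w) l c) / 2
     * dBw D' (p * m D D' + q)%N w c 0 =
   \sum_(q < m D D') (sigma (XD D' (p * m D D' + q).+1 w) l c - sigma (XD D' (p * m D D' + q) w) l c) / 2
     * dBw D' (p * m D D' + q)%N w c 0 +
   \sum_(q < m D D') (sigma (XD D' (p * m D D' + q) w) l c - sigma (XD D p w) l c)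
     * dBw D' (p * m D D' + q)%N w c 0 + sigma (XD D p w) l c * dBw D p w c 0.
  rewrite -(dB_block p c w DD) mulr_sumr -!big_split /=; apply: eq_bigr => q _.
  by field.
rewrite (eq_bigr _ (fun c _ => C c)) mulr_sumr mulr_sumr.
have -> : dsigma sigma i j l (XD D p w) * sigma (XD D p w) l j * delta D =
  \sum_(c < r) Z l D p w * sigma (XD D p w) l c * ((j == c)%:R * delta D).
  rewrite (bigD1 j)//= eqxx mul1r big1 ?addr0// => c cj.
  by rewrite eq_sym (negbTE cj) mul0r mulr0.
rewrite -sumrB; apply: eq_bigr => c _; rewrite /t4 /t5 /t6 /wick; ring.
Qed.

Lemma bracket_split D D' w : (D <= D')%N -> bracket_error D w =
  \sum_(p < n D) dBw D p w j 0 * tau D p w +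
  \sum_l (\sum_(p < n D) t2 l D D' p w + \sum_(p < n D) t3 l D D' p w +
    \sum_(c < r) (\sum_(p < n D) t4 l c D D' p w + \sum_(p < n D) t5 l c D D' p w +
      \sum_(p < n D) t6 l c D p w)).
Proof.
move=> DD; rewrite /bracket_error (eq_bigr _ (fun (p : 'I_(n D)) _ => bracket_term p w DD)) big_split /=.
congr (_ + _); rewrite exchange_big /=; apply: eq_bigr => l _.
rewrite big_split /=; congr (_ + _); first by rewrite big_split.
by rewrite exchange_big /=; apply: eq_bigr => c _; rewrite !big_split.
Qed.

Lemma sqr_sum_le (a c : R) : `|a / 2 * c| <= a ^+ 2 + c ^+ 2.
Proof.
rewrite normrM normrM normfV (@ger0_norm _ 2)//.
rewrite -[a ^+ 2]real_normK ?num_real// -[c ^+ 2]real_normK ?num_real//.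
have := sqr_ge0 (`|a| - `|c|); have := normr_ge0 a; have := normr_ge0 c; nra.
Qed.

(** The Taylor remainder is bounded by the squared increment of [X], whose sums are tight, and the
    increments of [B] are uniformly small. *)
Lemma tau_tends : ptends P \oo (fun D w => \sum_(p < n D) dBw D p w j 0 * tau D p w).
Proof.
refine (ptends_small_sum (Fl := \oo) (a := fun D p w => dBw D p w j 0) (c := tau) (n := n) _ _).
  move=> e e0; refine (prare_sub (Fl := \oo) _ (prare_dB j e0)); exists 0%N => // D _ w [k kn H].
  by exists k => //; exact: leq_trans kn (nN D).
apply: (ptight_le (Fl := \oo) (g := fun D w => K * QX D w)); last first.
  by apply: ptightM; [exact: ptight_cst|exact: QX_tight].
exists 0%N => // D _ w; rewrite ger0_norm; last exact: sumr_ge0.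
have K0 : 0 <= K by have := cb_ge1 cb; lra.
rewrite ger0_norm; last by rewrite mulr_ge0// QX_ge0.
apply: le_trans (ler_wpM2l K0 (sum_dX_le w (nN D))).
rewrite mulr_sumr; apply: ler_sum => p _; exact: (cb_taylor cb).
Qed.

Lemma Z_bound l D p w : `|Z l D p w| <= K.
Proof. exact: (cb_ds_bound cb). Qed.

Let K0 : 0 <= K. Proof. by have := cb_ge1 cb; lra. Qed.

Lemma prare_dB_outer e : 0 < e -> prare P iter_near (fun x =>
  [set w | exists2 k, (k < n x.1)%N & e < `|dBw x.1 k w j 0|]).
Proof.
move=> e0; refine (prare_sub _ (prare_to_outer (prare_dB j e0))).
by apply: filterE => x w [k kn H]; exists k => //; exact: leq_trans kn (nN x.1).
Qed.

Lemma iter_near_le : iter_near [set x | (x.1 <= x.2)%N].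
Proof. by exists 0%N => // d _; exists d. Qed.

(** For a fixed coarse grid there are finitely many terms, each tending to 0 with the fine mesh but
    without a rate. This term dictates the order of the two limits. *)
Lemma t2_tends l : ptends P iter_near (fun x w => \sum_(p < n x.1) t2 l x.1 x.2 p w).
Proof.
apply: (@ptends_iter _ _ _ P (fun x w => \sum_(p < n x.1) t2 l x.1 x.2 p w)) => D /=.
apply: (@ptends_sum _ _ _ P _ \oo _ _ _ (fun (p : 'I_(n D)) D' w => t2 l D D' p w)) => p.
have pN := leq_trans (ltn_ord p) (nN D).
have te : ptends P \oo (fun D' w => expansion_error D D' p.+1 w l - expansion_error D D' p w l).
  by apply: ptendsB; apply: expansion_cvg => //; exact: ltnW.
have tr : ptight P \oo (fun (_ : nat) w => dBw D p w j 0 * Z l D p w).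
  refine (@ptight_rv _ _ _ P _ \oo _ _ _); apply: measurable_funM; last first.
    exact: (sol_comp_measurable (@dsigma_continuous i j l) (pt_in HG (ltnW pN))).
  exact: (gi_meas (noise_incr (wiener_noise FU BW HG D) pN)).
apply: ptends_le (ptendsM te tr); exists 0%N => // D' _ w.
by rewrite le_eqVlt; apply/orP; left; apply/eqP; congr `|_|; rewrite /t2; ring.
Qed.

(** On a bounded path the sums of the drift are bounded, and each block is multiplied by a uniformly
    small increment of [B]. *)
Lemma t3_tends l : ptends P iter_near (fun x w => \sum_(p < n x.1) t3 l x.1 x.2 p w).
Proof.
refine (ptends_small_sum (a := fun x p w => dBw x.1 p w j 0) (c := fun x p w => Z l x.1 p w *
  \sum_(q < m x.1 x.2) b (XD x.2 (p * m x.1 x.2 + q) w) l 0 * delta x.2) (n := fun x => n x.1) _ _).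
  by move=> e e0; exact: prare_dB_outer.
move=> e e0; have [c c0 Hc] := sol_bounded e0.
have L0 : 0 < K * (K * (1 + c) * T) + 1 by rewrite ltr_wpDl// !mulr_ge0 ?addr_ge0 ?(ltW c0)// ltW.
exists (K * (K * (1 + c) * T) + 1) => //.
apply: filterS iter_near_le => -[D D'] /= DD; apply: pr_le_sub Hc => // w /=.
apply: contraPP => nE; apply/negP; rewrite -leNgt ger0_norm; last exact: sumr_ge0.
have Xc t : 0 <= t <= T -> `|X t w| <= c.
  by move=> tT; rewrite leNgt; apply/negP => H; apply: nE; exists t.
apply: (@le_trans _ _ (K * (K * (1 + c) * T))); last by rewrite lerDl.
apply: (@le_trans _ _ (\sum_(p < n D) K * \sum_(q < m D D') K * (1 + c) * delta D')).
  apply: ler_sum => p _; rewrite normrM; apply: ler_pM => //; first exact: Z_bound.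
  apply: le_trans (ler_norm_sum _ _ _) _; apply: ler_sum => q _.
  rewrite normrM (gtr0_norm (mesh_gt0 HG D')) ler_wpM2r ?(ltW (mesh_gt0 HG D'))//.
  apply: le_trans (cb_b_growth cb _ _) _; rewrite ler_wpM2l// lerD2l; apply: XD_bound Xc _.
  exact: ltnW (block_lt T0 HG DD (ltn_ord p) (nN D) (ltn_ord q)).
rewrite -mulr_sumr ler_wpM2l// (block_sum (fun _ => K * (1 + c) * delta D')) sumr_const card_ord.
rewrite -[leLHS]mulr_natl mulrCA ler_wpM2l ?mulr_ge0 ?addr_ge0 ?(ltW c0)//.
apply: (pt_leT HG (d := D')); have [_ _ ->] := ratioP T0 HG DD.
by rewrite leq_mul2r nN orbT.
Qed.

(** The products of fine increments are bounded by the fine quadratic variations of [X] and [B],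
    which are tight; the coarse increment supplies the small factor. *)
Lemma t4_tends l c : ptends P iter_near (fun x w => \sum_(p < n x.1) t4 l c x.1 x.2 p w).
Proof.
refine (ptends_small_sum (a := fun x p w => dBw x.1 p w j 0) (c := fun x p w => Z l x.1 p w *
  \sum_(q < m x.1 x.2) (sigma (XD x.2 (p * m x.1 x.2 + q).+1 w) l c - sigma (XD x.2 (p * m x.1 x.2 + q) w) l c) / 2
     * dBw x.2 (p * m x.1 x.2 + q)%N w c 0) (n := fun x => n x.1) _ _).
  by move=> e e0; exact: prare_dB_outer.
have tg : ptight P iter_near (fun x w => K * (K ^+ 2 * QX x.2 w + \sum_(k < N x.2) `|dBw x.2 k w| ^+ 2)).
  apply: (@ptight_to_inner _ _ _ P (fun D w => K * (K ^+ 2 * QX D w + \sum_(k < N D) `|dBw D k w| ^+ 2))).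
  apply: ptightM; first exact: ptight_cst.
  apply: ptightD; last exact: (dB_qv_tight FU BW HG).
  by apply: ptightM; [exact: ptight_cst|exact: QX_tight].
apply: ptight_le tg; apply: filterS iter_near_le => -[D D'] /= DD w.
have Q0 : 0 <= \sum_(k < N D') `|dBw D' k w| ^+ 2 by apply: sumr_ge0 => k _; rewrite sqr_ge0.
rewrite ger0_norm; last exact: sumr_ge0.
rewrite ger0_norm; last by rewrite mulr_ge0// addr_ge0// mulr_ge0 ?sqr_ge0// QX_ge0.
pose f q := K ^+ 2 * `|XD D' q.+1 w - XD D' q w| ^+ 2 + `|dBw D' q w| ^+ 2.
apply: (@le_trans _ _ (\sum_(p < n D) K * \sum_(q < m D D') f (p * m D D' + q)%N)).
  apply: ler_sum => p _; rewrite normrM; apply: ler_pM => //; first exact: Z_bound.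
  apply: le_trans (ler_norm_sum _ _ _) _; apply: ler_sum => q _.
  apply: le_trans (sqr_sum_le _ _) _; rewrite /f; apply: lerD.
    rewrite -exprMn -[leLHS]real_normK ?num_real//; apply: lerXn2r; rewrite ?nnegrE ?mulr_ge0//.
    exact: (cb_s_lip cb).
  rewrite -[leLHS]real_normK ?num_real//; apply: lerXn2r; rewrite ?nnegrE//; exact: colnorm_ge.
have le2 : (n D * m D D' <= N D')%N.
  by have [_ _ ->] := ratioP T0 HG DD; rewrite leq_mul2r nN orbT.
rewrite -mulr_sumr ler_wpM2l// (block_sum f) /f big_split /=; apply: lerD.
  by rewrite -mulr_sumr ler_wpM2l ?sqr_ge0//; exact: sum_dX_le.
exact: (sum_nat_le (f := fun k => `|dBw D' k w| ^+ 2) le2 (fun k => sqr_ge0 _)).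
Qed.

Lemma XD_osc D D' q e w : (D <= D')%N -> (q < n D * m D D')%N -> ~ vosc T delta X D e w ->
  `|XD D' q w - XD D (q %/ m D D') w| <= e.
Proof.
move=> DD qn no; have [m0 _ NE] := ratioP T0 HG DD.
have pn : (q %/ m D D' < n D)%N by rewrite ltn_divLR.
have pN := leq_trans pn (nN D).
apply: (vosc_cell HG no pN); rewrite !(pt_ratio T0 HG _ DD); apply/andP; split.
  by apply: (pt_le HG); exact: leq_trunc_div.
by apply: (pt_le HG); rewrite ltnW// ltn_ceil.
Qed.

(** [fine_block_law] applies with the variation of [sigma (X)] inside a coarse cell as integrand,
    small by uniform continuity of the path. *)
Lemma t5_tends l c : ptends P iter_near (fun x w => \sum_(p < n x.1) t5 l c x.1 x.2 p w).
Proof.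
pose V (x : nat * nat) q w := sigma (XD x.2 q w) l c - sigma (XD x.1 (q %/ m x.1 x.2) w) l c.
have H := @fine_block_law _ _ _ _ P T F FU B BW N delta t_ T0 HG (Z l) V n j c nN.
apply: ptends_le (H _ _ _); last 3 first.
- move=> -[D D'] q /= DD qn; have [m0 _ NE] := ratioP T0 HG DD.
  have pn : (q %/ m D D' < n D)%N by rewrite ltn_divLR.
  have pN := ltnW (leq_trans pn (nN D)).
  have qN : (q <= N D')%N by apply: ltnW; apply: leq_trans qn _; rewrite NE leq_mul2r nN orbT.
  have q1 := pt_in HG qN; have p1 := pt_in HG pN.
  apply: measurable_funB; first exact: (sol_comp_gmeas (@sigma_continuous l c) q1).
  have G := sol_comp_gmeas (@sigma_continuous l c) p1.
  apply: (gmeas_sub (filtration_sub_sigma FU p1) (filtration_sub_sigma FU q1) _ G).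
  apply: (filtration_monotone FU); [by case/andP: p1| |by case/andP: q1].
  by rewrite (pt_ratio T0 HG _ DD); apply: (pt_le HG); exact: leq_trunc_div.
- move=> e e0; exists (K + 1); first by rewrite ltr_wpDl.
  exists 0%N => // D _; apply: pr_le_ae; first exact: ltW.
  apply: filterE => w [k _ H']; have := Z_bound l D k w; lra.
- move=> e e0; have K1 : 0 < K by have := cb_ge1 cb; lra.
  have e1 : 0 < e / K by rewrite divr_gt0.
  refine (prare_sub _ (prare_to_outer (prare_sol_osc e1))).
  apply: filterS iter_near_le => -[D D'] /= DD w [q qn]; apply: contraPP => no.
  apply/negP; rewrite -leNgt; apply: le_trans (cb_s_lip cb _ _ _ _) _.
  by rewrite mulrC -ler_pdivlMr//; exact: XD_osc.
apply: filterS iter_near_le => -[D D'] /= DD w; have [m0 _ NE] := ratioP T0 HG DD.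
rewrite le_eqVlt; apply/orP; left; apply/eqP; congr `|_|; apply: eq_bigr => p _.
congr (_ * _); apply: eq_bigr => q _.
by rewrite /V/= /m divnMDl// divn_small ?addn0.
Qed.

Lemma t6_tends l c : ptends P \oo (fun D w => \sum_(p < n D) t6 l c D p w).
Proof.
have := @bracket_law _ _ _ _ P T F FU B BW N delta t_ T0 HG
  (fun D p w => Z l D p w * sigma (XD D p w) l c) n j c nN; apply.
- move=> D p pn; have pN := pt_in HG (ltnW (leq_trans pn (nN D))).
  apply: measurable_funM; first exact: (sol_comp_gmeas (@dsigma_continuous i j l) pN).
  exact: (sol_comp_gmeas (@sigma_continuous l c) pN).
- move=> e e0; have [a a0 Ha] := sol_bounded e0.
  have L0 : 0 < K * (K * (1 + a)) + 1 by rewrite ltr_wpDl// !mulr_ge0// addr_ge0// ltW.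
  exists (K * (K * (1 + a)) + 1) => //; exists 0%N => // D _.
  apply: pr_le_sub Ha => // w [k kn]; apply: contraPP => nE; apply/negP; rewrite -leNgt.
  have Xc t : 0 <= t <= T -> `|X t w| <= a.
    by move=> tT; rewrite leNgt; apply/negP => H; apply: nE; exists t.
  apply: (@le_trans _ _ (K * (K * (1 + a)))); last by rewrite lerDl.
  rewrite normrM; apply: ler_pM => //; first exact: Z_bound.
  apply: le_trans (cb_s_growth cb _ _ _) _; rewrite ler_wpM2l// lerD2l.
  by apply: XD_bound Xc _; exact: ltnW (leq_trans kn (nN D)).
Qed.

Lemma bracket_cvg : ptends P \oo bracket_error.
Proof.
apply: ptends_outer.
apply: (@ptends_le _ _ _ P _ iter_near _ _ (fun x w => \sum_(p < n x.1) dBw x.1 p w j 0 * tau x.1 p w +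
  \sum_l (\sum_(p < n x.1) t2 l x.1 x.2 p w + \sum_(p < n x.1) t3 l x.1 x.2 p w +
    \sum_(c < r) (\sum_(p < n x.1) t4 l c x.1 x.2 p w + \sum_(p < n x.1) t5 l c x.1 x.2 p w +
      \sum_(p < n x.1) t6 l c x.1 p w)))).
  apply: filterS iter_near_le => -[D D'] /= DD w.
  by rewrite -(bracket_split w DD).
apply: ptendsD; first exact: (ptends_to_outer tau_tends).
apply: ptends_sum => l; apply: ptendsD.
  by apply: ptendsD; [exact: t2_tends|exact: t3_tends].
apply: ptends_sum => c; apply: ptendsD; last exact: (ptends_to_outer (t6_tends l c)).
by apply: ptendsD; [exact: t4_tends|exact: t5_tends].
Qed.

End Bracket.

Definition ito_step D q w i := (b (XD D q w) i 0 + 2^-1 * \sum_(j < r) drift_rate sigma i j j (XD D q w)) * delta D +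
  \sum_(j < r) sigma (XD D q w) i j * dBw D q w j 0.

Definition ito_error d D k w i := X (pt delta d k) w i 0 - x0 i 0 -
  \sum_(q < k * ratio N d D) ito_step D q w i.

(** The symmetric value exceeds the left one by half an increment of [sigma (X)], so that the two
    expansions differ by half of [bracket_error] for each column. *)
Lemma ito_expansion_cvg d k i : (k <= N d)%N -> ptends P \oo (fun D w => ito_error d D k w i).
Proof.
move=> kN.
have nN D : (k * ratio N d D <= N D)%N.
  apply: leq_trans (_ : (N d * ratio N d D <= _)%N); first by rewrite leq_mul2r kN orbT.
  by rewrite /ratio mulnC leq_trunc_div.
pose g D w := expansion_error d D k w i +
  \sum_(j < r) bracket_error (fun D => (k * ratio N d D)%N) i j D w * 2^-1.
have tg : ptends P \oo g.
  apply: ptendsD; first exact: expansion_cvg.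
  apply: (@ptends_sum _ _ _ P _ \oo _ _ _ (fun (j : 'I_r) D w =>
    bracket_error (fun D => (k * ratio N d D)%N) i j D w * 2^-1)) => j.
  by apply: ptendsM; [exact: bracket_cvg|exact: ptight_cst].
apply: ptends_le tg; exists 0%N => // D _ w.
rewrite le_eqVlt; apply/orP; left; apply/eqP; congr `|_|.
rewrite /g /ito_error /expansion_error /bracket_error.
pose G (j : 'I_r) p := (sigma (XD D p.+1 w) i j - sigma (XD D p w) i j) * dBw D p w j 0 -
  drift_rate sigma i j j (XD D p w) * delta D.
have -> : \sum_(j < r) (\sum_(p < k * ratio N d D) G j p) / 2 =
  \sum_(p < k * ratio N d D) \sum_(j < r) G j p / 2.
  by rewrite exchange_big; apply: eq_bigr => j _; rewrite mulr_suml.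
rewrite -[RHS]addrA; congr (_ + _).
rewrite -!sumrN -big_split /=; apply: eq_bigr => q _.
have -> : \sum_(j < r) G j q / 2 =
  \sum_(j < r) (sigma (XD D q w) i j + sigma (XD D q.+1 w) i j) / 2 * dBw D q w j 0 -
  \sum_(j < r) sigma (XD D q w) i j * dBw D q w j 0 -
  2^-1 * (\sum_(j < r) drift_rate sigma i j j (XD D q w)) * delta D.
  rewrite mulr_sumr mulr_suml -!sumrB; apply: eq_bigr => j _; by rewrite /G; field.
by rewrite /ito_step /strat_step; ring.
Qed.

End Expansion.

(** * Comparison of the two recursions *)

Lemma sqr_sum_card {R : realType} r (x : 'I_r -> R) : (\sum_j x j) ^+ 2 <= r%:R * \sum_j x j ^+ 2.
Proof.
have H : 0 <= \sum_j \sum_k (x j - x k) ^+ 2.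
  by apply: sumr_ge0 => j _; apply: sumr_ge0 => k _; exact: sqr_ge0.
have E : \sum_j \sum_k (x j - x k) ^+ 2 = 2 * (r%:R * \sum_j x j ^+ 2 - (\sum_j x j) ^+ 2).
  have A j : \sum_k (x j - x k) ^+ 2 = r%:R * x j ^+ 2 + \sum_k x k ^+ 2 - 2 * (x j * \sum_k x k).
    rewrite mulr_sumr mulr_sumr -[r in r%:R]card_ord -sumr_const mulr_suml -big_split -sumrB /=.
    by apply: eq_bigr => k _; ring.
  under eq_bigr do rewrite A.
  rewrite sumrB big_split /= -mulr_sumr sumr_const card_ord -mulr_sumr -mulr_suml -[_ *+ r]mulr_natl.
  by ring.
by move: H; rewrite E pmulr_rge0// subr_ge0.
Qed.

Lemma sum_le_const {R : realType} r (f : 'I_r -> R) c : (forall j, f j <= c) -> \sum_j f j <= r%:R * c.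
Proof. by move=> H; rewrite mulr_natl -[r in leRHS]card_ord -sumr_const; apply: ler_sum => j _. Qed.

Lemma sqr_add3_le {R : realType} (x y z : R) : (x + y + z) ^+ 2 <= 3 * (x ^+ 2 + y ^+ 2 + z ^+ 2).
Proof. by have := sqr_ge0 (x - y); have := sqr_ge0 (x - z); have := sqr_ge0 (y - z); lra. Qed.

(** The 2 is the cost of Young's inequality for two cross terms; [5 + 6 T] is 3 for the noise plus
    [1 + 3 T] for each of drift and remainder. *)
Definition stopped_rate {R : realType} (v : nat) (T C : R) := 2 + v%:R * C * (5 + 6 * T).

Lemma stopped_rate_ge0 {R : realType} v (T C : R) : 0 <= T -> 0 <= C -> 0 <= stopped_rate v T C.
Proof. by move=> T0 C0; rewrite addr_ge0// mulr_ge0 ?addr_ge0 ?mulr_ge0. Qed.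

(** * Second moment of an abstract recursion with drift, noise and remainder *)

Section StoppedRecursion.
Context {R : realType} {disp : measure_display} {Omega : measurableType disp}.
Variables (P : probability Omega R) (v N : nat) (h T C kap : R).
Variables (w a M rho : nat -> 'I_v -> Omega -> R).
Let sF := @sub_sigma_full disp Omega.
Let U k o := \sum_i w k i o ^+ 2.
Hypotheses (h0 : 0 < h) (hT : N%:R * h <= T) (hT1 : h <= T) (C0 : 0 <= C) (kap0 : 0 <= kap)
  (w0 : forall i o, w 0%N i o = 0)
  (wS : forall k i o, (k < N)%N -> w k.+1 i o = w k i o + a k i o + M k i o + rho k i o)
  (Lw : forall k i, (k <= N)%N -> LG P measurable (w k i))
  (La : forall k i, (k < N)%N -> LG P measurable (a k i))
  (LM : forall k i, (k < N)%N -> LG P measurable (M k i))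
  (Lr : forall k i, (k < N)%N -> LG P measurable (rho k i))
  (Ha : forall k i o, (k < N)%N -> a k i o ^+ 2 <= C * h ^+ 2 * (U k o + kap))
  (HM0 : forall k i, (k < N)%N -> Ex P (fun o => w k i o * M k i o) = 0)
  (HM : forall k i, (k < N)%N -> Ex P (fun o => M k i o ^+ 2) <= C * h * (Ex P (U k) + kap))
  (Hr : forall k i, (k < N)%N -> Ex P (fun o => rho k i o ^+ 2) <= C * h ^+ 2 * kap).

Let rate := stopped_rate v T C.

(** The cross term with the noise vanishes in mean; those with drift and remainder are split by
    [2 x y <= h x^2 + h^-1 y^2], which is affordable because the squares of these two terms are of
    order [h^2]. *)
Lemma stopped_recursion : Ex P (U N) <= T * rate * kap * expR (T * rate).
Proof.
have T0 : 0 <= T by exact: le_trans (ltW h0) hT1.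
have rate0 : 0 <= rate := stopped_rate_ge0 v T0 C0.
have LU k : (k <= N)%N -> LG P measurable (U k).
  by move=> kN; apply: LG_sum => // i _; apply: LGX => //; exact: Lw.
have U0 k : 0 <= Ex P (U k) by apply: Ex_ge0 => o; apply: sumr_ge0 => i _; exact: sqr_ge0.
have step k : (k < N)%N -> Ex P (U k.+1) <= (1 + h * rate) * Ex P (U k) + h * rate * kap.
  move=> kN; have kN' := ltnW kN.
  have one i : Ex P (fun o => w k.+1 i o ^+ 2) <= (1 + 2 * h) * Ex P (fun o => w k i o ^+ 2) +
     (C * h * (5 + 6 * T)) * (Ex P (U k) + kap).
    have L0 := Lw i kN'; have L1 := La i kN; have L2 := LM i kN; have L3 := Lr i kN; have LU0 := LU k kN'.
    have L02 : LG P measurable (fun o => w k i o ^+ 2) by lgt.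
    have L22 : LG P measurable (fun o => M k i o ^+ 2) by lgt.
    have L32 : LG P measurable (fun o => rho k i o ^+ 2) by lgt.
    have LwM : LG P measurable (fun o => w k i o * M k i o) by lgt.
    have LUk : LG P measurable (fun o => U k o + kap) by lgt.
    have LwS : LG P measurable (fun o => w k.+1 i o ^+ 2) by have := Lw i kN => ?; lgt.
    pose cU : R := (h^-1 + 3) * (C * h ^+ 2); pose cr : R := h^-1 + 3.
    pose g o := (1 + 2 * h) * w k i o ^+ 2 + cU * (U k o + kap) + (2 * (w k i o * M k i o) + (3 * M k i o ^+ 2 + cr * rho k i o ^+ 2)).
    have hi : 0 < h^-1 by rewrite invr_gt0.
    apply: (@le_trans _ _ (Ex P g)).
      apply: (Ex_le sF); [exact: LwS|by rewrite /g; lgt|move=> o].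
      rewrite wS// /g; have A := Ha i o kN.
      have yg (x y : R) : 2 * (x * y) <= h * x ^+ 2 + h^-1 * y ^+ 2.
        have /(le_trans (ler_norm _)) := weighted_am_gm x y h0.
        by move: (x * y) (h * _) (h^-1 * _) => p q s; lra.
      have Y1 := yg (w k i o) (a k i o); have Y2 := yg (w k i o) (rho k i o).
      have A1 : (h^-1 + 3) * a k i o ^+ 2 <= cU * (U k o + kap).
        by rewrite /cU -mulrA ler_pM2l// addr_gt0.
      rewrite /cr; move: (w k i o) (a k i o) (M k i o) (rho k i o) Y1 Y2 A1 => x y z t Y1 Y2 A1.
      apply: (@le_trans _ _ ((1 + 2 * h) * x ^+ 2 + (h^-1 + 3) * y ^+ 2 + (2 * (x * z) + (3 * z ^+ 2 + (h^-1 + 3) * t ^+ 2)))).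
        have S : (y + z + t) ^+ 2 <= 3 * y ^+ 2 + 3 * z ^+ 2 + 3 * t ^+ 2.
          by have := sqr_ge0 (y - z); have := sqr_ge0 (y - t); have := sqr_ge0 (z - t); lra.
        have -> : (x + y + z + t) ^+ 2 = x ^+ 2 + 2 * (x * y) + 2 * (x * t) + 2 * (x * z) + (y + z + t) ^+ 2 by ring.
        rewrite (_ : (1 + 2 * h) * x ^+ 2 = x ^+ 2 + 2 * (h * x ^+ 2)); last by ring.
        rewrite (_ : (h^-1 + 3) * y ^+ 2 = h^-1 * y ^+ 2 + 3 * y ^+ 2); last by ring.
        rewrite (_ : (h^-1 + 3) * t ^+ 2 = h^-1 * t ^+ 2 + 3 * t ^+ 2); last by ring.
        move: (h^-1 * y ^+ 2) (h^-1 * t ^+ 2) (h * x ^+ 2) Y1 Y2 S => p1 p2 p3.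
        by move: (x * y) (x * t) (x * z) ((y + z + t) ^+ 2) => q1 q2 q3 q4; lra.
      by rewrite lerD2r lerD2l.
    have Lg1 : LG P measurable (fun o => (1 + 2 * h) * w k i o ^+ 2) by lgt.
    have Lg2 : LG P measurable (fun o => cU * (U k o + kap)) by lgt.
    have Lg3 : LG P measurable (fun o => 2 * (w k i o * M k i o)) by lgt.
    have Lg4 : LG P measurable (fun o => 3 * M k i o ^+ 2) by lgt.
    have Lg5 : LG P measurable (fun o => cr * rho k i o ^+ 2) by lgt.
    have Lg45 := LGD sF Lg4 Lg5; have Lg345 := LGD sF Lg3 Lg45; have Lg12 := LGD sF Lg1 Lg2.
    rewrite /g (ExD sF Lg12 Lg345) (ExD sF Lg1 Lg2) (ExD sF Lg3 Lg45) (ExD sF Lg4 Lg5).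
    rewrite (ExZ sF _ L02) (ExZ sF _ LUk) (ExZ sF _ LwM) (ExZ sF _ L22) (ExZ sF _ L32) HM0// mulr0 add0r.
    rewrite (ExD sF LU0 (LG_cst P _ kap)) Ex_cst -addrA lerD2l.
    have H1 := HM i kN; have H2 := Hr i kN.
    have cr0 : 0 <= cr by rewrite addr_ge0// ltW.
    have {}H1 : 3 * Ex P (fun o => M k i o ^+ 2) <= 3 * (C * h * (Ex P (U k) + kap)) by rewrite ler_pM2l.
    have {}H2 : cr * Ex P (fun o => rho k i o ^+ 2) <= cr * (C * h ^+ 2 * kap) by rewrite ler_wpM2l.
    have hC : 0 <= C * h by rewrite mulr_ge0// ltW.
    have E1 : cU = C * h * (1 + 3 * h) by rewrite /cU; field; rewrite gt_eqF.
    have E2 : cr * (C * h ^+ 2 * kap) = C * h * (1 + 3 * h) * kap by rewrite /cr; field; rewrite gt_eqF.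
    rewrite E1; rewrite E2 in H2.
    have Q1 : C * h * (1 + 3 * h) * (Ex P (U k) + kap) <= C * h * (1 + 3 * T) * (Ex P (U k) + kap).
      by rewrite ler_wpM2r ?addr_ge0// ler_wpM2l// lerD2l ler_pM2l.
    have Q2 : C * h * (1 + 3 * h) * kap <= C * h * (1 + 3 * T) * (Ex P (U k) + kap).
      apply: (@le_trans _ _ (C * h * (1 + 3 * h) * (Ex P (U k) + kap))) => //.
      by rewrite ler_wpM2l ?lerDr// mulr_ge0// addr_ge0// mulr_ge0// ltW.
    rewrite (_ : C * h * (5 + 6 * T) * _ = C * h * (1 + 3 * T) * (Ex P (U k) + kap) +
       (3 * (C * h * (Ex P (U k) + kap)) + C * h * (1 + 3 * T) * (Ex P (U k) + kap))); last by ring.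
    by apply: lerD => //; apply: lerD => //; exact: le_trans H2 Q2.
  rewrite (Ex_sum sF); last by move=> i _; apply: LGX => //; exact: Lw.
  apply: (@le_trans _ _ (\sum_(i < v) ((1 + 2 * h) * Ex P (fun o => w k i o ^+ 2) +
     (C * h * (5 + 6 * T)) * (Ex P (U k) + kap)))); first by apply: ler_sum => i _; exact: one.
  rewrite big_split /= -mulr_sumr -(Ex_sum sF); last by move=> i _; apply: LGX => //; exact: Lw.
  rewrite -/(U k) sumr_const card_ord -[_ *+ v]mulr_natl.
  rewrite /rate /stopped_rate; set u := Ex P (U k) in U0 *.
  have u0 : 0 <= u by exact: U0.
  have X1 : 0 <= 2 * h * kap by rewrite !mulr_ge0// ltW.
  lra.
have hr0 : 0 <= h * rate by rewrite mulr_ge0// ltW.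
have hk0 : 0 <= h * rate * kap by rewrite mulr_ge0.
have u0 : Ex P (U 0%N) = 0.
  by rewrite (_ : U 0%N = fun=> 0) ?Ex_cst//; apply/funext => o; rewrite /U big1// => i _; rewrite w0 expr0n.
have := gronwall_le (u := fun k => Ex P (U k)) hr0 hk0 _ step (leqnn N); rewrite u0 add0r => /(_ (lexx 0)) H.
apply: le_trans H _; rewrite !mulrA; apply: ler_pM; rewrite ?expR_ge0//.
- by rewrite mulr_ge0// mulr_ge0// mulr_ge0// ltW.
- by do 2! (rewrite ler_wpM2r//).
- by rewrite ler_expR ler_wpM2r.
Qed.

End StoppedRecursion.

Section Comparison.
Context {R : realType} {disp : measure_display} {Omega : measurableType disp} {v r : nat}.
Variables (b : 'cV[R]_v -> 'cV[R]_v) (sigma : 'cV[R]_v -> 'M[R]_(v, r)) (K : R).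
Hypothesis cb : coefficient_bounds b sigma K.
Variables (P : probability Omega R) (T : R) (F : R -> set (set Omega)).
Hypothesis FU : usual_filtration P T F.
Variables (B : R -> Omega -> 'cV[R]_r).
Hypothesis BW : wiener_process P T F B.
Variables (N : nat -> nat) (delta : nat -> R) (t_ : nat -> nat -> R).
Hypotheses (T0 : 0 < T) (HG : nested_partitions T N delta t_).
Variables (x0 : 'cV[R]_v) (X : R -> Omega -> 'cV[R]_v).
Hypothesis HX : stratonovich_sde_solution P T F b sigma x0 B X.
Variables (C lam : R).
Hypotheses (C1 : 1 <= C) (lam0 : 0 <= lam) (HC : step_bounds b sigma T C lam).
Let sF := @sub_sigma_full disp Omega.
Let K0 : 0 <= K. Proof. exact: le_trans ler01 (cb_ge1 cb). Qed.

Definition ito_drift i y := b y i 0 + 2^-1 * \sum_(j < r) drift_rate sigma i j j y.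

Lemma drift_rate_bound i j m q y : `|y| <= q -> `|drift_rate sigma i j m y| <= v%:R * (K * (K * (1 + q))).
Proof.
move=> yq; apply: sum_const_le => l; rewrite normrM; apply: ler_pM => //; first exact: (cb_ds_bound cb).
by apply: le_trans (cb_s_growth cb _ _ _) _; rewrite ler_wpM2l// lerD2l.
Qed.

Lemma drift_rate_lip i j m q y z : `|y| <= q -> `|z| <= q ->
  `|drift_rate sigma i j m y - drift_rate sigma i j m z| <= v%:R * (K ^+ 2 * (2 + q) * `|y - z|).
Proof.
move=> yq zq; rewrite /drift_rate -sumrB; apply: sum_const_le => l.
have -> : dsigma sigma i j l y * sigma y l m - dsigma sigma i j l z * sigma z l m =
  (dsigma sigma i j l y - dsigma sigma i j l z) * sigma y l m +
  dsigma sigma i j l z * (sigma y l m - sigma z l m) by ring.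
apply: le_trans (ler_normD _ _) _.
rewrite (_ : K ^+ 2 * _ * _ = (K * `|y - z|) * (K * (1 + q)) + K * (K * `|y - z|)); last by ring.
rewrite !normrM; apply: lerD; apply: ler_pM => //; try exact: (cb_ds_lip cb); try exact: (cb_ds_bound cb);
  try exact: (cb_s_lip cb).
by apply: le_trans (cb_s_growth cb _ _ _) _; rewrite ler_wpM2l// lerD2l.
Qed.

(** [drift_rate] sums products of a bounded Lipschitz factor and a Lipschitz factor of linear
    growth, hence the bound for the Lipschitz constant on a ball of radius [q] is affine in [q]. *)
Definition local_lip (q : R) := K + r%:R * (v%:R * (K ^+ 2 * (2 + q))).

Lemma ito_drift_lip i q y z : `|y| <= q -> `|z| <= q ->
  `|ito_drift i y - ito_drift i z| <= local_lip q * `|y - z|.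
Proof.
move=> yq zq; rewrite /ito_drift opprD addrACA -mulrBr -sumrB.
apply: le_trans (ler_normD _ _) _; rewrite mulrDl; apply: lerD; first exact: (cb_b_lip cb).
rewrite normrM ger0_norm ?invr_ge0//.
have q0 : 0 <= q by exact: le_trans yq.
have H : `|\sum_(j < r) (drift_rate sigma i j j y - drift_rate sigma i j j z)| <= r%:R * (v%:R * (K ^+ 2 * (2 + q) * `|y - z|)).
  apply: (@sum_const_le _ r) => j; exact: drift_rate_lip.
have G0 : 0 <= r%:R * (v%:R * (K ^+ 2 * (2 + q))) * `|y - z|.
  by rewrite !mulr_ge0 ?sqr_ge0// addr_ge0.
apply: (@le_trans _ _ (2^-1 * (r%:R * (v%:R * (K ^+ 2 * (2 + q))) * `|y - z|))).
  by rewrite ler_pM2l ?invr_gt0//; apply: le_trans H _; rewrite !mulrA.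
by move: (_ * `|y - z|) G0 => p G0; lra.
Qed.

(** * The surrogate of the difference at the coarse points *)

Section Stopped.
Variables (d D : nat) (x : Omega -> R -> 'cV[R]_v) (n eta eps : R).
Hypotheses (dD : (d <= D)%N) (xstart : forall o, x o 0 = x0)
  (xpiece : forall k o, (k < N d)%N -> ode_piece b sigma (k%:R * delta d) (delta d) (dB B delta d k o) (x o)).
Hypotheses (n0 : 0 < n) (eta0 : 0 < eta) (eta1 : eta <= 1) (eps0 : 0 < eps) (eps1 : eps <= 1).

Let m := ratio N d D.
Let h := delta d.
Let Y k o := gval h x k o.
Let Xk k o := XD delta X d k o.
Let Xf q o := XD delta X D q o.
Let HN := wiener_noise FU BW HG d.
Let HN' := wiener_noise FU BW HG D.
Let h0 : 0 < h := mesh_gt0 HG d.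
Let hT1 : h <= T := mesh_le T0 HG d.
(** While the indicator is nonzero, [|Y|] is at most [|X| + |stopped| + eta], and the last two are
    at most 1. *)
Let q0 : R := n + 2.
Let L := local_lip q0.
(** The truncation level for variations of coefficients inside a coarse cell; they stay below it on
    a path that is bounded by [n] and oscillates by at most [eta] in the cell. *)
Let Le := L * eta.

Lemma local_lip_ge : K <= L.
Proof.
rewrite /L /local_lip lerDl; apply: mulr_ge0 => //; apply: mulr_ge0 => //.
by rewrite mulr_ge0 ?sqr_ge0// addr_ge0// addr_ge0// ltW.
Qed.

Let L0 : 0 <= L := le_trans K0 local_lip_ge.
Let Le0 : 0 <= Le. Proof. by rewrite mulr_ge0// ltW. Qed.

(** Decided at step [k]: [X] is in its ball, the surrogate [y] is within [eta] of the true
    difference, and [y] is below [eps]. The indicator is a real number so that it can multiply the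
    increments and keep them adapted. *)
Definition alive k (y : 'cV[R]_v) o : R :=
  [&& `|Xk k o| <= n, `|Xk k o - Y k o - y| <= eta & `|y| <= eps]%:R.

(** The increment of [X - Y] over a coarse cell is split into drift, three kinds of noise and the
    Milstein remainder. The factor [c] is the indicator, or 1 for the exact recursion. Coefficients
    of [X] on the fine grid are written as their value at the coarse point plus a truncated
    variation; the products of increments in the expansion of [Y] give the Ito correction in the
    drift and, once centred, [noise_incr3]. *)
Definition drift_incr (c : R) k i o : R :=
  c * ((ito_drift i (Xk k o) - ito_drift i (Y k o)) * h +
  \sum_(s < m) trunc Le (ito_drift i (Xf (k * m + s) o) - ito_drift i (Xk k o)) * delta D).

Definition noise_incr1 (c : R) k i o : R :=
  \sum_(j < r) c * (sigma (Xk k o) i j - sigma (Y k o) i j) * dB B delta d k o j 0.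

Definition noise_incr2 (c : R) k i o : R :=
  \sum_(j < r) \sum_(s < m) c * trunc Le (sigma (Xf (k * m + s) o) i j - sigma (Xk k o) i j) *
    dB B delta D (k * m + s) o j 0.

Definition noise_incr3 (c : R) k i o : R :=
  \sum_(j < r) \sum_(l < r) c * (- 2^-1 * drift_rate sigma i j l (Y k o)) *
    wick h (dB B delta d) j l k o.

Definition milstein_rem k i o : R :=
  gval h x k.+1 o i 0 - Y k o i 0 - b (Y k o) i 0 * h
  - \sum_(j < r) sigma (Y k o) i j * dB B delta d k o j 0
  - 2^-1 * \sum_(j < r) \sum_(l < r) drift_rate sigma i j l (Y k o) * (dB B delta d k o j 0 * dB B delta d k o l 0).

Definition stopped_incr (c : R) k i o : R := drift_incr c k i o +
  (noise_incr1 c k i o + noise_incr2 c k i o + noise_incr3 c k i o) + c * - milstein_rem k i o.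

(* The difference [X - Y] at the coarse points, frozen on leaving the event [alive]
   and with truncated coefficients: these make every increment adapted with all
   moments, and change nothing as long as the path is good. *)
Fixpoint stopped k o : 'cV[R]_v := if k is k'.+1 then
  stopped k' o + \col_i stopped_incr (alive k' (stopped k' o) o) k' i o else 0.

Definition live k o := alive k (stopped k o) o.

Lemma live1 k o : live k o != 0 ->
  [/\ live k o = 1, `|Xk k o| <= n, `|Xk k o - Y k o| <= `|stopped k o| + eta,
      `|stopped k o| <= eps & `|Y k o| <= q0].
Proof.
rewrite /live /alive; case: and3P => [[A1 A2 A3] _|]; last by rewrite eqxx.
have A4 : `|Xk k o - Y k o| <= `|stopped k o| + eta.
  rewrite -[Xk k o - Y k o](subrK (stopped k o)) addrC.
  by apply: le_trans (ler_normD _ _) _; rewrite lerD2l.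
split => //.
rewrite -[Y k o](subKr (Xk k o)); apply: le_trans (ler_normB _ _) _.
apply: lerD => //; apply: (le_trans A4); rewrite (_ : 2 = 1 + 1 :> R)//.
by apply: lerD => //; exact: le_trans A3 eps1.
Qed.

Lemma live_le k o (f g : R) : 0 <= g -> (live k o != 0 -> `|f| <= g) -> `|live k o * f| <= g.
Proof.
move=> g0 H; have [->|nz] := eqVneq (live k o) 0; first by rewrite mul0r normr0.
by have [-> _ _ _ _] := live1 nz; rewrite mul1r; exact: H.
Qed.

Lemma grid_sub k : (k <= N d)%N -> sub_sigma (F (pt delta d k)).
Proof. exact: (noise_sub HN). Qed.

Lemma gm_lift (f : Omega -> R) s t : 0 <= s -> s <= t -> t <= T -> gmeas (F s) f -> gmeas (F t) f.
Proof.
move=> s0 st tT; apply: gmeas_sub.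
- by apply: (filtration_sub_sigma FU); rewrite s0 (le_trans st).
- by apply: (filtration_sub_sigma FU); rewrite tT (le_trans s0).
- exact: (filtration_monotone FU).
Qed.

Lemma gm_Y (f : 'cV[R]_v -> R) k : continuous f -> (k <= N d)%N -> gmeas (F (pt delta d k)) (fun o => f (Y k o)).
Proof.
move=> cf kN; apply: (measurable_comp_col (T := g_sigma_algebraType (F (pt delta d k)))) => // i.
exact: (gmeas_gval cb HN h0 xstart xpiece i kN).
Qed.

Lemma gm_X (f : 'cV[R]_v -> R) k : continuous f -> (k <= N d)%N -> gmeas (F (pt delta d k)) (fun o => f (Xk k o)).
Proof. by move=> cf kN; exact: (sol_comp_gmeas FU HX cf (pt_in HG kN)). Qed.

Lemma block_index k s : (k < N d)%N -> (s < m)%N ->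
  (k * m + s < N D)%N /\ pt delta d k <= pt delta D (k * m + s)%N /\ pt delta D (k * m + s).+1 <= pt delta d k.+1.
Proof.
move=> kN sm; have H := block_lt T0 HG dD (ltnSn k) kN sm.
split; first by exact: H.
rewrite !(pt_ratio T0 HG _ dD) -/m; split; apply: (pt_le HG); first exact: leq_addr.
by rewrite mulSn addnC ltn_add2r.
Qed.

Lemma gm_Xf (f : 'cV[R]_v -> R) k s : continuous f -> (k < N d)%N -> (s < m)%N ->
  gmeas (F (pt delta D (k * m + s))) (fun o => f (Xf (k * m + s) o)).
Proof.
by move=> cf kN sm; have [A _] := block_index kN sm; exact: (sol_comp_gmeas FU HX cf (pt_in HG (ltnW A))).
Qed.

Lemma gm_block (f : Omega -> R) k s : (k < N d)%N -> (s < m)%N ->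
  gmeas (F (pt delta d k)) f -> gmeas (F (pt delta D (k * m + s))) f.
Proof.
move=> kN sm; have [A [A1 A2]] := block_index kN sm.
by apply: gm_lift => //; [exact: (pt_ge0 HG)|exact: (pt_leT HG (ltnW A))].
Qed.

Lemma gm_next (f : Omega -> R) k s : (k < N d)%N -> (s < m)%N ->
  gmeas (F (pt delta D (k * m + s))) f -> gmeas (F (pt delta d k.+1)) f.
Proof.
move=> kN sm; have [A [A1 A2]] := block_index kN sm.
apply: gm_lift; [exact: (pt_ge0 HG)| |exact: (pt_leT HG kN)].
by apply: le_trans A2; exact: (pt_le HG).
Qed.

Lemma gm_succ (f : Omega -> R) k : (k < N d)%N -> gmeas (F (pt delta d k)) f -> gmeas (F (pt delta d k.+1)) f.
Proof. by move=> kN; apply: gm_lift; [exact: (pt_ge0 HG)|exact: (pt_le HG)|exact: (pt_leT HG)]. Qed.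

Lemma measurable_drift_rate (G : set (set Omega)) i j l (Z : Omega -> 'cV[R]_v) :
  (forall f : 'cV[R]_v -> R, continuous f -> gmeas G (fun o => f (Z o))) ->
  gmeas G (fun o => drift_rate sigma i j l (Z o)).
Proof.
move=> H; apply: measurable_sum => a; apply: measurable_funM.
  exact: (H _ (@dsigma_continuous _ _ _ _ _ _ cb i j a)).
exact: (H _ (@sigma_continuous _ _ _ _ _ _ cb a l)).
Qed.

Lemma measurable_ito_drift (G : set (set Omega)) i (Z : Omega -> 'cV[R]_v) :
  (forall f : 'cV[R]_v -> R, continuous f -> gmeas G (fun o => f (Z o))) ->
  gmeas G (fun o => ito_drift i (Z o)).
Proof.
move=> H; apply: measurable_funD; first exact: (H _ (@b_continuous _ _ _ _ _ _ cb i)).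
by apply: measurable_funM => //; apply: measurable_sum => j; exact: measurable_drift_rate.
Qed.

Lemma coord_cont i : continuous (fun y : 'cV[R]_v => y i 0).
Proof. exact: coord_continuous. Qed.

Lemma norm_cont : continuous (fun y : 'cV[R]_v => `|y|).
Proof. exact: norm_continuous. Qed.

Section Step.
Variable k : nat.
Hypothesis kN : (k < N d)%N.
Hypothesis Lst : forall i, LG P (F (pt delta d k)) (fun o => stopped k o i 0).

Let sk := grid_sub (ltnW kN).
Let sk1 := grid_sub kN.
Let chi := live k.

Lemma gm_live : gmeas (F (pt delta d k)) chi.
Proof.
have mst i : gmeas (F (pt delta d k)) (fun o => stopped k o i 0) by case: (Lst i).
have mX i : gmeas (F (pt delta d k)) (fun o => Xk k o i 0) by exact: (gm_X (@coord_cont i) (ltnW kN)).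
have mY i : gmeas (F (pt delta d k)) (fun o => Y k o i 0) by exact: (gm_Y (@coord_cont i) (ltnW kN)).
have m1 : gmeas (F (pt delta d k)) (fun o => `|Xk k o|) by exact: (gm_X norm_cont (ltnW kN)).
have m2 : gmeas (F (pt delta d k)) (fun o => `|Xk k o - Y k o - stopped k o|).
  apply: (measurable_colnorm (T := g_sigma_algebraType (F (pt delta d k)))) => i.
  under eq_fun do rewrite !mxE.
  exact: (measurable_funB (measurable_funB (mX i) (mY i)) (mst i)).
have m3 : gmeas (F (pt delta d k)) (fun o => `|stopped k o|).
  exact: (measurable_colnorm (T := g_sigma_algebraType (F (pt delta d k)))).
have ind (f : Omega -> R) c : gmeas (F (pt delta d k)) f -> gmeas (F (pt delta d k)) (fun o => \1_(`]-oo, c]) (f o) : R).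
  by move=> mf; apply: (measurableT_comp (f := \1_(`]-oo, c]) : R -> R)) => //; exact: measurable_indic.
rewrite (_ : chi = fun o => \1_(`]-oo, n]) `|Xk k o| * \1_(`]-oo, eta]) `|Xk k o - Y k o - stopped k o| *
   \1_(`]-oo, eps]) `|stopped k o|).
  by apply: measurable_funM; [apply: measurable_funM|]; exact: ind.
apply/funext => o; rewrite /chi /live /alive !indicE.
by rewrite !mem_setE !in_itv/=; do 3! (case: (_ <= _)); rewrite /= ?mulr1 ?mul1r ?mul0r ?mulr0.
Qed.

Lemma LG_chi_bounded (G : set (set Omega)) (f : Omega -> R) (c : R) : sub_sigma G -> gmeas G chi -> gmeas G f -> 0 <= c ->
  (forall o, live k o != 0 -> `|f o| <= c) -> LG P G (fun o => chi o * f o).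
Proof.
move=> sG mchi mf c0 H; apply: (LG_bdd P sG (c := c)); first exact: measurable_funM.
by move=> o; apply: live_le => // nz; exact: H.
Qed.

Let nq : n <= q0. Proof. by rewrite lerDl. Qed.
Let q00 : 0 <= q0. Proof. by rewrite addr_ge0// ltW. Qed.

Lemma drift_diff_le o i : live k o != 0 ->
  `|ito_drift i (Xk k o) - ito_drift i (Y k o)| <= L * (`|stopped k o| + eta).
Proof.
move=> /live1[_ A1 A2 A3 A4]; apply: le_trans (ito_drift_lip _ (le_trans A1 nq) A4) _.
by rewrite ler_wpM2l.
Qed.

Lemma sigma_diff_le o i j : live k o != 0 ->
  `|sigma (Xk k o) i j - sigma (Y k o) i j| <= K * (`|stopped k o| + eta).
Proof. by move=> /live1[_ _ A2 _ _]; apply: le_trans (cb_s_lip cb _ _ _ _) _; rewrite ler_wpM2l. Qed.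

Let Dn : R := v%:R * (K * (K * (1 + q0))).
Let Dn0 : 0 <= Dn.
Proof. by apply: mulr_ge0 => //; apply: mulr_ge0 => //; apply: mulr_ge0 => //; exact: addr_ge0. Qed.

Lemma drift_coef_le o i j l : live k o != 0 -> `|- 2^-1 * drift_rate sigma i j l (Y k o)| <= Dn.
Proof.
move=> /live1[_ _ _ _ A4]; rewrite normrM normrN (@ger0_norm _ 2^-1) ?invr_ge0//.
apply: (le_trans _ (drift_rate_bound i j l A4)); rewrite ler_piMl// invf_le1// ler1n//.
Qed.

Let mchi := gm_live.

Lemma LG_s1 i j : LG P (F (pt delta d k)) (fun o => chi o * (sigma (Xk k o) i j - sigma (Y k o) i j)).
Proof.
apply: (LG_chi_bounded (c := K * 2)) => //.
- apply: measurable_funB; first exact: (gm_X (@sigma_continuous _ _ _ _ _ _ cb i j) (ltnW kN)).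
  exact: (gm_Y (@sigma_continuous _ _ _ _ _ _ cb i j) (ltnW kN)).
- exact: mulr_ge0.
- move=> o nz; apply: le_trans (sigma_diff_le _ _ nz) _; rewrite ler_wpM2l//.
  have [_ _ _ A _] := live1 nz; rewrite (_ : 2 = 1 + 1 :> R)//; apply: lerD => //; exact: le_trans A eps1.
Qed.

Lemma gm_s2 i j s : (s < m)%N -> gmeas (F (pt delta D (k * m + s)))
  (fun o => chi o * trunc Le (sigma (Xf (k * m + s) o) i j - sigma (Xk k o) i j)).
Proof.
move=> sm; apply: measurable_funM; first exact: (gm_block kN sm mchi).
apply: gmeas_trunc; apply: measurable_funB; first exact: (gm_Xf (@sigma_continuous _ _ _ _ _ _ cb i j) kN sm).
exact: (gm_block kN sm (gm_X (@sigma_continuous _ _ _ _ _ _ cb i j) (ltnW kN))).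
Qed.

Lemma s2_bound i j q o :
  `|chi o * trunc Le (sigma (Xf q o) i j - sigma (Xk k o) i j)| <= Le.
Proof. by apply: live_le => // _; exact: trunc_bound. Qed.

Lemma LG_s3 i j l : LG P (F (pt delta d k)) (fun o => chi o * (- 2^-1 * drift_rate sigma i j l (Y k o))).
Proof.
apply: (LG_chi_bounded (c := Dn)) => //.
- apply: measurable_funM => //; apply: measurable_drift_rate => f cf; exact: (gm_Y cf (ltnW kN)).
- by move=> o; exact: drift_coef_le.
Qed.

Lemma LG_a i : LG P (F (pt delta d k.+1)) (fun o => drift_incr (chi o) k i o).
Proof.
have c0 : 0 <= L * 2 * h + m%:R * (Le * delta D).
  by apply: addr_ge0; apply: mulr_ge0 => //; [exact: mulr_ge0|exact: ltW|rewrite mulr_ge0// ltW// (mesh_gt0 HG)].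
have mX := gm_succ kN (measurable_ito_drift i (fun f cf => gm_X cf (ltnW kN))).
have mY := gm_succ kN (measurable_ito_drift i (fun f cf => gm_Y cf (ltnW kN))).
apply: (LG_chi_bounded sk1 (gm_succ kN mchi) _ c0).
- apply: measurable_funD; first by apply: measurable_funM => //; exact: measurable_funB.
  apply: measurable_sum => s; apply: measurable_funM => //; apply: gmeas_trunc; apply: measurable_funB => //.
  by apply: (gm_next kN (ltn_ord s)); apply: measurable_ito_drift => f cf; exact: gm_Xf.
- move=> o nz; apply: le_trans (ler_normD _ _) _; apply: lerD.
    rewrite normrM (gtr0_norm h0) ler_wpM2r ?(ltW h0)//; apply: le_trans (drift_diff_le _ nz) _.
    rewrite ler_wpM2l//; have [_ _ _ A _] := live1 nz.
    by rewrite (_ : 2 = 1 + 1 :> R)//; apply: lerD => //; exact: le_trans A eps1.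
  apply: (@sum_const_le _ m) => s; rewrite normrM (gtr0_norm (mesh_gt0 HG D)).
  by rewrite ler_wpM2r ?(ltW (mesh_gt0 HG D))//; exact: trunc_bound.
Qed.

Lemma LG_P1 i : LG P (F (pt delta d k.+1)) (fun o => noise_incr1 (chi o) k i o).
Proof.
apply: LG_sum => // j _; apply: LGM => //; last exact: (LG_beta HN j kN).
exact: (LG_lift HN (leqnSn k) kN (LG_s1 i j)).
Qed.

Lemma LG_P2 i : LG P (F (pt delta d k.+1)) (fun o => noise_incr2 (chi o) k i o).
Proof.
apply: LG_sum => // j _; apply: LG_sum => // s _; have [A [A1 A2]] := block_index kN (ltn_ord s).
have sq := noise_sub HN' A.
have H : LG P (F (pt delta D (k * m + s).+1)) (fun o => chi o * trunc Le (sigma (Xf (k * m + s) o) i j - sigma (Xk k o) i j) *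
    dB B delta D (k * m + s) o j 0).
  apply: LGM => //; last exact: (LG_beta HN' j A).
  apply: (LG_lift HN' (leqnSn _) A).
  exact: (LG_bdd P (noise_sub HN' (ltnW A)) (gm_s2 i j (ltn_ord s)) (fun o => s2_bound i j _ o)).
apply: (LG_sub sq sk1 _ H); apply: (filtration_monotone FU) => //; [exact: (pt_ge0 HG)|exact: (pt_leT HG)].
Qed.

Lemma LG_P3 i : LG P (F (pt delta d k.+1)) (fun o => noise_incr3 (chi o) k i o).
Proof.
apply: LG_sum => // j _; apply: LG_sum => // l _; apply: LGM => //; last exact: (LG_wick HN j l kN).
exact: (LG_lift HN (leqnSn k) kN (LG_s3 i j l)).
Qed.

Let Bn : R := 1 + q0.
Let Bn0 : 0 <= Bn. Proof. exact: addr_ge0. Qed.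

Lemma rem_bound i o : `|live k o * - milstein_rem k i o| <=
  C * (h * Num.sqrt h) * Bn ^+ 2 * nexp h lam (dB B delta d k) o.
Proof.
have C0 : 0 <= C := le_trans ler01 C1.
have s0 : 0 <= h * Num.sqrt h by rewrite mulr_ge0 ?sqrtr_ge0// ltW.
have e0 := nexp_ge0 h (dB B delta d) k lam o.
apply: live_le => [|nz].
  by apply: mulr_ge0 => //; apply: mulr_ge0; [exact: mulr_ge0|exact: sqr_ge0].
have [_ _ _ _ A4] := live1 nz; rewrite normrN.
have [_ _ H] := piece_bounds HC h0 hT1 xpiece o kN; apply: le_trans (H i) _.
rewrite -[leRHS]mulrA [Bn ^+ 2 * _]mulrC [leRHS]mulrA; apply: ler_wpM2l.
  by apply: mulr_ge0 => //; exact: mulr_ge0.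
by apply: lerXn2r; [rewrite nnegrE addr_ge0|rewrite nnegrE|rewrite lerD2l].
Qed.

Lemma LG_rem i : LG P (F (pt delta d k.+1)) (fun o => chi o * - milstein_rem k i o).
Proof.
have Le' := LG_nexp HN kN lam0.
have LeZ : LG P (F (pt delta d k.+1)) (fun o => C * (h * Num.sqrt h) * Bn ^+ 2 * nexp h lam (dB B delta d k) o).
  exact: LGZ Le'.
apply: (LG_dom sk1 _ LeZ); last by move=> o; apply: le_trans (rem_bound i o) (ler_norm _).
have mB j : gmeas (F (pt delta d k.+1)) (fun o => dB B delta d k o j 0) := noise_meas HN j kN.
have mY (f : 'cV[R]_v -> R) : continuous f -> gmeas (F (pt delta d k.+1)) (fun o => f (Y k o)).
  by move=> cf; exact: (gm_succ kN (gm_Y cf (ltnW kN))).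
apply: measurable_funM; first exact: (gm_succ kN mchi).
apply: measurableT_comp => //; apply: measurable_funB; last first.
  apply: measurable_funM => //; apply: measurable_sum => j; apply: measurable_sum => l.
  by apply: measurable_funM; [exact: (measurable_drift_rate _ _ _ mY)|exact: (measurable_funM (mB j) (mB l))].
apply: measurable_funB; last first.
  apply: measurable_sum => j; have cs : continuous (fun y => sigma y i j) := @sigma_continuous _ _ _ _ _ _ cb i j.
  exact: (measurable_funM (mY _ cs) (mB j)).
apply: measurable_funB; last first.
  by apply: measurable_funM => //; exact: (mY (fun y => b y i 0) (@b_continuous _ _ _ _ _ _ cb i)).
apply: measurable_funB; last exact: (mY (fun y => y i 0) (@coord_cont i)).
exact: (gmeas_gval cb HN h0 xstart xpiece i kN).
Qed.

Lemma LG_stopped_step i : LG P (F (pt delta d k.+1)) (fun o => stopped k.+1 o i 0).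
Proof.
have LS := LG_lift HN (leqnSn k) kN (Lst i).
have A1 := LG_a i; have A2 := LG_P1 i; have A3 := LG_P2 i; have A4 := LG_P3 i; have A5 := LG_rem i.
rewrite /= /stopped_incr; under eq_fun do rewrite !mxE.
exact: (LGD sk1 LS (LGD sk1 (LGD sk1 A1 (LGD sk1 (LGD sk1 A2 A3) A4)) A5)).
Qed.

(** Each summand is a coefficient known at the start of its own step, coarse or fine, times a
    centred variable. The surrogate at the coarse point is known at every fine step of the cell that
    follows. *)
Lemma orth_noise i : Ex P (fun o => stopped k o i 0 *
  (noise_incr1 (chi o) k i o + noise_incr2 (chi o) k i o + noise_incr3 (chi o) k i o)) = 0.
Proof.
have Lz := Lst i; have Lz1 := LG_of HN kN (LG_lift HN (leqnSn k) kN Lz).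
have A2 := LG_of HN kN (LG_P1 i); have A3 := LG_of HN kN (LG_P2 i); have A4 := LG_of HN kN (LG_P3 i).
have B2 := LGM sF Lz1 A2; have B3 := LGM sF Lz1 A3; have B4 := LGM sF Lz1 A4.
rewrite (_ : Ex P _ = Ex P (fun o => stopped k o i 0 * noise_incr1 (chi o) k i o +
  stopped k o i 0 * noise_incr2 (chi o) k i o + stopped k o i 0 * noise_incr3 (chi o) k i o)); last first.
  by apply: eq_Ex => o; rewrite !mulrDr.
rewrite (ExD sF (LGD sF B2 B3) B4) (ExD sF B2 B3).
have E1 : Ex P (fun o => stopped k o i 0 * noise_incr1 (chi o) k i o) = 0.
  rewrite (_ : Ex P _ = Ex P (fun o => \sum_(j < r) (stopped k o i 0 *
     (chi o * (sigma (Xk k o) i j - sigma (Y k o) i j))) * dB B delta d k o j 0)); last first.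
    by apply: eq_Ex => o; rewrite mulr_sumr; apply: eq_bigr => j _; rewrite mulrA.
  have Lj j := LGM sk Lz (LG_s1 i j).
  rewrite (Ex_sum sF); last first.
    by move=> j _; apply: LGM => //; [exact: (LG_of HN (ltnW kN) (Lj j))|exact: (LG_of HN kN (LG_beta HN j kN))].
  by rewrite big1// => j _; exact: (Ex_mulW sk (noise_incr HN kN) j (Lj j)).
have E2 : Ex P (fun o => stopped k o i 0 * noise_incr2 (chi o) k i o) = 0.
  pose g j s o := stopped k o i 0 * (chi o * trunc Le (sigma (Xf (k * m + s) o) i j - sigma (Xk k o) i j)).
  rewrite (_ : Ex P _ = Ex P (fun o => \sum_(j < r) \sum_(s < m) g j s o * dB B delta D (k * m + s) o j 0)); last first.
    apply: eq_Ex => o; rewrite mulr_sumr; apply: eq_bigr => j _; rewrite mulr_sumr.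
    by apply: eq_bigr => s _; rewrite mulrA.
  have Lg j (s : 'I_m) : LG P (F (pt delta D (k * m + s))) (g j s).
    have [A [A1 _]] := block_index kN (ltn_ord s); have sq := noise_sub HN' (ltnW A).
    apply: LGM => //; last first.
      exact: (LG_bdd P sq (gm_s2 i j (ltn_ord s)) (fun o => s2_bound i j _ o)).
    apply: (LG_sub sk sq _ Lz); apply: (filtration_monotone FU) => //; first exact: (pt_ge0 HG).
    exact: (pt_leT HG (ltnW A)).
  have Lgb j (s : 'I_m) : LG P measurable (fun o => g j s o * dB B delta D (k * m + s) o j 0).
    have [A _] := block_index kN (ltn_ord s).
    by apply: LGM => //; [exact: (LG_of HN' (ltnW A) (Lg j s))|exact: (LG_of HN' A (LG_beta HN' j A))].
  rewrite (Ex_sum sF); last by move=> j _; apply: LG_sum => // s _; exact: Lgb.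
  rewrite big1// => j _; rewrite (Ex_sum sF); last by move=> s _; exact: Lgb.
  rewrite big1// => s _; have [A _] := block_index kN (ltn_ord s).
  exact: (Ex_mulW (noise_sub HN' (ltnW A)) (noise_incr HN' A) j (Lg j s)).
have E3 : Ex P (fun o => stopped k o i 0 * noise_incr3 (chi o) k i o) = 0.
  pose g j l o := stopped k o i 0 * (chi o * (- 2^-1 * drift_rate sigma i j l (Y k o))).
  rewrite (_ : Ex P _ = Ex P (fun o => \sum_(j < r) \sum_(l < r) g j l o * wick h (dB B delta d) j l k o)); last first.
    apply: eq_Ex => o; rewrite mulr_sumr; apply: eq_bigr => j _; rewrite mulr_sumr.
    by apply: eq_bigr => s _; rewrite mulrA.
  have Lg j l : LG P (F (pt delta d k)) (g j l) by apply: LGM => //; exact: LG_s3.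
  have Lgb j l : LG P measurable (fun o => g j l o * wick h (dB B delta d) j l k o).
    by apply: LGM => //; [exact: (LG_of HN (ltnW kN) (Lg j l))|exact: (LG_of HN kN (LG_wick HN j l kN))].
  rewrite (Ex_sum sF); last by move=> j _; apply: LG_sum => // s _; exact: Lgb.
  rewrite big1// => j _; rewrite (Ex_sum sF); last by move=> s _; exact: Lgb.
  rewrite big1// => l _; exact: (Ex_wick HN j l kN (Lg j l)).
by rewrite E1 E2 E3 !addr0.
Qed.

(** The errors that do not feed on the difference: [eta ^+ 2] from variations inside cells and from
    the distance between surrogate and true difference, [h] from the centred products and the
    Milstein remainder. *)
Let kap : R := eta ^+ 2 + h.
Let kap0 : 0 <= kap. Proof. by rewrite addr_ge0 ?sqr_ge0// ltW. Qed.
Let U o := \sum_i stopped k o i 0 ^+ 2.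

Lemma LG_U : LG P (F (pt delta d k)) U.
Proof. by apply: LG_sum => // i _; apply: LGX. Qed.

Lemma sq_sum_le o (c a : R) : 0 <= c -> 0 <= a -> (a <= c * (`|stopped k o| + 2 * eta)) ->
  a ^+ 2 <= 8 * c ^+ 2 * (U o + kap).
Proof.
move=> c0 a0 H; have s0 := normr_ge0 (stopped k o).
apply: (@le_trans _ _ ((c * (`|stopped k o| + 2 * eta)) ^+ 2)).
  by apply: lerXn2r; rewrite ?nnegrE// (le_trans a0).
have H1 : (`|stopped k o| + 2 * eta) ^+ 2 <= 8 * (`|stopped k o| ^+ 2 + eta ^+ 2).
  have := sqr_ge0 (`|stopped k o| - 2 * eta); have := sqr_ge0 `|stopped k o|.
  move: (`|stopped k o|) (eta) => p q; nra.
rewrite exprMn (_ : 8 * c ^+ 2 * _ = c ^+ 2 * (8 * (U o + kap))); last by ring.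
apply: ler_wpM2l; first exact: sqr_ge0.
apply: (le_trans H1); rewrite ler_pM2l//; apply: lerD; first exact: colnorm_sqr_le.
by rewrite lerDl ltW.
Qed.

Lemma drift_incr_sqr i o : drift_incr (chi o) k i o ^+ 2 <= 8 * L ^+ 2 * h ^+ 2 * (U o + kap).
Proof.
have [m0 dE _] := ratioP T0 HG dD; rewrite -/m -/h in m0 dE.
have E : `|drift_incr (chi o) k i o| <= (L * h) * (`|stopped k o| + 2 * eta).
  have g0 : 0 <= `|stopped k o| + 2 * eta by rewrite addr_ge0// mulr_ge0// ltW.
  have Lh : 0 <= L * h by rewrite mulr_ge0// ltW.
  apply: live_le => [|nz]; first exact: mulr_ge0.
  rewrite (_ : L * h * _ = L * (`|stopped k o| + eta) * h + m%:R * (Le * delta D)); last first.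
    by rewrite /Le dE; ring.
  apply: le_trans (ler_normD _ _) _; apply: lerD.
    by rewrite normrM (gtr0_norm h0) ler_wpM2r ?(ltW h0)//; exact: drift_diff_le.
  apply: (@sum_const_le _ m) => s; rewrite normrM (gtr0_norm (mesh_gt0 HG D)).
  by rewrite ler_wpM2r ?(ltW (mesh_gt0 HG D))//; exact: trunc_bound.
have Lh : 0 <= L * h by rewrite mulr_ge0// ltW.
rewrite -[leLHS]real_normK ?num_real//; apply: le_trans (sq_sum_le Lh (normr_ge0 _) E) _.
by rewrite exprMn !mulrA.
Qed.

Lemma P1_sqr i : Ex P (fun o => noise_incr1 (chi o) k i o ^+ 2) <= r%:R * (r%:R * (8 * K ^+ 2)) * h * (Ex P U + kap).
Proof.
pose s j o := chi o * (sigma (Xk k o) i j - sigma (Y k o) i j).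
have Ls j : LG P (F (pt delta d k)) (s j) by exact: LG_s1.
have Ls2 j : LG P (F (pt delta d k)) (fun o => s j o ^+ 2) by exact: LGX.
have Lb j := LG_of HN kN (LG_beta HN j kN).
have Lsb j : LG P measurable (fun o => (s j o * dB B delta d k o j 0) ^+ 2).
  by apply: LGX => //; apply: LGM => //; exact: (LG_of HN (ltnW kN) (Ls j)).
have LU' := LG_of HN (ltnW kN) LG_U; have LUk := LGD sF LU' (LG_cst P measurable kap).
have Esb j : Ex P (fun o => (s j o * dB B delta d k o j 0) ^+ 2) <= 8 * K ^+ 2 * h * (Ex P U + kap).
  have -> : Ex P (fun o => (s j o * dB B delta d k o j 0) ^+ 2) = h * Ex P (fun o => s j o ^+ 2).
    have := Ex_mulWW sk (noise_incr HN kN) j j (Ls2 j); rewrite eqxx mul1r => <-.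
    by apply: eq_Ex => o; ring.
  rewrite [leRHS](_ : _ = h * (8 * K ^+ 2 * (Ex P U + kap))); last by ring.
  rewrite ler_pM2l// -[X in Ex P U + X](Ex_cst P) -(ExD sF LU' (LG_cst P _ kap)) -(ExZ sF _ LUk).
  apply: (Ex_le sF); [exact: (LG_of HN (ltnW kN) (Ls2 j))|by apply: LGZ => //; apply: LGD => //; exact: LG_cst|move=> o].
  rewrite -[leLHS]real_normK ?num_real//; apply: sq_sum_le => //.
  apply: live_le => [|nz]; first by rewrite mulr_ge0// addr_ge0// mulr_ge0// ltW.
  apply: le_trans (sigma_diff_le _ _ nz) _; rewrite ler_wpM2l// lerD2l.
  by rewrite ler_peMl ?ler1n// ltW.
apply: (@le_trans _ _ (Ex P (fun o => r%:R * \sum_j (s j o * dB B delta d k o j 0) ^+ 2))).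
  apply: (Ex_le sF); [by apply: LGX => //; exact: (LG_of HN kN (LG_P1 i))|by apply: LGZ => //; apply: LG_sum|].
  by move=> o; exact: sqr_sum_card.
rewrite (ExZ sF); last by apply: LG_sum.
rewrite (Ex_sum sF); last by move=> j _; exact: Lsb.
rewrite -2!mulrA; apply: ler_wpM2l => //; rewrite -mulrA; apply: sum_le_const => j.
by rewrite mulrA; exact: Esb.
Qed.

Lemma P2_sqr i : Ex P (fun o => noise_incr2 (chi o) k i o ^+ 2) <= r%:R * (r%:R * L ^+ 2) * h * (Ex P U + kap).
Proof.
have [m0 dE NE] := ratioP T0 HG dD; rewrite -/m -/h in m0 dE NE.
have bN : (k * m + m <= N D)%N by rewrite addnC -mulSn NE leq_mul2r kN orbT.
pose V j q o := chi o * trunc Le (sigma (Xf q o) i j - sigma (Xk k o) i j).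
have mV j q : (k * m <= q)%N -> (q < k * m + m)%N -> gmeas (F (pt delta D q)) (V j q).
  by move=> q1 q2; rewrite -(subnKC q1); apply: gm_s2; rewrite ltn_subLR.
have H j := ito_block HN' j bN Le0 (mV j) (fun q o => s2_bound i j q o).
have LS2 j : LG P measurable (fun o => (\sum_(s < m) V j (k * m + s)%N o * dB B delta D (k * m + s) o j 0) ^+ 2).
  by apply: LGX => //; exact: (H j).1.
apply: (@le_trans _ _ (Ex P (fun o => r%:R * \sum_j (\sum_(s < m) V j (k * m + s)%N o * dB B delta D (k * m + s) o j 0) ^+ 2))).
  apply: (Ex_le sF); [by apply: LGX => //; exact: (LG_of HN kN (LG_P2 i))|by apply: LGZ => //; apply: LG_sum|].
  by move=> o; exact: sqr_sum_card.
rewrite (ExZ sF); last by apply: LG_sum.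
rewrite (Ex_sum sF); last by move=> j _; exact: LS2.
rewrite -2!mulrA; apply: ler_wpM2l => //; rewrite -mulrA; apply: sum_le_const => j.
apply: le_trans (H j).2 _; rewrite -dE /Le exprMn -mulrA.
apply: ler_wpM2l; first exact: sqr_ge0.
rewrite [leLHS]mulrC ler_pM2l//; apply: (@le_trans _ _ kap); first by rewrite lerDl ltW.
by rewrite lerDr; apply: Ex_ge0 => o; apply: sumr_ge0 => l _; exact: sqr_ge0.
Qed.

Let g4 : R := gconst r 4.
Let g40 : 0 <= g4. Proof. exact: le_trans ler01 (gconst_ge1 r 4). Qed.
Let EU0 : 0 <= Ex P U.
Proof. by apply: Ex_ge0 => o; apply: sumr_ge0 => l _; exact: sqr_ge0. Qed.

Lemma P3_sqr i : Ex P (fun o => noise_incr3 (chi o) k i o ^+ 2) <=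
  r%:R * (r%:R * (r%:R * (r%:R * (Dn ^+ 2 * (4 * g4))))) * h * (Ex P U + kap).
Proof.
pose s j l o := chi o * (- 2^-1 * drift_rate sigma i j l (Y k o)).
have sD j l o : `|s j l o| <= Dn by apply: live_le => // nz; exact: drift_coef_le.
have Lt j l : LG P measurable (fun o => s j l o * wick h (dB B delta d) j l k o).
  apply: LGM => //; first exact: (LG_of HN (ltnW kN) (LG_s3 i j l)).
  exact: (LG_of HN kN (LG_wick HN j l kN)).
have Lt2 j l : LG P measurable (fun o => (s j l o * wick h (dB B delta d) j l k o) ^+ 2) by exact: LGX.
have four0 : (0 : R) <= 4 by [].
have Et j l : Ex P (fun o => (s j l o * wick h (dB B delta d) j l k o) ^+ 2) <= Dn ^+ 2 * (4 * g4) * (h * kap).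
  have Ln := LG_of HN kN (LG_nexp HN kN four0).
  apply: (@le_trans _ _ (Ex P (fun o => (Dn ^+ 2 * (4 * h ^+ 2)) * nexp h 4 (dB B delta d k) o))).
    apply: (Ex_le sF); [exact: Lt2|exact: LGZ|move=> o].
    rewrite exprMn -mulrA; apply: ler_pM; rewrite ?sqr_ge0//; last exact: (wick_le HN).
    by rewrite -[leLHS]real_normK ?num_real//; apply: lerXn2r => //; rewrite nnegrE.
  rewrite (ExZ sF _ Ln); have L1c := LG_cst P (F (pt delta d k)) (1 : R).
  have := Ex_nexp HN kN four0 L1c (fun _ => ler01).
  rewrite Ex_cst mulr1 (eq_Ex _ (fun w => mul1r _)) -/g4 => H.
  apply: (@le_trans _ _ (Dn ^+ 2 * (4 * h ^+ 2) * g4)).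
    by rewrite ler_wpM2l// mulr_ge0 ?sqr_ge0// mulr_ge0 ?sqr_ge0.
  rewrite (_ : _ * g4 = Dn ^+ 2 * (4 * g4) * (h * h)); last by ring.
  apply: ler_wpM2l; first by rewrite mulr_ge0 ?sqr_ge0// mulr_ge0.
  by rewrite ler_pM2l// lerDr sqr_ge0.
apply: (@le_trans _ _ (Ex P (fun o => r%:R * \sum_j (r%:R * \sum_l (s j l o * wick h (dB B delta d) j l k o) ^+ 2)))).
  apply: (Ex_le sF).
  - by apply: LGX => //; exact: (LG_of HN kN (LG_P3 i)).
  - by apply: LGZ => //; apply: LG_sum => // j _; apply: LGZ => //; exact: LG_sum.
  - move=> o; apply: le_trans (sqr_sum_card _) _; rewrite ler_wpM2l//; apply: ler_sum => j _; exact: sqr_sum_card.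
have Ls j : LG P measurable (fun o => \sum_l (s j l o * wick h (dB B delta d) j l k o) ^+ 2) by exact: LG_sum.
rewrite (ExZ sF); last by apply: LG_sum => // j _; exact: LGZ.
rewrite (Ex_sum sF); last by move=> j _; exact: LGZ.
rewrite -2!mulrA; apply: ler_wpM2l => //; rewrite -mulrA; apply: sum_le_const => j.
rewrite (ExZ sF _ (Ls j)) -mulrA; apply: ler_wpM2l => //; rewrite -mulrA.
rewrite (Ex_sum sF); last by move=> l _; exact: Lt2.
apply: sum_le_const => l; apply: (le_trans (Et j l)).
apply: (@le_trans _ _ (Dn ^+ 2 * (4 * g4) * (h * (Ex P U + kap)))); last by rewrite !mulrA.
apply: ler_wpM2l; first by rewrite mulr_ge0 ?sqr_ge0// mulr_ge0.
by rewrite ler_pM2l// lerDr.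
Qed.

(** The mean square of the remainder is of order [h^3]; one power of [h] goes into [kap] and leaves
    the [h^2] that [stopped_recursion] asks for. *)
Lemma rem_sqr i : Ex P (fun o => (chi o * - milstein_rem k i o) ^+ 2) <=
  C ^+ 2 * Bn ^+ 4 * gconst r (2 * lam) * h ^+ 2 * kap.
Proof.
have C0 : 0 <= C := le_trans ler01 C1.
have lam20 : 0 <= 2 * lam by exact: mulr_ge0.
have Ln := LG_of HN kN (LG_nexp HN kN lam20).
apply: (@le_trans _ _ (Ex P (fun o => (C ^+ 2 * h ^+ 3 * Bn ^+ 4) * nexp h (2 * lam) (dB B delta d k) o))).
  apply: (Ex_le sF); [by apply: LGX => //; exact: (LG_of HN kN (LG_rem i))|exact: LGZ|move=> o].
  have H := rem_bound i o; rewrite -[leLHS]real_normK ?num_real//.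
  apply: (@le_trans _ _ ((C * (h * Num.sqrt h) * Bn ^+ 2 * nexp h lam (dB B delta d k) o) ^+ 2)).
    by apply: lerXn2r => //; rewrite nnegrE (le_trans _ H).
  have -> : nexp h (2 * lam) (dB B delta d k) o = nexp h lam (dB B delta d k) o ^+ 2 by rewrite nexpX.
  have sh : h ^+ 3 = (h * Num.sqrt h) ^+ 2 by rewrite exprMn sqr_sqrtr ?(ltW h0)//; ring.
  by rewrite sh le_eqVlt; apply/orP; left; apply/eqP; ring.
rewrite (ExZ sF _ Ln); have L1c := LG_cst P (F (pt delta d k)) (1 : R).
have := Ex_nexp HN kN lam20 L1c (fun _ => ler01).
rewrite Ex_cst mulr1 (eq_Ex _ (fun w => mul1r _)) => H.
have A0 : 0 <= C ^+ 2 * h ^+ 3 * Bn ^+ 4.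
  by apply: mulr_ge0; [apply: mulr_ge0; [exact: sqr_ge0|apply: exprn_ge0; exact: ltW]|exact: exprn_ge0].
apply: (le_trans (ler_wpM2l A0 H)).
rewrite [leLHS](_ : _ = C ^+ 2 * Bn ^+ 4 * gconst r (2 * lam) * h ^+ 2 * h); last by ring.
apply: ler_wpM2l; last by rewrite lerDr sqr_ge0.
have G1 := gconst_ge1 r (2 * lam).
apply: mulr_ge0; last exact: sqr_ge0.
apply: mulr_ge0; last exact: le_trans ler01 G1.
by apply: mulr_ge0; [exact: sqr_ge0|exact: exprn_ge0].
Qed.

Lemma noise_sqr i : Ex P (fun o => (noise_incr1 (chi o) k i o + noise_incr2 (chi o) k i o + noise_incr3 (chi o) k i o) ^+ 2)
  <= 3 * (r%:R * (r%:R * (8 * K ^+ 2)) + r%:R * (r%:R * L ^+ 2) +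
      r%:R * (r%:R * (r%:R * (r%:R * (Dn ^+ 2 * (4 * g4)))))) * h * (Ex P U + kap).
Proof.
have A1 := LG_of HN kN (LG_P1 i); have A2 := LG_of HN kN (LG_P2 i); have A3 := LG_of HN kN (LG_P3 i).
have B1 := LGX 2 sF A1; have B2 := LGX 2 sF A2; have B3 := LGX 2 sF A3.
apply: (@le_trans _ _ (Ex P (fun o => 3 * (noise_incr1 (chi o) k i o ^+ 2 + noise_incr2 (chi o) k i o ^+ 2 + noise_incr3 (chi o) k i o ^+ 2)))).
  apply: (Ex_le sF).
  - by apply: LGX => //; exact: (LGD sF (LGD sF A1 A2) A3).
  - by apply: LGZ => //; exact: (LGD sF (LGD sF B1 B2) B3).
  - by move=> o; exact: sqr_add3_le.
rewrite (ExZ sF _ (LGD sF (LGD sF B1 B2) B3)) (ExD sF (LGD sF B1 B2) B3) (ExD sF B1 B2).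
rewrite -2!mulrA ler_pM2l// [leRHS]mulrDl; apply: lerD; first (rewrite [leRHS]mulrDl; apply: lerD).
- by rewrite mulrA; exact: P1_sqr.
- by rewrite mulrA; exact: P2_sqr.
- by rewrite mulrA; exact: P3_sqr.
Qed.

End Step.

Let Dn : R := v%:R * (K * (K * (1 + q0))).

Definition comparison_rate := 8 * L ^+ 2 + 3 * (r%:R * (r%:R * (8 * K ^+ 2)) + r%:R * (r%:R * L ^+ 2) +
   r%:R * (r%:R * (r%:R * (r%:R * (Dn ^+ 2 * (4 * gconst r 4)))))) +
   C ^+ 2 * (1 + q0) ^+ 4 * gconst r (2 * lam).

Lemma comparison_rate_terms : [/\ 0 <= 8 * L ^+ 2,
  0 <= 3 * (r%:R * (r%:R * (8 * K ^+ 2)) + r%:R * (r%:R * L ^+ 2) +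
   r%:R * (r%:R * (r%:R * (r%:R * (Dn ^+ 2 * (4 * gconst r 4)))))) &
  0 <= C ^+ 2 * (1 + q0) ^+ 4 * gconst r (2 * lam)].
Proof.
have G1 := gconst_ge1 r (4 : R); have G2 := gconst_ge1 r (2 * lam).
have G10 := le_trans ler01 G1; have G20 := le_trans ler01 G2.
have q00 : 0 <= 1 + q0 by rewrite addr_ge0// addr_ge0// ltW.
have c1 : 0 <= 8 * L ^+ 2 by rewrite mulr_ge0 ?sqr_ge0.
have c2 : 0 <= 3 * (r%:R * (r%:R * (8 * K ^+ 2)) + r%:R * (r%:R * L ^+ 2) +
   r%:R * (r%:R * (r%:R * (r%:R * (Dn ^+ 2 * (4 * gconst r 4)))))).
  have a2 : 0 <= Dn ^+ 2 * (4 * gconst r 4) by rewrite mulr_ge0 ?sqr_ge0// mulr_ge0.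
  apply: mulr_ge0 => //; apply: addr_ge0; first apply: addr_ge0.
  - by do 2! apply: mulr_ge0 => //; rewrite mulr_ge0 ?sqr_ge0.
  - by do 2! apply: mulr_ge0 => //; exact: sqr_ge0.
  - by do 4! apply: mulr_ge0 => //.
have c3 : 0 <= C ^+ 2 * (1 + q0) ^+ 4 * gconst r (2 * lam).
  by apply: mulr_ge0 => //; apply: mulr_ge0; [exact: sqr_ge0|exact: exprn_ge0].
by [].
Qed.

Lemma comparison_rate_ge0 : 0 <= comparison_rate.
Proof. by have [? ? ?] := comparison_rate_terms; rewrite /comparison_rate !addr_ge0. Qed.

Lemma LG_stopped k i : (k <= N d)%N -> LG P (F (pt delta d k)) (fun o => stopped k o i 0).
Proof.
elim: k i => [|k IH] i kN.
  by under eq_fun do rewrite /= mxE; exact: LG_cst.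
exact: (LG_stopped_step kN (fun l => IH l (ltnW kN))).
Qed.

Lemma stopped_second_moment : Ex P (fun o => \sum_i stopped (N d) o i 0 ^+ 2) <=
  T * stopped_rate v T comparison_rate * (eta ^+ 2 + h) * expR (T * stopped_rate v T comparison_rate).
Proof.
have hT : (N d)%:R * h <= T by rewrite -(grid_end HG d).
have [c1 c2 c3] := comparison_rate_terms; have cr0 := comparison_rate_ge0.
have kap0 : 0 <= eta ^+ 2 + h by rewrite addr_ge0 ?sqr_ge0// ltW.
pose w k i o := stopped k o i 0.
pose a k i o := drift_incr (live k o) k i o.
pose M k i o := noise_incr1 (live k o) k i o + noise_incr2 (live k o) k i o + noise_incr3 (live k o) k i o.
pose rho k i o := live k o * - milstein_rem k i o.
have Lst k i (kN : (k < N d)%N) := LG_stopped i (ltnW kN).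
apply: (@stopped_recursion _ _ _ P v (N d) h T comparison_rate (eta ^+ 2 + h) w a M rho) => //.
- by move=> i o; rewrite /w/= mxE.
- by move=> k i o kN; rewrite /w/= /stopped_incr !mxE !addrA.
- by move=> k i kN; exact: (LG_of HN kN (LG_stopped i kN)).
- by move=> k i kN; exact: (LG_of HN kN (LG_a kN (fun l => Lst k l kN) i)).
- move=> k i kN; have H l := Lst k l kN; apply: LGD => //; first apply: LGD => //.
  + exact: (LG_of HN kN (LG_P1 kN H i)).
  + exact: (LG_of HN kN (LG_P2 kN H i)).
  + exact: (LG_of HN kN (LG_P3 kN H i)).
- by move=> k i kN; exact: (LG_of HN kN (LG_rem kN (fun l => Lst k l kN) i)).
- move=> k i o kN; apply: le_trans (drift_incr_sqr k i o) _.
  apply: ler_wpM2r; first by rewrite addr_ge0// sumr_ge0// => l _; exact: sqr_ge0.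
  by apply: ler_wpM2r; [exact: sqr_ge0|rewrite /comparison_rate -addrA lerDl addr_ge0].
- by move=> k i kN; exact: (orth_noise kN (fun l => Lst k l kN) i).
- move=> k i kN; apply: le_trans (noise_sqr kN (fun l => Lst k l kN) i) _.
  apply: ler_wpM2r; first by rewrite addr_ge0//; apply: Ex_ge0 => o; rewrite sumr_ge0// => l _; exact: sqr_ge0.
  apply: ler_wpM2r; first exact: ltW.
  by rewrite /comparison_rate -[leLHS]add0r -[leLHS]addr0; apply: lerD => //; apply: lerD.
- move=> k i kN; apply: le_trans (rem_sqr kN (fun l => Lst k l kN) i) _.
  do 2! (apply: ler_wpM2r; first by [|exact: sqr_ge0]).
  by rewrite /comparison_rate lerDr addr_ge0.
Qed.

(** [X] at a coarse point is replaced by its fine Ito sum, which obeys an exact recursion; the two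
    differ by [ito_error]. *)
Definition exact_gap k o : 'cV[R]_v :=
  \col_i (x0 i 0 + \sum_(q < k * m) ito_step b sigma B delta X D q o i - Y k o i 0).

Section GoodPath.
Variable o : Omega.
Hypotheses (Xn : forall t, 0 <= t <= T -> `|X t o| <= n)
  (Xe : forall k i, (k <= N d)%N -> `|ito_error b sigma B N delta x0 X d D k o i| <= eta)
  (Xo : ~ vosc T delta X d eta o).

(** On a good path all truncations are inactive, and the increment with [c = 1] is an algebraic
    rewriting of one block of the fine sum minus the Milstein expansion of [Y]. *)
Lemma gap_step k i : (k < N d)%N ->
  exact_gap k.+1 o i 0 = exact_gap k o i 0 + stopped_incr 1 k i o.
Proof.
move=> kN; have [m0 dE _] := ratioP T0 HG dD; rewrite -/m -/h in m0 dE.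
have kT := pt_in HG (ltnW kN).
have close s : (s < m)%N -> `|Xf (k * m + s) o - Xk k o| <= eta.
  move=> sm; have [A [A1 A2]] := block_index kN sm.
  apply: (vosc_cell HG Xo kN); rewrite A1 /=; apply: le_trans A2; exact: (pt_le HG).
have Xkn : `|Xk k o| <= q0 by apply: (le_trans (Xn kT)); rewrite lerDl.
have Xfn s : (s < m)%N -> `|Xf (k * m + s) o| <= q0.
  move=> sm; have [A _] := block_index kN sm.
  by apply: (le_trans (Xn (pt_in HG (ltnW A)))); rewrite lerDl.
have tr1 s : (s < m)%N -> trunc Le (ito_drift i (Xf (k * m + s) o) - ito_drift i (Xk k o)) =
    ito_drift i (Xf (k * m + s) o) - ito_drift i (Xk k o).
  move=> sm; apply: trunc_id; apply: le_trans (ito_drift_lip _ (Xfn s sm) Xkn) _.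
  by rewrite ler_wpM2l//; exact: close.
have tr2 s j : (s < m)%N -> trunc Le (sigma (Xf (k * m + s) o) i j - sigma (Xk k o) i j) =
    sigma (Xf (k * m + s) o) i j - sigma (Xk k o) i j.
  move=> sm; apply: trunc_id; apply: le_trans (cb_s_lip cb _ _ _ _) _.
  by apply: ler_pM => //; [exact: local_lip_ge|exact: close].
have S : \sum_(q < k.+1 * m) ito_step b sigma B delta X D q o i =
    \sum_(q < k * m) ito_step b sigma B delta X D q o i + \sum_(s < m) ito_step b sigma B delta X D (k * m + s) o i.
  by rewrite -!(block_sum (fun q => ito_step b sigma B delta X D q o i)) big_ord_recr.
have S1 : \sum_(s < m) ito_step b sigma B delta X D (k * m + s) o i =
    \sum_(s < m) (ito_drift i (Xf (k * m + s) o) - ito_drift i (Xk k o)) * delta D + ito_drift i (Xk k o) * h +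
    (\sum_(j < r) \sum_(s < m) (sigma (Xf (k * m + s) o) i j - sigma (Xk k o) i j) * dB B delta D (k * m + s) o j 0
     + \sum_(j < r) sigma (Xk k o) i j * dB B delta d k o j 0).
  rewrite /ito_step big_split /=; congr (_ + _).
    have <- : \sum_(s < m) ito_drift i (Xk k o) * delta D = ito_drift i (Xk k o) * h.
      by rewrite sumr_const card_ord dE -[LHS]mulr_natl; ring.
    rewrite -big_split /=; by apply: eq_bigr => s _; rewrite /ito_drift; ring.
  rewrite exchange_big -big_split /=; apply: eq_bigr => j _.
  rewrite -(dB_block B T0 HG k j o dD) mulr_sumr -big_split /=.
  by apply: eq_bigr => s _; rewrite /Xf /XD; ring.
have W : noise_incr3 1 k i o = - 2^-1 * \sum_(j < r) \sum_(l < r) drift_rate sigma i j l (Y k o) *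
    (dB B delta d k o j 0 * dB B delta d k o l 0) + 2^-1 * (\sum_(j < r) drift_rate sigma i j j (Y k o)) * h.
  rewrite /noise_incr3 mulr_sumr mulr_sumr mulr_suml -big_split /=; apply: eq_bigr => j _.
  have -> : 2^-1 * drift_rate sigma i j j (Y k o) * h =
     \sum_(l < r) 2^-1 * drift_rate sigma i j l (Y k o) * ((j == l)%:R * h).
    rewrite (bigD1 j)//= eqxx mul1r big1 ?addr0// => l lj.
    by rewrite eq_sym (negbTE lj) mul0r mulr0.
  by rewrite mulr_sumr -big_split /=; apply: eq_bigr => l _; rewrite /wick; ring.
have D1 : drift_incr 1 k i o = (ito_drift i (Xk k o) - ito_drift i (Y k o)) * h +
    \sum_(s < m) (ito_drift i (Xf (k * m + s) o) - ito_drift i (Xk k o)) * delta D.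
  by rewrite /drift_incr mul1r; congr (_ + _); apply: eq_bigr => s _; rewrite tr1.
have N1 : noise_incr1 1 k i o = \sum_(j < r) sigma (Xk k o) i j * dB B delta d k o j 0 -
    \sum_(j < r) sigma (Y k o) i j * dB B delta d k o j 0.
  by rewrite /noise_incr1 -sumrB; apply: eq_bigr => j _; ring.
have N2 : noise_incr2 1 k i o = \sum_(j < r) \sum_(s < m)
    (sigma (Xf (k * m + s) o) i j - sigma (Xk k o) i j) * dB B delta D (k * m + s) o j 0.
  by apply: eq_bigr => j _; apply: eq_bigr => s _; rewrite tr2// mul1r.
rewrite /exact_gap !mxE S S1 /stopped_incr D1 N1 N2 W /milstein_rem -/(Y k.+1 o).
have YD : ito_drift i (Y k o) = b (Y k o) i 0 + 2^-1 * \sum_(j < r) drift_rate sigma i j j (Y k o) by [].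
rewrite YD; ring.
Qed.

Lemma gap_error k i : (Xk k o - Y k o - exact_gap k o) i 0 = ito_error b sigma B N delta x0 X d D k o i.
Proof. by rewrite !mxE /ito_error -/m /Xk /XD; ring. Qed.

Lemma stopped_exit k l : (k <= l)%N -> eps < `|stopped k o| -> stopped l o = stopped k o.
Proof.
move=> kl ek; elim: l kl => [|l IH]; first by rewrite leqn0 => /eqP ->.
rewrite leq_eqVlt => /predU1P[<-//|kl]; rewrite /= IH//.
have -> : \col_i stopped_incr (alive l (stopped k o) o) l i o = 0.
  apply/matrixP => i j; rewrite !mxE /alive [X in [&& _, _ & X]]leNgt ek/= !andbF.
  rewrite /stopped_incr /drift_incr /noise_incr1 /noise_incr2 /noise_incr3 !mul0r add0r addr0.
  rewrite !big1 ?addr0// => l' _; rewrite ?mul0r// big1// => l'' _; by rewrite !mul0r.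
by rewrite addr0.
Qed.

(** As long as the surrogate equals the exact gap and does not exceed [eps], its distance to [X - Y]
    is given by [ito_error], at most [eta]; the indicator is then 1 and the next step is exact as
    well. *)
Lemma stopped_gap k : (k <= N d)%N -> stopped k o = exact_gap k o \/ eps < `|stopped k o|.
Proof.
elim: k => [_|k IH kN].
  by left; apply/matrixP => i j; rewrite ord1 !mxE mul0n big_ord0 addr0 /Y /gval mul0r xstart subrr.
have [E|ex] := IH (ltnW kN); last by right; rewrite (stopped_exit (leqnSn k)).
have [le|ex] := leP `|stopped k o| eps; last by right; rewrite (stopped_exit (leqnSn k)).
have A : alive k (stopped k o) o = 1.
  rewrite /alive le (Xn (pt_in HG (ltnW kN))) E (_ : `|_| <= eta)//.
  by apply: colnorm_le => [|l]; [exact: ltW|rewrite gap_error; exact: Xe (ltnW kN)].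
left; apply/matrixP => i j.
have Sk : stopped k.+1 o i 0 = stopped k o i 0 + stopped_incr (alive k (stopped k o) o) k i o by rewrite /= !mxE.
by rewrite ord1 Sk A gap_step// E.
Qed.

(** A surrogate that has exceeded [eps] is frozen, so that the excursion is still visible at the
    last step. A second moment at one time thus controls all coarse points on good paths, without a
    maximal inequality. *)
Lemma good_path_exit k : (k <= N d)%N -> eps + eta < `|Xk k o - Y k o| ->
  eps ^+ 2 <= \sum_i stopped (N d) o i 0 ^+ 2.
Proof.
move=> kN H; have ex : eps < `|stopped k o|.
  have [->|//] := stopped_gap kN.
  have G : `|Xk k o - Y k o - exact_gap k o| <= eta.
    by apply: colnorm_le => [|l]; [exact: ltW|rewrite gap_error; exact: Xe].
  rewrite ltNge; apply/negP => le; move: H; rewrite ltNge => /negP; apply.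
  rewrite -[Xk k o - Y k o](subrK (exact_gap k o)) addrC.
  by apply: le_trans (ler_normD _ _) _; apply: lerD.
rewrite (stopped_exit kN ex); apply: le_trans (colnorm_sqr_le _).
by apply: lerXn2r; rewrite ?nnegrE ?(ltW eps0)//; exact: ltW.
Qed.

End GoodPath.

End Stopped.

Variable (x : nat -> Omega -> R -> 'cV[R]_v).
Hypotheses (xstart : forall d o, x d o 0 = x0)
  (xpiece : forall d k o, (k < N d)%N -> ode_piece b sigma (k%:R * delta d) (delta d) (dB B delta d k o) (x d o)).

(** The choices are made in the order [n], [eps], [eta], [d], [D]. Among these the rate depends on
    [n] alone, which keeps the argument from being circular, and [D] has to serve only the finitely
    many points of the grid [d]. *)
Lemma comparison_cvg e : 0 < e -> prare P \oo (fun d =>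
  [set o | exists2 k, (k <= N d)%N & e < `|XD delta X d k o - gval (delta d) (x d) k o|]).
Proof.
move=> e0 p p0.
have p2 : 0 < p / 2 by rewrite divr_gt0.
have p4 : 0 < p / 2 / 2 by rewrite divr_gt0.
have [n n0 Hn] := sol_bounded FU T0 HG HX p4.
pose eps := Num.min 1 (e / 2).
have eps0 : 0 < eps by rewrite lt_min ltr01 divr_gt0.
have eps1 : eps <= 1 by rewrite ge_min lexx.
pose rate := stopped_rate v T (comparison_rate n).
pose Q := T * rate * expR (T * rate).
have Q1 : 0 < `|Q| + 1 by rewrite ltr_wpDl.
(* Once [eta ^+ 2] and [delta d] are at most [c], the second moment is at most [2 * (|Q| + 1) * c],
   that is [eps ^+ 2] times the allotted probability. *)
pose c := eps ^+ 2 * (p / 2 / 2) / (2 * (`|Q| + 1)).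
have c0 : 0 < c by rewrite divr_gt0 ?mulr_gt0// exprn_gt0.
pose eta := Num.min eps c.
have eta0 : 0 < eta by rewrite lt_min eps0.
have eta1 : eta <= 1 by rewrite ge_min eps1.
have etae : eta <= eps by rewrite ge_min lexx.
have etac : eta ^+ 2 <= c.
  apply: (@le_trans _ _ eta); last by rewrite ge_min lexx orbT.
  by rewrite expr2 ger_pMl.
apply: filterS2 (prare_sol_osc FU T0 HG HX eta0 p4) (mesh_small_near HG c0) => d Hosc hc.
(* The allotted probability is shared among [(N d).+1] points and [v] coordinates; [v.+1] keeps the
   share positive when [v] is 0. *)
have p' : 0 < (p / 2 / 2) / ((N d).+1%:R * v.+1%:R) by rewrite divr_gt0// mulr_gt0.
have near_err : \forall D \near \oo, forall k : 'I_(N d).+1, forall i : 'I_v,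
    pr_le P [set o | eta < `|ito_error b sigma B N delta x0 X d D k o i|] ((p / 2 / 2) / ((N d).+1%:R * v.+1%:R)).
  apply: filter_forall => k; apply: filter_forall => i.
  exact: (ito_expansion_cvg cb FU BW T0 HG HX i (leq_ord k) eta0 p').
have near_ge : \forall D \near \oo, (d <= D)%N by exists d.
have [D [Herr dD]] := filter_ex (filterI near_err near_ge).
have Herr' : pr_le P [set o | exists2 k, (k < (N d).+1)%N & exists i, eta < `|ito_error b sigma B N delta x0 X d D k o i|] (p / 2 / 2).
  have A k : (k < (N d).+1)%N -> pr_le P [set o | exists i, eta < `|ito_error b sigma B N delta x0 X d D k o i|]
      (v%:R * ((p / 2 / 2) / ((N d).+1%:R * v.+1%:R))).
    by move=> kN; apply: pr_le_exists => i; exact: (Herr (Ordinal kN)).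
  apply: pr_le_sub (pr_le_bigcup A) => //.
  have Nn : (N d).+1%:R / (N d).+1%:R = 1 :> R by rewrite divff// pnatr_eq0.
  rewrite invfM (_ : _ * _ = ((N d).+1%:R / (N d).+1%:R) * ((p / 2 / 2) * (v%:R / v.+1%:R))); last by ring.
  rewrite Nn mul1r.
  by rewrite ger_pMr// ler_pdivrMr// mul1r ler_nat.
have LS i := LG_of (wiener_noise FU BW HG d) (leqnn (N d))
  (LG_stopped dD (xstart d) (@xpiece d) n0 eta0 eta1 eps1 i (leqnn (N d))).
have Hst := stopped_second_moment dD (xstart d) (@xpiece d) n0 eta0 eta1 eps1.
set S := fun o => \sum_i stopped d D (x d) n eta eps (N d) o i 0 ^+ 2 in Hst.
have LSS : LG P measurable S by apply: LG_sum => // i _; apply: LGX => //; exact: LS.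
have S0 o : 0 <= S o by apply: sumr_ge0 => i _; exact: sqr_ge0.
have e2 : 0 < eps ^+ 2 by rewrite exprn_gt0.
have HS : pr_le P [set o | eps ^+ 2 <= S o] (p / 2 / 2).
  apply: pr_le_sub (pr_le_markov LSS S0 e2) => //; rewrite ler_pdivrMr//; apply: le_trans Hst _.
  rewrite -/rate (_ : T * rate * _ * _ = Q * (eta ^+ 2 + delta d)); last by rewrite /Q; ring.
  apply: (@le_trans _ _ ((`|Q| + 1) * (c + c))).
    apply: ler_pM => //; last by apply: lerD => //; exact: ltW.
    - rewrite /Q /rate; apply: mulr_ge0; last exact: expR_ge0.
      apply: mulr_ge0; first exact: ltW.
      by apply: stopped_rate_ge0; [exact: ltW|exact: comparison_rate_ge0].
    - by rewrite addr_ge0 ?sqr_ge0// ltW// (mesh_gt0 HG).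
    - by rewrite (le_trans (ler_norm _))// lerDl.
  rewrite (_ : _ * (c + c) = (2 * (`|Q| + 1)) * c); last by ring.
  by rewrite /c mulrC divfK ?gt_eqF ?mulr_gt0// mulrC.
have C1' := pr_le_cover (@subset_refl _ _) Hosc HS.
have C2' := pr_le_cover (@subset_refl _ _) Hn Herr'.
apply: pr_le_cover C1' C2' => o [k kN H] /=.
have [|no] := pselect (vosc T delta X d eta o); first by left; left.
have [|nX] := pselect (exists2 t, 0 <= t <= T & n < `|X t o|); first by right; left.
have [|nE] := pselect (exists2 k, (k < (N d).+1)%N & exists i, eta < `|ito_error b sigma B N delta x0 X d D k o i|).
  by right; right.
left; right; apply: (good_path_exit dD (xstart d) n0 eta0 eps0 _ _ no kN).
- by move=> t tT; rewrite leNgt; apply/negP => Ht; apply: nX; exists t.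
- by move=> l i lN; rewrite leNgt; apply/negP => Hl; apply: nE; exists l => //; exists i.
- apply: le_lt_trans H; apply: (@le_trans _ _ (eps + eps)); first by rewrite lerD2l.
  by rewrite [leRHS]splitr lerD// ge_min lexx orbT.
Qed.

End Comparison.

(** * Convergence in mean square *)

Section NonMeasurable.
Import HBNNSimple.
Context {R : realType} {disp : measure_display} {Omega : measurableType disp}.
Variable P : probability Omega R.

(* [g] need not be measurable: its integral is bounded through the simple
   functions below it. *)
Lemma le_integral_dominated (g D : Omega -> \bar R) : (forall o, (0 <= g o)%E) ->
  measurable_fun setT D -> (forall o, (0 <= D o)%E) -> {ae P, forall o, (g o <= D o)%E} ->
  (\int[P]_o g o <= \int[P]_o D o)%E.
Proof.
move=> g0 mD D0 gD; rewrite ge0_integralE//; apply: ge_ereal_sup => _ /= [h hg <-].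
rewrite -integralT_nnsfun; apply: ae_ge0_le_integral => //.
- by move=> o _; rewrite lee_fin; exact: fun_ge0.
- exact/measurable_EFinP.
- apply: filterS gD => o go _; apply: le_trans go.
  by have := hg o; rewrite patchT// inE.
Qed.

(** [G] is the lower limit of the sequence, and Fatou's lemma bounds its integral. The last clause
    lets [G] dominate, path by path, quantities that need not be measurable. *)
Lemma fatou_dominator (f : nat -> Omega -> R) (c : R) : (forall n, measurable_fun setT (f n)) ->
  (forall n o, 0 <= f n o) -> (forall n, (\int[P]_o (f n o)%:E <= c%:E)%E) ->
  exists G : Omega -> \bar R, [/\ measurable_fun setT G, forall o, (0 <= G o)%E,
    (\int[P]_o G o <= c%:E)%E &
    forall o a, (\forall n \near \oo, a <= f n o) -> (a%:E <= G o)%E].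
Proof.
move=> mf f0 fc; pose u n o := (f n o)%:E.
have mu n : measurable_fun setT (u n) by exact/measurable_EFinP.
have lb o a : (\forall n \near \oo, a <= f n o) -> (a%:E <= limn_einf (u^~ o))%E.
  move=> [n0 _ Hn]; rewrite limn_einf_lim.
  rewrite (cvg_lim _ (@cvg_einfs_sup _ (u^~ o)))//.
  apply: le_trans (ereal_sup_ubound _); last by exists n0.
  by apply: le_ereal_inf_tmp => _ [m /= nm <-]; rewrite lee_fin; exact: Hn.
exists (fun o => limn_einf (u^~ o)); split => //.
- rewrite /limn_einf; apply: measurableT_comp => //.
  apply: (measurable_fun_limn_esup (f := fun n o => (- u n o)%E)) => n.
  exact: measurableT_comp.
- by move=> o; apply: lb; exists 0%N => // n _; exact: f0.
- apply: le_trans (fatou P measurableT mu _) _; first by move=> n o _; rewrite lee_fin.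
  rewrite limn_einf_lim (cvg_lim _ (@cvg_einfs_sup _ _))//.
  apply: ge_ereal_sup => _ [n _ <-]; apply: le_trans (fc n).
  by apply: ereal_inf_lbound; exists n => /=.
Qed.

Lemma measurable_runmax (V : nat -> Omega -> R) k : (forall i, (i <= k)%N -> measurable_fun setT (V i)) ->
  measurable_fun setT (runmax V k).
Proof.
elim: k => [|k IH] mV; first exact: mV.
by apply: measurable_maxr; [apply: IH => i ik; apply: mV; exact: leqW|exact: mV].
Qed.

Lemma runmax_ex (V : nat -> Omega -> R) k o : exists2 i, (i <= k)%N & runmax V k o = V i o.
Proof.
elim: k => [|k [i ik IH]]; first by exists 0%N.
by rewrite /= IH; case: leP => _; [exists k.+1|exists i => //; exact: leqW].
Qed.

End NonMeasurable.

(** * From coarse points to all times, and from probability to mean square *)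

Section Conclusion.
Context {R : realType} {disp : measure_display} {Omega : measurableType disp} {v r : nat}.
Variables (b : 'cV[R]_v -> 'cV[R]_v) (sigma : 'cV[R]_v -> 'M[R]_(v, r)) (K : R).
Hypothesis cb : coefficient_bounds b sigma K.
Variables (P : probability Omega R) (T : R) (F : R -> set (set Omega)).
Hypothesis FU : usual_filtration P T F.
Variables (B : R -> Omega -> 'cV[R]_r).
Hypothesis BW : wiener_process P T F B.
Variables (N : nat -> nat) (delta : nat -> R) (t_ : nat -> nat -> R).
Hypotheses (T0 : 0 < T) (HG : nested_partitions T N delta t_).
Variables (x0 : 'cV[R]_v) (X : R -> Omega -> 'cV[R]_v).
Hypothesis HX : stratonovich_sde_solution P T F b sigma x0 B X.
Variables (C lam : R).
Hypotheses (C1 : 1 <= C) (lam0 : 0 <= lam) (HC : step_bounds b sigma T C lam).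
Variable (x : nat -> Omega -> R -> 'cV[R]_v).
Hypotheses (xstart : forall d o, x d o 0 = x0)
  (xpiece : forall d k o, (k < N d)%N -> ode_piece b sigma (k%:R * delta d) (delta d) (dB B delta d k o) (x d o)).
Let sF := @sub_sigma_full disp Omega.

Let HN d := wiener_noise FU BW HG d.
Let modulus d := ode_modulus C lam (N d) (delta d) (dB B delta d) (x d).
Let dominator d := ode_dominator C lam (N d) (delta d) (dB B delta d) (x d).

Lemma LG_modulus_at d : LG P measurable (modulus d).
Proof. exact: (LG_modulus cb lam0 HC (HN d) (mesh_gt0 HG d) (mesh_le T0 HG d) (xstart d) (@xpiece d)). Qed.

Lemma Ex_modulus_at d : Ex P (modulus d) <= @modulus_rate R v r T C lam x0 * delta d.
Proof. exact: (Ex_modulus cb C1 lam0 HC (HN d) (mesh_gt0 HG d) (grid_end HG d) (mesh_le T0 HG d) (xstart d) (@xpiece d)). Qed.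

Lemma LG_dominator_at d : LG P measurable (dominator d).
Proof. exact: (LG_dominator cb lam0 HC (HN d) (mesh_gt0 HG d) (mesh_le T0 HG d) (xstart d) (@xpiece d)). Qed.

Lemma Ex_dominator_at d : Ex P (dominator d) <= @dominator_bound R v r T C lam x0.
Proof. exact: (Ex_dominator cb C1 lam0 HC (HN d) (mesh_gt0 HG d) (grid_end HG d) (mesh_le T0 HG d) (xstart d) (@xpiece d)). Qed.

Lemma modulus_le_at d k t o : (k < N d)%N -> pt delta d k <= t <= pt delta d k.+1 ->
  `|x d o t - gval (delta d) (x d) k o| ^+ 4 <= modulus d o.
Proof. exact: (ode_modulus_le C1 HC (mesh_gt0 HG d) (mesh_le T0 HG d) (@xpiece d)). Qed.

Lemma dominator_le_at d t o : 0 <= t <= T -> (1 + `|x d o t|) ^+ 4 <= dominator d o.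
Proof. exact: (ode_dominator_le C1 HC (mesh_gt0 HG d) (grid_end HG d) (mesh_le T0 HG d) (@xpiece d)). Qed.

Lemma modulus_nonneg d o : 0 <= modulus d o.
Proof.
have k0 : pt delta d 0 <= pt delta d 0 <= pt delta d 1 by rewrite lexx (pt_le HG).
by apply: le_trans (modulus_le_at o (grid_size_gt0 T0 HG d) k0); rewrite exprn_even_ge0.
Qed.

Lemma dominator_nonneg d o : 0 <= dominator d o.
Proof.
have tT : 0 <= (0 : R) <= T by rewrite lexx ltW.
by apply: le_trans (dominator_le_at d o tT); rewrite exprn_even_ge0.
Qed.

Definition apart d e := [set o | exists2 t, 0 <= t <= T & e < `|X t o - x d o t|].

(** Three errors of [e / 3]: the oscillation of [X] in a cell, the distance at the coarse point, and
    the displacement of the polygonal solution in the cell. *)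
Lemma prare_apart e : 0 < e -> prare P \oo (fun d => apart d e).
Proof.
move=> e0; have e3 : 0 < e / 3 by rewrite divr_gt0.
have Hm : prare P \oo (fun d => [set o | (e / 3) ^+ 4 <= modulus d o]).
  move=> p p0; have e4 : 0 < (e / 3) ^+ 4 by rewrite exprn_gt0.
  have m0 : 0 <= @modulus_rate R v r T C lam x0.
    exact: (modulus_rate_ge0 _ _ C1 (mesh_gt0 HG 0) (mesh_le T0 HG 0)).
  set m := modulus_rate _ _ _ _ in m0.
  have q0 : 0 < p * (e / 3) ^+ 4 / (m + 1) by rewrite divr_gt0 ?mulr_gt0// ltr_wpDl.
  apply: filterS (mesh_small_near HG q0) => d; rewrite ltr_pdivlMr ?ltr_wpDl// => dq.
  apply: pr_le_sub (pr_le_markov (LG_modulus_at d) _ e4) => //.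
    rewrite ler_pdivrMr//; apply: le_trans (Ex_modulus_at d) _; rewrite -/m.
    have := mesh_gt0 HG d; move: dq; lra.
  exact: modulus_nonneg.
apply: prare_sub (prareU (prareU (prare_sol_osc FU T0 HG HX e3) (comparison_cvg cb FU BW T0 HG HX C1 lam0 HC xstart xpiece e3)) Hm).
exists 0%N => // d _ o [t tT].
apply: contraPP => H; apply/negP; rewrite -leNgt.
have {H}[Hv [Hc Hm']] : ~ vosc T delta X d (e / 3) o /\
    ~ (exists2 k, (k <= N d)%N & e / 3 < `|XD delta X d k o - gval (delta d) (x d) k o|) /\
    ~ ((e / 3) ^+ 4 <= modulus d o).
  by split; [|split] => A; apply: H; [left; left|left; right|right].
have [k kN kt] := grid_floor T0 HG d tT.
have A1 := vosc_cell HG Hv kN kt.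
have A2 : `|XD delta X d k o - gval (delta d) (x d) k o| <= e / 3.
  by rewrite leNgt; apply/negP => A; apply: Hc; exists k => //; exact: ltnW.
have A3 : `|x d o t - gval (delta d) (x d) k o| <= e / 3.
  rewrite leNgt; apply/negP => A; apply: Hm'; apply: le_trans (modulus_le_at o kN kt).
  by apply: lerXn2r; rewrite ?nnegrE ?(ltW e3)// ltW.
have := ler_distD (XD delta X d k o) (X t o) (x d o t).
have := ler_distD (gval (delta d) (x d) k o) (XD delta X d k o) (x d o t).
rewrite (distrC (gval _ _ _ _)).
by move: A1 A2 A3; rewrite -/(XD delta X d k o); lra.
Qed.

Let MX D := runmax (fun k o => `|XD delta X D k o|) (N D).

Lemma measurable_MX D : measurable_fun setT (MX D).
Proof.
apply: measurable_runmax => k kN.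
by apply: (sol_comp_measurable FU HX (f := fun y => `|y|)); [exact: norm_continuous|exact: (pt_in HG)].
Qed.

(** The truncation at [D] makes the moment finite before anything is known about [X], and it
    disappears as [D] grows. *)
Let f D o : R := (1 + Num.min (MX D o) D%:R) ^+ 4.
Let bound := @dominator_bound R v r T C lam x0.

Lemma MX_ge0 D o : 0 <= MX D o.
Proof. by rewrite /MX; have [k _ ->] := runmax_ex (fun k o => `|XD delta X D k o|) (N D) o. Qed.

(** For each [D] a partition [d] is chosen for which [X] is within 1 of the polygonal solution
    outside a very rare event. There [1 + |X| <= 2 (1 + |x d|)], whence the factor [16 = 2^4]; on
    the rare event the truncation bounds the integrand. *)
Lemma truncated_moment D : (\int[P]_o (f D o)%:E <= (16 * bound)%:E)%E.
Proof.
have m0 o : 0 <= Num.min (MX D o) D%:R by rewrite le_min MX_ge0 /=.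
have f0 o : 0 <= f D o by rewrite exprn_even_ge0.
have fL o : f D o <= (1 + D%:R) ^+ 4.
  by apply: lerXn2r; rewrite ?nnegrE ?addr_ge0// lerD2l ge_min lexx orbT.
have Lf : LG P measurable (f D).
  apply: (LG_bdd _ sF (c := (1 + D%:R) ^+ 4)) => [|o]; last by rewrite ger0_norm.
  apply: gmeas_full; apply: measurable_funX; apply: measurable_funD => //.
  by apply: measurable_minr => //; exact: measurable_MX.
rewrite (Ex_ereal sF)// lee_fin; apply/ler_addgt0Pl => e e0.
set L := (1 + D%:R) ^+ 4 in fL *.
have L0 : 0 <= L by rewrite exprn_even_ge0.
have p0 : 0 < e / (L + 1) by rewrite divr_gt0// ltr_wpDl.
have [d [E [mE AE PE]]] := filter_ex (prare_apart ltr01 p0).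
have LH := LG_dominator_at d.
have LE : LG P measurable (\1_E : Omega -> R) by exact: LG_indic.
have LH' := LGZ 16 sF LH; have LE' := LGZ L sF LE.
apply: (@le_trans _ _ (Ex P (fun o => L * \1_E o + 16 * dominator d o))).
  apply: (Ex_le sF) => // [|o]; first exact: LGD.
  have [oE|oE] := pselect (E o).
    rewrite indicE mem_set// mulr1; apply: le_trans (fL o) _.
    by rewrite lerDl mulr_ge0// dominator_nonneg.
  rewrite indicE memNset// mulr0 add0r.
  have [k kN kE] := runmax_ex (fun k o => `|XD delta X D k o|) (N D) o.
  have tT := pt_in HG kN; apply: le_trans (ler_wpM2l _ (dominator_le_at d o tT)) => //.
  rewrite (_ : 16 = 2 ^+ 4 :> R); last by rewrite -natrX.
  rewrite -exprMn; apply: lerXn2r; rewrite ?nnegrE ?mulr_ge0 ?addr_ge0//.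
  have A : `|XD delta X D k o - x d o (pt delta D k)| <= 1.
    by rewrite leNgt; apply/negP => A; apply: oE; apply: AE; exists (pt delta D k).
  have := ler_normD (XD delta X D k o - x d o (pt delta D k)) (x d o (pt delta D k)).
  have : Num.min (MX D o) D%:R <= MX D o by rewrite ge_min lexx.
  rewrite subrK /MX kE; have := normr_ge0 (x d o (pt delta D k)); move: A; lra.
rewrite (ExD sF)// (ExZ sF _ LE) (ExZ sF _ LH) (Ex_indic P mE); apply: lerD; last first.
  by rewrite ler_wpM2l// Ex_dominator_at.
have PE' : fine (P E) <= e / (L + 1).
  by rewrite -lee_fin fineK// fin_num_measure.
apply: le_trans (ler_wpM2l L0 PE') _.
rewrite mulrCA ger_pMr// ler_pdivrMr ?mul1r ?lerDl//; lra.
Qed.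

(** Once the mesh is fine, [|X t|] exceeds the maximum over grid points by less than 1, and the
    summand 1 in [f] makes up for it. *)
Lemma solution_dominator : exists G : Omega -> \bar R, [/\ measurable_fun setT G,
  forall o, (0 <= G o)%E, (\int[P]_o G o <= (16 * bound)%:E)%E &
  {ae P, forall o, forall t, 0 <= t <= T -> ((`|X t o| ^+ 4)%:E <= G o)%E}].
Proof.
have mf D : measurable_fun setT (f D).
  apply: measurable_funX; apply: measurable_funD => //.
  by apply: measurable_minr => //; exact: measurable_MX.
have [|G [mG G0 EG HG']] := @fatou_dominator _ _ _ P f (16 * bound) mf _ truncated_moment.
  by move=> D o; rewrite exprn_even_ge0.
exists G; split => //.
have cX : {ae P, forall o, forall i, cont_on 0 T (fun s => X s o i 0)}.
  by apply: filter_forall => i; exact: (sol_continuous HX i).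
apply: filterS cX => o cX t tT; apply: HG'.
have cn : cont_on 0 T (fun s => `|X s o|).
  apply: (cont_on_lipschitz (f := fun y => `|y|) (L := 1)) => // y z; rewrite mul1r; exact: ler_dist_dist.
have [q q0 Hq] := cont_on_unif cn ltr01.
apply: filterS2 (mesh_small_near HG q0) (nbhs_infty_ger `|X t o|) => D Dq DX.
have [k kN /andP[k1 k2]] := grid_floor T0 HG D tT.
have A : `| `|X t o| - `|X (pt delta D k) o| | < 1.
  apply: Hq => //; first exact: (pt_in HG (ltnW kN)).
  by apply: le_lt_trans Dq; rewrite ptS in k2; rewrite ger0_norm; lra.
have A' := runmax_ge (fun k o => `|XD delta X D k o|) o (ltnW kN).
have m0 : 0 <= Num.min (MX D o) D%:R by rewrite le_min MX_ge0 /=.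
apply: lerXn2r; rewrite ?nnegrE ?addr_ge0//.
rewrite -lerBlDl le_min; apply/andP; split; last by lra.
move: A A'; rewrite -/(MX D o) /XD ltr_norml => /andP[_]; lra.
Qed.

Definition gap d o := ereal_sup [set (enorm (X t o - x d o t) ^+ 2)%:E | t in `[0%R, T]].

Lemma gap_ge0 d o : (0 <= gap d o)%E.
Proof.
apply: le_trans (ereal_sup_ubound _); last by exists 0 => //=; rewrite in_itv/= lexx ltW.
by rewrite lee_fin sqr_ge0.
Qed.

Lemma bound_ge0 : 0 <= bound.
Proof. exact: le_trans (Ex_ge0 _ (dominator_nonneg 0)) (Ex_dominator_at 0). Qed.

(* On a small event the square of the gap is split as [a^2 <= Kc + a^4 / Kc], so
   that bounded fourth moments suffice. *)
Lemma gap_small e : 0 < e -> \forall d \near \oo, (\int[P]_o gap d o <= e%:E)%E.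
Proof.
move=> e0; have [G [mG G0 EG GX]] := solution_dominator; have b0 := bound_ge0.
pose n : R := v%:R; have n0 : 0 <= n by rewrite ler0n.
(* Chosen so that [8 * n / Kc] times [17 * bound] is at most [e / 3]; 17 is 16 for the moment of [X]
   plus 1 for that of the polygonal solution. *)
pose Kc := 24 * n * (17 * bound) / e + 1.
have Kc0 : 0 < Kc by rewrite ltr_wpDl// divr_ge0 ?mulr_ge0// ltW.
pose eta := Num.min 1 (e / (3 * (n + 1))).
have n1 : 0 < 3 * (n + 1) by rewrite mulr_gt0// ltr_wpDl.
have eta0 : 0 < eta by rewrite lt_min ltr01 divr_gt0.
have etae : n * eta ^+ 2 <= e / 3.
  have : eta ^+ 2 <= e / (3 * (n + 1)).
    apply: (@le_trans _ _ eta); last by rewrite ge_min lexx orbT.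
    by rewrite expr2 ger_pMl// ge_min lexx.
  rewrite ler_pdivlMr//; have := sqr_ge0 eta; lra.
have nK : 0 <= n * Kc by rewrite mulr_ge0// ltW.
have p0 : 0 < e / (3 * (n * Kc + 1)) by rewrite divr_gt0// mulr_gt0// ltr_wpDl.
apply: filterS (prare_apart eta0 p0) => d [E [mE AE PE]].
pose c := 8 * n / Kc; have c0 : 0 <= c by rewrite divr_ge0 ?mulr_ge0// ltW.
have LH := LG_dominator_at d.
have LE : LG P measurable (\1_E : Omega -> R) by exact: LG_indic.
have LH' := LGZ c sF LH; have LE' := LGZ (n * Kc) sF LE; have Lc := LG_cst P measurable (n * eta ^+ 2).
pose u o := n * eta ^+ 2 + (n * Kc * \1_E o + c * dominator d o).
have Lu : LG P measurable u by apply: LGD => //; exact: LGD.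
have u0 o : 0 <= u o.
  apply: addr_ge0; first by rewrite mulr_ge0 ?sqr_ge0.
  by apply: addr_ge0; rewrite mulr_ge0// dominator_nonneg.
have mu : measurable_fun setT (fun o => (u o)%:E) by apply/measurable_EFinP; exact: LG_measurable Lu.
have mcG : measurable_fun setT (fun o => (c%:E * G o)%E) by exact: measurable_funeM.
have cG0 o : (0 <= c%:E * G o)%E by rewrite mule_ge0.
apply: (@le_trans _ _ (\int[P]_o ((u o)%:E + c%:E * G o))%E).
  apply: le_integral_dominated => //.
  - exact: gap_ge0.
  - exact: emeasurable_funD.
  - by move=> o; rewrite adde_ge0// lee_fin.
  apply: filterS GX => o GXo; rewrite /gap; apply: ge_ereal_sup => y [t /=]; rewrite in_itv/= => tT <- {y}.
  (* Up to [eta] the first term of [u] suffices; beyond it [o] lies in the rare event [E]. *)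
  have [oA|oA] := leP `|X t o - x d o t| eta.
    apply: (@le_trans _ _ (u o)%:E); last by rewrite leeDl.
    rewrite lee_fin; apply: le_trans (enorm_sqr_le _) _; rewrite -/n.
    apply: (@le_trans _ _ (n * eta ^+ 2)).
      by rewrite ler_wpM2l//; apply: lerXn2r; rewrite ?nnegrE ?(ltW eta0).
    by rewrite lerDl addr_ge0// mulr_ge0// dominator_nonneg.
  have oE : E o by apply: AE; exists t.
  have A1 : (\1_E o = 1 :> R) by rewrite indicE mem_set.
  apply: (@le_trans _ _ ((u o)%:E + c%:E * (`|X t o| ^+ 4)%:E))%E; last first.
    by rewrite leeD2l// lee_wpmul2l// ?lee_fin//; exact: GXo.
  rewrite -EFinM -EFinD lee_fin; apply: le_trans (enorm_sqr_le _) _; rewrite -/n /u A1 mulr1.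
  have H1 := dominator_le_at d o tT.
  have H2 : `|x d o t| ^+ 4 <= dominator d o.
    by apply: le_trans H1; apply: lerXn2r; rewrite ?nnegrE ?addr_ge0// lerDr.
  have H3 : `|X t o - x d o t| ^+ 4 <= 8 * `|X t o| ^+ 4 + 8 * `|x d o t| ^+ 4.
    apply: le_trans (pow4_add_le _ _).
    by apply: lerXn2r; rewrite ?nnegrE ?addr_ge0//; exact: ler_normB.
  set a := `|X t o - x d o t| in H3 *.
  have H4 : a ^+ 2 <= Kc + a ^+ 4 / Kc.
    rewrite -(ler_pM2r Kc0) mulrDl divfK ?gt_eqF//.
    have := sqr_ge0 (Kc - a ^+ 2); have := sqr_ge0 Kc; have := sqr_ge0 (a ^+ 2).
    by rewrite -exprM; lra.
  apply: le_trans (ler_wpM2l n0 H4) _.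
  have H5 : a ^+ 4 / Kc <= 8 / Kc * (`|X t o| ^+ 4 + dominator d o).
    rewrite [leRHS]mulrAC ler_pM2r ?invr_gt0//; lra.
  have := ler_wpM2l n0 H5; rewrite (_ : n * (8 / Kc * _) = c * `|X t o| ^+ 4 + c * dominator d o); last by rewrite /c; ring.
  have : 0 <= n * eta ^+ 2 by rewrite mulr_ge0 ?sqr_ge0.
  by rewrite mulrDr; lra.
rewrite ge0_integralD//; last by move=> o _; rewrite lee_fin.
rewrite ge0_integralZl// (Ex_ereal sF)//.
apply: (@le_trans _ _ ((Ex P u)%:E + c%:E * (16 * bound)%:E))%E; first by rewrite leeD2l// lee_wpmul2l.
rewrite -EFinM -EFinD lee_fin /u (ExD sF)//; last exact: LGD.
rewrite (ExD sF)// (ExZ sF _ LE) (ExZ sF _ LH) (Ex_indic P mE) Ex_cst.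
have PE' : fine (P E) <= e / (3 * (n * Kc + 1)) by rewrite -lee_fin fineK// fin_num_measure.
have B1 := ler_wpM2l nK PE'.
have B2 : n * Kc * (e / (3 * (n * Kc + 1))) <= e / 3.
  rewrite mulrA ler_pdivrMr ?mulr_gt0// ?ltr_wpDl//.
  have : 0 <= n * Kc * e by rewrite mulr_ge0// ltW.
  lra.
have B3 := ler_wpM2l c0 (Ex_dominator_at d).
have B4 : c * (17 * bound) <= e / 3.
  have KE : e / 3 * Kc = 8 * n * (17 * bound) + e / 3 by rewrite /Kc; field; rewrite gt_eqF.
  by rewrite /c mulrAC ler_pdivrMr// KE lerDl divr_ge0// ltW.
rewrite -/bound in B3; move: etae B1 B2 B3 B4; lra.
Qed.

Lemma wong_zakai : (\int[P]_o gap d o)%E @[d --> \oo] --> 0%E.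
Proof.
have I0 d : (0 <= \int[P]_o gap d o)%E by apply: integral_ge0 => o _; exact: gap_ge0.
apply/fine_cvgP; split.
  apply: filterS (gap_small ltr01) => d Hd; rewrite ge0_fin_numE//.
  exact: le_lt_trans Hd (ltry _).
apply/cvgrPdist_le => e e0; apply: filterS (gap_small e0) => d Hd /=.
rewrite sub0r normrN ger0_norm ?fine_ge0//.
by rewrite -lee_fin fineK// ge0_fin_numE// (le_lt_trans Hd (ltry _)).
Qed.

End Conclusion.

Theorem theorem1p1 (R : realType) (v r : nat)
  (b : 'cV[R]_v -> 'cV[R]_v) (sigma : 'cV[R]_v -> 'M[R]_(v, r))
  (b_C1 : forall i, class_C1 (fun x => b x i 0))
  (sigma_C2 : forall i j, class_C2 (fun x => sigma x i j))
  (Mc : R)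
  (b_bound : forall x, gradient_norm b x <= Mc)
  (sigma_bound1 : forall j x, gradient_norm (fun y => col j (sigma y)) x <= Mc)
  (sigma_bound2 : forall j x, hessian_norm (fun y => col j (sigma y)) x <= Mc)
  (Sigma_lipschitz : globally_lipschitz (Sigma sigma))
  (T : R) (T_gt0 : 0 < T)
  (disp : measure_display) (Omega : measurableType disp)
  (P : probability Omega R) (F : R -> set (set Omega))
  (F_usual : usual_filtration P T F)
  (B : R -> Omega -> 'cV[R]_r) (B_wiener : wiener_process P T F B)
  (N : nat -> nat) (delta : nat -> R) (t_ : nat -> nat -> R)
  (Pi_nested : nested_partitions T N delta t_)
  (x0 : 'cV[R]_v)
  (Xd : nat -> R -> Omega -> 'cV[R]_v)
  (Xd_solution : forall d w, ode_solution b sigma x0 T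
     (interpolation (N d) (delta d) (t_ d) (fun t => B t w))
     (fun t => Xd d t w))
  (X : R -> Omega -> 'cV[R]_v)
  (X_solution : stratonovich_sde_solution P T F b sigma x0 B X) :
  (\int[P]_w ereal_sup
     [set (enorm (X t w - Xd d t w) ^+ 2)%:E | t in `[0%R, T]])%E
    @[d --> \oo] --> 0%E.
Proof.
have [K cb] := coefficient_boundsP b_C1 sigma_C2 b_bound sigma_bound1 sigma_bound2.
have [C [lam [C1 lam0 HC]]] := ode_step cb (ltW T_gt0).
have pieces d w := ode_solution_pieces cb (mesh_gt0 Pi_nested d)
  (partition_start Pi_nested d) (partition_end Pi_nested d)
  (@partition_step _ _ _ _ _ Pi_nested d) (Xd_solution d w).
apply: (wong_zakai cb F_usual B_wiener T_gt0 Pi_nested X_solution C1 lam0 HC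
  (x := fun d w t => Xd d t w)) => [d w|d k w kN].
  by have [] := pieces d w.
have [_ /(_ k kN)] := pieces d w.
by rewrite (gridE Pi_nested (ltnW kN)) (gridE Pi_nested kN).
Qed.
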